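(* Let $F:\mathbb{C}\to\mathbb{C}$ be an entire function, $F\not\equiv 0$, and let $M\subset\mathbb{C}$ be a domain that is flow-invariant with respect to $F$ and such that all orbits of $\dot x=F(x)$ on $\partial M\setminus F^{-1}(\{0\})$ are unbounded. Then $\partial M$ has at most countably many path components, each of which is of one of the following types: (i) The path component consists of one (non-equilibrium) orbit. (ii) The path component consists of one equilibrium. (iii) The path component consists of one equilibrium and one attached orbit, i.e. the orbit has the equilibrium as one of its limit sets. (iv) The path component consists of one equilibrium and two attached orbits, i.e. each of the two orbits has the equilibrium as one of its limit sets. Moreover, the set $\{\Gamma(x):x\in\partial M\}$ of all orbits of $\dot x=F(x)$ on $\partial M$ is at most countable.
   Context: Setting: for an entire function $F$, consider the planar ODE $\dot x=F(x)$, $x\in\mathbb{C}$, with real time $t$. For $x_0\in\mathbb{C}$ let $I(x_0)\subset\mathbb{R}$ be the maximal interval of existence of the solution $\Phi(\cdot,x_0)$ with $\Phi(0,x_0)=x_0$; the orbit through $x_0$ is $\Gamma(x_0)=\Phi(I(x_0),x_0)$. Equilibria are the zeros of $F$. A domain is an open connected set. A set $M$ is flow-invariant if $\Gamma(x)\subset M$ for all $x\in M$; the boundary of a flow-invariant set is again flow-invariant. Limit sets: for an orbit $\Gamma=\Gamma(x_0)$, $\omega_{+}(\Gamma)$ (resp. $\omega_-(\Gamma)$) is the set of all $v\in\mathbb{C}$ for which there is a sequence $(t_k)\subset I(x_0)$ with $t_k\to+\infty$ (resp. $t_k\to-\infty$) and $\Phi(t_k,x_0)\to v$. An orbit $\Gamma$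 has the equilibrium $\tilde a$ as one of its limit sets if $\omega_+(\Gamma)=\{\tilde a\}$ or $\omega_-(\Gamma)=\{\tilde a\}$. Path components are the path-connected components (of $\partial M$ with the subspace topology). *)

(* Defs.v *)
From Stdlib Require Import Reals ClassicalEpsilon.
From Coquelicot Require Import Coquelicot.

Open Scope R_scope.

Definition at_most_countable {T : Type} (S : T -> Prop) : Prop :=
  exists f : T -> nat, forall a b : T, S a -> S b -> f a = f b -> a = b.

Definition bounded_set (A : C -> Prop) : Prop :=
  exists r : R, forall z : C, A z -> Cmod z <= r.

Definition boundary (A : C -> Prop) (z : C) : Prop :=
  forall U : C -> Prop, open U -> U z ->
    (exists w : C, U w /\ A w) /\ (exists w : C, U w /\ ~ A w).

(* Coquelicot's [is_connected] is convexity of a subset of R, hence this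
   definition for subsets of the plane. *)
Definition connected_set (A : C -> Prop) : Prop :=
  forall U V : C -> Prop, open U -> open V ->
    (forall z : C, A z -> U z \/ V z) ->
    (exists z : C, A z /\ U z) -> (exists z : C, A z /\ V z) ->
    exists z : C, A z /\ U z /\ V z.

Definition planar_domain (A : C -> Prop) : Prop := open A /\ connected_set A.

(* [joined A x y]: a path inside [A] leads from [x] to [y]; its values outside
   [0,1] are irrelevant, so continuity is relative to [0,1]. *)
Definition joined (A : C -> Prop) (x y : C) : Prop :=
  exists g : R -> C,
    (forall t : R, 0 <= t <= 1 ->
       filterlim g (within (fun s : R => 0 <= s <= 1) (locally t))
         (locally (g t))) /\
    (forall t : R, 0 <= t <= 1 -> A (g t)) /\
    g 0 = x /\ g 1 = y.

Definition path_component (A P : C -> Prop) : Prop :=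
  exists x : C, A x /\ P = joined A x.

Definition entire (F : C -> C) : Prop :=
  forall z : C, @ex_derive C_AbsRing C_NormedModule F z.

Definition solution (F : C -> C) (x0 : C) (J : R -> Prop) (phi : R -> C)
  : Prop :=
  open J /\ is_connected J /\ J 0 /\ phi 0 = x0 /\
  forall t : R, J t ->
    @is_derive R_AbsRing C_R_NormedModule phi t (F (phi t)).

(* I(x0), as the union of the open intervals around 0 carrying a solution of
   the initial value problem. *)
Definition max_interval (F : C -> C) (x0 : C) (t : R) : Prop :=
  exists (J : R -> Prop) (phi : R -> C), solution F x0 J phi /\ J t.

(* Phi(t, x0): the common value at [t] of all solutions starting at [x0] whose
   interval contains [t]; meaningless for [t] outside [max_interval F x0]. *)
Definition flow (F : C -> C) (t : R) (x0 : C) : C :=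
  epsilon (inhabits (RtoC 0)) (fun v : C =>
    exists (J : R -> Prop) (phi : R -> C),
      solution F x0 J phi /\ J t /\ phi t = v).

Definition orbit (F : C -> C) (x0 : C) (z : C) : Prop :=
  exists t : R, max_interval F x0 t /\ z = flow F t x0.

Definition flow_invariant (F : C -> C) (M : C -> Prop) : Prop :=
  forall x : C, M x -> forall z : C, orbit F x z -> M z.

(* The limit set of [orbit F x0] as time tends to [e], where [e] is [p_infty]
   or [m_infty]. *)
Definition limit_set (F : C -> C) (e : Rbar) (x0 v : C) : Prop :=
  exists u : nat -> R,
    (forall k : nat, max_interval F x0 (u k)) /\ is_lim_seq u e /\
    filterlim (fun k : nat => flow F (u k) x0) eventually (locally v).

Definition omega_plus (F : C -> C) : C -> C -> Prop := limit_set F p_infty.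
Definition omega_minus (F : C -> C) : C -> C -> Prop := limit_set F m_infty.

(* The orbit through [x] has [a] as one of its limit sets. *)
Definition attached (F : C -> C) (x a : C) : Prop :=
  (forall v : C, omega_plus F x v <-> v = a) \/
  (forall v : C, omega_minus F x v <-> v = a).

(* Main.v *)
(* Near a regular point the equation is straightened by a complex-time flow box
   [psi] with [psi' = F(psi)], the inverse of a primitive of [1/F]; the real flow
   acts on flow boxes as a translation.  If a boundary orbit crossed the
   transversal [psi(is)] at two parameters [s1], [s2], then the closed curve made
   of the orbit arc and the transversal segment would trap, forwards or
   backwards in time, every orbit through the segment (winding numbers), so the
   return map would be the translation by [s2 - s1] and the orbit would cross at
   [s1 + k (s2 - s1)] for all [k].  When such returns happen with arbitrarily
   small steps, the orbit is dense in half a flow box, which is impossible in the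
   boundary of [M].  Hence boundary orbits accumulate at no regular point, and
   each of their ends tends to an equilibrium or to infinity.  Being unbounded,
   an orbit has at most one end at an equilibrium [a].

   Three orbits attached to the same [a] would give a planar K_{3,3} with
   vertices [a], infinity, [M] against the three orbits.  An orbit with both ends
   at infinity has [M] on one side only, since otherwise a curve through [M]
   crossing it once would separate its ends; so it is the first boundary orbit
   met by a suitable segment with rational end points.  This bounds the number of
   orbits.  A path in the boundary cannot change orbit at a regular point because
   the boundary contains no open set, which yields the path components. *)
Require Import Defs.
From Stdlib Require Import Reals Lra Lia Classical ClassicalEpsilon FunctionalExtensionality PropExtensionality Cantor.
From Coquelicot Require Import Coquelicot.

(** Planar topology enters without the Jordan curve theorem. The sets in question mix orbit arcs
    with connected pieces of [M] that carry no parametrization, so they are handled as a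
    [continuum]: closed, bounded, and with connectedness stated as the intermediate value property,
    the form in which it acts on arguments. Besides Lipschitz bounds, analyticity yields two facts:
    equilibria are isolated, and the flow commutes with complex-time flow boxes, which forces return
    maps to be translations instead of arbitrary monotone maps. Cauchy's formula is needed for this,
    since [entire] only gives a derivative at each point. Unboundedness excludes closed orbits and
    orbits with both ends at equilibria. Statements about backward time are the forward ones for
    [- F]. *)

Lemma Cmod_sym (a b : C) : Cmod (a - b) = Cmod (b - a).
Proof. rewrite <- Cmod_opp. f_equal. ring. Qed.

Lemma Cmod_tri (a b c : C) : Cmod (a - c) <= Cmod (a - b) + Cmod (b - c).
Proof. replace (a - c)%C with ((a - b) + (b - c))%C by ring. apply Cmod_triangle. Qed.

Lemma Cmod_minus_le (a b : C) : Cmod (a - b) <= Cmod a + Cmod b.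
Proof. unfold Cminus. rewrite <- (Cmod_opp b). apply Cmod_triangle. Qed.

Lemma Cmod_rev (a b : C) : Cmod a - Cmod b <= Cmod (a - b).
Proof.
  pose proof (Cmod_triangle (a - b) b) as H.
  replace (a - b + b)%C with a in H by ring. lra.
Qed.

Lemma Cmod_diag (a : C) : Cmod (a - a) = 0.
Proof. replace (a - a)%C with (RtoC 0) by ring. apply Cmod_0. Qed.

Lemma Cmod_minus_gt0 (a b : C) : a <> b -> 0 < Cmod (a - b).
Proof.
  intros H. apply Cmod_gt_0. intros E. apply H.
  replace a with ((a - b) + b)%C by ring. rewrite E. ring.
Qed.

Lemma Cmod_minus_eq0 (a b : C) : Cmod (a - b) = 0 -> a = b.
Proof.
  intros H. apply Cmod_eq_0 in H.
  replace a with ((a - b) + b)%C by ring. rewrite H. ring.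
Qed.

Lemma Cmod_small_eq (a b : C) : (forall e, 0 < e -> Cmod (a - b) <= e) -> a = b.
Proof.
  intros H. apply Cmod_minus_eq0. apply Rle_antisym; [|apply Cmod_ge_0].
  apply le_epsilon. intros e He. rewrite Rplus_0_l. now apply H.
Qed.

Lemma Cmod_Rmult (r : R) (z : C) : Cmod (RtoC r * z) = Rabs r * Cmod z.
Proof. now rewrite Cmod_mult, Cmod_R. Qed.

(** * Continuity and derivatives of functions into [C] *)

Definition contR (g : R -> C) (t : R) : Prop :=
  forall e, 0 < e -> exists d, 0 < d /\ forall s, Rabs (s - t) < d -> Cmod (g s - g t) < e.

Definition contC (f : C -> C) (z : C) : Prop :=
  forall e, 0 < e -> exists d, 0 < d /\ forall w, Cmod (w - z) < d -> Cmod (f w - f z) < e.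

(** The difference quotient is cleared of its denominator, so that [s = t] is no special case. *)
Definition derR (g : R -> C) (t : R) (l : C) : Prop :=
  forall e, 0 < e -> exists d, 0 < d /\ forall s, Rabs (s - t) < d ->
    Cmod (g s - g t - RtoC (s - t) * l) <= e * Rabs (s - t).

Definition derC (f : C -> C) (z l : C) : Prop :=
  forall e, 0 < e -> exists d, 0 < d /\ forall w, Cmod (w - z) < d ->
    Cmod (f w - f z - (w - z) * l) <= e * Cmod (w - z).

Lemma ball_Cmod (z w : C) (d : R) : Cmod (w - z) < d -> ball z d w.
Proof. exact (C_NormedModule_mixin_compat1 z w d). Qed.

(** The balls of the product structure are squares; the sharp factor [sqrt 2] is rounded up to 2. *)
Lemma ball_Cmod_inv (z w : C) (d : posreal) : ball z d w -> Cmod (w - z) < 2 * d.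
Proof.
  intros H. apply (C_NormedModule_mixin_compat2 z w d) in H.
  eapply Rlt_le_trans; [exact H|]. apply Rmult_le_compat_r; [left; apply cond_pos|].
  apply Rsqr_incr_0_var; [|lra]. rewrite Rsqr_sqrt by lra. unfold Rsqr; lra.
Qed.

Lemma locally_Cmod (z : C) (P : C -> Prop) :
  locally z P <-> exists d, 0 < d /\ forall w, Cmod (w - z) < d -> P w.
Proof.
  split.
  - intros [d H]. exists d. split; [apply cond_pos|]. intros w Hw. apply H. now apply ball_Cmod.
  - intros [d [Hd H]]. exists (mkposreal (d / 2) ltac:(lra)).
    intros w Hw. apply H. apply ball_Cmod_inv in Hw. simpl in Hw. lra.
Qed.

Lemma open_Cmod (U : C -> Prop) :
  open U <-> forall z, U z -> exists d, 0 < d /\ forall w, Cmod (w - z) < d -> U w.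
Proof.
  split; intros H z Hz; apply locally_Cmod; now apply H.
Qed.

Lemma contR_iff (g : R -> C) (t : R) : contR g t <-> continuous g t.
Proof.
  split.
  - intros H P HP. apply locally_Cmod in HP. destruct HP as [e [He HP]].
    destruct (H e He) as [d [Hd Hs]]. exists (mkposreal d Hd). intros s Hs'. apply HP, Hs, Hs'.
  - intros H e He.
    assert (HP : locally (g t) (fun w => Cmod (w - g t) < e)).
    { apply locally_Cmod. exists e. auto. }
    apply H in HP. destruct HP as [d HP]. exists d. split; [apply cond_pos|].
    intros s Hs. apply HP. exact Hs.
Qed.

Lemma contC_of_derC f z l : derC f z l -> contC f z.
Proof.
  intros H e He. destruct (H 1 Rlt_0_1) as [d [Hd Hw]].
  pose proof (Cmod_ge_0 l) as Hl.
  exists (Rmin d (e / (2 + Cmod l))).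
  assert (0 < e / (2 + Cmod l)) by (apply Rdiv_lt_0_compat; lra).
  split; [apply Rmin_glb_lt; lra|]. intros w Hw'.
  assert (H1 := Rlt_le_trans _ _ _ Hw' (Rmin_l _ _)). assert (H2 := Rlt_le_trans _ _ _ Hw' (Rmin_r _ _)).
  specialize (Hw w H1).
  replace (f w - f z)%C with ((f w - f z - (w - z) * l) + (w - z) * l)%C by ring.
  eapply Rle_lt_trans; [apply Cmod_triangle|]. rewrite Cmod_mult.
  assert (H3 : Cmod (w - z) * (2 + Cmod l) < e).
  { apply (Rmult_lt_compat_r (2 + Cmod l)) in H2; [|lra]. unfold Rdiv in H2.
    rewrite Rmult_assoc, Rinv_l in H2 by lra. lra. }
  pose proof (Cmod_ge_0 (w - z)). lra.
Qed.

Lemma contR_of_derR g t l : derR g t l -> contR g t.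
Proof.
  intros H e He. destruct (H 1 Rlt_0_1) as [d [Hd Hw]].
  pose proof (Cmod_ge_0 l) as Hl.
  exists (Rmin d (e / (2 + Cmod l))).
  assert (0 < e / (2 + Cmod l)) by (apply Rdiv_lt_0_compat; lra).
  split; [apply Rmin_glb_lt; lra|]. intros s Hs.
  assert (H1 := Rlt_le_trans _ _ _ Hs (Rmin_l _ _)). assert (H2 := Rlt_le_trans _ _ _ Hs (Rmin_r _ _)).
  specialize (Hw s H1).
  replace (g s - g t)%C with ((g s - g t - RtoC (s - t) * l) + RtoC (s - t) * l)%C by ring.
  eapply Rle_lt_trans; [apply Cmod_triangle|]. rewrite Cmod_Rmult.
  assert (H3 : Rabs (s - t) * (2 + Cmod l) < e).
  { apply (Rmult_lt_compat_r (2 + Cmod l)) in H2; [|lra]. unfold Rdiv in H2.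
    rewrite Rmult_assoc, Rinv_l in H2 by lra. lra. }
  pose proof (Rabs_pos (s - t)). lra.
Qed.

Lemma scal_RC (r : R) (z : C) : @scal R_Ring C_R_ModuleSpace r z = (RtoC r * z)%C.
Proof.
  destruct z as [a b]. unfold scal, Cmult; simpl. unfold prod_scal, scal; simpl. unfold mult; simpl.
  f_equal; ring.
Qed.

Lemma derR_iff (g : R -> C) t l :
  derR g t l <-> @is_derive R_AbsRing C_R_NormedModule g t l.
Proof.
  split.
  - intros H. split; [apply is_linear_scal_l|].
    intros x Hx. assert (x = t) as -> by (symmetry; apply (is_filter_lim_locally_unique (K:=R_AbsRing) (V:=R_NormedModule)); exact Hx).
    intros e. destruct (H e (cond_pos e)) as [d [Hd Hs]].
    exists (mkposreal d Hd). intros s Hs'.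
    specialize (Hs s Hs').
    rewrite <- Cmod_norm.
    change (Cmod (g s - g t - @scal R_Ring C_R_ModuleSpace (s - t) l) <= e * Rabs (s - t)).
    rewrite scal_RC. exact Hs.
  - intros [_ H] e He.
    specialize (H t (fun P HP => HP) (mkposreal e He)).
    destruct H as [d Hd]. exists d. split; [apply cond_pos|]. intros s Hs.
    specialize (Hd s Hs). rewrite <- Cmod_norm in Hd.
    change (Cmod (g s - g t - @scal R_Ring C_R_ModuleSpace (s - t) l) <= e * Rabs (s - t)) in Hd.
    rewrite scal_RC in Hd. exact Hd.
Qed.

(* The increment in [is_derive] over [C_AbsRing] lives in the uniform structure
   of the absolute value, not in the product one. *)
Lemma derC_iff (f : C -> C) z l :
  derC f z l <-> @is_derive C_AbsRing C_NormedModule f z l.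
Proof.
  split.
  - intros H. split; [apply is_linear_scal_l|].
    intros x Hx.
    assert (x = z) as -> by (symmetry; apply (is_filter_lim_locally_unique (K:=C_AbsRing) (V:=AbsRing_NormedModule C_AbsRing)); exact Hx).
    intros e. destruct (H e (cond_pos e)) as [d [Hd Hs]].
    exists (mkposreal d Hd). intros w Hw. exact (Hs w Hw).
  - intros [_ H] e He.
    specialize (H z (fun P HP => HP) (mkposreal e He)).
    destruct H as [d H]. exists d. split; [apply cond_pos|].
    intros w Hw. exact (H w Hw).
Qed.

Lemma contR_const c t : contR (fun _ => c) t.
Proof. intros e He. exists 1. split; [lra|]. intros. now rewrite Cmod_diag. Qed.

Lemma contR_plus f g t : contR f t -> contR g t -> contR (fun s => f s + g s)%C t.
Proof.
  intros Hf Hg e He. destruct (Hf (e/2)) as [d1 [H1 K1]]; [lra|].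
  destruct (Hg (e/2)) as [d2 [H2 K2]]; [lra|].
  exists (Rmin d1 d2). split; [now apply Rmin_glb_lt|]. intros s Hs.
  specialize (K1 s (Rlt_le_trans _ _ _ Hs (Rmin_l _ _))).
  specialize (K2 s (Rlt_le_trans _ _ _ Hs (Rmin_r _ _))).
  replace (f s + g s - (f t + g t))%C with ((f s - f t) + (g s - g t))%C by ring.
  eapply Rle_lt_trans; [apply Cmod_triangle|]. lra.
Qed.

(** The sum bounds the error of a product whose factors have modulus [A] and [B] and are perturbed
    by [x] and [y]. *)
Lemma mult_small (e A B : R) : 0 < e -> 0 <= A -> 0 <= B ->
  exists d, 0 < d /\ forall x y, 0 <= x < d -> 0 <= y < d -> x * B + A * y + x * y < e.
Proof.
  intros He HA HB. exists (Rmin 1 (e / (A + B + 2))).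
  assert (0 < e / (A + B + 2)) by (apply Rdiv_lt_0_compat; lra).
  split; [apply Rmin_glb_lt; lra|]. intros x y [Hx0 Hx] [Hy0 Hy].
  assert (H1 := Rlt_le_trans _ _ _ Hx (Rmin_l _ _)). assert (H2 := Rlt_le_trans _ _ _ Hx (Rmin_r _ _)).
  assert (H4 := Rlt_le_trans _ _ _ Hy (Rmin_r _ _)).
  set (q := e / (A + B + 2)) in *.
  assert (q * (A + B + 2) = e) by (unfold q; field; lra). nra.
Qed.

Lemma contR_mult f g t : contR f t -> contR g t -> contR (fun s => f s * g s)%C t.
Proof.
  intros Hf Hg e He.
  destruct (mult_small e (Cmod (f t)) (Cmod (g t)) He (Cmod_ge_0 _) (Cmod_ge_0 _)) as [d [Hd K]].
  destruct (Hf d Hd) as [d1 [H1 K1]]. destruct (Hg d Hd) as [d2 [H2 K2]].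
  exists (Rmin d1 d2). split; [now apply Rmin_glb_lt|]. intros s Hs.
  specialize (K1 s (Rlt_le_trans _ _ _ Hs (Rmin_l _ _))).
  specialize (K2 s (Rlt_le_trans _ _ _ Hs (Rmin_r _ _))).
  replace (f s * g s - f t * g t)%C
    with ((f s - f t) * g t + f t * (g s - g t) + (f s - f t) * (g s - g t))%C by ring.
  eapply Rle_lt_trans; [|apply (K (Cmod (f s - f t)) (Cmod (g s - g t)))];
    [|split; [apply Cmod_ge_0|assumption]..].
  eapply Rle_trans; [apply Cmod_triangle|].
  rewrite Cmod_mult. apply Rplus_le_compat_r.
  eapply Rle_trans; [apply Cmod_triangle|]. rewrite !Cmod_mult. lra.
Qed.

Lemma contR_comp f g t : contC f (g t) -> contR g t -> contR (fun s => f (g s)) t.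
Proof.
  intros Hf Hg e He. destruct (Hf e He) as [d [Hd K]]. destruct (Hg d Hd) as [d' [Hd' K']].
  exists d'. split; [exact Hd'|]. intros s Hs. now apply K, K'.
Qed.

Lemma contC_comp f g z : contC f (g z) -> contC g z -> contC (fun w => f (g w)) z.
Proof.
  intros Hf Hg e He. destruct (Hf e He) as [d [Hd K]]. destruct (Hg d Hd) as [d' [Hd' K']].
  exists d'. split; [exact Hd'|]. intros s Hs. now apply K, K'.
Qed.

Lemma contR_ext f g t : (forall s, f s = g s) -> contR f t -> contR g t.
Proof.
  intros E H e He. destruct (H e He) as [d [Hd K]]. exists d; split; [exact Hd|].
  intros s Hs. rewrite <- !E. now apply K.
Qed.

Lemma contC_inv (z : C) : z <> 0 -> contC Cinv z.
Proof.
  intros Hz e He. apply Cmod_gt_0 in Hz. set (m := Cmod z) in *.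
  exists (Rmin (m / 2) (e * (m * m) / 4)).
  assert (0 < e * (m * m) / 4) by (assert (0 < m * m) by nra; nra).
  split; [apply Rmin_glb_lt; lra|].
  intros w Hw.
  assert (H1 := Rlt_le_trans _ _ _ Hw (Rmin_l _ _)). assert (H2 := Rlt_le_trans _ _ _ Hw (Rmin_r _ _)).
  assert (Hw1 : m / 2 < Cmod w).
  { pose proof (Cmod_rev z w). rewrite Cmod_sym in H0. fold m in H0. lra. }
  assert (Hw0 : w <> 0) by (apply Cmod_gt_0; lra).
  assert (Hz0 : z <> 0) by (apply Cmod_gt_0; unfold m in *; lra).
  replace (/ w - / z)%C with ((z - w) * (/ w * / z))%C by (field; auto).
  rewrite !Cmod_mult, !Cmod_inv by auto. fold m. rewrite Cmod_sym.
  assert (/ Cmod w < 2 / m).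
  { unfold Rdiv. rewrite <- (Rinv_inv 2), <- Rinv_mult. apply Rinv_lt_contravar; [nra|lra]. }
  assert (0 < / m) by (apply Rinv_0_lt_compat; lra).
  assert (0 < / Cmod w) by (apply Rinv_0_lt_compat; lra).
  assert (/ Cmod w * / m < 2 / (m * m)).
  { replace (2 / (m * m)) with (2 / m * / m) by (field; lra). now apply Rmult_lt_compat_r. }
  apply Rlt_le_trans with (e * (m * m) / 4 * (2 / (m * m)) ).
  - apply Rmult_le_0_lt_compat; try lra; [apply Cmod_ge_0|nra].
  - replace (e * (m * m) / 4 * (2 / (m * m))) with (e / 2) by (field; lra). lra.
Qed.

Lemma derR_const c t : derR (fun _ => c) t 0.
Proof.
  intros e He. exists 1. split; [lra|]. intros s _.
  replace (c - c - RtoC (s - t) * 0)%C with (RtoC 0) by ring. rewrite Cmod_0.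
  pose proof (Rabs_pos (s - t)); nra.
Qed.

Lemma derR_id t : derR RtoC t 1.
Proof.
  intros e He. exists 1. split; [lra|]. intros s _.
  replace (RtoC s - RtoC t - RtoC (s - t) * 1)%C with (RtoC 0) by (rewrite RtoC_minus; ring).
  rewrite Cmod_0. pose proof (Rabs_pos (s - t)); nra.
Qed.

Lemma derR_plus f g t l m : derR f t l -> derR g t m -> derR (fun s => f s + g s)%C t (l + m)%C.
Proof.
  rewrite !derR_iff. intros H1 H2. exact (is_derive_plus f g t l m H1 H2).
Qed.

Lemma derR_comp f g t k l : derC f (g t) k -> derR g t l -> derR (fun s => f (g s)) t (l * k)%C.
Proof.
  intros Hf Hg e He.
  pose proof (Cmod_ge_0 k) as Hk. pose proof (Cmod_ge_0 l) as Hl.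
  set (e1 := e / (2 * (Cmod l + 1))).
  assert (He1 : 0 < e1) by (apply Rdiv_lt_0_compat; lra).
  set (e2 := Rmin 1 (e / (2 * (Cmod k + 1)))).
  assert (He2' : 0 < e / (2 * (Cmod k + 1))) by (apply Rdiv_lt_0_compat; lra).
  assert (He2 : 0 < e2) by (apply Rmin_glb_lt; lra).
  assert (H21 : e2 <= 1) by apply Rmin_l.
  assert (H22 : e2 * (2 * (Cmod k + 1)) <= e).
  { apply Rle_trans with (e / (2 * (Cmod k + 1)) * (2 * (Cmod k + 1))); [|right; field; lra].
    apply Rmult_le_compat_r; [lra|]. apply Rmin_r. }
  assert (H1 : e1 * (2 * (Cmod l + 1)) = e) by (unfold e1; field; lra).
  destruct (Hf e1 He1) as [d1 [Hd1 K1]].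
  destruct (contR_of_derR _ _ _ Hg d1 Hd1) as [d2 [Hd2 K2]].
  destruct (Hg e2 He2) as [d3 [Hd3 K3]].
  exists (Rmin d2 d3). split; [now apply Rmin_glb_lt|]. intros s Hs.
  specialize (K2 s (Rlt_le_trans _ _ _ Hs (Rmin_l _ _))).
  specialize (K3 s (Rlt_le_trans _ _ _ Hs (Rmin_r _ _))).
  specialize (K1 _ K2).
  replace (f (g s) - f (g t) - RtoC (s - t) * (l * k))%C with
    ((f (g s) - f (g t) - (g s - g t) * k) + (g s - g t - RtoC (s - t) * l) * k)%C by ring.
  eapply Rle_trans; [apply Cmod_triangle|]. rewrite Cmod_mult.
  assert (H4 : Cmod (g s - g t) <= (Cmod l + 1) * Rabs (s - t)).
  { replace (g s - g t)%C with ((g s - g t - RtoC (s - t) * l) + RtoC (s - t) * l)%C by ring.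
    eapply Rle_trans; [apply Cmod_triangle|]. rewrite Cmod_Rmult.
    pose proof (Rabs_pos (s - t)). nra. }
  pose proof (Rabs_pos (s - t)). pose proof (Cmod_ge_0 (g s - g t)).
  assert (e1 * Cmod (g s - g t) <= e / 2 * Rabs (s - t)).
  { apply Rle_trans with (e1 * ((Cmod l + 1) * Rabs (s - t))); [|right; rewrite <- H1; field].
    apply Rmult_le_compat_l; lra. }
  assert (Cmod (g s - g t - RtoC (s - t) * l) * Cmod k <= e / 2 * Rabs (s - t)).
  { apply Rle_trans with (e2 * Rabs (s - t) * Cmod k); [apply Rmult_le_compat_r; lra|].
    apply Rle_trans with ((e2 * Cmod k) * Rabs (s - t)); [right; ring|].
    apply Rmult_le_compat_r; [lra|]. nra. }
  lra.
Qed.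

Lemma derR_eq g t l m : derR g t l -> l = m -> derR g t m.
Proof. now intros H <-. Qed.

Lemma derR_ext f g t l : (forall s, f s = g s) -> derR f t l -> derR g t l.
Proof.
  intros E H e He. destruct (H e He) as [d [Hd K]]. exists d; split; [exact Hd|].
  intros s Hs. rewrite <- !E. now apply K.
Qed.

Lemma derC_const c z : derC (fun _ => c) z 0.
Proof.
  intros e He. exists 1. split; [lra|]. intros w _.
  replace (c - c - (w - z) * 0)%C with (RtoC 0) by ring. rewrite Cmod_0.
  pose proof (Cmod_ge_0 (w - z)); nra.
Qed.

Lemma derC_id z : derC (fun w => w) z 1.
Proof.
  intros e He. exists 1. split; [lra|]. intros w _.
  replace (w - z - (w - z) * 1)%C with (RtoC 0) by ring. rewrite Cmod_0.
  pose proof (Cmod_ge_0 (w - z)); nra.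
Qed.

Lemma derC_plus f g z l m : derC f z l -> derC g z m -> derC (fun w => f w + g w)%C z (l + m)%C.
Proof.
  rewrite !derC_iff. intros H1 H2. exact (is_derive_plus (K:=C_AbsRing) (V:=C_NormedModule) f g z l m H1 H2).
Qed.

Lemma derC_ext f g z l : (forall s, f s = g s) -> derC f z l -> derC g z l.
Proof.
  intros E H e He. destruct (H e He) as [d [Hd K]]. exists d; split; [exact Hd|].
  intros s Hs. rewrite <- !E. now apply K.
Qed.

Lemma derC_eq g t l m : derC g t l -> l = m -> derC g t m.
Proof. now intros H <-. Qed.

(** Caratheodory's form of differentiability: with a slope function continuous at [z], the product
    rule is algebra plus continuity. *)
Lemma derC_slope f z l :
  derC f z l <-> exists q : C -> C, contC q z /\ q z = l /\ forall w, f w = (f z + (w - z) * q w)%C.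
Proof.
  split.
  - intros H.
    assert (forall w, exists y, (w = z -> y = l) /\ f w = (f z + (w - z) * y)%C) as H0.
    { intros w. destruct (classic (w = z)) as [->|n].
      - exists l. split; [auto|ring].
      - exists ((f w - f z) / (w - z))%C. split; [tauto|]. field.
        intros E. apply n. replace w with ((w - z) + z)%C by ring. rewrite E; ring. }
    apply (choice (fun w y => (w = z -> y = l) /\ f w = (f z + (w - z) * y)%C)) in H0.
    destruct H0 as [q Hq].
    assert (Hl : q z = l) by now apply Hq.
    exists q. split; [|split; [exact Hl|intros w; apply Hq]].
    intros e He. destruct (H (e/2)) as [d [Hd K]]; [lra|]. exists d. split; [exact Hd|].
    intros w Hw. rewrite Hl. specialize (K w Hw). rewrite (proj2 (Hq w)) in K.
    replace (f z + (w - z) * q w - f z - (w - z) * l)%C with ((w - z) * (q w - l))%C in K by ring.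
    rewrite Cmod_mult in K.
    destruct (Req_dec (Cmod (w - z)) 0) as [E|E].
    + apply Cmod_minus_eq0 in E. subst w. rewrite Hl, Cmod_diag. exact He.
    + pose proof (Cmod_ge_0 (w - z)). assert (0 < Cmod (w - z)) by lra.
      apply Rle_lt_trans with (e / 2); [|lra].
      apply Rmult_le_reg_l with (Cmod (w - z)); lra.
  - intros [q [Hq [Hl Hf]]] e He. destruct (Hq e He) as [d [Hd K]]. exists d. split; [exact Hd|].
    intros w Hw. rewrite (Hf w).
    replace (f z + (w - z) * q w - f z - (w - z) * l)%C with ((w - z) * (q w - q z))%C by (rewrite Hl; ring).
    rewrite Cmod_mult, Rmult_comm. apply Rmult_le_compat_r; [apply Cmod_ge_0|]. left; now apply K.
Qed.

Lemma contC_const c z : contC (fun _ => c) z.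
Proof. intros e He. exists 1. split; [lra|]. intros. now rewrite Cmod_diag. Qed.

Lemma contC_id z : contC (fun w => w) z.
Proof. intros e He. exists e. split; [lra|]. auto. Qed.

Lemma contC_plus f g t : contC f t -> contC g t -> contC (fun s => f s + g s)%C t.
Proof.
  intros Hf Hg e He. destruct (Hf (e/2)) as [d1 [H1 K1]]; [lra|].
  destruct (Hg (e/2)) as [d2 [H2 K2]]; [lra|].
  exists (Rmin d1 d2). split; [now apply Rmin_glb_lt|]. intros s Hs.
  specialize (K1 s (Rlt_le_trans _ _ _ Hs (Rmin_l _ _))).
  specialize (K2 s (Rlt_le_trans _ _ _ Hs (Rmin_r _ _))).
  replace (f s + g s - (f t + g t))%C with ((f s - f t) + (g s - g t))%C by ring.
  eapply Rle_lt_trans; [apply Cmod_triangle|]. lra.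
Qed.

Lemma contC_mult f g t : contC f t -> contC g t -> contC (fun s => f s * g s)%C t.
Proof.
  intros Hf Hg e He.
  destruct (mult_small e (Cmod (f t)) (Cmod (g t)) He (Cmod_ge_0 _) (Cmod_ge_0 _)) as [d [Hd K]].
  destruct (Hf d Hd) as [d1 [H1 K1]]. destruct (Hg d Hd) as [d2 [H2 K2]].
  exists (Rmin d1 d2). split; [now apply Rmin_glb_lt|]. intros s Hs.
  specialize (K1 s (Rlt_le_trans _ _ _ Hs (Rmin_l _ _))).
  specialize (K2 s (Rlt_le_trans _ _ _ Hs (Rmin_r _ _))).
  replace (f s * g s - f t * g t)%C
    with ((f s - f t) * g t + f t * (g s - g t) + (f s - f t) * (g s - g t))%C by ring.
  eapply Rle_lt_trans; [|apply (K (Cmod (f s - f t)) (Cmod (g s - g t)))];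
    [|split; [apply Cmod_ge_0|assumption]..].
  eapply Rle_trans; [apply Cmod_triangle|].
  rewrite Cmod_mult. apply Rplus_le_compat_r.
  eapply Rle_trans; [apply Cmod_triangle|]. rewrite !Cmod_mult. lra.
Qed.

Lemma derC_mult f g z l m : derC f z l -> derC g z m ->
  derC (fun w => f w * g w)%C z (l * g z + f z * m)%C.
Proof.
  rewrite !derC_slope. intros [q [Hq [Hl Hf]]] [p [Hp [Hm Hg]]].
  exists (fun w => q w * g z + f z * p w + (w + - z) * (q w * p w))%C.
  split; [|split].
  - assert (H := contC_plus (fun w => w) (fun _ => (- z)%C) z (contC_id z) (contC_const _ z)).
    repeat apply contC_plus; repeat apply contC_mult; auto using contC_const.
  - rewrite Hl, Hm. ring.
  - intros w. rewrite (Hf w), (Hg w). ring.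
Qed.

Lemma derC_inv (f : C -> C) (z l : C) : derC f z l -> f z <> 0 -> derC (fun w => / f w)%C z (- l / (f z * f z))%C.
Proof.
  intros H Hz.
  pose proof (contC_of_derC _ _ _ H) as Hc.
  assert (Hc' : contC (fun w => / f w)%C z) by (apply contC_comp; [now apply contC_inv|exact Hc]).
  destruct (proj1 (derC_slope _ _ _) H) as [q [Hq [Hl Hf]]].
  set (m := Cmod (f z)). assert (Hm : 0 < m) by now apply Cmod_gt_0.
  destruct (Hc m Hm) as [d0 [Hd0 K0]].
  assert (Hq' : contC (fun w => (- (1)) * (q w * (/ f w * / f z)))%C z).
  { repeat apply contC_mult; auto using contC_const. }
  intros e He. destruct (Hq' e He) as [d [Hd K]].
  exists (Rmin d d0). split; [now apply Rmin_glb_lt|]. intros w Hw.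
  specialize (K0 w (Rlt_le_trans _ _ _ Hw (Rmin_r _ _))).
  specialize (K w (Rlt_le_trans _ _ _ Hw (Rmin_l _ _))).
  assert (Hw0 : f w <> 0).
  { intros E. rewrite E in K0. replace (0 - f z)%C with (- f z)%C in K0 by ring.
    rewrite Cmod_opp in K0. unfold m in K0. lra. }
  replace (/ f w - / f z - (w - z) * (- l / (f z * f z)))%C with
    ((w - z) * (- (1) * (q w * (/ f w * / f z)) - - (1) * (q z * (/ f z * / f z))))%C.
  - rewrite Cmod_mult, Rmult_comm. apply Rmult_le_compat_r; [apply Cmod_ge_0|]. left; exact K.
  - rewrite Hl.
    assert (E : ((w - z) * q w = f w - f z)%C) by (rewrite (Hf w); ring).
    transitivity ((- ((w - z) * q w) * (/ f w * / f z)) + (w - z) * (l * (/ f z * / f z)))%C; [ring|].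
    rewrite E. field. auto.
Qed.

(** * Integrals of complex-valued functions *)

Definition CI (f : R -> C) (a b : R) : C := @RInt C_R_CompleteNormedModule f a b.

Definition contI (f : R -> C) (a b : R) : Prop := forall t, a <= t <= b -> contR f t.

Lemma CI_is f a b : a <= b -> contI f a b -> @is_RInt C_R_NormedModule f a b (CI f a b).
Proof.
  intros Hab H. apply (RInt_correct (V:=C_R_CompleteNormedModule)).
  apply (ex_RInt_continuous (V:=C_R_CompleteNormedModule)). intros z Hz.
  rewrite Rmin_left, Rmax_right in Hz by exact Hab. apply contR_iff, H, Hz.
Qed.

Lemma CI_unique f a b l : @is_RInt C_R_NormedModule f a b l -> CI f a b = l.
Proof. exact (is_RInt_unique (V:=C_R_CompleteNormedModule) f a b l). Qed.

Lemma CI_ext f g a b : a <= b -> (forall t, a <= t <= b -> f t = g t) -> CI f a b = CI g a b.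
Proof.
  intros Hab H. apply (RInt_ext (V:=C_R_CompleteNormedModule)). intros x Hx.
  rewrite Rmin_left, Rmax_right in Hx by exact Hab. apply H; lra.
Qed.

Lemma CI_plus f g a b : a <= b -> contI f a b -> contI g a b ->
  CI (fun t => f t + g t)%C a b = (CI f a b + CI g a b)%C.
Proof.
  intros Hab Hf Hg. apply CI_unique.
  exact (is_RInt_plus (V:=C_R_NormedModule) f g a b _ _ (CI_is f a b Hab Hf) (CI_is g a b Hab Hg)).
Qed.

(** Multiplication by a complex constant is not the scalar multiplication of the real normed space,
    so the two components are integrated separately. *)
Lemma is_RInt_Cscal (c : C) f a b l :
  @is_RInt C_R_NormedModule f a b l -> @is_RInt C_R_NormedModule (fun t => c * f t)%C a b (c * l)%C.
Proof.
  intros H.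
  assert (H1 := is_RInt_fct_extend_fst (U:=R_NormedModule) (V:=R_NormedModule) f a b l H).
  assert (H2 := is_RInt_fct_extend_snd (U:=R_NormedModule) (V:=R_NormedModule) f a b l H).
  apply (is_RInt_fct_extend_pair (U:=R_NormedModule) (V:=R_NormedModule)).
  - exact (is_RInt_minus _ _ _ _ _ _ (is_RInt_scal _ a b (fst c) _ H1) (is_RInt_scal _ a b (snd c) _ H2)).
  - exact (is_RInt_plus _ _ _ _ _ _ (is_RInt_scal _ a b (fst c) _ H2) (is_RInt_scal _ a b (snd c) _ H1)).
Qed.

Lemma CI_scal c f a b : a <= b -> contI f a b -> CI (fun t => c * f t)%C a b = (c * CI f a b)%C.
Proof. intros Hab Hf. apply CI_unique, is_RInt_Cscal, CI_is; assumption. Qed.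

Lemma contI_plus f g a b : contI f a b -> contI g a b -> contI (fun t => f t + g t)%C a b.
Proof. intros H K t Ht. apply contR_plus; auto. Qed.

Lemma contI_mult f g a b : contI f a b -> contI g a b -> contI (fun t => f t * g t)%C a b.
Proof. intros H K t Ht. apply contR_mult; auto. Qed.

Lemma contI_const c a b : contI (fun _ => c) a b.
Proof. intros t Ht. apply contR_const. Qed.

Lemma contI_sub f a b a' b' : contI f a b -> a <= a' -> b' <= b -> contI f a' b'.
Proof. intros H Ha Hb t Ht. apply H; lra. Qed.

Lemma CI_const c a b : CI (fun _ => c) a b = (RtoC (b - a) * c)%C.
Proof.
  rewrite <- scal_RC. apply CI_unique. exact (is_RInt_const (V:=C_R_NormedModule) a b c).
Qed.

Lemma CI_norm f a b M : a <= b -> contI f a b -> (forall t, a <= t <= b -> Cmod (f t) <= M) ->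
  Cmod (CI f a b) <= (b - a) * M.
Proof.
  intros Hab Hf HM. rewrite Cmod_norm.
  apply (norm_RInt_le_const (V:=C_R_NormedModule) f a b); [exact Hab| |now apply CI_is].
  intros t Ht. rewrite <- Cmod_norm. now apply HM.
Qed.

Lemma CI_Chasles f a b c : a <= b -> b <= c -> contI f a c ->
  CI f a c = (CI f a b + CI f b c)%C.
Proof.
  intros H1 H2 Hf. apply CI_unique.
  apply (is_RInt_Chasles (V:=C_R_NormedModule) f a b c); apply CI_is; auto; eapply contI_sub; eauto; lra.
Qed.

Lemma CI_FTC g g' a b : a <= b -> (forall t, a <= t <= b -> derR g t (g' t)) -> contI g' a b ->
  CI g' a b = (g b - g a)%C.
Proof.
  intros Hab Hg Hg'. apply CI_unique.
  apply (is_RInt_derive (V:=C_R_CompleteNormedModule) g g' a b); intros t Ht;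
    rewrite Rmin_left, Rmax_right in Ht by exact Hab.
  - apply derR_iff, Hg, Ht.
  - apply contR_iff, Hg', Ht.
Qed.

Lemma CI_minus f g a b : a <= b -> contI f a b -> contI g a b ->
  CI (fun t => f t - g t)%C a b = (CI f a b - CI g a b)%C.
Proof.
  intros Hab Hf Hg. apply CI_unique.
  exact (is_RInt_minus (V:=C_R_NormedModule) f g a b _ _ (CI_is f a b Hab Hf) (CI_is g a b Hab Hg)).
Qed.

Lemma mean_value_C g g' a b M : a <= b -> (forall t, a <= t <= b -> derR g t (g' t)) ->
  contI g' a b -> (forall t, a <= t <= b -> Cmod (g' t) <= M) ->
  Cmod (g b - g a) <= (b - a) * M.
Proof. intros Hab Hg Hc HM. rewrite <- (CI_FTC g g') by assumption. now apply CI_norm. Qed.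

(** * Goursat's theorem *)

Lemma Cmod_tri4 (a b c d : C) : Cmod (a + b - c - d) <= Cmod a + Cmod b + Cmod c + Cmod d.
Proof.
  eapply Rle_trans; [apply Cmod_minus_le|]. apply Rplus_le_compat_r.
  eapply Rle_trans; [apply Cmod_minus_le|]. apply Rplus_le_compat_r. apply Cmod_triangle.
Qed.

(* Goursat's lemma in parameter space: the form [f(w) dw] is pulled back along
   [W : [a,b] x [c,d] -> C] and the parameter rectangle is bisected. *)
Section Goursat.
Variables (W Wx Wy : R -> R -> C) (f : C -> C) (A B C0 D L : R).
Hypothesis (HL : 0 < L).
Hypothesis HWx : forall x y, A <= x <= B -> C0 <= y <= D -> derR (fun x => W x y) x (Wx x y).
Hypothesis HWy : forall x y, A <= x <= B -> C0 <= y <= D -> derR (fun y => W x y) y (Wy x y).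
Hypothesis HcWx : forall x y, A <= x <= B -> C0 <= y <= D -> contR (fun x => Wx x y) x.
Hypothesis HcWy : forall x y, A <= x <= B -> C0 <= y <= D -> contR (fun y => Wy x y) y.
Hypothesis HbWx : forall x y, A <= x <= B -> C0 <= y <= D -> Cmod (Wx x y) <= L.
Hypothesis HbWy : forall x y, A <= x <= B -> C0 <= y <= D -> Cmod (Wy x y) <= L.
Hypothesis Hf : forall x y, A <= x <= B -> C0 <= y <= D -> exists l, derC f (W x y) l.

Definition hside (h : C -> C) y a b := CI (fun x => h (W x y) * Wx x y)%C a b.
Definition vside (h : C -> C) x c d := CI (fun y => h (W x y) * Wy x y)%C c d.
Definition rect_int (h : C -> C) a b c d : C :=
  (hside h c a b + vside h b c d - hside h d a b - vside h a c d)%C.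

Definition subrect a b c d := A <= a /\ a <= b /\ b <= B /\ C0 <= c /\ c <= d /\ d <= D.

Definition cont_on_W (h : C -> C) := forall x y, A <= x <= B -> C0 <= y <= D -> contC h (W x y).

Lemma contI_h h y a b : cont_on_W h -> A <= a -> b <= B -> C0 <= y <= D ->
  contI (fun x => h (W x y) * Wx x y)%C a b.
Proof.
  intros Hh Ha Hb Hy t Ht. apply contR_mult; [|apply HcWx; lra].
  apply contR_comp; [apply Hh; lra|]. eapply contR_of_derR, HWx; lra.
Qed.

Lemma contI_v h x c d : cont_on_W h -> C0 <= c -> d <= D -> A <= x <= B ->
  contI (fun y => h (W x y) * Wy x y)%C c d.
Proof.
  intros Hh Ha Hb Hy t Ht. apply contR_mult; [|apply HcWy; lra].
  apply contR_comp; [apply Hh; lra|]. eapply contR_of_derR, HWy; lra.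
Qed.

Lemma cont_f : cont_on_W f.
Proof. intros x y Hx Hy. destruct (Hf x y Hx Hy) as [l Hl]. eapply contC_of_derC, Hl. Qed.

Lemma rect_int_split h a b c d : cont_on_W h -> subrect a b c d ->
  let m := (a + b) / 2 in let n := (c + d) / 2 in
  rect_int h a b c d = (rect_int h a m c n + rect_int h m b c n
    + rect_int h a m n d + rect_int h m b n d)%C.
Proof.
  intros Hh (H1 & H2 & H3 & H4 & H5 & H6) m n.
  assert (a <= m /\ m <= b) by (unfold m; lra). assert (c <= n /\ n <= d) by (unfold n; lra).
  unfold rect_int, hside, vside.
  rewrite (CI_Chasles (fun x => h (W x c) * Wx x c)%C a m b), (CI_Chasles (fun x => h (W x d) * Wx x d)%C a m b),
    (CI_Chasles (fun y => h (W a y) * Wy a y)%C c n d), (CI_Chasles (fun y => h (W b y) * Wy b y)%C c n d);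
    try lra; try (apply contI_h; auto; lra); try (apply contI_v; auto; lra).
  ring.
Qed.

Lemma rect_int_le h a b c d M : cont_on_W h -> subrect a b c d ->
  (forall x y, a <= x <= b -> c <= y <= d -> Cmod (h (W x y)) <= M) ->
  Cmod (rect_int h a b c d) <= 2 * (M * L) * (b - a + (d - c)).
Proof.
  intros Hh (H1 & H2 & H3 & H4 & H5 & H6) HM.
  assert (0 <= M) by (eapply Rle_trans; [apply Cmod_ge_0|apply (HM a c); lra]).
  unfold rect_int. eapply Rle_trans; [apply Cmod_tri4|].
  assert (Hhs : forall y, c <= y <= d -> Cmod (hside h y a b) <= (b - a) * (M * L)).
  { intros y Hy. apply CI_norm; [lra|apply contI_h; auto; lra|]. intros t Ht. rewrite Cmod_mult.
    apply Rmult_le_compat; try apply Cmod_ge_0; [apply HM|apply HbWx]; lra. }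
  assert (Hvs : forall x, a <= x <= b -> Cmod (vside h x c d) <= (d - c) * (M * L)).
  { intros y Hy. apply CI_norm; [lra|apply contI_v; auto; lra|]. intros t Ht. rewrite Cmod_mult.
    apply Rmult_le_compat; try apply Cmod_ge_0; [apply HM|apply HbWy]; lra. }
  pose proof (Hhs c). pose proof (Hhs d). pose proof (Hvs a). pose proof (Hvs b). lra.
Qed.

Lemma rect_int_plus h k a b c d : cont_on_W h -> cont_on_W k -> subrect a b c d ->
  rect_int (fun w => h w + k w)%C a b c d = (rect_int h a b c d + rect_int k a b c d)%C.
Proof.
  intros Hh Hk (H1 & H2 & H3 & H4 & H5 & H6).
  assert (Ha : forall y, c <= y <= d ->
    hside (fun w => h w + k w)%C y a b = (hside h y a b + hside k y a b)%C).
  { intros y Hy. unfold hside. rewrite <- CI_plus; try (apply contI_h; auto; lra); [|lra].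
    apply CI_ext; [lra|]. intros. ring. }
  assert (Hb : forall x, a <= x <= b ->
    vside (fun w => h w + k w)%C x c d = (vside h x c d + vside k x c d)%C).
  { intros y Hy. unfold vside. rewrite <- CI_plus; try (apply contI_v; auto; lra); [|lra].
    apply CI_ext; [lra|]. intros. ring. }
  unfold rect_int. rewrite (Ha c), (Ha d), (Hb a), (Hb b) by lra. ring.
Qed.

(** With a primitive each side contributes a difference of corner values, and the four differences
    cancel. *)
Lemma rect_int_exact P h a b c d : cont_on_W h ->
  (forall x y, A <= x <= B -> C0 <= y <= D -> derC P (W x y) (h (W x y))) ->
  subrect a b c d -> rect_int h a b c d = 0.
Proof.
  intros Hh HP (H1 & H2 & H3 & H4 & H5 & H6).
  assert (Ha : forall y, c <= y <= d -> hside h y a b = (P (W b y) - P (W a y))%C).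
  { intros y Hy. unfold hside. rewrite (CI_FTC (fun x => P (W x y))); auto; [|apply contI_h; auto; lra].
    intros t Ht. eapply derR_eq; [apply derR_comp; [apply HP; lra|apply HWx; lra]|ring]. }
  assert (Hb : forall x, a <= x <= b -> vside h x c d = (P (W x d) - P (W x c))%C).
  { intros y Hy. unfold vside. rewrite (CI_FTC (fun x => P (W y x))); auto; [|apply contI_v; auto; lra].
    intros t Ht. eapply derR_eq; [apply derR_comp; [apply HP; lra|apply HWy; lra]|ring]. }
  unfold rect_int. rewrite (Ha c), (Ha d), (Hb a), (Hb b) by lra. ring.
Qed.

Lemma W_lip x y x' y' : A <= x <= B -> C0 <= y <= D -> A <= x' <= B -> C0 <= y' <= D ->
  Cmod (W x y - W x' y') <= L * (Rabs (x - x') + Rabs (y - y')).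
Proof.
  intros Hx Hy Hx' Hy'.
  assert (H1 : forall u v, A <= u <= B -> A <= v <= B -> u <= v -> Cmod (W v y - W u y) <= L * (v - u)).
  { intros u v Hu Hv Huv. rewrite Rmult_comm.
    apply (mean_value_C (fun x => W x y) (fun x => Wx x y)); auto.
    - intros t Ht. apply HWx; lra.
    - intros t Ht. apply HcWx; lra.
    - intros t Ht. apply HbWx; lra. }
  assert (H2 : forall u v, C0 <= u <= D -> C0 <= v <= D -> u <= v -> Cmod (W x' v - W x' u) <= L * (v - u)).
  { intros u v Hu Hv Huv. rewrite Rmult_comm.
    apply (mean_value_C (fun y => W x' y) (fun y => Wy x' y)); auto.
    - intros t Ht. apply HWy; lra.
    - intros t Ht. apply HcWy; lra.
    - intros t Ht. apply HbWy; lra. }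
  eapply Rle_trans; [apply (Cmod_tri _ (W x' y))|]. rewrite Rmult_plus_distr_l.
  apply Rplus_le_compat.
  - destruct (Rle_dec x' x).
    + rewrite Rabs_pos_eq by lra. apply H1; lra.
    + rewrite Cmod_sym, Rabs_left by lra. replace (- (x - x')) with (x' - x) by ring. apply H1; lra.
  - destruct (Rle_dec y' y).
    + rewrite Rabs_pos_eq by lra. apply H2; lra.
    + rewrite Cmod_sym, Rabs_left by lra. replace (- (y - y')) with (y' - y) by ring. apply H2; lra.
Qed.

(** Near the point [f] is affine up to an error small compared with the distance. The affine part
    has a primitive and contributes nothing; the error, times the length of the boundary, is
    quadratic in the size. *)
Lemma rect_int_local x y e : A <= x <= B -> C0 <= y <= D -> 0 < e ->
  exists s, 0 < s /\ forall a b c d, subrect a b c d -> a <= x <= b -> c <= y <= d ->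
    b - a + (d - c) < s -> Cmod (rect_int f a b c d) <= e * (b - a + (d - c)) ^ 2.
Proof.
  intros Hx Hy He. destruct (Hf x y Hx Hy) as [l Hl].
  set (w0 := W x y) in *.
  (* One [L] comes from the Lipschitz bound on [W], the other from the bound on its derivatives, and
     the 2 from the two pairs of sides in [rect_int_le]. *)
  set (e' := e / (2 * (L * L))).
  assert (He' : 0 < e') by (apply Rdiv_lt_0_compat; nra).
  destruct (Hl e' He') as [dl [Hdl K]].
  exists (dl / L). split; [apply Rdiv_lt_0_compat; lra|].
  intros a b c d Hs Hxa Hyc Hsz.
  set (lin := fun w : C => (f w0 + (w - w0) * l)%C).
  set (err := fun w : C => (f w + - lin w)%C).
  assert (Hlin : forall w, contC lin w).
  { intros w. apply contC_plus; [apply contC_const|]. apply contC_mult; [|apply contC_const].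
    apply contC_plus; [apply contC_id|apply contC_const]. }
  assert (Hlin' : cont_on_W lin) by (intros u v _ _; apply Hlin).
  assert (Herr : cont_on_W err).
  { intros u v Hu Hv. apply contC_plus; [now apply cont_f|].
    assert (contC (fun w => - (1) * lin w)%C (W u v)) as H by (apply contC_mult; [apply contC_const|apply Hlin]).
    intros q Hq. destruct (H q Hq) as [r [Hr Kr]]. exists r. split; auto. intros w Hw.
    replace (- lin w - - lin (W u v))%C with (- (1) * lin w - - (1) * lin (W u v))%C by ring. auto. }
  assert (E : rect_int f a b c d = rect_int (fun w => lin w + err w)%C a b c d).
  { unfold rect_int, hside, vside. destruct Hs as (H1 & H2 & H3 & H4 & H5 & H6).
    assert (Hle : forall w, f w = (lin w + err w)%C) by (intros w; unfold err; ring).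
    f_equal; [f_equal; [f_equal|]|]; apply CI_ext; try lra; intros; rewrite <- Hle; reflexivity. }
  rewrite E, rect_int_plus by auto.
  rewrite (rect_int_exact (fun w => f w0 * w + / 2 * ((w - w0) * (w - w0)) * l)%C lin); auto.
  2:{ intros u v _ _. set (w := W u v). unfold lin.
    assert (Hi : derC (fun w : C => w - w0)%C w 1).
    { eapply derC_eq; [apply (derC_plus (fun w => w) (fun _ => - w0)%C); [apply derC_id|apply derC_const]|ring]. }
    eapply derC_eq.
    - apply derC_plus.
      + apply derC_mult; [apply derC_const|apply derC_id].
      + apply derC_mult; [|apply derC_const]. apply derC_mult; [apply derC_const|].
        apply derC_mult; exact Hi.
    - cbv beta. field. }
  rewrite Cplus_0_l.
  pose proof Hs as (H1 & H2 & H3 & H4 & H5 & H6).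
  set (s := b - a + (d - c)) in *.
  apply Rle_trans with (2 * (e' * (L * s) * L) * s); [|right; unfold e'; field; lra].
  apply rect_int_le; auto.
  intros u v Hu Hv. unfold err, lin.
  assert (Hw : Cmod (W u v - w0) <= L * s).
  { eapply Rle_trans; [apply W_lip; lra|]. apply Rmult_le_compat_l; [lra|].
    unfold s. apply Rplus_le_compat; apply Rabs_le; lra. }
  replace (f (W u v) + - (f w0 + (W u v - w0) * l))%C with (f (W u v) - f w0 - (W u v - w0) * l)%C by ring.
  eapply Rle_trans; [apply K|].
  - eapply Rle_lt_trans; [exact Hw|]. apply (Rmult_lt_compat_l L) in Hsz; [|lra].
    replace (L * (dl / L)) with dl in Hsz by (field; lra). exact Hsz.
  - apply Rmult_le_compat_l; lra.
Qed.

Record rect := mkrect { ra : R; rb : R; rc : R; rd : R }.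

(** The threshold is quadratic in the size, so it drops by exactly 4 under bisection and some
    quarter is bad with the same [e]. *)
Definition bad e (r : rect) := subrect (ra r) (rb r) (rc r) (rd r) /\
  e * (rb r - ra r + (rd r - rc r)) ^ 2 < Cmod (rect_int f (ra r) (rb r) (rc r) (rd r)).

Definition quarter (r q : rect) :=
  ra r <= ra q /\ rb q <= rb r /\ rc r <= rc q /\ rd q <= rd r /\
  rb q - ra q = (rb r - ra r) / 2 /\ rd q - rc q = (rd r - rc r) / 2.

Lemma bad_quarter e r : bad e r -> exists q, bad e q /\ quarter r q.
Proof.
  intros [Hs Hb]. pose proof Hs as (H1 & H2 & H3 & H4 & H5 & H6).
  destruct r as [a b c d]; simpl in *.
  set (m := (a + b) / 2). set (n := (c + d) / 2).
  assert (Hm : a <= m <= b /\ b - m = (b - a) / 2 /\ m - a = (b - a) / 2) by (unfold m; lra).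
  assert (Hn : c <= n <= d /\ d - n = (d - c) / 2 /\ n - c = (d - c) / 2) by (unfold n; lra).
  apply NNPP. intros Hno.
  assert (Hq : forall q, subrect (ra q) (rb q) (rc q) (rd q) -> quarter (mkrect a b c d) q ->
    Cmod (rect_int f (ra q) (rb q) (rc q) (rd q)) <= e * (b - a + (d - c)) ^ 2 / 4).
  { intros q Hsq Hq. apply Rnot_lt_le. intros Hlt. apply Hno. exists q. split; [split|]; auto.
    destruct Hq as (_ & _ & _ & _ & E1 & E2). simpl in *. rewrite E1, E2.
    eapply Rle_lt_trans; [|exact Hlt]. right. field. }
  rewrite (rect_int_split f a b c d cont_f Hs) in Hb. fold m n in Hb.
  assert (Q1 := Hq (mkrect a m c n)). assert (Q2 := Hq (mkrect m b c n)).
  assert (Q3 := Hq (mkrect a m n d)). assert (Q4 := Hq (mkrect m b n d)).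
  unfold quarter, subrect in Q1, Q2, Q3, Q4; simpl in Q1, Q2, Q3, Q4.
  assert (Q1' := Q1 ltac:(repeat split; lra) ltac:(repeat split; lra)).
  assert (Q2' := Q2 ltac:(repeat split; lra) ltac:(repeat split; lra)).
  assert (Q3' := Q3 ltac:(repeat split; lra) ltac:(repeat split; lra)).
  assert (Q4' := Q4 ltac:(repeat split; lra) ltac:(repeat split; lra)).
  clear Q1 Q2 Q3 Q4.
  match type of Hb with _ < Cmod (?a + ?b + ?c + ?d) =>
    pose proof (Cmod_triangle (a + b + c) d); pose proof (Cmod_triangle (a + b) c);
    pose proof (Cmod_triangle a b) end.
  lra.
Qed.

Lemma goursat_rect : A <= B -> C0 <= D -> rect_int f A B C0 D = 0.
Proof.
  intros HAB HCD. apply Cmod_eq_0, Rle_antisym; [|apply Cmod_ge_0].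
  apply Rnot_lt_le. intros Hpos.
  set (s0 := B - A + (D - C0)).
  (* Small enough for the whole rectangle to be bad; the summand 1 admits a degenerate rectangle. *)
  set (e := Cmod (rect_int f A B C0 D) / (2 * (s0 ^ 2 + 1))).
  assert (Hs0 : 0 <= s0 ^ 2) by apply pow2_ge_0.
  assert (He : 0 < e) by (apply Rdiv_lt_0_compat; lra).
  assert (Hbad0 : bad e (mkrect A B C0 D)).
  { split; [unfold subrect; simpl; lra|]. simpl ra; simpl rb; simpl rc; simpl rd. fold s0.
    assert (e * (2 * (s0 ^ 2 + 1)) = Cmod (rect_int f A B C0 D)) by (unfold e; field; lra). nra. }
  assert (Hch : forall r, exists q, bad e r -> bad e q /\ quarter r q).
  { intros r. destruct (classic (bad e r)) as [H|H]; [|exists r; tauto].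
    destruct (bad_quarter e r H) as [q Hq]. exists q; auto. }
  apply choice in Hch. destruct Hch as [nx Hnx].
  set (r := fun n => Nat.iter n nx (mkrect A B C0 D)).
  assert (Hr : forall n, bad e (r n)).
  { induction n; [exact Hbad0|]. apply Hnx, IHn. }
  assert (Hq : forall n, quarter (r n) (r (S n))) by (intros n; apply (Hnx (r n)), Hr).
  assert (Hmono : forall n k, ra (r n) <= ra (r (n + k)%nat) /\ rb (r (n + k)%nat) <= rb (r n) /\
     rc (r n) <= rc (r (n + k)%nat) /\ rd (r (n + k)%nat) <= rd (r n)).
  { intros n k. induction k.
    - rewrite Nat.add_0_r. repeat split; lra.
    - rewrite Nat.add_succ_r. destruct (Hq (n + k)%nat) as (? & ? & ? & ? & _). lra. }
  assert (Hord : forall n, ra (r n) <= rb (r n) /\ rc (r n) <= rd (r n)).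
  { intros n. destruct (Hr n) as [(? & ? & ? & ? & ? & ?) _]. lra. }
  assert (Hcross : forall n m, ra (r n) <= rb (r m) /\ rc (r n) <= rd (r m)).
  { intros n m. destruct (Nat.le_ge_cases n m) as [H|H].
    - destruct (Hmono n (m - n)%nat) as (? & ? & ? & ?). replace (n + (m - n))%nat with m in * by lia.
      destruct (Hord m). lra.
    - destruct (Hmono m (n - m)%nat) as (? & ? & ? & ?). replace (m + (n - m))%nat with n in * by lia.
      destruct (Hord n). lra. }
  assert (Hlim : forall u v : nat -> R, (forall n m, u n <= v m) -> exists x, forall n, u n <= x <= v n).
  { intros u v H. destruct (completeness (fun x => exists n, x = u n)) as [x [Hu Hl]].
    - exists (v O). intros y [n ->]. apply H.
    - exists (u O), O; reflexivity.
    - exists x. intros n. split; [apply Hu; eauto|]. apply Hl. intros y [k ->]. apply H. }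
  destruct (Hlim (fun n => ra (r n)) (fun n => rb (r n))) as [x Hx]; [apply Hcross|].
  destruct (Hlim (fun n => rc (r n)) (fun n => rd (r n))) as [y Hy]; [apply Hcross|].
  pose proof (Hx O) as Hx0. pose proof (Hy O) as Hy0. simpl in Hx0, Hy0.
  destruct (rect_int_local x y e Hx0 Hy0 He) as [s [Hs K]].
  assert (Hsz : forall n, rb (r n) - ra (r n) + (rd (r n) - rc (r n)) = s0 / 2 ^ n).
  { induction n; [simpl; unfold s0; field|].
    destruct (Hq n) as (_ & _ & _ & _ & E1 & E2). rewrite E1, E2.
    replace ((rb (r n) - ra (r n)) / 2 + (rd (r n) - rc (r n)) / 2)
      with ((rb (r n) - ra (r n) + (rd (r n) - rc (r n))) / 2) by field.
    rewrite IHn. simpl. field. apply pow_nonzero; lra. }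
  assert (Hs0' : 0 <= s0) by (unfold s0; lra).
  destruct (Pow_x_infinity 2 ltac:(rewrite Rabs_pos_eq; lra) (s0 / s + 1)) as [n Hn].
  specialize (Hn n (Nat.le_refl n)). rewrite Rabs_pos_eq in Hn by (apply pow_le; lra).
  destruct (Hr n) as [Hsr Hb].
  assert (H2n : 0 < 2 ^ n) by (apply pow_lt; lra).
  specialize (K _ _ _ _ Hsr (Hx n) (Hy n)).
  assert (Hlt : rb (r n) - ra (r n) + (rd (r n) - rc (r n)) < s).
  { rewrite Hsz. apply (Rmult_lt_reg_r (2 ^ n)); [exact H2n|].
    replace (s0 / 2 ^ n * 2 ^ n) with s0 by (field; lra).
    apply Rlt_le_trans with (s * (s0 / s + 1)); [|apply Rmult_le_compat_l; lra].
    replace (s * (s0 / s + 1)) with (s0 + s) by (field; lra). lra. }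
  specialize (K Hlt). lra.
Qed.

Lemma goursat_W : A <= B -> C0 <= D ->
  (CI (fun x => f (W x C0) * Wx x C0) A B + CI (fun y => f (W B y) * Wy B y) C0 D
   = CI (fun x => f (W x D) * Wx x D) A B + CI (fun y => f (W A y) * Wy A y) C0 D)%C.
Proof.
  intros HAB HCD. pose proof (goursat_rect HAB HCD) as H. unfold rect_int, hside, vside in H.
  match type of H with (?p + ?q - ?r - ?s)%C = _ =>
    replace (p + q)%C with ((p + q - r - s) + (r + s))%C by ring end.
  rewrite H. ring.
Qed.

End Goursat.

(** * Cauchy's integral formula and its consequences *)

Definition cis (t : R) : C := (cos t, sin t).

Lemma Cmod_cis t : Cmod (cis t) = 1.
Proof.
  unfold Cmod, cis; simpl fst; simpl snd. rewrite <- sqrt_1. f_equal.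
  pose proof (sin2_cos2 t). unfold Rsqr in H. simpl. lra.
Qed.

Lemma cis_neq0 t : cis t <> 0.
Proof. apply Cmod_gt_0. rewrite Cmod_cis. lra. Qed.

Lemma derR_cis t : derR cis t (Ci * cis t)%C.
Proof.
  intros e He.
  assert (H1 := derivable_pt_lim_cos t (e / 2) ltac:(lra)).
  assert (H2 := derivable_pt_lim_sin t (e / 2) ltac:(lra)).
  destruct H1 as [d1 K1]. destruct H2 as [d2 K2].
  exists (Rmin d1 d2). split; [apply Rmin_glb_lt; apply cond_pos|]. intros s Hs.
  assert (L1 := Rlt_le_trans _ _ _ Hs (Rmin_l _ _)). assert (L2 := Rlt_le_trans _ _ _ Hs (Rmin_r _ _)).
  destruct (Req_dec s t) as [->|n].
  - replace (cis t - cis t - RtoC (t - t) * (Ci * cis t))%C with (RtoC 0).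
    + rewrite Cmod_0. pose proof (Rabs_pos (t - t)). nra.
    + rewrite Rminus_diag. ring.
  - assert (n' : s - t <> 0) by lra.
    specialize (K1 (s - t) n' L1). specialize (K2 (s - t) n' L2).
    replace (t + (s - t)) with s in * by ring.
    replace (cis s - cis t - RtoC (s - t) * (Ci * cis t))%C
      with (RtoC (s - t) * (((cos s - cos t) / (s - t) - - sin t)%R, ((sin s - sin t) / (s - t) - cos t)%R))%C.
    + rewrite Cmod_Rmult, Rmult_comm. apply Rmult_le_compat_r; [apply Rabs_pos|].
      eapply Rle_trans; [apply Cmod_2Rmax|]. simpl fst; simpl snd.
      apply Rle_trans with (2 * (e / 2)); [|lra].
      apply Rmult_le_compat; [apply sqrt_pos| | |].
      * eapply Rle_trans; [apply Rabs_pos|apply Rmax_l].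
      * apply Rsqr_incr_0_var; [|lra]. rewrite Rsqr_sqrt by lra. unfold Rsqr; lra.
      * apply Rmax_lub; lra.
    + unfold cis, Ci, RtoC, Cmult, Cminus, Cplus, Copp; simpl. f_equal; field; exact n'.
Qed.

Lemma derR_affine (a b : C) t : derR (fun s => a + RtoC s * b)%C t b.
Proof.
  eapply derR_eq.
  - apply derR_plus; [apply derR_const|].
    apply (derR_comp (fun w => w * b)%C RtoC); [|apply derR_id].
    apply derC_mult; [apply derC_id|apply derC_const].
  - cbv beta; ring.
Qed.

Lemma contR_affine (a b : C) t : contR (fun s => a + RtoC s * b)%C t.
Proof. eapply contR_of_derR, derR_affine. Qed.

Lemma contI_bounded f a b : a <= b -> contI f a b -> exists M, 0 < M /\ forall t, a <= t <= b -> Cmod (f t) <= M.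
Proof.
  intros Hab Hf. destruct (continuity_ab_maj (fun t => Cmod (f t)) a b Hab) as [x [Hx _]].
  - intros t Ht e He. destruct (Hf t Ht e He) as [d [Hd K]]. exists d. split; [exact Hd|].
    intros s [_ Hs]. unfold dist in *; simpl in *; unfold Rdist in *. specialize (K s Hs).
    pose proof (Cmod_rev (f s) (f t)). pose proof (Cmod_rev (f t) (f s)). rewrite Cmod_sym in H0.
    apply Rabs_def1; lra.
  - exists (Cmod (f x) + 1). split; [pose proof (Cmod_ge_0 (f x)); lra|].
    intros t Ht. specialize (Hx t Ht). simpl in Hx. lra.
Qed.

(** The primitive is the integral along the radius from [p]. The square mapped by
    [p + s ((z - p) + t h)] is a triangle, its side [s = 0] collapsing to [p]; Goursat on it turns
    the increment of the primitive into the integral over the segment from [z] to [z + h]. *)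
Lemma primitive_ball (f : C -> C) (p : C) (R0 : R) : 0 < R0 ->
  (forall z, Cmod (z - p) < R0 -> exists l, derC f z l) ->
  exists G, forall z, Cmod (z - p) < R0 -> derC G z (f z).
Proof.
  intros HR Hf.
  assert (Hcf : forall z, Cmod (z - p) < R0 -> contC f z).
  { intros z Hz. destruct (Hf z Hz) as [l Hl]. eapply contC_of_derC, Hl. }
  exists (fun z => CI (fun s => f (p + RtoC s * (z - p)) * (z - p))%C 0 1).
  assert (Hconv : forall z h s t, Cmod (z - p) < R0 -> Cmod (z + h - p) < R0 -> 0 <= s <= 1 -> 0 <= t <= 1 ->
    Cmod (p + RtoC s * ((z - p) + RtoC t * h) - p) < R0).
  { intros z h s t Hz Hh Hs Ht.
    replace (p + RtoC s * (z - p + RtoC t * h) - p)%C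
      with (RtoC (s * (1 - t)) * (z - p) + RtoC (s * t) * (z + h - p))%C
      by (rewrite !RtoC_mult, RtoC_minus; ring).
    eapply Rle_lt_trans; [apply Cmod_triangle|]. rewrite !Cmod_Rmult, !Rabs_pos_eq by nra.
    assert (0 <= s * t) by nra. assert (0 <= s * (1 - t)) by nra.
    pose proof (Cmod_ge_0 (z - p)). pose proof (Cmod_ge_0 (z + h - p)).
    set (m := Rmax (Cmod (z - p)) (Cmod (z + h - p))).
    assert (m < R0) by (apply Rmax_lub_lt; auto).
    assert (Cmod (z - p) <= m) by apply Rmax_l. assert (Cmod (z + h - p) <= m) by apply Rmax_r.
    apply Rle_lt_trans with (s * (1 - t) * m + s * t * m); [|replace (s * (1 - t) * m + s * t * m) with (s * m) by ring; nra].
    apply Rplus_le_compat; apply Rmult_le_compat_l; lra. }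
  assert (Hdiff : forall z h, Cmod (z - p) < R0 -> Cmod (z + h - p) < R0 ->
    (CI (fun s => f (p + RtoC s * (z + h - p)) * (z + h - p)) 0 1
     = CI (fun s => f (p + RtoC s * (z - p)) * (z - p)) 0 1 + CI (fun t => f (z + RtoC t * h) * h) 0 1)%C).
  { intros z h Hz Hh.
    set (L := Cmod (z - p) + Cmod h + 1).
    assert (HL : 0 < L) by (unfold L; pose proof (Cmod_ge_0 (z - p)); pose proof (Cmod_ge_0 h); lra).
    pose proof (goursat_W (fun s t => p + RtoC s * ((z - p) + RtoC t * h))%C
      (fun s t => (z - p) + RtoC t * h)%C (fun s t => RtoC s * h)%C f 0 1 0 1 L HL) as Hg.
    cbv beta in Hg.
    assert (Hg' := Hg
      (fun x y _ _ => derR_affine _ _ _)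
      (fun x y _ _ => ltac:(eapply derR_ext; [|apply (derR_affine (p + RtoC x * (z - p)) (RtoC x * h))];
          intros; simpl; ring))
      (fun x y _ _ => contR_const _ _) (fun x y _ _ => contR_const _ _)).
    clear Hg.
    assert (E := Hg' ltac:(intros x y Hx Hy; unfold L; eapply Rle_trans; [apply Cmod_triangle|];
      rewrite Cmod_Rmult, Rabs_pos_eq by lra; pose proof (Cmod_ge_0 h); nra)
      ltac:(intros x y Hx Hy; unfold L; rewrite Cmod_Rmult, Rabs_pos_eq by lra;
        pose proof (Cmod_ge_0 h); pose proof (Cmod_ge_0 (z - p)); nra)
      ltac:(intros x y Hx Hy; apply Hf, Hconv; auto) ltac:(lra) ltac:(lra)).
    clear Hg'.
    transitivity (CI (fun x => f (p + RtoC x * (z - p + RtoC 1 * h)) * (z - p + RtoC 1 * h)) 0 1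
      + CI (fun y => f (p + RtoC 0 * (z - p + RtoC y * h)) * (RtoC 0 * h)) 0 1)%C.
    - rewrite (CI_ext (fun y => f (p + RtoC 0 * (z - p + RtoC y * h)) * (RtoC 0 * h))%C (fun _ => RtoC 0));
        [|lra|intros; ring].
      rewrite CI_const. replace (z - p + RtoC 1 * h)%C with (z + h - p)%C by ring. ring.
    - rewrite <- E. f_equal.
      + apply CI_ext; [lra|]. intros t _. replace (z - p + RtoC 0 * h)%C with (z - p)%C by ring. reflexivity.
      + apply CI_ext; [lra|]. intros t _. f_equal; [f_equal|]; ring. }
  intros z Hz e He.
  destruct (Hcf z Hz (e) ltac:(lra)) as [d [Hd K]].
  exists (Rmin d (R0 - Cmod (z - p))). split; [apply Rmin_glb_lt; lra|].
  intros w Hw.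
  assert (L1 := Rlt_le_trans _ _ _ Hw (Rmin_l _ _)). assert (L2 := Rlt_le_trans _ _ _ Hw (Rmin_r _ _)).
  set (h := (w - z)%C) in *.
  assert (Ew : w = (z + h)%C) by (unfold h; ring).
  assert (Hzh : Cmod (z + h - p) < R0).
  { replace (z + h - p)%C with ((z - p) + h)%C by ring. eapply Rle_lt_trans; [apply Cmod_triangle|]. lra. }
  rewrite Ew, Hdiff by auto.
  match goal with |- Cmod (?a + ?b - ?a - ?c) <= _ => replace (a + b - a - c)%C with (b - c)%C by ring end.
  assert (Hin : forall t, 0 <= t <= 1 -> Cmod (z + RtoC t * h - p) < R0).
  { intros t Ht. replace (z + RtoC t * h - p)%C with (p + RtoC 1 * ((z - p) + RtoC t * h) - p)%C by ring.
    apply Hconv; auto; lra. }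
  assert (Hc : contI (fun t => f (z + RtoC t * h) * h)%C 0 1).
  { intros t Ht. apply contR_mult; [|apply contR_const]. apply contR_comp; [apply Hcf, Hin, Ht|apply contR_affine]. }
  replace (h * f z)%C with (CI (fun _ => f z * h)%C 0 1) by (rewrite CI_const; replace (1 - 0) with 1 by ring; ring).
  rewrite <- CI_minus; [|lra|exact Hc|apply contI_const].
  replace (e * Cmod h) with ((1 - 0) * (e * Cmod h)) by ring.
  apply CI_norm; [lra| |].
  - intros t Ht. assert (contI (fun t => f (z + RtoC t * h) * h + - (f z * h))%C 0 1) as H.
    { apply contI_plus; [exact Hc|apply contI_const]. } exact (H t Ht).
  - intros t Ht. replace (f (z + RtoC t * h) * h - f z * h)%C with ((f (z + RtoC t * h) - f z) * h)%C by ring.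
    rewrite Cmod_mult. apply Rmult_le_compat_r; [apply Cmod_ge_0|]. left. apply K.
    replace (z + RtoC t * h - z)%C with (RtoC t * h)%C by ring. rewrite Cmod_Rmult, Rabs_pos_eq by lra.
    pose proof (Cmod_ge_0 h). nra.
Qed.

Definition differentiable (F : C -> C) : Prop := forall z, exists l, derC F z l.

Lemma differentiable_cont F : differentiable F -> forall z, contC F z.
Proof. intros H z. destruct (H z) as [l Hl]. eapply contC_of_derC, Hl. Qed.

Definition circ (a : C) (R0 t : R) : C := (a + RtoC R0 * cis t)%C.

Lemma derR_circ a R0 t : derR (circ a R0) t (RtoC R0 * (Ci * cis t))%C.
Proof.
  unfold circ. eapply derR_eq.
  - apply derR_plus; [apply derR_const|].
    apply (derR_comp (fun w => RtoC R0 * w)%C cis); [|apply derR_cis].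
    apply derC_mult; [apply derC_const|apply derC_id].
  - cbv beta; ring.
Qed.

Lemma contR_circ a R0 t : contR (circ a R0) t.
Proof. eapply contR_of_derR, derR_circ. Qed.

Lemma contR_cis t : contR cis t.
Proof. eapply contR_of_derR, derR_cis. Qed.

Lemma circ_dist a R0 t z : 0 < R0 -> Cmod (z - a) < R0 -> R0 - Cmod (z - a) <= Cmod (circ a R0 t - z).
Proof.
  intros HR Hz. unfold circ.
  pose proof (Cmod_rev (RtoC R0 * cis t) (z - a)) as H.
  rewrite Cmod_Rmult, Cmod_cis, Rabs_pos_eq in H by lra.
  replace (a + RtoC R0 * cis t - z)%C with (RtoC R0 * cis t - (z - a))%C by ring. lra.
Qed.

(** The circles with centre [z + x (a - z)] and radius [ep + x (R0 - ep)] lead from a small circle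
    around [z] to the given one without passing through [z]; by periodicity the two remaining sides
    of the parameter rectangle cancel. So the integral equals that over the small circle for every
    [ep], and continuity of [F] at [z] gives the value. *)
Lemma cauchy_formula (F : C -> C) (a z : C) (R0 : R) : differentiable F ->
  Cmod (z - a) < R0 ->
  (CI (fun t => F (circ a R0 t) * / (circ a R0 t - z) * (RtoC R0 * (Ci * cis t))) 0 (2 * PI)
   = RtoC (2 * PI) * (Ci * F z))%C.
Proof.
  intros HF Hz.
  assert (HR : 0 < R0) by (pose proof (Cmod_ge_0 (z - a)); lra).
  pose proof PI_RGT_0 as HPI.
  set (d := R0 - Cmod (z - a)). assert (Hd : 0 < d) by (unfold d; lra).
  assert (Hstep : forall ep, 0 < ep ->
    (CI (fun t => F (circ a R0 t) * / (circ a R0 t - z) * (RtoC R0 * (Ci * cis t))) 0 (2 * PI)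
     = CI (fun t => Ci * F (circ z ep t)) 0 (2 * PI))%C).
  { intros ep Hep.
    set (Wx := fun (x y : R) => ((a - z) + RtoC (R0 - ep) * cis y)%C).
    set (W := fun (x y : R) => (circ z ep y + RtoC x * Wx x y)%C).
    set (Wy := fun (x y : R) => (RtoC (ep + x * (R0 - ep)) * (Ci * cis y))%C).
    set (L := Cmod (a - z) + R0 + ep + 1).
    assert (HWz : forall x y, 0 <= x <= 1 -> (W x y - z)%C <> 0).
    { intros x y Hx. apply Cmod_gt_0.
      replace (W x y - z)%C with (RtoC (ep + x * (R0 - ep)) * cis y - RtoC x * (z - a))%C
        by (unfold W, Wx, circ; rewrite ?RtoC_plus, ?RtoC_mult, ?RtoC_minus; ring).
      assert (0 < ep + x * (R0 - ep) - x * Cmod (z - a)).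
      { replace (ep + x * (R0 - ep) - x * Cmod (z - a)) with ((1 - x) * ep + x * d) by (unfold d; ring).
        destruct (Req_dec x 0) as [->|]; [lra|]. assert (0 < x * d) by nra. nra. }
      eapply Rlt_le_trans; [|apply Cmod_rev]. rewrite !Cmod_Rmult, Cmod_cis.
      assert (0 <= x * Cmod (z - a)) by (pose proof (Cmod_ge_0 (z - a)); nra).
      rewrite !Rabs_pos_eq by lra. lra. }
    pose proof (goursat_W W Wx Wy (fun w => F w * / (w - z))%C 0 1 0 (2 * PI) L) as G.
    assert (Eq := G ltac:(unfold L; pose proof (Cmod_ge_0 (a - z)); lra)
      (fun x y _ _ => derR_affine _ _ _)
      ltac:(intros x y _ _; unfold W, Wx, Wy;
        eapply derR_ext; [|eapply derR_eq; [apply (derR_circ (z + RtoC x * (a - z)) (ep + x * (R0 - ep)))|reflexivity]];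
        intros s; unfold circ; rewrite RtoC_plus, RtoC_mult; ring)
      (fun x y _ _ => contR_const _ _)
      ltac:(intros x y _ _; unfold Wy; apply contR_mult; [apply contR_const|];
        apply contR_mult; [apply contR_const|apply contR_cis])).
    clear G.
    assert (Eq' := Eq
      ltac:(intros x y Hx Hy; unfold Wx, L; eapply Rle_trans; [apply Cmod_triangle|];
        rewrite Cmod_Rmult, Cmod_cis; assert (Rabs (R0 - ep) <= R0 + ep) by (apply Rabs_le; lra); lra)
      ltac:(intros x y Hx Hy; unfold Wy, L; rewrite Cmod_Rmult, Cmod_mult, Cmod_cis, Cmod_Ci;
        assert (Rabs (ep + x * (R0 - ep)) <= R0 + ep) by (apply Rabs_le; nra);
        pose proof (Cmod_ge_0 (a - z)); lra)).
    clear Eq.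
    assert (E := Eq' ltac:(intros x y Hx Hy; destruct (HF (W x y)) as [l Hl]; eexists;
      apply derC_mult; [exact Hl|]; apply derC_inv;
        [apply (derC_plus (fun w => w) (fun _ => - z)%C); [apply derC_id|apply derC_const]|now apply HWz])
      ltac:(lra) ltac:(lra)).
    clear Eq'.
    assert (Hper : forall x, Wx x (2 * PI) = Wx x 0 /\ W x (2 * PI) = W x 0).
    { intros x. assert (E2 : cis (2 * PI) = cis 0) by (unfold cis; now rewrite cos_2PI, sin_2PI, cos_0, sin_0).
      unfold W, Wx, circ. rewrite E2. auto. }
    cbv beta in E.
    rewrite (CI_ext (fun x => (F (W x (2 * PI)%R) * / (W x (2 * PI)%R - z))* Wx x (2 * PI)%R)%C
      (fun x => (F (W x 0) * / (W x 0 - z))* Wx x 0)%C) in E;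
      [|lra|intros t _; destruct (Hper t) as [-> ->]; reflexivity].
    match type of E with (?p + ?q)%C = (?p + ?r)%C => assert (E' : q = r) end.
    { match type of E with (?p + ?q)%C = (?p + ?r)%C =>
        transitivity (p + q - p)%C; [ring|rewrite E; ring] end. }
    transitivity (CI (fun y => F (W 1 y) * / (W 1 y - z) * Wy 1 y)%C 0 (2 * PI)).
    - apply CI_ext; [lra|]. intros t _.
      assert (W 1 t = circ a R0 t) as -> by (unfold W, Wx, circ; rewrite RtoC_minus; ring).
      f_equal. unfold Wy. f_equal. f_equal. ring.
    - rewrite E'. apply CI_ext; [lra|]. intros t _.
      assert (W 0 t = circ z ep t) as -> by (unfold W, Wx, circ; ring).
      unfold Wy, circ. replace (ep + 0 * (R0 - ep)) with ep by ring.
      field. replace (z + RtoC ep * cis t - z)%C with (RtoC ep * cis t)%C by ring.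
      apply Cmod_gt_0. rewrite Cmod_Rmult, Cmod_cis, Rabs_pos_eq; lra. }
  apply Cmod_small_eq. intros e He.
  destruct (differentiable_cont F HF z (e / (2 * PI))) as [dl [Hdl K]]; [apply Rdiv_lt_0_compat; lra|].
  rewrite (Hstep (dl / 2)) by lra.
  replace (RtoC (2 * PI) * (Ci * F z))%C with (CI (fun _ => Ci * F z)%C 0 (2 * PI))
    by (rewrite CI_const; f_equal; f_equal; ring).
  assert (Hc : contI (fun t => Ci * F (circ z (dl / 2) t))%C 0 (2 * PI)).
  { intros t _. apply contR_mult; [apply contR_const|]. apply contR_comp; [now apply differentiable_cont|apply contR_circ]. }
  rewrite <- CI_minus; [|lra|exact Hc|apply contI_const].
  replace e with ((2 * PI - 0) * (e / (2 * PI))) by (field; lra).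
  apply CI_norm; [lra| |].
  - intros t Ht. assert (contI (fun t => Ci * F (circ z (dl / 2) t) + - (Ci * F z))%C 0 (2 * PI)) as H.
    { apply contI_plus; [exact Hc|apply contI_const]. } exact (H t Ht).
  - intros t _.
    replace (Ci * F (circ z (dl / 2) t) - Ci * F z)%C with (Ci * (F (circ z (dl / 2) t) - F z))%C by ring.
    rewrite Cmod_mult, Cmod_Ci, Rmult_1_l. left. apply K. unfold circ.
    replace (z + RtoC (dl / 2) * cis t - z)%C with (RtoC (dl / 2) * cis t)%C by ring.
    rewrite Cmod_Rmult, Cmod_cis, Rabs_pos_eq; lra.
Qed.

Lemma Cmod_inv_le (z : C) m : 0 < m -> m <= Cmod z -> Cmod (/ z) <= / m.
Proof.
  intros Hm Hz. rewrite Cmod_inv by (apply Cmod_gt_0; lra). now apply Rinv_le_contravar.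
Qed.

(** The density is arbitrary because [divide_zero] needs one that is not yet known to be the
    boundary value of a differentiable function. *)
Definition cauchy_int (phi : R -> C) (a : C) (R0 : R) (z : C) : C :=
  CI (fun t => phi t * / (circ a R0 t - z))%C 0 (2 * PI).

Lemma circ_neq a R0 t (z : C) : Cmod (z - a) < R0 -> (circ a R0 t - z)%C <> 0.
Proof.
  intros Hz. assert (HR : 0 < R0) by (pose proof (Cmod_ge_0 (z - a)); lra).
  apply Cmod_gt_0. pose proof (circ_dist a R0 t z HR Hz). lra.
Qed.

Lemma contR_circ_inv a R0 (z : C) t : Cmod (z - a) < R0 -> contR (fun t => / (circ a R0 t - z))%C t.
Proof.
  intros Hz. apply (contR_comp Cinv (fun t => circ a R0 t - z)%C).
  - apply contC_inv. now apply circ_neq.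
  - apply (contR_plus (circ a R0) (fun _ => - z)%C); [apply contR_circ|apply contR_const].
Qed.

(** Differentiation under the integral with the explicit remainder: the difference of the kernels
    minus its linear part is [(w - z)^2] over a product of three denominators. *)
Lemma cauchy_int_der phi a R0 z : contI phi 0 (2 * PI) -> Cmod (z - a) < R0 ->
  exists l, derC (cauchy_int phi a R0) z l.
Proof.
  intros Hphi Hz.
  assert (HR : 0 < R0) by (pose proof (Cmod_ge_0 (z - a)); lra).
  pose proof PI_RGT_0 as HPI.
  destruct (contI_bounded phi 0 (2 * PI) ltac:(lra) Hphi) as [M [HM HMb]].
  set (d := R0 - Cmod (z - a)). assert (Hd : 0 < d) by (unfold d; lra).
  exists (CI (fun t => phi t * (/ (circ a R0 t - z) * / (circ a R0 t - z)))%C 0 (2 * PI)).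
  assert (Hc : forall w, Cmod (w - a) < R0 -> contI (fun t => / (circ a R0 t - w))%C 0 (2 * PI)).
  { intros w Hw t _. now apply contR_circ_inv. }
  intros e He.
  (* On the circle the denominators are at least [d], [d] and, once [w] is within [d / 2] of [z],
     [d / 2]. *)
  set (K := 2 * PI * (M * (2 / (d * d * d)))).
  assert (Hd3 : 0 < d * d * d) by (repeat apply Rmult_lt_0_compat; lra).
  assert (HK : 0 < K) by (unfold K; apply Rmult_lt_0_compat; [lra|]; apply Rmult_lt_0_compat; [lra|]; apply Rdiv_lt_0_compat; lra).
  exists (Rmin (d / 2) (e / K)). split; [apply Rmin_glb_lt; [lra|now apply Rdiv_lt_0_compat]|].
  intros w Hw.
  assert (L1 := Rlt_le_trans _ _ _ Hw (Rmin_l _ _)). assert (L2 := Rlt_le_trans _ _ _ Hw (Rmin_r _ _)).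
  assert (Hwa : Cmod (w - a) < R0 - d / 2).
  { pose proof (Cmod_tri w z a). unfold d in *. lra. }
  unfold cauchy_int.
  rewrite <- CI_minus; try lra; try (apply contI_mult; auto; apply Hc; lra).
  rewrite <- (CI_scal (w - z)); try lra; [|apply contI_mult; auto; apply contI_mult; apply Hc; lra].
  assert (Hcc : contI (fun t => phi t * / (circ a R0 t - w) - phi t * / (circ a R0 t - z))%C 0 (2 * PI)).
  { intros t Ht. apply (contR_plus (fun t => phi t * / (circ a R0 t - w))%C (fun t => - (phi t * / (circ a R0 t - z)))%C).
    - apply contR_mult; [now apply Hphi|apply Hc; lra].
    - apply (contR_ext (fun t => - (1) * (phi t * / (circ a R0 t - z)))%C); [intros; ring|].
      apply contR_mult; [apply contR_const|]. apply contR_mult; [now apply Hphi|apply Hc; lra]. }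
  assert (Hcd : contI (fun t => (w - z) * (phi t * (/ (circ a R0 t - z) * / (circ a R0 t - z))))%C 0 (2 * PI)).
  { apply contI_mult; [apply contI_const|]. apply contI_mult; auto. apply contI_mult; apply Hc; lra. }
  rewrite <- CI_minus; try lra; auto.
  apply Rle_trans with ((2 * PI - 0) * (M * (2 / (d * d * d)) * (Cmod (w - z) * Cmod (w - z)))).
  2:{ replace ((2 * PI - 0) * (M * (2 / (d * d * d)) * (Cmod (w - z) * Cmod (w - z))))
      with (K * Cmod (w - z) * Cmod (w - z)) by (unfold K; field; lra).
    apply Rmult_le_compat_r; [apply Cmod_ge_0|].
    apply (Rmult_lt_compat_l K) in L2; [|exact HK]. replace (K * (e / K)) with e in L2 by (field; lra). lra. }
  apply CI_norm; [lra| |].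
  - intros t Ht.
    apply (contR_plus (fun t => phi t * / (circ a R0 t - w) - phi t * / (circ a R0 t - z))%C
      (fun t => - ((w - z) * (phi t * (/ (circ a R0 t - z) * / (circ a R0 t - z)))))%C); [now apply Hcc|].
    apply (contR_ext (fun t => - (1) * ((w - z) * (phi t * (/ (circ a R0 t - z) * / (circ a R0 t - z)))))%C); [intros; ring|].
    apply contR_mult; [apply contR_const|now apply Hcd].
  - intros t Ht.
    assert (N1 := circ_neq a R0 t z Hz). assert (N2 := circ_neq a R0 t w ltac:(lra)).
    replace (phi t * / (circ a R0 t - w) - phi t * / (circ a R0 t - z) -
       (w - z) * (phi t * (/ (circ a R0 t - z) * / (circ a R0 t - z))))%C
      with (phi t * ((/ (circ a R0 t - z) * / (circ a R0 t - z)) * / (circ a R0 t - w)) * ((w - z) * (w - z)))%C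
      by (field; auto).
    rewrite !Cmod_mult. apply Rmult_le_compat_r; [apply Rmult_le_pos; apply Cmod_ge_0|].
    apply Rmult_le_compat; [apply Cmod_ge_0| |now apply HMb|].
    + repeat apply Rmult_le_pos; apply Cmod_ge_0.
    + assert (B1 : Cmod (/ (circ a R0 t - z)) <= / d).
      { apply Cmod_inv_le; [lra|]. now apply circ_dist. }
      assert (B2 : Cmod (/ (circ a R0 t - w)) <= / (d / 2)).
      { apply Cmod_inv_le; [lra|]. pose proof (circ_dist a R0 t w HR ltac:(lra)). unfold d in *; lra. }
      replace (2 / (d * d * d)) with (/ d * / d * / (d / 2)) by (field; lra).
      apply Rmult_le_compat; try apply Cmod_ge_0; auto.
      * apply Rmult_le_pos; apply Cmod_ge_0.
      * apply Rmult_le_compat; try apply Cmod_ge_0; auto.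
Qed.

Definition cauchy_density (F : C -> C) (a : C) (R0 t : R) : C :=
  (F (circ a R0 t) * (RtoC R0 * (Ci * cis t)))%C.

Lemma cauchy_density_cont F a R0 : differentiable F -> contI (cauchy_density F a R0) 0 (2 * PI).
Proof.
  intros HF t _. apply contR_mult.
  - apply contR_comp; [now apply differentiable_cont|apply contR_circ].
  - repeat apply contR_mult; auto using contR_const, contR_cis.
Qed.

Definition tpi : C := (RtoC (2 * PI) * Ci)%C.

Lemma Cmod_tpi : Cmod tpi = 2 * PI.
Proof. pose proof PI_RGT_0. unfold tpi. rewrite Cmod_Rmult, Cmod_Ci, Rabs_pos_eq; lra. Qed.

Lemma tpi_neq0 : tpi <> 0.
Proof. pose proof PI_RGT_0. apply Cmod_gt_0. rewrite Cmod_tpi. lra. Qed.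

Lemma cauchy_formula' F a z R0 : differentiable F -> Cmod (z - a) < R0 ->
  cauchy_int (cauchy_density F a R0) a R0 z = (tpi * F z)%C.
Proof.
  intros HF Hz. pose proof PI_RGT_0. unfold tpi.
  transitivity (RtoC (2 * PI) * (Ci * F z))%C; [|ring].
  rewrite <- (cauchy_formula F a z R0 HF Hz). unfold cauchy_int, cauchy_density.
  apply CI_ext; [lra|]. intros. ring.
Qed.

Lemma cauchy_int_le phi a R0 z M m : contI phi 0 (2 * PI) -> Cmod (z - a) < R0 -> 0 < m -> 0 <= M ->
  (forall t, 0 <= t <= 2 * PI -> Cmod (phi t) <= M) -> m <= R0 - Cmod (z - a) ->
  Cmod (cauchy_int phi a R0 z) <= 2 * PI * (M * / m).
Proof.
  intros Hphi Hz Hm HM0 HM Hzm. pose proof PI_RGT_0.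
  replace (2 * PI * (M * / m)) with ((2 * PI - 0) * (M * / m)) by ring.
  apply CI_norm; [lra| |].
  - intros t Ht. apply contR_mult; [now apply Hphi|now apply contR_circ_inv].
  - intros t Ht. rewrite Cmod_mult. apply Rmult_le_compat; try apply Cmod_ge_0; [now apply HM|].
    apply Cmod_inv_le; [lra|]. pose proof (Cmod_ge_0 (z - a)). pose proof (circ_dist a R0 t z). lra.
Qed.

(** No bound on the derivative is at hand; instead, the difference of the two Cauchy integrals over
    the circle of radius [2 rho] carries the factor [z - w], and both kernels are bounded by
    [1 / rho]. *)
Lemma lipschitz_ball F rho : differentiable F -> 0 < rho ->
  exists L, 0 < L /\ forall z w, Cmod z <= rho -> Cmod w <= rho -> Cmod (F z - F w) <= L * Cmod (z - w).
Proof.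
  intros HF Hrho. pose proof PI_RGT_0.
  assert (Hc := cauchy_density_cont F 0 (2 * rho) HF).
  destruct (contI_bounded _ 0 (2 * PI) ltac:(lra) Hc) as [M [HM HMb]].
  exists (M * (/ rho * / rho)). assert (Hir : 0 < / rho) by now apply Rinv_0_lt_compat.
  split; [repeat apply Rmult_lt_0_compat; lra|].
  intros z w Hz Hw.
  assert (Hz0 : Cmod (z - 0) < 2 * rho) by (replace (z - 0)%C with z by ring; lra).
  assert (Hw0 : Cmod (w - 0) < 2 * rho) by (replace (w - 0)%C with w by ring; lra).
  assert (E : (tpi * (F z - F w))%C =
    ((z - w) * CI (fun t => cauchy_density F 0 (2 * rho) t *
       (/ (circ 0 (2 * rho) t - z) * / (circ 0 (2 * rho) t - w))) 0 (2 * PI))%C).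
  { rewrite <- CI_scal; [|lra|].
    2:{ apply contI_mult; auto. apply contI_mult; intros t _; now apply contR_circ_inv. }
    transitivity (tpi * F z - tpi * F w)%C; [ring|].
    rewrite <- (cauchy_formula' F 0 z (2 * rho)), <- (cauchy_formula' F 0 w (2 * rho)) by auto.
    unfold cauchy_int. rewrite <- CI_minus; [|lra| |].
    - apply CI_ext; [lra|]. intros t _.
      assert (N1 := circ_neq 0 _ t z Hz0). assert (N2 := circ_neq 0 _ t w Hw0).
      field. auto.
    - apply contI_mult; auto. intros t _; now apply contR_circ_inv.
    - apply contI_mult; auto. intros t _; now apply contR_circ_inv. }
  assert (E' := f_equal Cmod E). rewrite Cmod_mult, Cmod_tpi, Cmod_mult in E'.
  apply Rmult_le_reg_l with (2 * PI); [lra|]. rewrite E'.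
  replace (2 * PI * (M * (/ rho * / rho) * Cmod (z - w)))
    with (Cmod (z - w) * ((2 * PI - 0) * (M * (/ rho * / rho)))) by ring.
  apply Rmult_le_compat_l; [apply Cmod_ge_0|].
  apply CI_norm; [lra| |].
  - apply contI_mult; auto. apply contI_mult; intros t _; now apply contR_circ_inv.
  - intros t Ht. rewrite !Cmod_mult.
    apply Rmult_le_compat; try apply Cmod_ge_0; [apply Rmult_le_pos; apply Cmod_ge_0|now apply HMb|].
    assert (forall v, Cmod v <= rho -> Cmod (/ (circ 0 (2 * rho) t - v)) <= / rho).
    { intros v Hv. apply Cmod_inv_le; [lra|].
      assert (Cmod (v - 0) <= rho) by (replace (v - 0)%C with v by ring; auto).
      pose proof (circ_dist 0 (2 * rho) t v ltac:(lra) ltac:(lra)). lra. }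
    apply Rmult_le_compat; try apply Cmod_ge_0; auto.
Qed.

Lemma derC_local f g z l r : 0 < r -> (forall w, Cmod (w - z) < r -> f w = g w) -> derC f z l -> derC g z l.
Proof.
  intros Hr E H e He. destruct (H e He) as [d [Hd K]].
  exists (Rmin d r). split; [now apply Rmin_glb_lt|]. intros w Hw.
  assert (L1 := Rlt_le_trans _ _ _ Hw (Rmin_l _ _)). assert (L2 := Rlt_le_trans _ _ _ Hw (Rmin_r _ _)).
  rewrite <- (E w L2), <- (E z) by (rewrite Cmod_diag; exact Hr). now apply K.
Qed.

(** Removal of the singularity of [F z / (z - a)]: inside the unit disc around [a] the quotient is a
    Cauchy integral whose density is already divided by [zeta - a], and elsewhere it is the plain
    quotient. *)
Lemma divide_zero F (a : C) : differentiable F -> F a = 0 ->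
  exists g, differentiable g /\ forall z, F z = ((z - a) * g z)%C.
Proof.
  intros HF Ha. pose proof PI_RGT_0.
  set (phi := fun t => (cauchy_density F a 1 t * / (circ a 1 t - a))%C).
  assert (Haa : Cmod (a - a) < 1) by (rewrite Cmod_diag; lra).
  assert (Hphi : contI phi 0 (2 * PI)).
  { apply contI_mult; [now apply cauchy_density_cont|]. intros t _. now apply contR_circ_inv. }
  set (H1 := fun z => (/ tpi * cauchy_int phi a 1 z)%C).
  assert (HE : forall z, Cmod (z - a) < 1 -> F z = ((z - a) * H1 z)%C).
  { intros z Hz.
    assert (E : (tpi * F z - tpi * F a)%C = ((z - a) * cauchy_int phi a 1 z)%C).
    { rewrite <- (cauchy_formula' F a z 1), <- (cauchy_formula' F a a 1) by auto.
      unfold cauchy_int. rewrite <- CI_minus, <- CI_scal; try lra.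
      - apply CI_ext; [lra|]. intros t _. unfold phi.
        assert (N1 := circ_neq a _ t z Hz). assert (N2 := circ_neq a _ t a Haa). field. auto.
      - apply contI_mult; auto. intros t _; now apply contR_circ_inv.
      - apply contI_mult; [now apply cauchy_density_cont|]. intros t _; now apply contR_circ_inv.
      - apply contI_mult; [now apply cauchy_density_cont|]. intros t _; now apply contR_circ_inv. }
    unfold H1. rewrite Ha in E. pose proof tpi_neq0.
    transitivity (/ tpi * (tpi * F z - tpi * 0))%C; [field; auto|]. rewrite E. ring. }
  exists (fun z => if Rlt_dec (Cmod (z - a)) 1 then H1 z else (F z * / (z - a))%C).
  assert (Hne : forall z, 0 < Cmod (z - a) -> (if Rlt_dec (Cmod (z - a)) 1 then H1 z else (F z * / (z - a))%C)
     = (F z * / (z - a))%C).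
  { intros z Hz. destruct (Rlt_dec (Cmod (z - a)) 1) as [h|h]; [|reflexivity].
    rewrite (HE z h). field. now apply Cmod_gt_0. }
  split.
  - intros z. destruct (Rlt_dec (Cmod (z - a)) 1) as [h|h].
    + destruct (cauchy_int_der phi a 1 z Hphi h) as [l Hl].
      eexists. apply (derC_local H1 _ z _ (1 - Cmod (z - a))); [lra| |].
      * intros w Hw. pose proof (Cmod_tri w z a).
        destruct (Rlt_dec (Cmod (w - a)) 1) as [h'|h']; [reflexivity|lra].
      * apply derC_mult; [apply derC_const|exact Hl].
    + destruct (HF z) as [l Hl].
      eexists. apply (derC_local (fun z => F z * / (z - a))%C _ z _ 1); [lra| |].
      * intros w Hw. symmetry. apply Hne.
        pose proof (Cmod_tri z w a). rewrite (Cmod_sym z w) in H0. lra.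
      * apply derC_mult; [exact Hl|]. apply derC_inv.
        -- apply (derC_plus (fun w => w) (fun _ => - a)%C); [apply derC_id|apply derC_const].
        -- apply Cmod_gt_0. change (0 < Cmod (z - a)). lra.
  - intros z. destruct (Req_dec (Cmod (z - a)) 0) as [E|n].
    + apply Cmod_minus_eq0 in E. subst z. rewrite Ha. ring.
    + pose proof (Cmod_ge_0 (z - a)). rewrite Hne by lra. field. apply Cmod_gt_0. lra.
Qed.

(** Otherwise [F] is divisible by every power of [z - a]. The Cauchy estimate for the quotient on
    one fixed circle then bounds [F z0] by [M (rho / R0)^n], which tends to 0. *)
Lemma zeros_isolated F (a : C) : differentiable F -> (exists z, F z <> 0) -> F a = 0 ->
  exists r, 0 < r /\ forall z, 0 < Cmod (z - a) < r -> F z <> 0.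
Proof.
  intros HF [z0 Hz0] Ha. apply NNPP. intros Hno.
  pose proof PI_RGT_0.
  assert (Hdiv : forall n, exists g, differentiable g /\ forall z, F z = ((z - a) ^ n * g z)%C).
  { induction n.
    - exists F. split; [exact HF|]. intros z. simpl. ring.
    - destruct IHn as [g [Hg Eg]].
      destruct (classic (g a = 0)) as [E|n0].
      + destruct (divide_zero g a Hg E) as [k [Hk Ek]]. exists k. split; [exact Hk|].
        intros z. rewrite Eg, Ek. simpl. ring.
      + exfalso. apply Hno. apply Cmod_gt_0 in n0.
        destruct (differentiable_cont g Hg a _ n0) as [d [Hd K]]. exists d. split; [exact Hd|].
        intros z [Hz1 Hz2] E0. specialize (K z Hz2).
        assert (g z <> 0).
        { intros E1. rewrite E1 in K. replace (0 - g a)%C with (- g a)%C in K by ring.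
          rewrite Cmod_opp in K. lra. }
        rewrite Eg in E0. apply (f_equal Cmod) in E0. rewrite Cmod_mult, Cmod_0, Cmod_pow in E0.
        apply Cmod_gt_0 in H0. pose proof (pow_lt _ n Hz1). nra. }
  apply Hz0. apply Cmod_eq_0. apply Rle_antisym; [|apply Cmod_ge_0].
  set (rho := Cmod (z0 - a)). assert (Hrho : 0 <= rho) by apply Cmod_ge_0.
  (* Keeps [rho / R0] below 1/2 and the circle at distance at least 1 from [z0], also when
     [rho = 0]. *)
  set (R0 := 2 * rho + 1).
  destruct (contI_bounded (cauchy_density F a R0) 0 (2 * PI) ltac:(lra) (cauchy_density_cont F a R0 HF)) as [M [HM HMb]].
  assert (Hn : forall n, Cmod (F z0) <= M * (1 / 2) ^ n).
  { intros n. destruct (Hdiv n) as [g [Hg Eg]].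
    assert (HRn : 0 < R0 ^ n) by (apply pow_lt; unfold R0; lra).
    assert (Hgb : forall t, 0 <= t <= 2 * PI -> Cmod (cauchy_density g a R0 t) <= M / R0 ^ n).
    { intros t Ht. specialize (HMb t Ht). unfold cauchy_density in *. rewrite Eg in HMb.
      replace ((circ a R0 t - a) ^ n)%C with ((RtoC R0 * cis t) ^ n)%C in HMb by (f_equal; unfold circ; ring).
      replace ((RtoC R0 * cis t) ^ n * g (circ a R0 t) * (RtoC R0 * (Ci * cis t)))%C
        with ((RtoC R0 * cis t) ^ n * (g (circ a R0 t) * (RtoC R0 * (Ci * cis t))))%C in HMb by ring.
      rewrite (Cmod_mult (_ ^ n)), Cmod_pow, Cmod_Rmult, Cmod_cis, Rabs_pos_eq, Rmult_1_r in HMb by (unfold R0; lra).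
      apply Rmult_le_reg_l with (R0 ^ n); [exact HRn|]. eapply Rle_trans; [exact HMb|]. right. field. lra. }
    assert (HMn : 0 <= M / R0 ^ n) by (left; now apply Rdiv_lt_0_compat).
    pose proof (cauchy_int_le _ a R0 z0 _ 1 (cauchy_density_cont g a R0 Hg) ltac:(fold rho; unfold R0; lra)
      ltac:(lra) HMn Hgb ltac:(fold rho; unfold R0; lra)) as B.
    rewrite cauchy_formula' in B by (auto; fold rho; unfold R0; lra).
    rewrite Cmod_mult, Cmod_tpi in B.
    assert (B' : Cmod (g z0) <= M / R0 ^ n).
    { apply Rmult_le_reg_l with (2 * PI); [lra|]. eapply Rle_trans; [exact B|]. right. field. lra. }
    rewrite Eg, Cmod_mult, Cmod_pow. fold rho.
    apply Rle_trans with (rho ^ n * (M / R0 ^ n)).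
    - apply Rmult_le_compat_l; [now apply pow_le|exact B'].
    - replace (rho ^ n * (M / R0 ^ n)) with (M * (rho / R0) ^ n)
        by (unfold Rdiv; rewrite Rpow_mult_distr, pow_inv; ring).
      apply Rmult_le_compat_l; [lra|]. apply pow_incr. split.
      + apply Rmult_le_pos; [lra|]. left. apply Rinv_0_lt_compat. unfold R0; lra.
      + apply Rmult_le_reg_r with R0; [unfold R0; lra|]. unfold Rdiv. rewrite Rmult_assoc, Rinv_l by (unfold R0; lra).
        unfold R0. lra. }
  apply le_epsilon. intros e He. rewrite Rplus_0_l.
  destruct (pow_lt_1_zero (1 / 2) ltac:(rewrite Rabs_pos_eq; lra) (e / M) ltac:(now apply Rdiv_lt_0_compat)) as [N HN].
  specialize (HN N (Nat.le_refl N)). rewrite Rabs_pos_eq in HN by (apply pow_le; lra).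
  eapply Rle_trans; [apply (Hn N)|].
  apply (Rmult_lt_compat_l M) in HN; [|lra]. replace (M * (e / M)) with e in HN by (field; lra). lra.
Qed.

Lemma entire_differentiable F : entire F -> differentiable F.
Proof. intros H z. destruct (H z) as [l Hl]. exists l. now apply derC_iff. Qed.

(** * Geometric convergence and complex-time flow boxes *)

Lemma C_geometric_cauchy (u : nat -> C) D : 0 <= D ->
  (forall n, Cmod (u (S n) - u n) <= D * (1 / 2) ^ n) ->
  exists l, forall n, Cmod (l - u n) <= 2 * D * (1 / 2) ^ n.
Proof.
  intros HD Hu.
  assert (Hnm : forall n k, Cmod (u (n + k)%nat - u n) <= 2 * D * (1 / 2) ^ n).
  { intros n k.
    assert (Cmod (u (n + k)%nat - u n) <= 2 * D * ((1 / 2) ^ n - (1 / 2) ^ (n + k))).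
    { induction k.
      - rewrite Nat.add_0_r, Cmod_diag. lra.
      - rewrite Nat.add_succ_r. pose proof (Cmod_tri (u (S (n + k))) (u (n + k)%nat) (u n)).
        specialize (Hu (n + k)%nat).
        simpl pow. lra. }
    assert (0 < (1 / 2) ^ (n + k)) by (apply pow_lt; lra). nra. }
  assert (Hcau : forall p : C -> R, (forall z w, Rabs (p z - p w) <= Cmod (z - w)) ->
     exists l, Un_cv (fun n => p (u n)) l).
  { intros p Hp. destruct (Rcomplete.R_complete (fun n => p (u n))) as [l Hl]; [|exists l; exact Hl].
    intros e He.
    destruct (pow_lt_1_zero (1 / 2) ltac:(rewrite Rabs_pos_eq; lra) (e / (4 * D + 1))) as [N HN];
      [apply Rdiv_lt_0_compat; lra|].
    exists N. intros n m Hn Hm. unfold Rdist.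
    eapply Rle_lt_trans; [apply Hp|].
    specialize (HN N (Nat.le_refl N)). rewrite Rabs_pos_eq in HN by (apply pow_le; lra).
    apply (Rmult_lt_compat_l (4 * D + 1)) in HN; [|lra].
    replace ((4 * D + 1) * (e / (4 * D + 1))) with e in HN by (field; lra).
    assert (0 < (1 / 2) ^ N) by (apply pow_lt; lra).
    pose proof (Hnm N (n - N)%nat) as A1. pose proof (Hnm N (m - N)%nat) as A2.
    replace (N + (n - N))%nat with n in A1 by lia. replace (N + (m - N))%nat with m in A2 by lia.
    pose proof (Cmod_tri (u n) (u N) (u m)). rewrite (Cmod_sym (u N)) in H0. lra. }
  destruct (Hcau Re) as [x Hx].
  { intros z w. eapply Rle_trans; [|apply re_le_Cmod]. right. f_equal. }
  destruct (Hcau Im) as [y Hy].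
  { intros z w. eapply Rle_trans; [|apply (Rmax_Cmod (z - w)%C)]. apply Rmax_r. }
  exists (x, y). intros n. apply le_epsilon. intros e He.
  destruct (Hx (e / 4)) as [N1 H1]; [lra|]. destruct (Hy (e / 4)) as [N2 H2]; [lra|].
  set (m := (n + (N1 + N2))%nat).
  specialize (H1 m ltac:(unfold m; lia)). specialize (H2 m ltac:(unfold m; lia)).
  specialize (Hnm n (N1 + N2)%nat). fold m in Hnm.
  pose proof (Cmod_tri (x, y) (u m) (u n)).
  assert (Cmod ((x, y) - u m) <= e).
  { eapply Rle_trans; [apply Cmod_2Rmax|].
    apply Rle_trans with (2 * (e / 4)); [|lra]. apply Rmult_le_compat; [apply sqrt_pos| | |].
    - eapply Rle_trans; [apply Rabs_pos|apply Rmax_l].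
    - apply Rsqr_incr_0_var; [|lra]. rewrite Rsqr_sqrt by lra. unfold Rsqr; lra.
    - unfold Rdist in *. simpl. apply Rmax_lub.
      + left. rewrite <- Rabs_Ropp. replace (- (x + - fst (u m))) with (Re (u m) - x) by (unfold Re; ring). exact H1.
      + left. rewrite <- Rabs_Ropp. replace (- (y + - snd (u m))) with (Im (u m) - y) by (unfold Im; ring). exact H2. }
  lra.
Qed.

(** The last clause is openness of [psi] together with continuity of its inverse: points near
    [psi w0] have a parameter near [w0]. *)
Definition chart (F : C -> C) (p : C) (r : R) (psi : C -> C) : Prop :=
  0 < r /\ psi 0 = p /\
  (forall w, Cmod w < r -> derC psi w (F (psi w))) /\
  (forall w w', Cmod w < r -> Cmod w' < r -> psi w = psi w' -> w = w') /\
  (forall w0, Cmod w0 < r -> forall e, 0 < e -> exists d, 0 < d /\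
     forall z, Cmod (z - psi w0) < d -> exists w, Cmod w < r /\ Cmod (w - w0) < e /\ psi w = z).

(* Complex-time flow box: the inverse of a primitive of [1/F]. *)
Lemma chart_exists F p : differentiable F -> F p <> 0 -> exists r psi, chart F p r psi.
Proof.
  intros HF Hp. set (c := F p) in *.
  assert (Hmc : 0 < Cmod c) by now apply Cmod_gt_0.
  assert (Hcont : contC (fun z => c * / F z)%C p).
  { apply contC_mult; [apply contC_const|]. apply contC_comp; [now apply contC_inv|now apply differentiable_cont]. }
  (* Where [c / F] is within 1/2 of 1, the normalised primitive [h] differs from the identity by a
     map with Lipschitz constant 1/2. *)
  destruct (Hcont (1 / 2)) as [d1 [Hd1 K1]]; [lra|].
  destruct (differentiable_cont F HF p (Cmod c)) as [d2 [Hd2 K2]]; [exact Hmc|].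
  set (R1 := Rmin d1 d2). assert (HR1 : 0 < R1) by now apply Rmin_glb_lt.
  assert (HF0 : forall z, Cmod (z - p) < R1 -> F z <> 0).
  { intros z Hz E. specialize (K2 z (Rlt_le_trans _ _ _ Hz (Rmin_r _ _))). rewrite E in K2.
    fold c in K2. replace (0 - c)%C with (- c)%C in K2 by ring. rewrite Cmod_opp in K2. lra. }
  destruct (primitive_ball (fun z => / F z)%C p R1 HR1) as [G HG].
  { intros z Hz. destruct (HF z) as [l Hl]. eexists. apply derC_inv; [exact Hl|now apply HF0]. }
  set (h := fun z => (c * (G z - G p))%C).
  assert (Hconv : forall z z' t, Cmod (z - p) < R1 -> Cmod (z' - p) < R1 -> 0 <= t <= 1 ->
    Cmod (z + RtoC t * (z' - z) - p) < R1).
  { intros z z' t Hz Hz' Ht.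
    replace (z + RtoC t * (z' - z) - p)%C with (RtoC (1 - t) * (z - p) + RtoC t * (z' - p))%C
      by (rewrite RtoC_minus; ring).
    eapply Rle_lt_trans; [apply Cmod_triangle|]. rewrite !Cmod_Rmult, !Rabs_pos_eq by lra.
    destruct (Req_dec t 0) as [->|]; nra. }
  assert (Hh : forall z z', Cmod (z - p) < R1 -> Cmod (z' - p) < R1 ->
    Cmod ((h z' - z') - (h z - z)) <= 1 / 2 * Cmod (z' - z)).
  { intros z z' Hz Hz'.
    pose proof (mean_value_C (fun t => h (z + RtoC t * (z' - z)) - (z + RtoC t * (z' - z)))%C
      (fun t => (z' - z) * (c * / F (z + RtoC t * (z' - z)) - 1))%C 0 1 (1 / 2 * Cmod (z' - z))) as MV.
    cbv beta in MV.
    replace (z + RtoC 1 * (z' - z))%C with z' in MV by ring.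
    replace (z + RtoC 0 * (z' - z))%C with z in MV by ring.
    replace ((1 - 0) * (1 / 2 * Cmod (z' - z))) with (1 / 2 * Cmod (z' - z)) in MV by ring.
    apply MV; [lra| | |].
    - intros t Ht. eapply derR_eq.
      + apply (derR_comp (fun v => h v - v)%C (fun t => z + RtoC t * (z' - z))%C); [|apply derR_affine].
        apply (derC_plus h (fun v => - v)%C).
        * apply derC_mult; [apply derC_const|].
          apply (derC_plus G (fun _ => - G p)%C); [apply HG; now apply Hconv|apply derC_const].
        * apply (derC_ext (fun v => - (1) * v)%C); [intros; ring|]. apply derC_mult; [apply derC_const|apply derC_id].
      + cbv beta. ring.
    - intros t Ht. apply contR_mult; [apply contR_const|].
      apply (contR_plus (fun t => c * / F (z + RtoC t * (z' - z)))%C (fun _ => - (1))%C); [|apply contR_const].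
      apply contR_mult; [apply contR_const|].
      apply (contR_comp (fun v => / F v)%C (fun t => z + RtoC t * (z' - z))%C); [|apply contR_affine].
      apply contC_comp; [apply contC_inv, HF0; now apply Hconv|now apply differentiable_cont].
    - intros t Ht. rewrite Cmod_mult, Rmult_comm. apply Rmult_le_compat_r; [apply Cmod_ge_0|].
      left. specialize (K1 (z + RtoC t * (z' - z))%C (Rlt_le_trans _ _ _ (Hconv z z' t Hz Hz' Ht) (Rmin_l _ _))).
      cbv beta in K1. fold c in K1. replace (c * / c)%C with (RtoC 1) in K1; [exact K1|]. field. exact Hp. }
  assert (Hlow : forall z z', Cmod (z - p) < R1 -> Cmod (z' - p) < R1 -> Cmod (z' - z) <= 2 * Cmod (h z' - h z)).
  { intros z z' Hz Hz'. specialize (Hh z z' Hz Hz').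
    pose proof (Cmod_triangle (h z' - h z) (- (h z' - z' - (h z - z)))) as T. rewrite Cmod_opp in T.
    replace (h z' - h z + - (h z' - z' - (h z - z)))%C with (z' - z)%C in T by ring. lra. }
  assert (Hup : forall z z', Cmod (z - p) < R1 -> Cmod (z' - p) < R1 -> Cmod (h z' - h z) <= 2 * Cmod (z' - z)).
  { intros z z' Hz Hz'. specialize (Hh z z' Hz Hz').
    pose proof (Cmod_triangle (z' - z) (h z' - z' - (h z - z))) as T.
    replace (z' - z + (h z' - z' - (h z - z)))%C with (h z' - h z)%C in T by ring.
    pose proof (Cmod_ge_0 (z' - z)). lra. }
  assert (Hhp : h p = 0) by (unfold h; ring).
  assert (Hpp : Cmod (p - p) < R1) by (rewrite Cmod_diag; exact HR1).
  (* Contraction argument for [T z = z - (h z - v)] started at [p]; the iterates stay within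
     [2 |v| < R1 / 2] of [p]. *)
  assert (Hsurj : forall v, Cmod v < R1 / 4 -> exists z, Cmod (z - p) <= R1 / 2 /\ h z = v).
  { intros v Hv.
    set (T := fun z => (z - (h z - v))%C).
    set (u := fun n => Nat.iter n T p).
    assert (HT : forall z z', Cmod (z - p) < R1 -> Cmod (z' - p) < R1 -> Cmod (T z' - T z) <= 1 / 2 * Cmod (z' - z)).
    { intros z z' Hz Hz'. unfold T.
      replace (z' - (h z' - v) - (z - (h z - v)))%C with (- ((h z' - z') - (h z - z)))%C by ring.
      rewrite Cmod_opp. now apply Hh. }
    assert (Hu : forall n, Cmod (u n - p) <= R1 / 2).
    { induction n; [simpl; rewrite Cmod_diag; lra|].
      change (u (S n)) with (T (u n)).
      pose proof (HT p (u n) Hpp ltac:(lra)) as B.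
      assert (E : (T p - p)%C = v) by (unfold T; rewrite Hhp; ring).
      pose proof (Cmod_tri (T (u n)) (T p) p) as T1. rewrite E in T1. lra. }
    destruct (C_geometric_cauchy u (Cmod v) (Cmod_ge_0 v)) as [z Hz].
    { induction n.
      - change (u 1%nat) with (T p). simpl. unfold T. rewrite Hhp.
        replace (p - (0 - v) - p)%C with v by ring. lra.
      - change (u (S (S n))) with (T (u (S n))). change (u (S n)) with (T (u n)) at 2.
        eapply Rle_trans; [apply HT; eapply Rle_lt_trans; [apply Hu|lra|apply Hu|lra]|]. simpl pow. lra. }
    assert (Hsm : forall e, 0 < e -> exists n, 2 * Cmod v * (1 / 2) ^ n < e).
    { intros e He. pose proof (Cmod_ge_0 v).
      destruct (pow_lt_1_zero (1 / 2) ltac:(rewrite Rabs_pos_eq; lra) (e / (2 * Cmod v + 1))) as [N HN];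
        [apply Rdiv_lt_0_compat; lra|].
      specialize (HN N (Nat.le_refl N)). rewrite Rabs_pos_eq in HN by (apply pow_le; lra).
      exists N. apply (Rmult_lt_compat_l (2 * Cmod v + 1)) in HN; [|lra].
      replace ((2 * Cmod v + 1) * (e / (2 * Cmod v + 1))) with e in HN by (field; lra).
      assert (0 < (1 / 2) ^ N) by (apply pow_lt; lra). nra. }
    assert (Hzp : Cmod (z - p) <= R1 / 2).
    { apply le_epsilon. intros e He. destruct (Hsm e He) as [n Hn].
      pose proof (Cmod_tri z (u n) p). specialize (Hz n). specialize (Hu n). lra. }
    exists z. split; [exact Hzp|].
    assert (ET : T z = z).
    { apply Cmod_small_eq. intros e He. destruct (Hsm (e / 2)) as [n Hn]; [lra|].
      pose proof (Cmod_tri (T z) (u (S n)) z) as T1. pose proof (Hz n) as Z1. pose proof (Hz (S n)) as Z2.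
      change (u (S n)) with (T (u n)) in T1 at 1.
      pose proof (HT (u n) z ltac:(specialize (Hu n); lra) ltac:(lra)) as B.
      rewrite (Cmod_sym (u (S n)) z) in T1. simpl pow in Z2. lra. }
    unfold T in ET. transitivity (v + (z - (z - (h z - v))))%C; [ring|]. rewrite ET. ring. }
  (* [psi w] solves [h z = c w], and [h] covers the disc of radius [R1 / 4]. *)
  set (r := R1 / 4 / Cmod c).
  assert (Hr : 0 < r) by (apply Rdiv_lt_0_compat; lra).
  set (psi := fun w => epsilon (inhabits (RtoC 0)) (fun z => Cmod (z - p) <= R1 / 2 /\ h z = (c * w)%C)).
  assert (Hpsi : forall w, Cmod w < r -> Cmod (psi w - p) <= R1 / 2 /\ h (psi w) = (c * w)%C).
  { intros w Hw. apply (epsilon_spec (inhabits (RtoC 0)) (fun z => Cmod (z - p) <= R1 / 2 /\ h z = (c * w)%C)).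
    apply Hsurj. rewrite Cmod_mult. apply (Rmult_lt_compat_l (Cmod c)) in Hw; [|exact Hmc].
    unfold r in Hw. replace (Cmod c * (R1 / 4 / Cmod c)) with (R1 / 4) in Hw by (field; lra). exact Hw. }
  assert (Hinj : forall z z', Cmod (z - p) < R1 -> Cmod (z' - p) < R1 -> h z = h z' -> z = z').
  { intros z z' Hz Hz' E. specialize (Hlow z' z Hz' Hz). rewrite E, Cmod_diag in Hlow.
    apply Cmod_minus_eq0. pose proof (Cmod_ge_0 (z - z')). lra. }
  assert (Hlip : forall w w', Cmod w < r -> Cmod w' < r -> Cmod (psi w' - psi w) <= 2 * Cmod c * Cmod (w' - w)).
  { intros w w' Hw Hw'. destruct (Hpsi w Hw) as [A1 A2]. destruct (Hpsi w' Hw') as [B1 B2].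
    eapply Rle_trans; [apply Hlow; lra|]. rewrite A2, B2.
    replace (c * w' - c * w)%C with (c * (w' - w))%C by ring. rewrite Cmod_mult. lra. }
  exists r, psi. split; [exact Hr|]. split; [|split; [|split]].
  - destruct (Hpsi 0) as [A1 A2]; [rewrite Cmod_0; exact Hr|]. apply Hinj; [lra|exact Hpp|]. rewrite A2, Hhp. ring.
  - intros w0 Hw0 e He. destruct (Hpsi w0 Hw0) as [A1 A2]. set (z0 := psi w0) in *.
    assert (HFz : F z0 <> 0) by (apply HF0; lra).
    assert (Hm0 : 0 < Cmod (F z0)) by now apply Cmod_gt_0.
    set (e' := e / (2 * Cmod c * Cmod (F z0))).
    assert (He' : 0 < e') by (apply Rdiv_lt_0_compat; [lra|repeat apply Rmult_lt_0_compat; lra]).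
    destruct (HG z0 ltac:(lra) e' He') as [d [Hd K]].
    exists (Rmin (r - Cmod w0) (d / (2 * Cmod c))).
    split; [apply Rmin_glb_lt; [lra|apply Rdiv_lt_0_compat; lra]|].
    intros w Hw.
    assert (L1 := Rlt_le_trans _ _ _ Hw (Rmin_l _ _)). assert (L2 := Rlt_le_trans _ _ _ Hw (Rmin_r _ _)).
    assert (Hwr : Cmod w < r).
    { pose proof (Cmod_triangle (w - w0) w0) as T1. replace (w - w0 + w0)%C with w in T1 by ring. lra. }
    destruct (Hpsi w Hwr) as [B1 B2].
    specialize (Hlip w0 w Hw0 Hwr). fold z0 in Hlip.
    assert (Hzz : Cmod (psi w - z0) < d).
    { eapply Rle_lt_trans; [exact Hlip|]. apply (Rmult_lt_compat_l (2 * Cmod c)) in L2; [|lra].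
      replace (2 * Cmod c * (d / (2 * Cmod c))) with d in L2 by (field; lra). exact L2. }
    specialize (K _ Hzz).
    assert (EG : (G (psi w) - G z0)%C = (w - w0)%C).
    { transitivity (/ c * (h (psi w) - h z0))%C; [unfold h; field; exact Hp|]. rewrite A2, B2. field. exact Hp. }
    rewrite EG in K.
    replace (psi w - z0 - (w - w0) * F z0)%C with (- (F z0 * ((w - w0) - (psi w - z0) * / F z0)))%C by (field; exact HFz).
    rewrite Cmod_opp, Cmod_mult.
    apply Rle_trans with (Cmod (F z0) * (e' * (2 * Cmod c * Cmod (w - w0)))).
    + apply Rmult_le_compat_l; [lra|]. eapply Rle_trans; [exact K|]. apply Rmult_le_compat_l; lra.
    + right. unfold e'. field. lra.
  - intros w w' Hw Hw' E. destruct (Hpsi w Hw) as [A1 A2]. destruct (Hpsi w' Hw') as [B1 B2].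
    rewrite E in A2. rewrite A2 in B2. 
    transitivity (/ c * (c * w))%C; [field; exact Hp|]. rewrite B2. field. exact Hp.
  - intros w0 Hw0 e He. destruct (Hpsi w0 Hw0) as [A1 A2].
    set (m := Rmin e (r - Cmod w0)). assert (Hm : 0 < m) by (apply Rmin_glb_lt; lra).
    exists (Rmin (R1 / 2) (Cmod c * m / 2)).
    split; [apply Rmin_glb_lt; [lra|]; assert (0 < Cmod c * m) by (now apply Rmult_lt_0_compat); lra|].
    intros z Hz.
    assert (L1 := Rlt_le_trans _ _ _ Hz (Rmin_l _ _)). assert (L2 := Rlt_le_trans _ _ _ Hz (Rmin_r _ _)).
    assert (Hzp : Cmod (z - p) < R1) by (pose proof (Cmod_tri z (psi w0) p); lra).
    set (w := (/ c * h z)%C).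
    assert (Ew : (c * w)%C = h z) by (unfold w; field; exact Hp).
    assert (Hww : Cmod (w - w0) < m).
    { apply Rmult_lt_reg_l with (Cmod c); [exact Hmc|]. rewrite <- Cmod_mult.
      replace (c * (w - w0))%C with (h z - h (psi w0))%C by (rewrite A2, <- Ew; ring).
      eapply Rle_lt_trans; [apply Hup; [lra|exact Hzp]|]. lra. }
    assert (Hwr : Cmod w < r).
    { pose proof (Cmod_triangle (w - w0) w0) as T1. replace (w - w0 + w0)%C with w in T1 by ring.
      pose proof (Rmin_r e (r - Cmod w0)). fold m in H. lra. }
    exists w. split; [exact Hwr|]. split; [pose proof (Rmin_l e (r - Cmod w0)); fold m in H; lra|].
    destruct (Hpsi w Hwr) as [B1 B2]. apply Hinj; [lra|exact Hzp|]. rewrite B2. exact Ew.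
Qed.

(** * Existence, uniqueness and continuation of solutions *)

Lemma gronwall (u u' : R -> R) a b K : a <= b ->
  (forall t, a <= t <= b -> derivable_pt_lim u t (u' t)) ->
  (forall t, a <= t <= b -> u' t <= K * u t) -> u b <= u a * exp (K * (b - a)).
Proof.
  intros Hab Hd Hle.
  set (v := fun t => u t * exp (- K * t)).
  assert (Hv : forall t, a <= t <= b -> derivable_pt_lim v t ((u' t - K * u t) * exp (- K * t))).
  { intros t Ht. unfold v.
    replace ((u' t - K * u t) * exp (- K * t)) with (u' t * exp (- K * t) + u t * (exp (- K * t) * (- K * 1))) by ring.
    apply (derivable_pt_lim_mult u (fun t => exp (- K * t))); [now apply Hd|].
    apply (derivable_pt_lim_comp (fun t => - K * t) exp); [|apply derivable_pt_lim_exp].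
    apply (derivable_pt_lim_scal (fun t => t)). apply derivable_pt_lim_id. }
  assert (Hvab : v b <= v a).
  { destruct (Req_dec a b) as [->|n]; [lra|].
    destruct (MVT_cor2 v (fun t => (u' t - K * u t) * exp (- K * t)) a b) as [c [Hc1 Hc2]]; [lra|exact Hv|].
    specialize (Hle c ltac:(lra)). pose proof (exp_pos (- K * c)). 
    assert ((u' c - K * u c) * exp (- K * c) <= 0) by nra. nra. }
  unfold v in Hvab.
  apply Rmult_le_reg_r with (exp (- K * b)); [apply exp_pos|].
  eapply Rle_trans; [exact Hvab|]. right. rewrite Rmult_assoc, <- exp_plus. f_equal. f_equal. ring.
Qed.

Lemma derR_components g t l : derR g t l ->
  derivable_pt_lim (fun s => fst (g s)) t (fst l) /\ derivable_pt_lim (fun s => snd (g s)) t (snd l).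
Proof.
  intros H.
  assert (K : forall (p : C -> R), (forall z, Rabs (p z) <= Cmod z) ->
     (forall z w, p (z - w)%C = p z - p w) -> (forall (r : R) z, p (RtoC r * z)%C = r * p z) ->
     derivable_pt_lim (fun s => p (g s)) t (p l)).
  { intros p Hp Hm Hs e He. destruct (H (e / 2)) as [d [Hd K]]; [lra|].
    exists (mkposreal d Hd). intros h Hh0 Hh. simpl in Hh.
    specialize (K (t + h)). replace (t + h - t) with h in K by ring. specialize (K Hh).
    assert (K' : Rabs (p (g (t + h)) - p (g t) - h * p l) <= e / 2 * Rabs h).
    { rewrite <- Hs, <- !Hm. eapply Rle_trans; [apply Hp|exact K]. }
    replace ((p (g (t + h)) - p (g t)) / h - p l) with ((p (g (t + h)) - p (g t) - h * p l) / h) by (field; exact Hh0).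
    unfold Rdiv. rewrite Rabs_mult, Rabs_inv.
    assert (0 < Rabs h) by now apply Rabs_pos_lt.
    apply Rle_lt_trans with (e / 2); [|lra].
    apply Rmult_le_reg_r with (Rabs h); [exact H0|]. rewrite Rmult_assoc, Rinv_l by lra. lra. }
  split; apply K.
  - intros z. eapply Rle_trans; [|apply Rmax_Cmod]. apply Rmax_l.
  - reflexivity.
  - intros r z. simpl. ring.
  - intros z. eapply Rle_trans; [|apply Rmax_Cmod]. apply Rmax_r.
  - reflexivity.
  - intros r z. simpl. ring.
Qed.

Lemma Cmod_sq (z : C) : Cmod z ^ 2 = fst z * fst z + snd z * snd z.
Proof. rewrite Cmod2_alt. unfold Re, Im. ring. Qed.

Lemma dot_le (z w : C) : Rabs (fst z * fst w + snd z * snd w) <= Cmod z * Cmod w.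
Proof.
  rewrite <- Cmod_conj, <- Cmod_mult.
  eapply Rle_trans; [|apply re_le_Cmod]. right. f_equal. unfold Re; simpl. ring.
Qed.

Lemma derR_Cmod_sq g t l : derR g t l ->
  derivable_pt_lim (fun s => Cmod (g s) ^ 2) t (2 * (fst (g t) * fst l + snd (g t) * snd l)).
Proof.
  intros H. destruct (derR_components _ _ _ H) as [H1 H2].
  intros e He.
  assert (K : derivable_pt_lim (fun s => fst (g s) * fst (g s) + snd (g s) * snd (g s)) t
    ((fst l * fst (g t) + fst (g t) * fst l) + (snd l * snd (g t) + snd (g t) * snd l))).
  { apply (derivable_pt_lim_plus (fun s => fst (g s) * fst (g s)) (fun s => snd (g s) * snd (g s))).
    - now apply (derivable_pt_lim_mult (fun s => fst (g s)) (fun s => fst (g s))).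
    - now apply (derivable_pt_lim_mult (fun s => snd (g s)) (fun s => snd (g s))). }
  destruct (K e He) as [d Kd]. exists d. intros h Hh0 Hh. specialize (Kd h Hh0 Hh).
  rewrite !Cmod_sq.
  replace (2 * (fst (g t) * fst l + snd (g t) * snd l)) with
   ((fst l * fst (g t) + fst (g t) * fst l) + (snd l * snd (g t) + snd (g t) * snd l)) by ring.
  exact Kd.
Qed.

(** The squared modulus is differentiable even where [g] vanishes. The upper bound gives uniqueness
    of solutions; the lower one shows that an equilibrium is not reached in finite time. *)
Lemma Cmod_growth g g' a b K : a <= b -> (forall t, a <= t <= b -> derR g t (g' t)) ->
  (forall t, a <= t <= b -> Cmod (g' t) <= K * Cmod (g t)) ->
  Cmod (g b) ^ 2 <= Cmod (g a) ^ 2 * exp (2 * K * (b - a)) /\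
  Cmod (g a) ^ 2 * exp (- (2 * K) * (b - a)) <= Cmod (g b) ^ 2.
Proof.
  intros Hab Hd HK.
  set (u := fun s => Cmod (g s) ^ 2).
  set (u' := fun t => 2 * (fst (g t) * fst (g' t) + snd (g t) * snd (g' t))).
  assert (Hu : forall t, a <= t <= b -> derivable_pt_lim u t (u' t)) by (intros; apply derR_Cmod_sq; auto).
  assert (Hu' : forall t, a <= t <= b -> - (2 * K * u t) <= u' t <= 2 * K * u t).
  { intros t Ht. unfold u, u'. specialize (HK t Ht).
    pose proof (dot_le (g t) (g' t)) as D. apply Rabs_le_between in D.
    pose proof (Cmod_ge_0 (g t)). assert (Cmod (g t) * Cmod (g' t) <= K * Cmod (g t) ^ 2) by (simpl; nra). lra. }
  split.
  - apply (gronwall u u'); auto. intros t Ht. now apply Hu'.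
  - pose proof (gronwall (fun t => - u t) (fun t => - u' t) a b (- (2 * K)) Hab) as G.
    cbv beta in G. assert (Hg : - u b <= - u a * exp (- (2 * K) * (b - a))).
    { apply G.
      - intros t Ht. apply (derivable_pt_lim_opp u). now apply Hu.
      - intros t Ht. specialize (Hu' t Ht). lra. }
    unfold u in Hg. lra.
Qed.

(** The complex factor [c] serves for reversed time ([-1]), for transversals (an imaginary number)
    and for rays in complex time. *)
Lemma ode_unique F (c : C) (x y : R -> C) a b : differentiable F -> a <= b ->
  (forall t, a <= t <= b -> derR x t (c * F (x t))) ->
  (forall t, a <= t <= b -> derR y t (c * F (y t))) -> x a = y a -> x b = y b.
Proof.
  intros HF Hab Hx Hy E.
  destruct (contI_bounded x a b Hab) as [M1 [HM1 B1]]; [intros t Ht; eapply contR_of_derR, Hx, Ht|].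
  destruct (contI_bounded y a b Hab) as [M2 [HM2 B2]]; [intros t Ht; eapply contR_of_derR, Hy, Ht|].
  destruct (lipschitz_ball F (M1 + M2) HF ltac:(lra)) as [L [HL KL]].
  destruct (Cmod_growth (fun t => x t - y t)%C (fun t => c * F (x t) - c * F (y t))%C a b (Cmod c * L) Hab) as [G _].
  - intros t Ht.
    eapply derR_eq; [apply (derR_plus x (fun t => - y t)%C)|].
    + now apply Hx.
    + apply (derR_comp (fun w => - w)%C y); [|now apply Hy].
      apply (derC_ext (fun v => - (1) * v)%C); [intros; ring|]. apply derC_mult; [apply derC_const|apply derC_id].
    + cbv beta. ring.
  - intros t Ht. replace (c * F (x t) - c * F (y t))%C with (c * (F (x t) - F (y t)))%C by ring.
    rewrite Cmod_mult, Rmult_assoc. apply Rmult_le_compat_l; [apply Cmod_ge_0|].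
    specialize (B1 t Ht). specialize (B2 t Ht). apply KL; lra.
  - rewrite E, Cmod_diag in G. apply Cmod_minus_eq0. pose proof (Cmod_ge_0 (x b - y b)). 
    replace (0 ^ 2 * exp (2 * (Cmod c * L) * (b - a))) with 0 in G by ring. nra.
Qed.

Lemma derR_reverse (x : R -> C) t l : derR x (- t) l -> derR (fun s => x (- s)) t (- l)%C.
Proof.
  intros H e He. destruct (H e He) as [d [Hd K]]. exists d. split; [exact Hd|]. intros s Hs.
  specialize (K (- s)). replace (- s - - t) with (- (s - t)) in K by ring. rewrite Rabs_Ropp in K.
  specialize (K Hs). rewrite RtoC_opp in K.
  replace (x (- s)%R - x (- t)%R - RtoC (s - t) * - l)%C with (x (- s)%R - x (- t)%R - - RtoC (s - t) * l)%C by ring. exact K.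
Qed.

Lemma derR_shift (x : R -> C) a t l : derR x (a + t) l -> derR (fun s => x (a + s)) t l.
Proof.
  intros H e He. destruct (H e He) as [d [Hd K]]. exists d. split; [exact Hd|]. intros s Hs.
  specialize (K (a + s)). replace (a + s - (a + t)) with (s - t) in K by ring. now apply K.
Qed.

Lemma derR_local (f g : R -> C) t l d : 0 < d -> (forall s, Rabs (s - t) < d -> f s = g s) -> derR f t l -> derR g t l.
Proof.
  intros Hr E H e He. destruct (H e He) as [d' [Hd K]].
  exists (Rmin d' d). split; [now apply Rmin_glb_lt|]. intros w Hw.
  assert (L1 := Rlt_le_trans _ _ _ Hw (Rmin_l _ _)). assert (L2 := Rlt_le_trans _ _ _ Hw (Rmin_r _ _)).
  rewrite <- (E w L2), <- (E t) by (rewrite Rminus_diag, Rabs_R0; exact Hr). now apply K.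
Qed.

Lemma solution_iff F x0 J phi : solution F x0 J phi <->
  (forall t, J t -> exists d, 0 < d /\ forall s, Rabs (s - t) < d -> J s) /\
  (forall a b t, J a -> J b -> a <= t <= b -> J t) /\ J 0 /\ phi 0 = x0 /\
  forall t, J t -> derR phi t (F (phi t)).
Proof.
  unfold solution. split.
  - intros (H1 & H2 & H3 & H4 & H5). repeat split; auto.
    + intros t Ht. destruct (H1 t Ht) as [d Hd]. exists d. split; [apply cond_pos|]. exact Hd.
    + intros t Ht. apply derR_iff. now apply H5.
  - intros (H1 & H2 & H3 & H4 & H5). split; [|split; [|split; [|split]]]; auto.
    + intros t Ht. destruct (H1 t Ht) as [d [Hd K]]. exists (mkposreal d Hd). exact K.
    + intros t Ht. apply derR_iff. now apply H5.
Qed.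

Lemma ode_unique2 F (c : C) (x y : R -> C) (J : R -> Prop) t : differentiable F ->
  (forall a b t, J a -> J b -> a <= t <= b -> J t) -> J 0 -> J t ->
  (forall t, J t -> derR x t (c * F (x t))) ->
  (forall t, J t -> derR y t (c * F (y t))) -> x 0 = y 0 -> x t = y t.
Proof.
  intros HF Hc H0 Ht Hx Hy E. destruct (Rle_dec 0 t) as [h|h].
  - apply (ode_unique F c x y 0 t HF h); auto; intros s Hs; [apply Hx|apply Hy]; apply (Hc 0 t); auto.
  - assert (E' : x (- - t) = y (- - t)); [|now rewrite Ropp_involutive in E'].
    apply (ode_unique F (- c) (fun s => x (- s)) (fun s => y (- s)) 0 (- t) HF); [lra| | |now rewrite Ropp_0].
    + intros s Hs. eapply derR_eq; [apply derR_reverse, Hx, (Hc t 0); auto; lra|ring].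
    + intros s Hs. eapply derR_eq; [apply derR_reverse, Hy, (Hc t 0); auto; lra|ring].
Qed.

Section Flow.
Variable F : C -> C.
Hypothesis HF : differentiable F.

Lemma solution_agree x0 J J' phi phi' t : solution F x0 J phi -> solution F x0 J' phi' ->
  J t -> J' t -> phi t = phi' t.
Proof.
  rewrite !solution_iff. intros (H1 & H2 & H3 & H4 & H5) (H1' & H2' & H3' & H4' & H5') Ht Ht'.
  apply (ode_unique2 F 1 phi phi' (fun s => J s /\ J' s)); auto.
  - intros a b s [] [] Hs; split; [apply (H2 a b)|apply (H2' a b)]; auto.
  - intros s []. eapply derR_eq; [apply H5; auto|ring].
  - intros s []. eapply derR_eq; [apply H5'; auto|ring].
  - congruence.
Qed.

Lemma flow_eq x0 J phi t : solution F x0 J phi -> J t -> flow F t x0 = phi t.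
Proof.
  intros H Ht. unfold flow.
  destruct (epsilon_spec (inhabits (RtoC 0)) (fun v => exists J phi, solution F x0 J phi /\ J t /\ phi t = v))
    as (J' & phi' & H' & Ht' & <-); [exists (phi t), J, phi; auto|].
  eapply solution_agree; eauto.
Qed.

Lemma flow_solution_at x0 t : max_interval F x0 t -> exists J phi, solution F x0 J phi /\ J t /\
  forall s, J s -> max_interval F x0 s /\ flow F s x0 = phi s.
Proof.
  intros (J & phi & H & Ht). exists J, phi. split; [exact H|]. split; [exact Ht|].
  intros s Hs. split; [exists J, phi; auto|eapply flow_eq; eauto].
Qed.

Lemma flow_der x0 t : max_interval F x0 t -> derR (fun s => flow F s x0) t (F (flow F t x0)).
Proof.
  intros H. destruct (flow_solution_at x0 t H) as (J & phi & Hs & Ht & E).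
  apply solution_iff in Hs. destruct Hs as (H1 & H2 & H3 & H4 & H5).
  destruct (H1 t Ht) as [d [Hd K]].
  rewrite (proj2 (E t Ht)). apply (derR_local phi _ t _ d); auto.
  intros s Hs. symmetry. now apply E, K.
Qed.

Lemma flow_cont x0 t : max_interval F x0 t -> contR (fun s => flow F s x0) t.
Proof. intros H. eapply contR_of_derR, flow_der, H. Qed.

Lemma mi_open x0 t : max_interval F x0 t -> exists d, 0 < d /\ forall s, Rabs (s - t) < d -> max_interval F x0 s.
Proof.
  intros H. destruct (flow_solution_at x0 t H) as (J & phi & Hs & Ht & E).
  apply solution_iff in Hs. destruct Hs as (H1 & H2 & H3 & H4 & H5).
  destruct (H1 t Ht) as [d [Hd K]]. exists d. split; auto. intros s Hs. now apply E, K.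
Qed.

Lemma mi_conn0 x0 t s : max_interval F x0 t -> (0 <= s <= t \/ t <= s <= 0) -> max_interval F x0 s.
Proof.
  intros (J & phi & H & Ht) Hs. exists J, phi. split; auto.
  apply solution_iff in H. destruct H as (H1 & H2 & H3 & H4 & H5).
  destruct Hs as [Hs|Hs]; [apply (H2 0 t)|apply (H2 t 0)]; auto.
Qed.

Lemma mi_conn x0 a b t : max_interval F x0 a -> max_interval F x0 b -> a <= t <= b -> max_interval F x0 t.
Proof.
  intros Ha Hb Ht. destruct (Rle_dec 0 t); [apply (mi_conn0 x0 b)|apply (mi_conn0 x0 a)]; auto; lra.
Qed.

Lemma solution_sym y phi d : 0 < d -> phi 0 = y ->
  (forall s, Rabs s < d -> derR phi s (F (phi s))) -> solution F y (fun s => Rabs s < d) phi.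
Proof.
  intros Hd H0 H. apply solution_iff. repeat split; auto.
  - intros t Ht. exists (d - Rabs t). split; [lra|]. intros s Hs.
    pose proof (Rabs_triang (s - t) t). replace (s - t + t) with s in H1 by ring. lra.
  - intros a b t Ha Hb Ht. apply Rabs_def2 in Ha, Hb. apply Rabs_def1; lra.
  - rewrite Rabs_R0. exact Hd.
Qed.

Lemma derR_line (psi : C -> C) w s : derC psi (w + RtoC s)%C (F (psi (w + RtoC s)%C)) ->
  derR (fun s => psi (w + RtoC s)%C) s (F (psi (w + RtoC s)%C)).
Proof.
  intros H. eapply derR_eq; [apply (derR_comp psi (fun s => w + RtoC s)%C); [exact H|]|].
  - apply (derR_ext (fun s => w + RtoC s * 1)%C); [intros; ring|]. apply derR_affine.
  - ring.
Qed.

Lemma chart_solution p r psi w d : chart F p r psi -> 0 < d -> Cmod w + d <= r ->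
  solution F (psi w) (fun s => Rabs s < d) (fun s => psi (w + RtoC s)%C).
Proof.
  intros (Hr & H0 & Hd & _) Hd0 Hw. apply solution_sym; auto.
  - f_equal. ring.
  - intros s Hs. apply derR_line, Hd.
    eapply Rle_lt_trans; [apply Cmod_triangle|]. rewrite Cmod_R. lra.
Qed.

Lemma zero_solution a : F a = 0 -> solution F a (fun _ => True) (fun _ => a).
Proof.
  intros H. apply solution_iff. repeat split; auto.
  - intros. exists 1. split; [lra|auto].
  - intros t _. rewrite H. apply derR_const.
Qed.

Lemma mi_0 x0 : max_interval F x0 0.
Proof.
  destruct (classic (F x0 = 0)) as [H|H].
  - exists (fun _ => True), (fun _ => x0). split; auto. now apply zero_solution.
  - destruct (chart_exists F x0 HF H) as (r & psi & Hc). pose proof Hc as (Hr & H0 & _).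
    exists (fun s => Rabs s < r), (fun s => psi (0 + RtoC s)%C). split; [|rewrite Rabs_R0; auto].
    rewrite <- H0. eapply chart_solution; eauto. rewrite Cmod_0. lra.
Qed.

Lemma flow_0 x0 : flow F 0 x0 = x0.
Proof.
  destruct (flow_solution_at x0 0 (mi_0 x0)) as (J & phi & H & Ht & E).
  rewrite (proj2 (E 0 Ht)). apply solution_iff in H. tauto.
Qed.

Lemma flow_zero a t : F a = 0 -> max_interval F a t /\ flow F t a = a.
Proof.
  intros H. apply zero_solution in H. split.
  - exists (fun _ => True), (fun _ => a). auto.
  - now apply (flow_eq a _ _ t H).
Qed.

Lemma solution_flow x0 : solution F x0 (max_interval F x0) (fun s => flow F s x0).
Proof.
  apply solution_iff. repeat split.
  - intros t. apply mi_open.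
  - intros a b t. apply mi_conn.
  - apply mi_0.
  - apply flow_0.
  - intros t. apply flow_der.
Qed.

(** The flow up to [t] and a solution started there agree where both are defined, by uniqueness, so
    they glue to a solution on the union of the intervals, which lies in the maximal interval by
    definition of the latter. *)
Lemma flow_extend x0 t J phi s : max_interval F x0 t -> solution F (flow F t x0) J phi -> J s ->
  max_interval F x0 (t + s) /\ flow F (t + s) x0 = phi s.
Proof.
  intros Ht Hphi Hs.
  pose proof Hphi as Hphi'. apply solution_iff in Hphi'. destruct Hphi' as (H1 & H2 & H3 & H4 & H5).
  pose proof (solution_flow x0) as HX. apply solution_iff in HX. destruct HX as (X1 & X2 & X3 & X4 & X5).
  set (Z := fun u => if excluded_middle_informative (max_interval F x0 u) then flow F u x0 else phi (u - t)).
  assert (Hag : forall u, max_interval F x0 u -> J (u - t) -> flow F u x0 = phi (u - t)).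
  { intros u Hu Hu'.
    assert (E : (fun v => flow F (t + v) x0) (u - t) = phi (u - t)).
    { apply (ode_unique2 F 1 (fun v => flow F (t + v) x0) phi (fun v => max_interval F x0 (t + v) /\ J v)); auto.
      - intros a b v [] [] Hv. split; [apply (X2 (t + a) (t + b)); auto; lra|apply (H2 a b); auto].
      - rewrite Rplus_0_r. auto.
      - replace (t + (u - t)) with u by ring. auto.
      - intros v []. eapply derR_eq; [apply (derR_shift (fun v => flow F v x0)), X5; auto|ring].
      - intros v []. eapply derR_eq; [apply H5; auto|ring].
      - cbv beta. rewrite Rplus_0_r. auto. }
    cbv beta in E. replace (t + (u - t)) with u in E by ring. exact E. }
  assert (HZ1 : forall u, max_interval F x0 u -> Z u = flow F u x0).
  { intros u Hu. unfold Z. destruct (excluded_middle_informative _); tauto. }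
  assert (HZ2 : forall u, J (u - t) -> Z u = phi (u - t)).
  { intros u Hu. unfold Z. destruct (excluded_middle_informative _); auto. }
  assert (HZ : solution F x0 (fun u => max_interval F x0 u \/ J (u - t)) Z).
  { apply solution_iff. repeat split.
    - intros u [Hu|Hu].
      + destruct (X1 u Hu) as [d [Hd K]]. exists d. split; auto.
      + destruct (H1 _ Hu) as [d [Hd K]]. exists d. split; auto. intros v Hv. right. apply K.
        replace (v - t - (u - t)) with (v - u) by ring. auto.
    - assert (Jt : J (t - t)) by (rewrite Rminus_diag; auto).
      intros a b u Ha Hb Hu.
      destruct (Rle_dec u t) as [h|h].
      + destruct Ha as [Ha|Ha]; [left; apply (X2 a t); auto; lra|right; apply (H2 (a - t) (t - t)); auto; lra].
      + destruct Hb as [Hb|Hb]; [left; apply (X2 t b); auto; lra|right; apply (H2 (t - t) (b - t)); auto; lra].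
    - auto.
    - rewrite HZ1 by auto. apply X4.
    - intros u [Hu|Hu].
      + rewrite HZ1 by auto. destruct (X1 u Hu) as [d [Hd K]].
        apply (derR_local (fun v => flow F v x0) _ u _ d); auto.
        intros v Hv. symmetry. now apply HZ1, K.
      + rewrite HZ2 by auto. destruct (H1 _ Hu) as [d [Hd K]].
        apply (derR_local (fun v => phi (v - t)) _ u _ d); auto.
        * intros v Hv. symmetry. apply HZ2, K. replace (v - t - (u - t)) with (v - u) by ring. auto.
        * apply (derR_ext (fun v => phi (- t + v))); [intros; f_equal; ring|].
          apply derR_shift. replace (- t + u) with (u - t) by ring. now apply H5. }
  assert (Jts : J (t + s - t)) by (replace (t + s - t) with s by ring; auto).
  split.
  - exists (fun u => max_interval F x0 u \/ J (u - t)), Z. auto.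
  - rewrite (flow_eq x0 _ Z (t + s) HZ) by auto. rewrite HZ2 by auto. f_equal. ring.
Qed.

Lemma flow_plus x0 t s : max_interval F x0 t -> max_interval F (flow F t x0) s ->
  max_interval F x0 (t + s) /\ flow F (t + s) x0 = flow F s (flow F t x0).
Proof. intros Ht Hs. exact (flow_extend x0 t _ (fun u => flow F u (flow F t x0)) s Ht (solution_flow _) Hs). Qed.

Lemma flow_minus x0 t s : max_interval F x0 t -> max_interval F x0 s ->
  max_interval F (flow F t x0) (s - t) /\ flow F (s - t) (flow F t x0) = flow F s x0.
Proof.
  intros Ht Hs.
  assert (H : solution F (flow F t x0) (fun v => max_interval F x0 (t + v)) (fun v => flow F (t + v) x0)).
  { apply solution_iff. repeat split.
    - intros u Hu. destruct (mi_open x0 _ Hu) as [d [Hd K]]. exists d. split; auto. intros v Hv. apply K.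
      replace (t + v - (t + u)) with (v - u) by ring. auto.
    - intros a b u Ha Hb Hu. apply (mi_conn x0 (t + a) (t + b)); auto; lra.
    - rewrite Rplus_0_r; auto.
    - now rewrite Rplus_0_r.
    - intros u Hu. apply (derR_shift (fun v => flow F v x0)). now apply flow_der. }
  assert (Hs' : max_interval F x0 (t + (s - t))) by (replace (t + (s - t)) with s by ring; auto).
  split.
  - eexists _, _. split; [exact H|exact Hs'].
  - rewrite (flow_eq _ _ _ (s - t) H Hs'). f_equal. ring.
Qed.

Lemma flow_inverse x0 t : max_interval F x0 t ->
  max_interval F (flow F t x0) (- t) /\ flow F (- t) (flow F t x0) = x0.
Proof.
  intros Ht. destruct (flow_minus x0 t 0 Ht (mi_0 x0)) as [H1 H2].
  replace (0 - t) with (- t) in * by ring. split; auto. rewrite H2. apply flow_0.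
Qed.

Lemma orbit_refl x : orbit F x x.
Proof. exists 0. split; [apply mi_0|now rewrite flow_0]. Qed.

Lemma orbit_flow x t : max_interval F x t -> orbit F x (flow F t x).
Proof. intros H. exists t. auto. Qed.

Lemma orbit_sym x y : orbit F x y -> orbit F y x.
Proof.
  intros [t [Ht ->]]. destruct (flow_inverse x t Ht) as [H1 H2]. exists (- t). auto.
Qed.

Lemma orbit_trans x y z : orbit F x y -> orbit F y z -> orbit F x z.
Proof.
  intros [t [Ht ->]] [s [Hs ->]]. destruct (flow_plus x t s Ht Hs) as [H1 H2]. exists (t + s). auto.
Qed.

Lemma orbit_eq x y : orbit F x y -> orbit F x = orbit F y.
Proof.
  intros H. apply functional_extensionality. intros z. apply propositional_extensionality.
  split; intros; eapply orbit_trans; eauto using orbit_sym.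
Qed.

Lemma orbit_zero a z : F a = 0 -> orbit F a z -> z = a.
Proof. intros Ha [t [_ ->]]. now apply flow_zero. Qed.

Lemma orbit_nonzero x z : F x <> 0 -> orbit F x z -> F z <> 0.
Proof. intros Hx H E. apply orbit_sym in H. apply (orbit_zero z x E) in H. subst. auto. Qed.

Lemma ball_bound rho : exists N, 0 < N /\ forall z, Cmod z <= rho -> Cmod (F z) <= N.
Proof.
  destruct (lipschitz_ball F (Rabs rho + 1) HF) as [L [HL K]]; [pose proof (Rabs_pos rho); lra|].
  exists (Cmod (F 0) + L * (Rabs rho + 1) + 1). pose proof (Cmod_ge_0 (F 0)). pose proof (Rabs_pos rho).
  split; [nra|]. intros z Hz.
  assert (Hz' : Cmod z <= Rabs rho + 1) by (pose proof (Rle_abs rho); lra).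
  specialize (K z 0 Hz' ltac:(rewrite Cmod_0; lra)).
  pose proof (Cmod_triangle (F z - F 0) (F 0)) as T. replace (F z - F 0 + F 0)%C with (F z) in T by ring.
  replace (z - 0)%C with z in K by ring.
  assert (L * Cmod z <= L * (Rabs rho + 1)) by (apply Rmult_le_compat_l; lra). lra.
Qed.

Lemma flow_lip x0 N a b : a <= b -> max_interval F x0 a -> max_interval F x0 b ->
  (forall t, a <= t <= b -> Cmod (F (flow F t x0)) <= N) ->
  Cmod (flow F b x0 - flow F a x0) <= (b - a) * N.
Proof.
  intros Hab Ha Hb HN.
  apply (mean_value_C (fun t => flow F t x0) (fun t => F (flow F t x0))); auto.
  - intros t Ht. apply flow_der. now apply (mi_conn x0 a b).
  - intros t Ht. apply contR_comp; [now apply differentiable_cont|]. apply flow_cont. now apply (mi_conn x0 a b).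
Qed.

(* The limit at the end of the interval is either a
   regular point, where a flow box continues the solution, or an equilibrium,
   which is not reached in finite time. *)
Lemma flow_escape x0 b rho : 0 < b -> (forall t, 0 <= t < b -> max_interval F x0 t) ->
  (forall t, 0 <= t < b -> Cmod (flow F t x0) <= rho) -> max_interval F x0 b.
Proof.
  intros Hb HI Hrho.
  destruct (classic (F x0 = 0)) as [H0|H0]; [now apply flow_zero|].
  destruct (ball_bound rho) as [N [HN KN]].
  assert (Hlip : forall s t, 0 <= s <= t -> t < b -> Cmod (flow F t x0 - flow F s x0) <= (t - s) * N).
  { intros s t Hs Ht. apply flow_lip; try apply HI; try lra. intros u Hu. apply KN, Hrho; lra. }
  (* The remaining time is halved at every step, so the speed bound makes the positions a geometric
     Cauchy sequence. *)
  set (tn := fun n => b * (1 - (1 / 2) ^ n)).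
  assert (Hp : forall n, 0 < (1 / 2) ^ n <= 1).
  { intros n. split; [apply pow_lt; lra|]. rewrite <- (pow1 n) at 2. apply pow_incr; lra. }
  assert (Htn : forall n, 0 <= tn n < b /\ tn n <= tn (S n)).
  { intros n. unfold tn. specialize (Hp n). simpl pow. split; [split|]; nra. }
  destruct (C_geometric_cauchy (fun n => flow F (tn n) x0) (b * N)) as [y Hy].
  - nra.
  - intros n. destruct (Htn n) as [T1 T2]. destruct (Htn (S n)) as [T3 _].
    eapply Rle_trans; [apply Hlip; lra|].
    replace (tn (S n) - tn n) with (b * (1 / 2) ^ n / 2) by (unfold tn; simpl; field).
    specialize (Hp n). assert (0 < b * N) by nra. 
    assert (0 < b * N * (1 / 2) ^ n) by (apply Rmult_lt_0_compat; lra). lra.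
  - assert (Hlim : forall e, 0 < e -> exists d, 0 < d <= b /\ forall t, b - d <= t < b -> Cmod (flow F t x0 - y) < e).
    { intros e He.
      set (q := 3 * (b * N)). assert (Hq : 0 < q) by (unfold q; nra).
      destruct (pow_lt_1_zero (1 / 2) ltac:(rewrite Rabs_pos_eq; lra) (e / q)) as [n Hn];
        [apply Rdiv_lt_0_compat; lra|].
      specialize (Hn n (Nat.le_refl n)). rewrite Rabs_pos_eq in Hn by (apply pow_le; lra).
      apply (Rmult_lt_compat_l q) in Hn; [|exact Hq]. replace (q * (e / q)) with e in Hn by (field; lra).
      exists (b - tn n). destruct (Htn n) as [T1 _]. split; [lra|]. intros t Ht.
      pose proof (Hlip (tn n) t ltac:(lra) ltac:(lra)). specialize (Hy n). cbv beta in Hy.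
      pose proof (Cmod_tri (flow F t x0) (flow F (tn n) x0) y). rewrite (Cmod_sym y) in Hy.
      assert ((t - tn n) * N <= b * N * (1 / 2) ^ n).
      { replace (b * N * (1 / 2) ^ n) with (b * (1 / 2) ^ n * N) by ring.
        apply Rmult_le_compat_r; [lra|]. unfold tn in *. lra. }
      unfold q in Hn. lra. }
    destruct (classic (F y = 0)) as [Hy0|Hy0].
    + exfalso.
      assert (Hyr : Cmod y <= rho).
      { apply le_epsilon. intros e He. destruct (Hlim e He) as [d [Hd K]].
        specialize (K (b - d) ltac:(lra)). specialize (Hrho (b - d) ltac:(lra)).
        rewrite Cmod_sym in K. pose proof (Cmod_rev y (flow F (b - d) x0)). lra. }
      destruct (lipschitz_ball F (Rabs rho + 1) HF) as [L [HL KL]]; [pose proof (Rabs_pos rho); lra|].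
      pose proof (Rle_abs rho).
      assert (Hne : 0 < Cmod (x0 - y)) by (apply Cmod_minus_gt0; intros ->; auto).
      set (m := Cmod (x0 - y) ^ 2 * exp (- (2 * L) * b)).
      assert (Hm : 0 < m) by (apply Rmult_lt_0_compat; [apply pow_lt; exact Hne|apply exp_pos]).
      (* A distance below both 1 and [m / 2] has its square below [m], against the lower growth
         bound. *)
      destruct (Hlim (Rmin 1 (m / 2))) as [d [Hd K]]; [apply Rmin_glb_lt; lra|].
      specialize (K (b - d) ltac:(lra)).
      destruct (Cmod_growth (fun t => flow F t x0 - y)%C (fun t => F (flow F t x0)) 0 (b - d) L) as [_ G]; [lra| | |].
      * intros t Ht. eapply derR_eq.
        -- apply (derR_plus (fun t => flow F t x0) (fun _ => - y)%C); [apply flow_der, HI; lra|apply derR_const].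
        -- ring.
      * intros t Ht. replace (F (flow F t x0)) with (F (flow F t x0) - F y)%C by (rewrite Hy0; ring).
        specialize (Hrho t ltac:(lra)). apply KL; lra.
      * cbv beta in G. rewrite flow_0 in G.
        assert (Hex : exp (- (2 * L) * b) <= exp (- (2 * L) * (b - d - 0))).
        { destruct (Req_dec d 0) as [->|]; [right; f_equal; ring|]. left. apply exp_increasing. nra. }
        assert (m <= Cmod (flow F (b - d) x0 - y) ^ 2).
        { eapply Rle_trans; [|exact G]. unfold m. apply Rmult_le_compat_l; [apply pow2_ge_0|exact Hex]. }
        pose proof (Rmin_l 1 (m / 2)). pose proof (Rmin_r 1 (m / 2)).
        pose proof (Cmod_ge_0 (flow F (b - d) x0 - y)). nra.
    + destruct (chart_exists F y HF Hy0) as (r & psi & Hc). pose proof Hc as (Hr & Hc0 & _ & _ & Hop).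
      destruct (Hop 0) with (e := r / 2) as [d1 [Hd1 K1]]; [rewrite Cmod_0; lra|lra|].
      destruct (Hlim d1 Hd1) as [d [Hd K]].
      (* Late enough that the flow-box solution from this point, which lasts for time [r / 2],
         reaches beyond [b]. *)
      set (t := b - Rmin d (r / 4)).
      assert (Ht : b - d <= t < b /\ b - t <= r / 4).
      { pose proof (Rmin_l d (r / 4)). pose proof (Rmin_r d (r / 4)).
        assert (0 < Rmin d (r / 4)) by (apply Rmin_glb_lt; lra). unfold t; lra. }
      destruct (K1 (flow F t x0)) as (w & Hw1 & Hw2 & Hw3).
      { rewrite Hc0. apply K. lra. }
      replace (w - 0)%C with w in Hw2 by ring.
      assert (Hsol : solution F (flow F t x0) (fun s => Rabs s < r / 2) (fun s => psi (w + RtoC s)%C)).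
      { rewrite <- Hw3. eapply chart_solution; eauto; lra. }
      destruct (flow_extend x0 t _ _ (b - t) (HI t ltac:(lra)) Hsol) as [HH _].
      * rewrite Rabs_pos_eq; lra.
      * replace (t + (b - t)) with b in HH by ring. exact HH.
Qed.

End Flow.

(** * Time reversal *)

Lemma differentiable_opp F : differentiable F -> differentiable (fun z => - F z)%C.
Proof.
  intros HF z. destruct (HF z) as [l Hl]. exists (- l)%C.
  apply (derC_ext (fun v => - (1) * F v)%C); [intros; ring|].
  eapply derC_eq; [apply derC_mult; [apply derC_const|exact Hl]|cbv beta; ring].
Qed.

Lemma solution_opp F x0 J phi : solution F x0 J phi ->
  solution (fun z => - F z)%C x0 (fun t => J (- t)) (fun t => phi (- t)).
Proof.
  rewrite !solution_iff. intros (H1 & H2 & H3 & H4 & H5). repeat split.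
  - intros t Ht. destruct (H1 _ Ht) as [d [Hd K]]. exists d. split; auto. intros s Hs. apply K.
    replace (- s - - t) with (- (s - t)) by ring. now rewrite Rabs_Ropp.
  - intros a b t Ha Hb Ht. apply (H2 (- b) (- a)); auto; lra.
  - now rewrite Ropp_0.
  - now rewrite Ropp_0.
  - intros t Ht. apply derR_reverse. now apply H5.
Qed.

Lemma opp_opp_fun (F : C -> C) : (fun z => - - F z)%C = F.
Proof. apply functional_extensionality. intros z. ring. Qed.

Lemma mi_opp F x0 t : max_interval F x0 t -> max_interval (fun z => - F z)%C x0 (- t).
Proof.
  intros (J & phi & H & Ht). exists (fun t => J (- t)), (fun t => phi (- t)).
  split; [now apply solution_opp|now rewrite Ropp_involutive].
Qed.

Lemma flow_opp F x0 t : differentiable F -> max_interval F x0 t ->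
  flow (fun z => - F z)%C (- t) x0 = flow F t x0.
Proof.
  intros HF (J & phi & H & Ht).
  rewrite (flow_eq F HF x0 J phi t H Ht).
  rewrite (flow_eq _ (differentiable_opp F HF) x0 _ _ (- t) (solution_opp F x0 J phi H)); cbv beta;
    now rewrite Ropp_involutive.
Qed.

Lemma orbit_opp F x0 : differentiable F -> orbit (fun z => - F z)%C x0 = orbit F x0.
Proof.
  intros HF. apply functional_extensionality. intros z. apply propositional_extensionality. split.
  - intros [t [Ht ->]]. pose proof (differentiable_opp F HF) as HF'.
    rewrite <- (flow_opp _ x0 t HF' Ht). apply mi_opp in Ht. rewrite opp_opp_fun in *. exists (- t); auto.
  - intros [t [Ht ->]]. rewrite <- (flow_opp F x0 t HF Ht). apply mi_opp in Ht. exists (- t); auto.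
Qed.

(** Continuous induction. Near each [t] the property passes between any two points in either order,
    which covers the open and the closed step at once. *)
Lemma interval_prop (P : R -> Prop) a b : a <= b -> P a ->
  (forall t, a <= t <= b -> exists d, 0 < d /\ forall s u, a <= s <= b -> a <= u <= b ->
     Rabs (s - t) < d -> Rabs (u - t) < d -> P s -> P u) -> P b.
Proof.
  intros Hab Ha H.
  destruct (completeness (fun t => a <= t <= b /\ P t)) as [m [Hu Hl]].
  - exists b. intros t [Ht _]. lra.
  - exists a. split; [lra|exact Ha].
  - assert (Hm : a <= m <= b).
    { split; [apply Hu; split; [lra|exact Ha]|]. apply Hl. intros t [Ht _]. lra. }
    destruct (H m Hm) as [d [Hd K]].
    assert (Hs : exists s, (a <= s <= b /\ P s) /\ m - d < s).
    { apply NNPP. intros Hno. assert (m <= m - d); [|lra]. apply Hl. intros t Ht.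
      apply Rnot_lt_le. intros Hlt. apply Hno. exists t. auto. }
    destruct Hs as (s & [Hs Ps] & Hsm). assert (s <= m) by (apply Hu; auto).
    assert (HP : forall u, a <= u <= b -> Rabs (u - m) < d -> P u).
    { intros u Hu1 Hu2. apply (K s u); auto. apply Rabs_def1; lra. }
    destruct (Req_dec m b) as [->|n].
    + apply HP; [lra|]. rewrite Rminus_diag, Rabs_R0; lra.
    + exfalso. set (u := Rmin b (m + d / 2)).
      assert (Hu1 : m < u <= b /\ u <= m + d / 2).
      { split; [split; [apply Rmin_glb_lt; lra|apply Rmin_l]|apply Rmin_r]. }
      assert (u <= m); [|lra]. apply Hu. split; [lra|]. apply HP; [lra|]. apply Rabs_def1; lra.
Qed.

(** * Germs of solutions in complex time *)

Definition germ (F : C -> C) (p : C) (r : R) (chi : C -> C) : Prop :=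
  0 < r /\ chi 0 = p /\ forall w, Cmod w < r -> derC chi w (F (chi w)).

Lemma chart_germ F p r psi : chart F p r psi -> germ F p r psi.
Proof. intros (H1 & H2 & H3 & _). now repeat split. Qed.

Lemma derC_shift f w0 w l : derC f (w0 + w) l -> derC (fun v => f (w0 + v)%C) w l.
Proof.
  intros H e He. destruct (H e He) as [d [Hd K]]. exists d. split; auto. intros v Hv.
  specialize (K (w0 + v)%C). replace (w0 + v - (w0 + w))%C with (v - w)%C in K by ring. auto.
Qed.

Lemma germ_shift F p r chi w0 : germ F p r chi -> Cmod w0 < r ->
  germ F (chi w0) (r - Cmod w0) (fun w => chi (w0 + w)%C).
Proof.
  intros (Hr & H0 & Hd) Hw. split; [lra|]. split; [f_equal; ring|].
  intros w Hw'. apply derC_shift, Hd. eapply Rle_lt_trans; [apply Cmod_triangle|]. lra.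
Qed.

(** On the ray from 0 to [w] both maps solve the real-time equation [x' = w F(x)]. *)
Lemma germ_unique F p r1 r2 chi1 chi2 w : differentiable F -> germ F p r1 chi1 -> germ F p r2 chi2 ->
  Cmod w < r1 -> Cmod w < r2 -> chi1 w = chi2 w.
Proof.
  intros HF (Hr1 & H1 & D1) (Hr2 & H2 & D2) Hw1 Hw2.
  assert (E : forall chi r, (forall w, Cmod w < r -> derC chi w (F (chi w))) -> Cmod w < r ->
    forall t, 0 <= t <= 1 -> derR (fun s => chi (0 + RtoC s * w)%C) t (w * F (chi (0 + RtoC t * w)%C))%C).
  { intros chi r D Hw t Ht. apply (derR_comp chi (fun s => 0 + RtoC s * w)%C); [|apply derR_affine].
    apply D. rewrite Cplus_0_l, Cmod_Rmult, Rabs_pos_eq by lra. pose proof (Cmod_ge_0 w). nra. }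
  pose proof (ode_unique F w (fun s => chi1 (0 + RtoC s * w)%C) (fun s => chi2 (0 + RtoC s * w)%C) 0 1 HF ltac:(lra)
    (E _ _ D1 Hw1) (E _ _ D2 Hw2)) as G. cbv beta in G.
  replace (0 + RtoC 1 * w)%C with w in G by ring. apply G.
  replace (0 + RtoC 0 * w)%C with (RtoC 0) by ring. congruence.
Qed.

Lemma germ_flow F p r chi w s : differentiable F -> germ F p r chi -> Cmod w + Rabs s < r ->
  max_interval F (chi w) s /\ flow F s (chi w) = chi (w + RtoC s)%C.
Proof.
  intros HF (Hr & H0 & Hd) Hw.
  set (d := r - Cmod w). assert (Hd0 : Rabs s < d) by (unfold d; lra).
  assert (Hsol : solution F (chi w) (fun s => Rabs s < d) (fun s => chi (w + RtoC s)%C)).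
  { apply solution_sym; [pose proof (Rabs_pos s); lra|f_equal; ring|].
    intros u Hu. apply derR_line, Hd.
    eapply Rle_lt_trans; [apply Cmod_triangle|]. rewrite Cmod_R. unfold d in Hu. lra. }
  split; [eexists _, _; split; [exact Hsol|exact Hd0]|].
  exact (flow_eq F HF _ _ _ s Hsol Hd0).
Qed.

(* The real-time flow commutes with the complex-time flow boxes. *)
Lemma flow_germ F x0 r psi T r1 chi : differentiable F -> F x0 <> 0 -> germ F x0 r psi ->
  max_interval F x0 T -> germ F (flow F T x0) r1 chi ->
  exists e, 0 < e /\ forall w, Cmod w < e -> max_interval F (psi w) T /\ flow F T (psi w) = chi w.
Proof.
  intros HF Hx0 Hpsi HT Hchi.
  (* Induction along the times [u T] with [u] in [[0,1]], so that both signs of [T] are treated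
     alike. *)
  set (P := fun u => exists r' chi' e, germ F (flow F (u * T) x0) r' chi' /\ 0 < e /\
    forall w, Cmod w < e -> max_interval F (psi w) (u * T) /\ flow F (u * T) (psi w) = chi' w).
  assert (HuT : forall u, 0 <= u <= 1 -> max_interval F x0 (u * T)).
  { intros u Hu. apply (mi_conn0 F x0 T); auto. destruct (Rle_dec 0 T); [left|right]; split; nra. }
  assert (HP : P 1).
  { apply (interval_prop P 0 1); [lra| |].
    - exists r, psi, r. rewrite Rmult_0_l, flow_0 by auto. split; [exact Hpsi|]. split; [apply Hpsi|].
      intros w _. split; [now apply mi_0|now apply flow_0].
    - intros t Ht. specialize (HuT t Ht) as HtT.
      assert (HFq : F (flow F (t * T) x0) <> 0).
      { apply (orbit_nonzero F HF x0); auto. now apply orbit_flow. }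
      destruct (chart_exists F _ HF HFq) as (r' & psi' & Hc). apply chart_germ in Hc.
      pose proof Hc as (Hr' & Hc0 & _).
      exists (r' / 4 / (Rabs T + 1)). pose proof (Rabs_pos T).
      split; [apply Rdiv_lt_0_compat; lra|].
      intros s u Hs Hu Hst Hut (r2 & chi2 & e & Hchi2 & He & K).
      assert (Hsc : forall v, Rabs (v - t) < r' / 4 / (Rabs T + 1) -> Rabs ((v - t) * T) < r' / 4).
      { intros v Hv. rewrite Rabs_mult. apply (Rmult_lt_compat_r (Rabs T + 1)) in Hv; [|lra].
        replace (r' / 4 / (Rabs T + 1) * (Rabs T + 1)) with (r' / 4) in Hv by (field; lra).
        pose proof (Rabs_pos (v - t)). nra. }
      assert (Hfl : forall v, 0 <= v <= 1 -> Rabs ((v - t) * T) < r' / 4 ->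
         flow F (v * T) x0 = psi' (RtoC ((v - t) * T))).
      { intros v Hv Hvt.
        destruct (germ_flow F _ _ _ 0 ((v - t) * T) HF Hc) as [G1 G2]; [rewrite Cmod_0; lra|].
        rewrite Cplus_0_l in G2. rewrite Hc0 in G1, G2.
        destruct (flow_plus F HF x0 (t * T) ((v - t) * T) HtT G1) as [_ G3].
        replace (t * T + (v - t) * T) with (v * T) in G3 by ring. now rewrite G3. }
      pose proof (Hsc s Hst) as Hs'. pose proof (Hsc u Hut) as Hu'.
      set (w0 := RtoC ((s - t) * T)) in *. assert (Hw0 : Cmod w0 < r' / 4) by (unfold w0; rewrite Cmod_R; lra).
      pose proof (germ_shift F _ _ _ w0 Hc ltac:(lra)) as G0.
      unfold w0 in G0. rewrite <- (Hfl s Hs Hs') in G0. fold w0 in G0.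
      set (w1 := RtoC ((u - t) * T)) in *. assert (Hw1 : Cmod w1 < r' / 4) by (unfold w1; rewrite Cmod_R; lra).
      pose proof (germ_shift F _ _ _ w1 Hc ltac:(lra)) as G1. unfold w1 in G1. rewrite <- (Hfl u Hu Hu') in G1. fold w1 in G1.
      exists (r' - Cmod w1), (fun w => psi' (w1 + w)%C), (Rmin e (Rmin r2 (r' / 8))).
      split; [exact G1|]. pose proof Hchi2 as (Hr2 & _).
      split; [repeat apply Rmin_glb_lt; lra|]. intros w Hw.
      assert (Hwe : Cmod w < e) by (eapply Rlt_le_trans; [exact Hw|apply Rmin_l]).
      assert (Hwr : Cmod w < r2) by (eapply Rlt_le_trans; [exact Hw|eapply Rle_trans; [apply Rmin_r|apply Rmin_l]]).
      assert (Hw8 : Cmod w < r' / 8) by (eapply Rlt_le_trans; [exact Hw|eapply Rle_trans; [apply Rmin_r|apply Rmin_r]]).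
      destruct (K w Hwe) as [K1 K2].
      assert (E : chi2 w = psi' (w0 + w)%C).
      { apply (germ_unique F _ _ _ chi2 (fun w => psi' (w0 + w)%C) w HF Hchi2 G0); lra. }
      rewrite E in K2.
      assert (Htau : Rabs ((u - s) * T) < r' / 2).
      { replace ((u - s) * T) with ((u - t) * T + - ((s - t) * T)) by ring.
        eapply Rle_lt_trans; [apply Rabs_triang|]. rewrite Rabs_Ropp. lra. }
      destruct (germ_flow F _ _ _ (w0 + w)%C ((u - s) * T) HF Hc) as [G2 G3].
      { pose proof (Cmod_triangle w0 w). lra. }
      rewrite <- K2 in G2, G3.
      destruct (flow_plus F HF _ _ _ K1 G2) as [G4 G5].
      replace (s * T + (u - s) * T) with (u * T) in * by ring.
      split; [exact G4|]. rewrite G5, G3. f_equal. unfold w0, w1.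
      replace ((u - t) * T) with ((s - t) * T + (u - s) * T) by ring. rewrite RtoC_plus. ring. }
  destruct HP as (r' & chi' & e & Hg & He & K). rewrite Rmult_1_l in *.
  pose proof Hg as (Hr' & _). pose proof Hchi as (Hr1 & _).
  exists (Rmin e (Rmin r' r1)). split; [repeat apply Rmin_glb_lt; lra|]. intros w Hw.
  assert (Hwe : Cmod w < e) by (eapply Rlt_le_trans; [exact Hw|apply Rmin_l]).
  assert (Hwr : Cmod w < r') by (eapply Rlt_le_trans; [exact Hw|eapply Rle_trans; [apply Rmin_r|apply Rmin_l]]).
  assert (Hw1 : Cmod w < r1) by (eapply Rlt_le_trans; [exact Hw|eapply Rle_trans; [apply Rmin_r|apply Rmin_r]]).
  destruct (K w Hwe) as [K1 K2]. split; auto. rewrite K2. eapply germ_unique; eauto.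
Qed.

(** * Boundary of an invariant set *)

Lemma boundary_iff (M : C -> Prop) z : boundary M z <-> forall d, 0 < d ->
  (exists w, Cmod (w - z) < d /\ M w) /\ (exists w, Cmod (w - z) < d /\ ~ M w).
Proof.
  split.
  - intros H d Hd. apply (H (fun w => Cmod (w - z) < d)).
    + apply open_Cmod. intros v Hv. exists (d - Cmod (v - z)). split; [lra|].
      intros w Hw. pose proof (Cmod_tri w v z). lra.
    + rewrite Cmod_diag. exact Hd.
  - intros H U HU Hz. destruct (proj1 (open_Cmod U) HU z Hz) as [d [Hd K]].
    destruct (H d Hd) as [(w & H1 & H2) (v & H3 & H4)]. split; [exists w|exists v]; auto.
Qed.

Lemma boundary_closed M z : (forall d, 0 < d -> exists w, Cmod (w - z) < d /\ boundary M w) -> boundary M z.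
Proof.
  intros H. apply boundary_iff. intros d Hd. destruct (H (d / 2) ltac:(lra)) as (w & Hw & Hb).
  rewrite boundary_iff in Hb. destruct (Hb (d / 2) ltac:(lra)) as [(u & H1 & H2) (v & H3 & H4)].
  pose proof (Cmod_tri u w z). pose proof (Cmod_tri v w z).
  split; [exists u|exists v]; split; auto; lra.
Qed.

Lemma boundary_not_in M z : open M -> boundary M z -> ~ M z.
Proof.
  intros HM Hb Hz. rewrite open_Cmod in HM. destruct (HM z Hz) as [d [Hd K]].
  rewrite boundary_iff in Hb. destruct (Hb d Hd) as [_ (v & H3 & H4)]. auto.
Qed.

Section Inv.
Variables (F : C -> C) (M : C -> Prop).
Hypothesis HF : differentiable F.
Hypothesis Minv : flow_invariant F M.

Lemma M_flow x t : M x -> max_interval F x t -> M (flow F t x).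
Proof. intros Hx Ht. apply (Minv x Hx). now apply orbit_flow. Qed.

(** In flow boxes around [x] and its image the time-[t] map is the identity of the parameters, so
    points of [M] and of its complement near [x] are carried to points near the image; the
    complement is invariant because the flow can be undone. *)
Lemma boundary_flow x t : boundary M x -> max_interval F x t -> boundary M (flow F t x).
Proof.
  intros Hb Ht. destruct (classic (F x = 0)) as [E|E]; [now rewrite (proj2 (flow_zero F HF x t E))|].
  assert (Ey : F (flow F t x) <> 0) by (apply (orbit_nonzero F HF x); auto; now apply orbit_flow).
  destruct (chart_exists F x HF E) as (r & psi & Hc). destruct (chart_exists F _ HF Ey) as (r' & chi & Hc').
  destruct (flow_germ F x r psi t r' chi HF E (chart_germ _ _ _ _ Hc) Ht (chart_germ _ _ _ _ Hc')) as [e [He K]].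
  destruct Hc as (Hr & H0 & _ & _ & Hop). destruct Hc' as (Hr' & H0' & Hd' & _).
  apply boundary_iff. intros d Hd.
  assert (Hcont : contC chi 0) by (eapply contC_of_derC, Hd'; rewrite Cmod_0; auto).
  destruct (Hcont d Hd) as [e2 [He2 K2]].
  destruct (Hop 0) with (e := Rmin e e2) as [d1 [Hd1 K1]]; [rewrite Cmod_0; auto|now apply Rmin_glb_lt|].
  rewrite boundary_iff in Hb.
  assert (Hmap : forall z, Cmod (z - x) < d1 -> exists w, max_interval F z t /\ flow F t z = chi w /\
     Cmod (chi w - flow F t x) < d).
  { intros z Hz. destruct (K1 z) as (w & Hw1 & Hw2 & <-); [now rewrite H0|].
    assert (Hwe : Cmod (w - 0) < e) by (eapply Rlt_le_trans; [exact Hw2|apply Rmin_l]).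
    assert (Hwe2 : Cmod (w - 0) < e2) by (eapply Rlt_le_trans; [exact Hw2|apply Rmin_r]).
    specialize (K2 w Hwe2). rewrite H0' in K2. replace (w - 0)%C with w in Hwe by ring.
    destruct (K w Hwe) as [G1 G2]. exists w. auto. }
  destruct (Hb d1 Hd1) as [(u & H1 & H2) (v & H3 & H4)]. split.
  - destruct (Hmap u H1) as (w & I1 & I2 & I3). exists (chi w). split; auto. rewrite <- I2. now apply M_flow.
  - destruct (Hmap v H3) as (w & I1 & I2 & I3). exists (chi w). split; auto. intros Hm. apply H4.
    rewrite <- I2 in Hm. destruct (flow_inverse F HF v t I1) as [J1 J2]. rewrite <- J2. now apply M_flow.
Qed.

Lemma boundary_orbit x z : boundary M x -> orbit F x z -> boundary M z.
Proof. intros Hb [t [Ht ->]]. now apply boundary_flow. Qed.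
End Inv.

(** * Continuous branches of the argument *)

Lemma cis_plus a b : cis (a + b) = (cis a * cis b)%C.
Proof. unfold cis, Cmult; simpl. rewrite cos_plus, sin_plus. f_equal; ring. Qed.

Lemma cos_eq_1 x : cos x = 1 -> Rabs x < 2 * PI -> x = 0.
Proof.
  intros H Hx. assert (Hs : sin (x / 2) = 0).
  { replace x with (2 * (x / 2)) in H by field. rewrite cos_2a_sin in H. nra. }
  apply Rabs_def2 in Hx. destruct (Rtotal_order x 0) as [h|[h|h]]; [|exact h|].
  - pose proof (sin_gt_0 (- (x / 2)) ltac:(lra) ltac:(lra)) as G. rewrite sin_neg in G. lra.
  - pose proof (sin_gt_0 (x / 2) ltac:(lra) ltac:(lra)). lra.
Qed.

Lemma cis_eq_cos a b : cis a = cis b -> cos (a - b) = 1.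
Proof.
  intros E. unfold cis in E. injection E as E1 E2. rewrite cos_minus, E1, E2.
  pose proof (sin2_cos2 b) as H. unfold Rsqr in H. lra.
Qed.

Lemma cis_inj a b : cis a = cis b -> Rabs (a - b) < 2 * PI -> a = b.
Proof. intros E H. apply cis_eq_cos in E. pose proof (cos_eq_1 _ E H). lra. Qed.

(** Meaningful on the right half-plane, where it is a continuous argument. *)
Definition arg0 (q : C) : R := atan (snd q / fst q).

Lemma polar_arg0 (q : C) : 0 < fst q -> q = (RtoC (Cmod q) * cis (arg0 q))%C.
Proof.
  destruct q as [a b]. simpl. intros Ha.
  set (x := b / a). assert (Eb : b = a * x) by (unfold x; field; lra).
  assert (Hs : 0 < sqrt (1 + x²)) by (apply sqrt_lt_R0; pose proof (Rle_0_sqr x); lra).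
  assert (Em : Cmod (a, b) = a * sqrt (1 + x²)).
  { unfold Cmod; simpl fst; simpl snd. rewrite Eb.
    replace (a ^ 2 + (a * x) ^ 2) with ((a * a) * (1 + x²)) by (unfold Rsqr; ring).
    rewrite sqrt_mult_alt by nra. f_equal. apply sqrt_square. lra. }
  unfold arg0. simpl. fold x. rewrite Em. unfold cis. rewrite cos_atan, sin_atan.
  unfold Cmult, RtoC; simpl. f_equal; [|rewrite Eb at 1]; field; lra.
Qed.

Lemma polar_exists (q : C) : exists t, - PI < t <= PI /\ q = (RtoC (Cmod q) * cis t)%C.
Proof.
  pose proof PI_RGT_0 as HPI.
  destruct (Rtotal_order (fst q) 0) as [h|[h|h]].
  - assert (Hq : (- q)%C = (RtoC (Cmod (- q)) * cis (arg0 (- q)))%C) by (apply polar_arg0; simpl; lra).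
    rewrite Cmod_opp in Hq. pose proof (atan_bound (snd (- q)%C / fst (- q)%C)) as B. fold (arg0 (- q)) in B.
    destruct (Rle_dec 0 (snd q)) as [h'|h'].
    + exists (arg0 (- q) + PI). split.
      * assert (arg0 (- q) <= 0); [|lra]. unfold arg0. rewrite <- atan_0.
        destruct (Req_dec (snd q) 0) as [e|n]; [right; f_equal; simpl; rewrite e; field; lra|].
        left. apply atan_increasing. simpl. apply Ropp_lt_cancel. rewrite Ropp_0.
        replace (- (- snd q / - fst q)) with (snd q / - fst q) by (field; lra). apply Rdiv_lt_0_compat; lra.
      * rewrite cis_plus. replace (cis PI) with (- (1))%C
          by (unfold cis; rewrite cos_PI, sin_PI; unfold Copp, RtoC; simpl; f_equal; ring).
        transitivity (- (- q))%C; [ring|]. rewrite Hq at 1. ring.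
    + exists (arg0 (- q) - PI). split.
      * assert (0 < arg0 (- q)); [|lra]. unfold arg0. rewrite <- atan_0. apply atan_increasing. simpl.
        replace (- snd q / - fst q) with ((- snd q) / (- fst q)) by reflexivity. apply Rdiv_lt_0_compat; lra.
      * unfold Rminus. rewrite cis_plus. replace (cis (- PI)) with (- (1))%C
          by (unfold cis; rewrite cos_neg, sin_neg, cos_PI, sin_PI; unfold Copp, RtoC; simpl; f_equal; ring).
        transitivity (- (- q))%C; [ring|]. rewrite Hq at 1. ring.
  - destruct q as [x y]. simpl in h. subst x.
    assert (E : Cmod (0, y) = Rabs y).
    { unfold Cmod; simpl fst; simpl snd. replace (0 ^ 2 + y ^ 2) with (y²) by (unfold Rsqr; ring). apply sqrt_Rsqr_abs. }
    rewrite E. destruct (Rle_dec 0 y) as [h|h].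
    + exists (PI / 2). split; [lra|]. rewrite Rabs_pos_eq by lra. unfold cis. rewrite cos_PI2, sin_PI2.
      unfold Cmult, RtoC; simpl; f_equal; ring.
    + exists (- (PI / 2)). split; [lra|]. rewrite Rabs_left by lra. unfold cis. rewrite cos_neg, sin_neg, cos_PI2, sin_PI2.
      unfold Cmult, RtoC; simpl; f_equal; ring.
  - exists (arg0 q). split; [|now apply polar_arg0].
    pose proof (atan_bound (snd q / fst q)). unfold arg0. lra.
Qed.

Lemma polar_mult (p q : C) a b : p = (RtoC (Cmod p) * cis a)%C -> q = (RtoC (Cmod q) * cis b)%C ->
  (p * q)%C = (RtoC (Cmod (p * q)) * cis (a + b))%C.
Proof. intros Hp Hq. rewrite Cmod_mult, RtoC_mult, cis_plus. rewrite Hp at 1. rewrite Hq at 1. ring. Qed.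

Lemma polar_div (p q : C) a b : q <> 0 -> p = (RtoC (Cmod p) * cis a)%C -> q = (RtoC (Cmod q) * cis b)%C ->
  (p / q)%C = (RtoC (Cmod (p / q)) * cis (a - b))%C.
Proof.
  intros Hq0 Hp Hq. assert (0 < Cmod q) by now apply Cmod_gt_0.
  assert (Ec : cis a = (cis (a - b) * cis b)%C) by (rewrite <- cis_plus; f_equal; ring).
  rewrite Cmod_div by exact Hq0.
  assert (Hq1 : RtoC (Cmod q) <> 0) by (intros E; apply RtoC_inj in E; lra).
  rewrite RtoC_div by lra. rewrite Hp at 1. rewrite Hq at 1. rewrite Ec. field.
  split; first [exact Hq1|apply cis_neq0].
Qed.

Lemma polar_cis_unique (p : C) a b : p <> 0 -> p = (RtoC (Cmod p) * cis a)%C -> p = (RtoC (Cmod p) * cis b)%C -> cis a = cis b.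
Proof.
  intros Hp Ha Hb. assert (0 < Cmod p) by now apply Cmod_gt_0.
  assert (Hq1 : RtoC (Cmod p) <> 0) by (intros E; apply RtoC_inj in E; lra).
  assert (E : (RtoC (Cmod p) * cis a)%C = (RtoC (Cmod p) * cis b)%C) by congruence.
  transitivity (/ RtoC (Cmod p) * (RtoC (Cmod p) * cis a))%C; [field; exact Hq1|]. rewrite E. field; exact Hq1.
Qed.

Lemma fst_near1 (q : C) d : Cmod (q - 1) <= d -> 1 - d <= fst q.
Proof.
  intros H. pose proof (re_le_Cmod (q - 1)) as K. unfold Re in K. simpl in K.
  apply Rabs_le_between in K. lra.
Qed.

Lemma arg0_small (q : C) : Cmod (q - 1) <= 1 / 8 -> Rabs (arg0 q) <= 1 / 7.
Proof.
  intros H. pose proof (fst_near1 _ _ H) as Hf.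
  assert (Hs : Rabs (snd q) <= 1 / 8).
  { pose proof (Rmax_Cmod (q - 1)%C) as K. simpl in K.
    pose proof (Rmax_r (Rabs (fst q + - (1))) (Rabs (snd q + - 0))) as K2.
    replace (snd q + - 0) with (snd q) in K2 by ring. replace (snd q + - 0) with (snd q) in K by ring. lra. }
  assert (Hx : Rabs (snd q / fst q) <= 1 / 7).
  { unfold Rdiv at 1. rewrite Rabs_mult, Rabs_inv, (Rabs_pos_eq (fst q)) by lra.
    apply Rmult_le_reg_r with (fst q); [lra|]. rewrite Rmult_assoc, Rinv_l by lra. lra. }
  assert (Hat : forall x, 0 <= x -> atan x <= x).
  { intros x Hx0. destruct (Req_dec x 0) as [->|n]; [rewrite atan_0; lra|].
    destruct (MVT_cor2 atan (fun x => / (1 + x ^ 2)) 0 x) as [c [E Hc]]; [lra| |].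
    - intros c Hc. apply derivable_pt_lim_atan.
    - rewrite atan_0 in E. pose proof (pow2_ge_0 c).
      assert (/ (1 + c ^ 2) <= 1). { rewrite <- Rinv_1. apply Rinv_le_contravar; lra. } nra. }
  unfold arg0. set (x := snd q / fst q) in *.
  destruct (Rle_dec 0 x).
  - rewrite Rabs_pos_eq in Hx by lra. pose proof (Hat x r).
    assert (0 <= atan x). { rewrite <- atan_0. destruct (Req_dec x 0) as [->|]; [lra|]. left; apply atan_increasing; lra. }
    rewrite Rabs_pos_eq; lra.
  - rewrite Rabs_left in Hx by lra. pose proof (Hat (- x) ltac:(lra)) as G. rewrite atan_opp in G.
    assert (atan x < 0). { rewrite <- atan_0. apply atan_increasing; lra. }
    rewrite Rabs_left; lra.
Qed.

Lemma arg0_cont (q : C) : 0 < fst q -> forall e, 0 < e -> exists d, 0 < d /\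
  forall p : C, Cmod (p - q) < d -> Rabs (arg0 p - arg0 q) < e.
Proof.
  intros Hq e He.
  assert (Hc : continuous (fun p : C => atan (snd p / fst p)) q).
  { apply (continuous_comp (fun p : C => snd p / fst p) atan).
    - apply (continuous_mult (fun p : C => snd p) (fun p : C => / fst p)).
      + apply continuous_snd.
      + apply (continuous_comp (fun p : C => fst p) Rinv); [apply continuous_fst|]. apply continuous_Rinv. lra.
    - apply (ex_derive_continuous (K:=R_AbsRing) (V:=R_NormedModule) atan). eexists. apply is_derive_Reals. apply derivable_pt_lim_atan. }
  assert (HP : locally (arg0 q) (fun y => Rabs (y - arg0 q) < e)).
  { exists (mkposreal e He). intros y Hy. exact Hy. }
  apply Hc in HP. apply locally_Cmod in HP. exact HP.
Qed.

Definition cont_on (A : C -> Prop) (f : C -> R) : Prop :=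
  forall w, A w -> forall e, 0 < e -> exists d, 0 < d /\
    forall v, A v -> Cmod (v - w) < d -> Rabs (f v - f w) < e.

Lemma cont_on_sub (A B : C -> Prop) f : (forall w, B w -> A w) -> cont_on A f -> cont_on B f.
Proof.
  intros HB H w Hw e He. destruct (H w (HB w Hw) e He) as [d [Hd K]]. exists d. split; auto.
Qed.

Lemma cont_on_plus A f g : cont_on A f -> cont_on A g -> cont_on A (fun w => f w + g w).
Proof.
  intros Hf Hg w Hw e He. destruct (Hf w Hw (e / 2)) as [d1 [H1 K1]]; [lra|].
  destruct (Hg w Hw (e / 2)) as [d2 [H2 K2]]; [lra|].
  exists (Rmin d1 d2). split; [now apply Rmin_glb_lt|]. intros v Hv Hd.
  specialize (K1 v Hv (Rlt_le_trans _ _ _ Hd (Rmin_l _ _))).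
  specialize (K2 v Hv (Rlt_le_trans _ _ _ Hd (Rmin_r _ _))).
  replace (f v + g v - (f w + g w)) with ((f v - f w) + (g v - g w)) by ring.
  eapply Rle_lt_trans; [apply Rabs_triang|]. lra.
Qed.

Lemma cont_on_opp A f : cont_on A f -> cont_on A (fun w => - f w).
Proof.
  intros Hf w Hw e He. destruct (Hf w Hw e He) as [d [Hd K]]. exists d. split; auto.
  intros v Hv Hvd. replace (- f v - - f w) with (- (f v - f w)) by ring. rewrite Rabs_Ropp. auto.
Qed.

Lemma cont_on_minus A f g : cont_on A f -> cont_on A g -> cont_on A (fun w => f w - g w).
Proof. intros Hf Hg. apply cont_on_plus; [exact Hf|now apply cont_on_opp]. Qed.

Lemma cont_on_arg0 (A : C -> Prop) (q : C -> C) : (forall w, A w -> contC q w) -> (forall w, A w -> 0 < fst (q w)) ->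
  cont_on A (fun w => arg0 (q w)).
Proof.
  intros Hq Hp w Hw e He. destruct (arg0_cont (q w) (Hp w Hw) e He) as [d [Hd K]].
  destruct (Hq w Hw d Hd) as [d' [Hd' K']]. exists d'. split; auto.
Qed.

Definition branch (A : C -> Prop) (z : C) (th : C -> R) : Prop :=
  cont_on A th /\ forall w, A w -> (w - z)%C = (RtoC (Cmod (w - z)) * cis (th w))%C.

(* [A] has winding number zero around [z]. *)
Definition has_arg (A : C -> Prop) (z : C) : Prop := exists th, branch A z th.

Definition separated (A : C -> Prop) (z : C) : Prop := exists d, 0 < d /\ forall w, A w -> d <= Cmod (w - z).

Lemma contC_ratio (z z' w : C) : w <> z -> contC (fun w => (w - z') / (w - z))%C w.
Proof.
  intros H. assert (G : forall u, contC (fun w => w - u)%C w).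
  { intros u. apply (contC_plus (fun w => w) (fun _ => - u)%C); [apply contC_id|apply contC_const]. }
  apply (contC_mult (fun w => w - z')%C (fun w => / (w - z))%C); [apply G|].
  apply (contC_comp Cinv (fun w => w - z)%C); [|apply G]. apply contC_inv.
  apply Cmod_gt_0. now apply Cmod_minus_gt0.
Qed.

(** The quotient [(w - z') / (w - z)] is at distance less than 1 from 1, so [arg0] of it corrects a
    branch for [z] into one for [z']. *)
Lemma has_arg_local A (z z' : C) d : has_arg A z -> (forall w, A w -> d <= Cmod (w - z)) -> Cmod (z' - z) < d ->
  has_arg A z'.
Proof.
  intros [th [Hth Eth]] Hd Hz.
  assert (Hne : forall w, A w -> (w - z)%C <> 0).
  { intros w Hw. apply Cmod_gt_0. specialize (Hd w Hw). pose proof (Cmod_ge_0 (z' - z)). lra. }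
  assert (Hpos : forall w, A w -> 0 < fst ((w - z') / (w - z))%C).
  { intros w Hw. specialize (Hne w Hw). specialize (Hd w Hw).
    pose proof (Cmod_ge_0 (z' - z)).
    pose proof (fst_near1 ((w - z') / (w - z)) (Cmod (z' - z) / Cmod (w - z))) as G.
    assert (Cmod (z' - z) / Cmod (w - z) < 1).
    { apply Rmult_lt_reg_r with (Cmod (w - z)); [lra|]. unfold Rdiv. rewrite Rmult_assoc, Rinv_l by lra. lra. }
    assert (1 - Cmod (z' - z) / Cmod (w - z) <= fst ((w - z') / (w - z))%C); [|lra]. apply G.
    right. rewrite <- Cmod_div by exact Hne. rewrite <- Cmod_opp. f_equal. field. exact Hne. }
  exists (fun w => th w + arg0 ((w - z') / (w - z))). split.
  - apply cont_on_plus; [exact Hth|]. apply cont_on_arg0; [|exact Hpos].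
    intros w Hw. apply contC_ratio. intros ->. apply (Hne z Hw). ring.
  - intros w Hw. specialize (Hne w Hw).
    pose proof (polar_mult _ _ _ _ (Eth w Hw) (polar_arg0 _ (Hpos w Hw))) as E.
    replace ((w - z) * ((w - z') / (w - z)))%C with (w - z')%C in E by (field; exact Hne). exact E.
Qed.

(** Seen from a point outside a disc containing the set, [w - z] stays in a half-plane around
    [- z]. *)
Lemma has_arg_far A (z : C) rho : (forall w, A w -> Cmod w <= rho) -> rho < Cmod z -> has_arg A z.
Proof.
  intros HA Hz. destruct (classic (exists w, A w)) as [[w0 Hw0]|Hno].
  2:{ exists (fun _ => 0). split; [intros w Hw|intros w Hw]; exfalso; eauto. }
  assert (Hrho : 0 <= rho) by (eapply Rle_trans; [apply Cmod_ge_0|apply (HA w0 Hw0)]).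
  assert (Hz0 : z <> 0) by (apply Cmod_gt_0; lra).
  destruct (polar_exists (- z)) as [al [_ Eal]].
  assert (Hpos : forall w, A w -> 0 < fst ((w - z) / - z)%C).
  { intros w Hw. specialize (HA w Hw).
    assert (Cmod w / Cmod z < 1).
    { apply Rmult_lt_reg_r with (Cmod z); [lra|]. unfold Rdiv. rewrite Rmult_assoc, Rinv_l by lra. lra. }
    pose proof (fst_near1 ((w - z) / - z) (Cmod w / Cmod z)) as G.
    assert (1 - Cmod w / Cmod z <= fst ((w - z) / - z)%C); [|lra]. apply G. right.
    rewrite <- Cmod_div by exact Hz0. rewrite <- Cmod_opp. f_equal. field. exact Hz0. }
  exists (fun w => al + arg0 ((w - z) / - z)). split.
  - apply cont_on_plus; [intros w Hw e He; exists 1; split; [lra|]; intros; rewrite Rminus_diag, Rabs_R0; exact He|].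
    apply cont_on_arg0; [|exact Hpos]. intros w Hw.
    apply (contC_mult (fun w => w - z)%C (fun _ => / - z)%C); [|apply contC_const].
    apply (contC_plus (fun w => w) (fun _ => - z)%C); [apply contC_id|apply contC_const].
  - intros w Hw. pose proof (polar_mult _ _ _ _ Eal (polar_arg0 _ (Hpos w Hw))) as E.
    replace (- z * ((w - z) / - z))%C with (w - z)%C in E by (field; exact Hz0). exact E.
Qed.

(** By [has_arg_local] the existence of a branch is locally constant off the set. *)
Lemma has_arg_path A (c : R -> C) a b : a <= b -> contI c a b -> (forall t, a <= t <= b -> separated A (c t)) ->
  (has_arg A (c a) <-> has_arg A (c b)).
Proof.
  intros Hab Hc Hfar.
  assert (Hloc : forall t, a <= t <= b -> exists d, 0 < d /\ forall s u, a <= s <= b -> a <= u <= b ->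
     Rabs (s - t) < d -> Rabs (u - t) < d -> has_arg A (c s) -> has_arg A (c u)).
  { intros t Ht. destruct (Hfar t Ht) as [m [Hm Km]]. destruct (Hc t Ht (m / 4)) as [d [Hd K]]; [lra|].
    exists d. split; auto. intros s u Hs Hu Hsd Hud H. specialize (K s Hsd) as K1. specialize (K u Hud) as K2.
    apply (has_arg_local A (c s) (c u) (m / 2)); auto.
    - intros w Hw. specialize (Km w Hw). pose proof (Cmod_tri w (c s) (c t)). lra.
    - pose proof (Cmod_tri (c u) (c t) (c s)). rewrite (Cmod_sym (c t)) in H0. lra. }
  split.
  - intros H. apply (interval_prop (fun t => has_arg A (c t)) a b); auto.
  - apply (interval_prop (fun t => has_arg A (c t) -> has_arg A (c a)) a b); auto.
    intros t Ht. destruct (Hloc t Ht) as [d [Hd K]]. exists d. split; auto.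
    intros s u Hs Hu Hsd Hud H1 H2. apply H1. apply (K u s); auto.
Qed.

(** * Continua *)

Definition continuum (A : C -> Prop) : Prop :=
  (forall z, ~ A z -> separated A z) /\ (exists rho, forall w, A w -> Cmod w <= rho) /\
  (forall f, cont_on A f -> forall u w v, A u -> A w -> f u <= v <= f w -> exists t, A t /\ f t = v).

Definition path_image (c : R -> C) a b (z : C) : Prop := exists t, a <= t <= b /\ z = c t.

Lemma continuum_path c a b : a <= b -> contI c a b -> continuum (path_image c a b).
Proof.
  intros Hab Hc. split; [|split].
  - intros z Hz.
    assert (H : exists d, 0 < d /\ forall s, a <= s <= b -> d <= Cmod (c s - z)).
    { apply (interval_prop (fun t => exists d, 0 < d /\ forall s, a <= s <= t -> d <= Cmod (c s - z)) a b); auto.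
      - exists (Cmod (c a - z)). split; [apply Cmod_minus_gt0; intros E; apply Hz; exists a; split; [lra|auto]|].
        intros s Hs. replace s with a by lra. lra.
      - intros t Ht.
        assert (Hm : 0 < Cmod (c t - z)) by (apply Cmod_minus_gt0; intros E; apply Hz; exists t; auto).
        destruct (Hc t Ht (Cmod (c t - z) / 2)) as [d [Hd K]]; [lra|].
        exists d. split; auto. intros s u Hs Hu Hsd Hud [m [Hm0 Km]].
        exists (Rmin m (Cmod (c t - z) / 2)). split; [apply Rmin_glb_lt; lra|]. intros v Hv.
        destruct (Rle_dec v s) as [h|h].
        + eapply Rle_trans; [apply Rmin_l|]. apply Km; lra.
        + eapply Rle_trans; [apply Rmin_r|].
          assert (Hvt : Rabs (v - t) < d).
          { apply Rabs_def2 in Hsd, Hud. apply Rabs_def1; lra. }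
          specialize (K v Hvt). pose proof (Cmod_tri (c t) (c v) z) as T. rewrite (Cmod_sym (c t) (c v)) in T. lra. }
    destruct H as [d [Hd K]]. exists d. split; auto. intros w (t & Ht & ->). auto.
  - destruct (contI_bounded c a b Hab Hc) as [M [_ HM]]. exists M. intros w (t & Ht & ->). auto.
  - intros f Hf u w v (s & Hs & ->) (t & Ht & ->) Hv.
    apply NNPP. intros Hno.
    assert (Hne : forall x, a <= x <= b -> f (c x) <> v).
    { intros x Hx E. apply Hno. exists (c x). split; auto. exists x; auto. }
    assert (Hloc : forall x, a <= x <= b -> exists d, 0 < d /\ forall y, a <= y <= b -> Rabs (y - x) < d ->
       (f (c y) < v <-> f (c x) < v)).
    { intros x Hx. pose proof (Hne x Hx).
      destruct (Hf (c x) ltac:(exists x; auto) (Rabs (f (c x) - v))) as [d [Hd K]]; [apply Rabs_pos_lt; lra|].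
      destruct (Hc x Hx d Hd) as [d' [Hd' K']]. exists d'. split; auto. intros y Hy Hyx.
      specialize (K (c y) ltac:(exists y; auto) (K' y Hyx)).
      destruct (Rle_dec 0 (f (c x) - v)).
      - rewrite (Rabs_pos_eq (f (c x) - v)) in K by auto. apply Rabs_def2 in K. lra.
      - rewrite (Rabs_left (f (c x) - v)) in K by lra. apply Rabs_def2 in K. lra. }
    assert (Hall : forall x y, a <= x <= b -> a <= y <= b -> x <= y -> (f (c x) < v <-> f (c y) < v)).
    { intros x y Hx Hy Hxy.
      apply (interval_prop (fun z => f (c x) < v <-> f (c z) < v) x y); auto; [tauto|].
      intros z Hz. destruct (Hloc z ltac:(lra)) as [d [Hd K]]. exists d. split; auto.
      intros p q Hp Hq Hpz Hqz E. rewrite (K q ltac:(lra) Hqz), <- (K p ltac:(lra) Hpz). exact E. }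
    pose proof (Hne s Hs). pose proof (Hne t Ht).
    destruct (Rle_dec s t) as [h|h]; [pose proof (Hall s t Hs Ht h)|pose proof (Hall t s Ht Hs ltac:(lra))]; lra.
Qed.

Lemma continuum_union (A B : C -> Prop) p : continuum A -> continuum B -> A p -> B p -> continuum (fun z => A z \/ B z).
Proof.
  intros (A1 & A2 & A3) (B1 & B2 & B3) Ap Bp. split; [|split].
  - intros z Hz. destruct (A1 z) as [d1 [Hd1 K1]]; [tauto|]. destruct (B1 z) as [d2 [Hd2 K2]]; [tauto|].
    exists (Rmin d1 d2). split; [now apply Rmin_glb_lt|]. intros w [Hw|Hw].
    + eapply Rle_trans; [apply Rmin_l|auto].
    + eapply Rle_trans; [apply Rmin_r|auto].
  - destruct A2 as [r1 H1]. destruct B2 as [r2 H2]. exists (Rmax r1 r2). intros w [Hw|Hw].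
    + eapply Rle_trans; [apply H1, Hw|apply Rmax_l].
    + eapply Rle_trans; [apply H2, Hw|apply Rmax_r].
  - intros f Hf u w v Hu Hw Hv.
    assert (HfA := cont_on_sub _ A f (fun z h => or_introl h) Hf).
    assert (HfB := cont_on_sub _ B f (fun z h => or_intror h) Hf).
    assert (HA : forall u w, A u -> A w -> f u <= v <= f w -> exists t, (A t \/ B t) /\ f t = v).
    { intros u' w' Hu' Hw' Hv'. destruct (A3 f HfA u' w' v Hu' Hw' Hv') as [t [? ?]]; eauto. }
    assert (HB : forall u w, B u -> B w -> f u <= v <= f w -> exists t, (A t \/ B t) /\ f t = v).
    { intros u' w' Hu' Hw' Hv'. destruct (B3 f HfB u' w' v Hu' Hw' Hv') as [t [? ?]]; eauto. }
    destruct Hu as [Hu|Hu]; destruct Hw as [Hw|Hw]; eauto.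
    + destruct (Rle_dec v (f p)); [apply (HA u p)|apply (HB p w)]; auto; lra.
    + destruct (Rle_dec v (f p)); [apply (HB u p)|apply (HA p w)]; auto; lra.
Qed.

(** The values of [g] are multiples of [2 PI]. Between two different ones the intermediate value
    property gives a value exceeding the smaller by at most 1, which is no such multiple. *)
Lemma continuum_angle_const A g : continuum A -> cont_on A g -> (forall w, A w -> cos (g w) = 1) ->
  forall u w, A u -> A w -> g u = g w.
Proof.
  intros HA Hg H1.
  assert (Hle : forall u w, A u -> A w -> g w <= g u).
  { intros u w Hu Hw. apply Rnot_lt_le. intros Hlt.
    set (m := Rmin (g w - g u) 1). assert (Hm : 0 < m <= 1 /\ m <= g w - g u).
    { split; [split; [apply Rmin_glb_lt; lra|apply Rmin_r]|apply Rmin_l]. }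
    destruct HA as (_ & _ & HA). destruct (HA g Hg u w (g u + m) Hu Hw ltac:(lra)) as [t [Ht E]].
    pose proof (H1 u Hu) as C1. pose proof (H1 t Ht) as C2. rewrite E in C2.
    assert (cos m = 1).
    { replace m with ((g u + m) - g u) by ring. rewrite cos_minus, C1, C2.
      pose proof (sin2_cos2 (g u)) as S1. rewrite C1 in S1. unfold Rsqr in S1. assert (sin (g u) = 0) by nra. rewrite H. ring. }
    pose proof PI_RGT_0. pose proof PI2_3_2. apply cos_eq_1 in H; [lra|]. rewrite Rabs_pos_eq; lra. }
  intros u w Hu Hw. apply Rle_antisym; auto.
Qed.

(** The branches may live on different larger sets; on their common connected part they differ by a
    constant. This is how branches over different unions are compared along a shared piece. *)
Lemma branch_unique A B z th1 th2 u w : continuum A -> ~ A z -> (forall v, A v -> B v) -> branch B z th1 ->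
  forall B', (forall v, A v -> B' v) -> branch B' z th2 -> A u -> A w -> th1 u - th2 u = th1 w - th2 w.
Proof.
  intros HA Hz HB [H1 E1] B' HB' [H2 E2] Hu Hw.
  apply (continuum_angle_const A (fun v => th1 v - th2 v)); auto.
  - apply cont_on_minus; eapply cont_on_sub; [exact HB|exact H1|exact HB'|exact H2].
  - intros v Hv. apply cis_eq_cos. apply (polar_cis_unique (v - z)); auto.
    intros E. apply Hz. replace z with v; [exact Hv|]. transitivity (v - z + z)%C; [ring|rewrite E; ring].
Qed.

(** Any continuous argument of [q] differs from [arg0] of [q] by a constant, and the latter is at
    most 1/7 in absolute value. *)
Lemma branch_variation A (q : C -> C) g : continuum A -> cont_on A g -> (forall w, A w -> contC q w) ->
  (forall w, A w -> Cmod (q w - 1) <= 1 / 8) ->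
  (forall w, A w -> q w = (RtoC (Cmod (q w)) * cis (g w))%C) ->
  forall u w, A u -> A w -> Rabs (g u - g w) <= 2 / 7.
Proof.
  intros HA Hg Hq Hq1 Hpol u w Hu Hw.
  assert (Hpos : forall w, A w -> 0 < fst (q w)) by (intros v Hv; pose proof (fst_near1 _ _ (Hq1 v Hv)); lra).
  assert (E : g u - arg0 (q u) = g w - arg0 (q w)).
  { apply (continuum_angle_const A (fun v => g v - arg0 (q v))); auto.
    - apply cont_on_minus; [exact Hg|]. now apply cont_on_arg0.
    - intros v Hv. apply cis_eq_cos. specialize (Hpos v Hv).
      apply (polar_cis_unique (q v)); auto.
      + intros E. rewrite E in Hpos. simpl in Hpos. lra.
      + now apply polar_arg0. }
  pose proof (arg0_small _ (Hq1 u Hu)) as B1. pose proof (arg0_small _ (Hq1 w Hw)) as B2.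
  apply Rabs_le_between in B1, B2. apply Rabs_le. lra.
Qed.

Definition seg (p q : C) (t : R) : C := (p + RtoC t * (q - p))%C.

Lemma contI_seg p q a b : contI (seg p q) a b.
Proof. intros t _. apply contR_affine. Qed.

Lemma seg_0 p q : seg p q 0 = p.
Proof. unfold seg. ring. Qed.

Lemma seg_1 p q : seg p q 1 = q.
Proof. unfold seg. ring. Qed.

Lemma seg_dist (p q : C) t : 0 <= t <= 1 -> Cmod (seg p q t - p) <= Cmod (q - p).
Proof.
  intros Ht. unfold seg. replace (p + RtoC t * (q - p) - p)%C with (RtoC t * (q - p))%C by ring.
  rewrite Cmod_Rmult, Rabs_pos_eq by lra. pose proof (Cmod_ge_0 (q - p)). nra.
Qed.

Lemma continuum_seg p q : continuum (path_image (seg p q) 0 1).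
Proof. apply continuum_path; [lra|apply contI_seg]. Qed.

Lemma seg_start p q : path_image (seg p q) 0 1 p.
Proof. exists 0. split; [lra|now rewrite seg_0]. Qed.

Lemma seg_end p q : path_image (seg p q) 0 1 q.
Proof. exists 1. split; [lra|now rewrite seg_1]. Qed.

(** The points reachable from [x] by a continuum in [M] form an open set, and so do the others in
    [M], since discs in [M] are bridged by segments; connectedness of [M] leaves only one of the
    two. *)
Lemma domain_continuum M x y : planar_domain M -> M x -> M y ->
  exists A, continuum A /\ (forall z, A z -> M z) /\ A x /\ A y.
Proof.
  intros [HO HC] Hx Hy. rewrite open_Cmod in HO.
  set (P := fun z => exists A, continuum A /\ (forall v, A v -> M v) /\ A x /\ A z).
  assert (Hball : forall z d w, (forall v, Cmod (v - z) < d -> M v) -> M z -> Cmod (w - z) < d -> (P z <-> P w)).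
  { intros z d w Hd Hz Hw.
    assert (HS : forall v, path_image (seg z w) 0 1 v -> M v).
    { intros v (t & Ht & ->). apply Hd. eapply Rle_lt_trans; [now apply seg_dist|exact Hw]. }
    split; intros (A & A1 & A2 & A3 & A4).
    - exists (fun v => A v \/ path_image (seg z w) 0 1 v). repeat split.
      + apply (continuum_union A _ z); auto using continuum_seg, seg_start.
      + apply (continuum_union A _ z); auto using continuum_seg, seg_start.
      + apply (continuum_union A _ z); auto using continuum_seg, seg_start.
      + intros v [Hv|Hv]; auto.
      + auto.
      + right. apply seg_end.
    - exists (fun v => A v \/ path_image (seg z w) 0 1 v). repeat split.
      + apply (continuum_union A _ w); auto using continuum_seg, seg_end.
      + apply (continuum_union A _ w); auto using continuum_seg, seg_end.
      + apply (continuum_union A _ w); auto using continuum_seg, seg_end.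
      + intros v [Hv|Hv]; auto.
      + auto.
      + right. apply seg_start. }
  apply NNPP. intros HPy. fold (P y) in HPy.
  destruct (HC (fun z => M z /\ P z) (fun z => M z /\ ~ P z)) as (z & _ & [_ H1] & [_ H2]); auto.
  - apply open_Cmod. intros z [Hz Pz]. destruct (HO z Hz) as [d [Hd K]]. exists d. split; auto.
    intros w Hw. split; auto. now apply (Hball z d w).
  - apply open_Cmod. intros z [Hz Pz]. destruct (HO z Hz) as [d [Hd K]]. exists d. split; auto.
    intros w Hw. split; auto. intros Pw. apply Pz. now apply (Hball z d w).
  - intros z Hz. destruct (classic (P z)); tauto.
  - exists x. repeat split; auto. exists (path_image (seg x x) 0 1). repeat split; try apply continuum_seg; try apply seg_start.
    intros v (t & Ht & ->). replace (seg x x t) with x; auto. unfold seg. ring.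
  - exists y. auto.
Qed.

(** * Change of the winding number across a curve *)

Lemma div_le_of (a b k : R) : 0 < b -> a <= k * b -> a / b <= k.
Proof.
  intros Hb H. apply Rmult_le_reg_r with b; [exact Hb|]. unfold Rdiv. rewrite Rmult_assoc, Rinv_l; lra.
Qed.

Definition cont_int (h : R -> R) a b : Prop := forall t, a <= t <= b -> forall e, 0 < e ->
  exists d, 0 < d /\ forall s, a <= s <= b -> Rabs (s - t) < d -> Rabs (h s - h t) < e.

Lemma cont_int_of_cont_on A D c a b : cont_on A D -> contI c a b -> (forall t, a <= t <= b -> A (c t)) ->
  cont_int (fun t => D (c t)) a b.
Proof.
  intros HD Hc HA t Ht e He. destruct (HD (c t) (HA t Ht) e He) as [d [Hd K]].
  destruct (Hc t Ht d Hd) as [d' [Hd' K']]. exists d'. split; auto.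
Qed.

(** A real interval is regarded as a continuum in the plane, so that the lemmas on continua apply to
    functions of a real parameter. *)
Lemma cont_int_on h a b : cont_int h a b -> cont_on (path_image RtoC a b) (fun z => h (fst z)).
Proof.
  intros H w (t & Ht & ->) e He. destruct (H t Ht e He) as [d [Hd K]]. exists d. split; auto.
  intros v (s & Hs & ->) Hv. simpl. apply K; auto. rewrite <- RtoC_minus, Cmod_R in Hv. exact Hv.
Qed.

Lemma contI_RtoC a b : contI RtoC a b.
Proof. intros t _. eapply contR_of_derR, derR_id. Qed.

Lemma contC_fst g z : contR g (fst z) -> contC (fun w => g (fst w)) z.
Proof.
  intros H e He. destruct (H e He) as [d [Hd K]]. exists d. split; auto. intros w Hw. apply K.
  eapply Rle_lt_trans; [|exact Hw]. eapply Rle_trans; [|apply (re_le_Cmod (w - z))]. right. f_equal.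
Qed.

Lemma path_variation (q : R -> C) h a b : a <= b -> cont_int h a b -> contI q a b ->
  (forall t, a <= t <= b -> Cmod (q t - 1) <= 1 / 8) ->
  (forall t, a <= t <= b -> q t = (RtoC (Cmod (q t)) * cis (h t))%C) -> Rabs (h b - h a) <= 2 / 7.
Proof.
  intros Hab Hh Hq Hq1 Hp.
  apply (branch_variation (path_image RtoC a b) (fun z => q (fst z)) (fun z => h (fst z)))
    with (u := RtoC b) (w := RtoC a).
  - apply continuum_path; auto using contI_RtoC.
  - now apply cont_int_on.
  - intros w (t & Ht & ->). now apply contC_fst, Hq.
  - intros w (t & Ht & ->). now apply Hq1.
  - intros w (t & Ht & ->). now apply Hp.
  - exists b. split; [lra|auto].
  - exists a. split; [lra|auto].
Qed.

Lemma path_angle_const h a b : a <= b -> cont_int h a b ->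
  (forall t, a <= t <= b -> cos (h t) = 1) -> h a = h b.
Proof.
  intros Hab Hh H1.
  apply (continuum_angle_const (path_image RtoC a b) (fun z => h (fst z))) with (u := RtoC a) (w := RtoC b).
  - apply continuum_path; auto using contI_RtoC.
  - now apply cont_int_on.
  - intros w (t & Ht & ->). now apply H1.
  - exists a. split; [lra|auto].
  - exists b. split; [lra|auto].
Qed.

Lemma Cmod_xy x y : (Rabs x + Rabs y) / 2 <= Cmod (x, y).
Proof. pose proof (Rmax_Cmod (x, y)) as H. simpl in H. pose proof (Rmax_l (Rabs x) (Rabs y)). pose proof (Rmax_r (Rabs x) (Rabs y)). lra. Qed.

(** The straight model of a crossing: the quotient of [(x, - y)] by [(x, y)] has argument
    [2 atan (x / y) - PI], which grows by almost [2 PI] as [x] runs from far left to far right. *)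
Lemma cis_atan_ratio x y : 0 < y ->
  ((x, (- y)%R) : C) = (RtoC (Cmod (x, (- y)%R)) * cis (atan (x / y) - PI / 2))%C /\
  ((x, y) : C) = (RtoC (Cmod (x, y)) * cis (PI / 2 - atan (x / y)))%C.
Proof.
  intros Hy.
  assert (H : ((y, x) : C) = (RtoC (Cmod (y, x)) * cis (atan (x / y)))%C) by exact (polar_arg0 (y, x) Hy).
  assert (E1 : Cmod (x, (- y)%R) = Cmod (y, x)) by (unfold Cmod; simpl fst; simpl snd; f_equal; ring).
  assert (E2 : Cmod (x, y) = Cmod (y, x)) by (unfold Cmod; simpl fst; simpl snd; f_equal; ring).
  set (t := atan (x / y)) in *. set (m := Cmod (y, x)) in *.
  unfold cis, Cmult, RtoC in H. simpl in H. injection H as Ha Hb.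
  split; [rewrite E1|rewrite E2]; unfold cis, Cmult, RtoC; simpl.
  - replace (t - PI / 2) with (- (PI / 2 - t)) by ring. rewrite cos_neg, sin_neg, cos_shift, sin_shift. f_equal; lra.
  - rewrite cos_shift, sin_shift. f_equal; lra.
Qed.

(* Crossing a closed curve once changes the winding number: the angle of
   [(w - c eta) / (w - c (- eta))] turns by almost [2 * PI] along the crossed
   part and by little along the rest. *)
Lemma jump_pos (A0 : C -> Prop) (s : R -> C) a b t0 (v : C) c k :
  a < t0 < b -> contI s a b -> derR s t0 v -> v <> 0 -> (forall t, a <= t <= b -> t <> t0 -> s t <> s t0) ->
  continuum A0 -> A0 (s a) -> A0 (s b) -> ~ A0 (s t0) -> 0 < k ->
  derR c 0 (RtoC k * (Ci * v))%C -> c 0 = s t0 ->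
  exists eta0, 0 < eta0 /\ forall eta, 0 < eta < eta0 ->
    ~ (has_arg (fun z => A0 z \/ path_image s a b z) (c eta) /\
       has_arg (fun z => A0 z \/ path_image s a b z) (c (- eta))).
Proof.
  intros Ht0 Hs Hds Hv Hinj HA Ha Hb Hp Hk Hdc Hc0.
  assert (Hmv : 0 < Cmod v) by now apply Cmod_gt_0.
  set (p := s t0) in *.
  (* Then [ep 1 x / ep (-1) x] lies within [4 e / (31 / 32) < 1 / 8] of 1. *)
  set (e := / 64).
  assert (He : 0 < e) by (unfold e; lra).
  destruct (Hds (e * Cmod v)) as [d1 [Hd1 K1]]; [nra|].
  destruct (Hdc (e * Cmod v * k)) as [d2 [Hd2 K2]]; [repeat apply Rmult_lt_0_compat; lra|].
  set (rho := Rmin (d1 / 2) (Rmin ((t0 - a) / 2) ((b - t0) / 2))).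
  assert (Hrho : 0 < rho /\ rho < d1 /\ a < t0 - rho /\ t0 + rho < b).
  { assert (0 < rho) by (repeat apply Rmin_glb_lt; lra).
    pose proof (Rmin_l (d1 / 2) (Rmin ((t0 - a) / 2) ((b - t0) / 2))) as R1. fold rho in R1.
    pose proof (Rmin_r (d1 / 2) (Rmin ((t0 - a) / 2) ((b - t0) / 2))) as R2. fold rho in R2.
    pose proof (Rmin_l ((t0 - a) / 2) ((b - t0) / 2)). pose proof (Rmin_r ((t0 - a) / 2) ((b - t0) / 2)). lra. }
  (* The closed curve without the short piece around the crossing; it is compact and misses [p]. *)
  set (O := fun z => (A0 z \/ path_image s a (t0 - rho) z) \/ path_image s (t0 + rho) b z).
  assert (HO : continuum O).
  { apply (continuum_union _ _ (s b)).
    - apply (continuum_union _ _ (s a)); auto; [|exists a; split; [lra|auto]].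
      apply continuum_path; [lra|]. eapply contI_sub; [exact Hs|lra|lra].
    - apply continuum_path; [lra|]. eapply contI_sub; [exact Hs|lra|lra].
    - auto.
    - exists b. split; [lra|auto]. }
  assert (HpO : ~ O p).
  { intros [[H|(t & Ht & E)]|(t & Ht & E)]; [auto| |]; symmetry in E; revert E; apply Hinj; lra. }
  destruct HO as [HOfar HO']. destruct (HOfar p HpO) as [d0 [Hd0 K0]].
  assert (HO : continuum O) by (split; auto). clear HO'.
  assert (Hcc : contR c 0) by (eapply contR_of_derR, Hdc).
  (* With [c eta] and [c (- eta)] this close to [p], the quotient [q] is within
     [(d0 / 20) / (d0 / 2) = 1 / 10] of 1 on [O]. *)
  destruct (Hcc (d0 / 40)) as [d3 [Hd3 K3]]; [lra|].
  exists (Rmin d2 (Rmin d3 (rho / k))).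
  assert (Hrk : 0 < rho / k) by (apply Rdiv_lt_0_compat; lra).
  split; [repeat apply Rmin_glb_lt; lra|]. intros eta [Heta Heta'] [[thp [Hthp Ethp]] [thm [Hthm Ethm]]].
  assert (L2 : eta < d2) by (eapply Rlt_le_trans; [exact Heta'|apply Rmin_l]).
  assert (L3 : eta < d3) by (eapply Rlt_le_trans; [exact Heta'|eapply Rle_trans; [apply Rmin_r|apply Rmin_l]]).
  assert (L4 : eta < rho / k) by (eapply Rlt_le_trans; [exact Heta'|eapply Rle_trans; [apply Rmin_r|apply Rmin_r]]).
  set (y := k * eta). assert (Hy : 0 < y) by (unfold y; nra).
  assert (Hyr : y < rho).
  { unfold y. apply (Rmult_lt_compat_l k) in L4; [|lra]. replace (k * (rho / k)) with rho in L4 by (field; lra). exact L4. }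
  set (A := fun z => A0 z \/ path_image s a b z) in *.
  set (D := fun w => thp w - thm w).
  assert (HD : cont_on A D) by (apply cont_on_minus; auto).
  set (q := fun w => ((w - c eta) / (w - c (- eta)%R))%C).
  assert (HDq : forall w, A w -> w <> c (- eta) -> q w = (RtoC (Cmod (q w)) * cis (D w))%C).
  { intros w Hw Hne. apply polar_div; auto. apply Cmod_gt_0. now apply Cmod_minus_gt0. }
  assert (Hcp : forall sg, sg = 1 \/ sg = -1 ->
    Cmod (c (sg * eta) - p - RtoC sg * (RtoC y * (Ci * v))) <= e * Cmod v * y /\ Cmod (c (sg * eta) - p) < d0 / 40).
  { intros sg Hsg. assert (Habs : Rabs (sg * eta - 0) = eta).
    { destruct Hsg as [-> | ->]; [rewrite Rabs_pos_eq; lra|rewrite Rabs_left; lra]. }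
    specialize (K2 (sg * eta)). specialize (K3 (sg * eta)). rewrite Habs in K2, K3. rewrite Hc0 in K2, K3. split.
    - replace (c (sg * eta)%R - p - RtoC sg * (RtoC y * (Ci * v)))%C
        with (c (sg * eta)%R - p - RtoC (sg * eta - 0) * (RtoC k * (Ci * v)))%C.
      + eapply Rle_trans; [apply K2; exact L2|]. unfold y. right; ring.
      + unfold y. rewrite Rminus_0_r, !RtoC_mult. ring.
    - apply K3; exact L3. }
  destruct (Hcp 1 ltac:(auto)) as [P1 P2]. destruct (Hcp (-1) ltac:(auto)) as [N1 N2]. clear Hcp.
  replace (1 * eta) with eta in P1, P2 by ring. replace (-1 * eta) with (- eta) in N1, N2 by ring.
  assert (Hout : Rabs (D (s (t0 + rho)) - D (s (t0 - rho))) <= 2 / 7).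
  { assert (HOA : forall w, O w -> A w).
    { intros w [[H|(t & Ht & E)]|(t & Ht & E)]; [left; auto|right; exists t; split; [lra|auto]|right; exists t; split; [lra|auto]]. }
    assert (Hfar2 : forall w, O w -> d0 / 2 <= Cmod (w - c (- eta))).
    { intros w Hw. specialize (K0 w Hw). pose proof (Cmod_tri w (c (- eta)) p). lra. }
    apply (branch_variation O q D).
    - exact HO.
    - eapply cont_on_sub; [exact HOA|exact HD].
    - intros w Hw. apply contC_ratio. intros E. specialize (Hfar2 w Hw). rewrite <- E, Cmod_diag in Hfar2. lra.
    - intros w Hw. specialize (Hfar2 w Hw).
      assert (Hn : (w - c (- eta)%R)%C <> 0) by (apply Cmod_gt_0; lra).
      unfold q. replace ((w - c eta) / (w - c (- eta)%R) - 1)%C with ((c (- eta)%R - c eta) / (w - c (- eta)%R))%C by (field; exact Hn).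
      rewrite Cmod_div by exact Hn.
      assert (Cmod (c (- eta) - c eta) <= d0 / 20).
      { pose proof (Cmod_tri (c (- eta)) p (c eta)) as T. rewrite (Cmod_sym p (c eta)) in T. lra. }
      apply div_le_of; lra.
    - intros w Hw. apply HDq; auto. intros E. specialize (Hfar2 w Hw). rewrite <- E, Cmod_diag in Hfar2. lra.
    - right. exists (t0 + rho). split; [lra|auto].
    - left. right. exists (t0 - rho). split; [lra|auto]. }
  (* The true vector from [c (sg * eta)] to the curve, divided by the one in which the curve and [c]
     are replaced by their tangents. *)
  set (ep := fun sg x => ((s (t0 + x)%R - c (sg * eta)%R) / (v * ((x, (- (sg * y))%R) : C)))%C).
  assert (Hxy0 : forall sg x, sg = 1 \/ sg = -1 -> 0 < Cmod (x, (- (sg * y))%R) /\ (Rabs x + y) / 2 <= Cmod (x, (- (sg * y))%R)).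
  { intros sg x Hsg. pose proof (Cmod_xy x (- (sg * y))) as H. rewrite Rabs_Ropp, Rabs_mult, (Rabs_pos_eq y) in H by lra.
    assert (Rabs sg = 1) by (destruct Hsg as [-> | ->]; [apply Rabs_R1|rewrite Rabs_left; lra]).
    rewrite H0 in H. pose proof (Rabs_pos x). lra. }
  assert (Hep : forall sg x, sg = 1 \/ sg = -1 -> Rabs x <= rho -> Cmod (ep sg x - 1) <= 2 * e).
  { intros sg x Hsg Hx. destruct (Hxy0 sg x Hsg) as [X1 X2].
    assert (Hx0 : ((x, (- (sg * y))%R) : C) <> 0) by now apply Cmod_gt_0.
    assert (Hden : (v * ((x, (- (sg * y))%R) : C))%C <> 0) by (apply Cmod_gt_0; rewrite Cmod_mult; now apply Rmult_lt_0_compat).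
    assert (Exy : ((x, (- (sg * y))%R) : C) = (RtoC x - RtoC sg * (RtoC y * Ci))%C).
    { unfold Ci, RtoC, Cminus, Cplus, Copp, Cmult; simpl. f_equal; ring. }
    assert (Hc1 : Cmod (c (sg * eta) - p - RtoC sg * (RtoC y * (Ci * v))) <= e * Cmod v * y).
    { destruct Hsg as [-> | ->]; [replace (1 * eta) with eta by ring|replace (-1 * eta) with (- eta) by ring]; auto. }
    specialize (K1 (t0 + x)). replace (t0 + x - t0) with x in K1 by ring. specialize (K1 ltac:(lra)). fold p in K1.
    unfold ep. replace ((s (t0 + x)%R - c (sg * eta)%R) / (v * ((x, (- (sg * y))%R) : C)) - 1)%C
      with (((s (t0 + x)%R - p - RtoC x * v) - (c (sg * eta)%R - p - RtoC sg * (RtoC y * (Ci * v)))) / (v * ((x, (- (sg * y))%R) : C)))%C.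
    2:{ transitivity ((s (t0 + x)%R - c (sg * eta)%R - (v * ((x, (- (sg * y))%R) : C))) / (v * ((x, (- (sg * y))%R) : C)))%C.
        - f_equal. rewrite Exy. ring.
        - field. split; auto. }
    rewrite Cmod_div, Cmod_mult by exact Hden.
    apply Rmult_le_reg_r with (Cmod v * Cmod (x, (- (sg * y))%R)); [now apply Rmult_lt_0_compat|].
    unfold Rdiv. rewrite Rmult_assoc, Rinv_l by (apply Rgt_not_eq; now apply Rmult_lt_0_compat). rewrite Rmult_1_r.
    eapply Rle_trans; [apply Cmod_minus_le|].
    apply Rle_trans with (e * Cmod v * (Rabs x + y)); [lra|].
    replace (2 * e * (Cmod v * Cmod (x, (- (sg * y))%R))) with (e * Cmod v * (2 * Cmod (x, (- (sg * y))%R))) by ring.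
    apply Rmult_le_compat_l; [nra|lra]. }
  assert (Hepf : forall sg x, sg = 1 \/ sg = -1 -> Rabs x <= rho -> 31 / 32 <= Cmod (ep sg x) /\ ep sg x <> 0).
  { intros sg x Hsg Hx. specialize (Hep sg x Hsg Hx). pose proof (Cmod_rev 1 (ep sg x)) as H.
    rewrite Cmod_sym, Cmod_1 in H. unfold e in Hep. assert (31 / 32 <= Cmod (ep sg x)) by lra.
    split; auto. apply Cmod_gt_0. lra. }
  assert (Hepc : forall sg, sg = 1 \/ sg = -1 -> contI (ep sg) (- rho) rho).
  { intros sg Hsg x Hx. unfold ep. apply contR_mult.
    - apply (contR_plus (fun x => s (t0 + x)) (fun _ => - c (sg * eta)%R)%C); [|apply contR_const].
      intros u Hu. destruct (Hs (t0 + x) ltac:(lra) u Hu) as [d [Hd K]]. exists d. split; auto.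
      intros z Hz. apply K. replace (t0 + z - (t0 + x)) with (z - x) by ring. exact Hz.
    - apply (contR_comp Cinv (fun x => v * ((x, (- (sg * y))%R) : C))%C).
      + apply contC_inv. destruct (Hxy0 sg x Hsg) as [X1 _]. apply Cmod_gt_0. rewrite Cmod_mult. now apply Rmult_lt_0_compat.
      + apply contR_mult; [apply contR_const|].
        apply (contR_ext (fun x => (0%R, (- (sg * y))%R) + RtoC x * 1)%C); [|apply contR_affine].
        intros z. unfold RtoC, Cplus, Cmult; simpl. f_equal; ring. }
  (* [D] minus the argument of the straight model is an argument of [ep 1 x / ep (-1) x], which
     stays near 1, so [D] follows the model up to 2/7. *)
  assert (Hmid : Rabs ((D (s (t0 + rho)) - 2 * atan (rho / y)) - (D (s (t0 + - rho)) - 2 * atan (- rho / y))) <= 2 / 7).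
  { assert (G := path_variation (fun x => ep 1 x / ep (-1) x)%C (fun x => (D (s (t0 + x)) - 2 * atan (x / y)) + PI) (- rho) rho ltac:(lra)).
    replace ((D (s (t0 + rho)) - 2 * atan (rho / y)) - (D (s (t0 + - rho)) - 2 * atan (- rho / y)))
      with (D (s (t0 + rho)) - 2 * atan (rho / y) + PI - (D (s (t0 + - rho)) - 2 * atan (- rho / y) + PI)) by ring.
    apply G; clear G.
    - intros x Hx u Hu.
      assert (HDc : cont_int (fun t => D (s t)) a b).
      { apply (cont_int_of_cont_on A); auto. intros t Ht. right. exists t; auto. }
      destruct (HDc (t0 + x) ltac:(lra) (u / 2)) as [m1 [Hm1 G1]]; [lra|].
      assert (Hat : continuity_pt (fun x => 2 * atan (x / y)) x).
      { apply derivable_continuous_pt. exists (2 * (/ (1 + (x / y) ^ 2) * (/ y))).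
        apply (derivable_pt_lim_scal (fun x => atan (x / y))).
        apply (derivable_pt_lim_comp (fun x => x / y) atan); [|apply derivable_pt_lim_atan].
        apply is_derive_Reals. auto_derive; [lra|field; lra]. }
      destruct (Hat (u / 2)) as [m2 [Hm2 G2]]; [lra|].
      exists (Rmin m1 m2). split; [now apply Rmin_glb_lt|]. intros z Hz Hzx.
      assert (B1 := G1 (t0 + z) ltac:(lra)). replace (t0 + z - (t0 + x)) with (z - x) in B1 by ring.
      specialize (B1 (Rlt_le_trans _ _ _ Hzx (Rmin_l _ _))).
      assert (B2 : Rabs (2 * atan (z / y) - 2 * atan (x / y)) < u / 2).
      { destruct (Req_dec z x) as [->|n]; [rewrite Rminus_diag, Rabs_R0; lra|].
        apply (G2 z). split; [split; [exact I|congruence]|]. exact (Rlt_le_trans _ _ _ Hzx (Rmin_r _ _)). }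
      apply Rabs_def2 in B1, B2. apply Rabs_def1; lra.
    - intros x Hx. apply contR_mult; [apply Hepc; auto|].
      apply (contR_comp Cinv (ep (-1))); [|apply Hepc; auto]. apply contC_inv. apply Hepf; auto. apply Rabs_le; lra.
    - intros x Hx. assert (Hx' : Rabs x <= rho) by (apply Rabs_le; lra).
      pose proof (Hep 1 x ltac:(auto) Hx') as E1. pose proof (Hep (-1) x ltac:(auto) Hx') as E2.
      destruct (Hepf (-1) x ltac:(auto) Hx') as [E3 E4].
      replace (ep 1 x / ep (-1) x - 1)%C with ((ep 1 x - ep (-1) x) / ep (-1) x)%C by (field; exact E4).
      rewrite Cmod_div by exact E4.
      assert (Cmod (ep 1 x - ep (-1) x) <= 4 * e).
      { pose proof (Cmod_tri (ep 1 x) 1 (ep (-1) x)) as T. rewrite (Cmod_sym 1 (ep (-1) x)) in T. lra. }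
      unfold e in H. apply div_le_of; lra.
    - intros x Hx. assert (Hx' : Rabs x <= rho) by (apply Rabs_le; lra).
      destruct (Hepf 1 x ltac:(auto) Hx') as [E1 E1']. destruct (Hepf (-1) x ltac:(auto) Hx') as [E3 E4].
      set (w := s (t0 + x)).
      assert (HwA : A w) by (right; exists (t0 + x); split; [lra|auto]).
      destruct (Hxy0 1 x ltac:(auto)) as [X1 _]. destruct (Hxy0 (-1) x ltac:(auto)) as [X2 _].
      assert (X1' : ((x, (- (1 * y))%R) : C) <> 0) by now apply Cmod_gt_0.
      assert (X2' : ((x, (- (-1 * y))%R) : C) <> 0) by now apply Cmod_gt_0.
      assert (Hwm : w <> c (- eta)).
      { intros E. apply E4. unfold ep. fold w. replace (-1 * eta) with (- eta) by ring. rewrite E. field. auto. }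
      destruct (cis_atan_ratio x y Hy) as [C1 C2].
      assert (X3 : ((x, y) : C) <> 0) by (replace y with (- (-1 * y)) by ring; exact X2').
      assert (X4 : ((x, (- y)%R) : C) <> 0) by (replace y with (1 * y) by ring; exact X1').
      pose proof (polar_div _ _ _ _ X3 C1 C2) as C3.
      assert (X5 : (((x, (- y)%R) : C) / ((x, y) : C))%C <> 0).
      { apply Cmod_gt_0. rewrite Cmod_div by exact X3. apply Rdiv_lt_0_compat; now apply Cmod_gt_0. }
      pose proof (polar_div _ _ _ _ X5 (HDq w HwA Hwm) C3) as C4.
      assert (Eq : (q w / (((x, (- y)%R) : C) / ((x, y) : C)))%C = (ep 1 x / ep (-1) x)%C).
      { assert (Hwm' : (w - c (- eta)%R)%C <> 0) by (apply Cmod_gt_0; now apply Cmod_minus_gt0).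
        unfold q, ep. fold w. replace (-1 * eta) with (- eta) by ring. replace (1 * eta) with eta by ring.
        replace (- (1 * y)) with (- y) by ring. replace (- (-1 * y)) with y by ring.
        field. repeat split; auto. }
      rewrite Eq in C4. rewrite C4 at 1. f_equal. f_equal. field. }
  (* Because [y < rho]. The model then turns by at least [PI], already too much for the two bounds
     of 2/7. *)
  assert (Hatan : PI / 4 <= atan (rho / y)).
  { rewrite <- atan_1. destruct (Req_dec (rho / y) 1) as [->|n]; [lra|]. left. apply atan_increasing.
    assert (1 < rho / y); [|lra].
    apply Rmult_lt_reg_r with y; [lra|]. unfold Rdiv. rewrite Rmult_assoc, Rinv_l by lra. lra. }
  assert (Hopp : atan (- rho / y) = - atan (rho / y)).
  { rewrite <- atan_opp. f_equal. field. lra. }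
  rewrite Hopp in Hmid. replace (t0 + - rho) with (t0 - rho) in Hmid by ring.
  apply Rabs_le_between in Hmid, Hout. pose proof PI2_3_2. lra.
Qed.

Lemma jump (A0 : C -> Prop) (s : R -> C) a b t0 (v : C) c k :
  a < t0 < b -> contI s a b -> derR s t0 v -> v <> 0 -> (forall t, a <= t <= b -> t <> t0 -> s t <> s t0) ->
  continuum A0 -> A0 (s a) -> A0 (s b) -> ~ A0 (s t0) -> k <> 0 ->
  derR c 0 (RtoC k * (Ci * v))%C -> c 0 = s t0 ->
  exists eta0, 0 < eta0 /\ forall eta, 0 < eta < eta0 ->
    ~ (has_arg (fun z => A0 z \/ path_image s a b z) (c eta) /\
       has_arg (fun z => A0 z \/ path_image s a b z) (c (- eta))).
Proof.
  intros Ht0 Hs Hds Hv Hinj HA Ha Hb Hp Hk Hdc Hc0.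
  destruct (Rlt_dec 0 k) as [h|h].
  - now apply (jump_pos A0 s a b t0 v c k).
  - destruct (jump_pos A0 s a b t0 v (fun x => c (- x)) (- k)) as [eta0 [H0 K]]; auto; [lra| |now rewrite Ropp_0|].
    + eapply derR_eq; [apply derR_reverse; rewrite Ropp_0; exact Hdc|]. rewrite RtoC_opp. ring.
    + exists eta0. split; auto. intros eta He [E1 E2]. apply (K eta He). rewrite Ropp_involutive. auto.
Qed.

(** * Three disjoint arcs from a point to infinity *)

Definition arc_pt (a : C) (r phi : R) : C := (a + RtoC r * cis phi)%C.

Lemma contI_arc a r x y : contI (arc_pt a r) x y.
Proof. intros t _. apply (contR_circ a r t). Qed.

Lemma arc_dist a r phi : 0 < r -> Cmod (arc_pt a r phi - a) = r.
Proof.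
  intros Hr. unfold arc_pt. replace (a + RtoC r * cis phi - a)%C with (RtoC r * cis phi)%C by ring.
  rewrite Cmod_Rmult, Cmod_cis, Rabs_pos_eq; lra.
Qed.

(** On the circle around [a] the parameter itself is an argument, so the branch differs from it by a
    constant. *)
Lemma branch_arc B a r th x y : 0 < r -> x <= y -> (forall w, path_image (arc_pt a r) x y w -> B w) ->
  branch B a th -> th (arc_pt a r y) - th (arc_pt a r x) = y - x.
Proof.
  intros Hr Hxy HB [Hth Eth].
  assert (Hc : cont_int (fun t => th (arc_pt a r t)) x y).
  { apply (cont_int_of_cont_on B); auto using contI_arc. intros t Ht. apply HB. exists t; auto. }
  assert (E : (fun t => th (arc_pt a r t) - t) x = (fun t => th (arc_pt a r t) - t) y); [|cbv beta in E; lra].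
  apply (path_angle_const (fun t => th (arc_pt a r t) - t) x y); auto.
  - intros t Ht e He. destruct (Hc t Ht (e / 2)) as [d [Hd K]]; [lra|]. exists (Rmin d (e / 2)).
    split; [apply Rmin_glb_lt; lra|]. intros s Hs Hst.
    specialize (K s Hs (Rlt_le_trans _ _ _ Hst (Rmin_l _ _))).
    assert (K2 := Rlt_le_trans _ _ _ Hst (Rmin_r _ _)).
    apply Rabs_def2 in K, K2. apply Rabs_def1; lra.
  - intros t Ht. apply cis_eq_cos.
    assert (Hw : B (arc_pt a r t)) by (apply HB; exists t; auto).
    apply (polar_cis_unique (arc_pt a r t - a)%C).
    + apply Cmod_gt_0. rewrite arc_dist; auto.
    + now apply Eth.
    + rewrite arc_dist by auto. unfold arc_pt. ring.
Qed.

(** Go once around the circle. The three arcs add up to [2 PI]; but each [D] ties its point on the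
    circle to the common point [c], and there the two branches involved differ by a constant, so the
    sum telescopes to 0. *)
Lemma no_three_sectors (a c : C) r (D1 D2 D3 : C -> Prop) p1 p2 p3 : 0 < r ->
  p1 < p2 -> p2 < p3 -> p3 < p1 + 2 * PI -> continuum D1 -> continuum D2 -> continuum D3 ->
  ~ D1 a -> ~ D2 a -> ~ D3 a -> D1 c -> D2 c -> D3 c ->
  D1 (arc_pt a r p1) -> D2 (arc_pt a r p2) -> D3 (arc_pt a r p3) ->
  has_arg (fun z => (D1 z \/ D2 z) \/ path_image (arc_pt a r) p1 p2 z) a ->
  has_arg (fun z => (D2 z \/ D3 z) \/ path_image (arc_pt a r) p2 p3 z) a ->
  has_arg (fun z => (D3 z \/ D1 z) \/ path_image (arc_pt a r) p3 (p1 + 2 * PI) z) a -> False.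
Proof.
  intros Hr H12 H23 H31 N1 N2 N3 A1 A2 A3 C1 C2 C3 L1 L2 L3 [t12 B12] [t23 B23] [t31 B31].
  pose proof PI_RGT_0.
  assert (E1 := branch_arc _ a r t12 p1 p2 Hr ltac:(lra) (fun w h => or_intror h) B12).
  assert (E2 := branch_arc _ a r t23 p2 p3 Hr ltac:(lra) (fun w h => or_intror h) B23).
  assert (E3 := branch_arc _ a r t31 p3 (p1 + 2 * PI) Hr ltac:(lra) (fun w h => or_intror h) B31).
  assert (Ep : arc_pt a r (p1 + 2 * PI) = arc_pt a r p1).
  { unfold arc_pt. f_equal. f_equal. unfold cis. now rewrite cos_plus, sin_plus, cos_2PI, sin_2PI, !Rmult_0_r, !Rmult_1_r, Rminus_0_r, Rplus_0_r. }
  rewrite Ep in E3.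
  assert (F1 := branch_unique D1 _ a t12 t31 (arc_pt a r p1) c N1 A1 (fun v h => or_introl (or_introl h)) B12 _ (fun v h => or_introl (or_intror h)) B31 L1 C1).
  assert (F2 := branch_unique D2 _ a t23 t12 (arc_pt a r p2) c N2 A2 (fun v h => or_introl (or_introl h)) B23 _ (fun v h => or_introl (or_intror h)) B12 L2 C2).
  assert (F3 := branch_unique D3 _ a t31 t23 (arc_pt a r p3) c N3 A3 (fun v h => or_introl (or_introl h)) B31 _ (fun v h => or_introl (or_intror h)) B23 L3 C3).
  lra.
Qed.

(** A curve from [a] to infinity in the complement of [M]; the last clause, at the single time 0,
    supplies the edge of the graph that leads to [M]. *)
Definition end_arc (M : C -> Prop) (a : C) (y : R -> C) : Prop :=
  (forall t, contR y t) /\ (forall t, y t <> a) /\ (forall t, ~ M (y t)) /\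
  (forall e, 0 < e -> exists T, forall t, t < T -> Cmod (y t - a) < e) /\
  (forall rho, exists T, forall t, T < t -> rho < Cmod (y t)) /\
  (forall e, 0 < e -> exists m, M m /\ Cmod (m - y 0) < e).

(** Outside a compact time interval the curve is near [a] or near infinity, hence away from [p]. *)
Lemma end_arc_far M a y p : end_arc M a y -> p <> a -> (forall t, y t <> p) ->
  exists d, 0 < d /\ forall t, d <= Cmod (y t - p).
Proof.
  intros (Hc & _ & _ & Hm & Hp & _) Hpa Hne.
  assert (Hd : 0 < Cmod (p - a)) by now apply Cmod_minus_gt0.
  destruct (Hm (Cmod (p - a) / 2)) as [T1 K1]; [lra|].
  destruct (Hp (Cmod p + 1)) as [T2 K2].
  set (u := Rmin T1 T2 - 1). set (v := Rmax T1 T2 + 1).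
  assert (u < T1 /\ T2 < v /\ u <= v).
  { pose proof (Rmin_l T1 T2). pose proof (Rmax_r T1 T2). pose proof (Rmax_l T1 T2). unfold u, v; lra. }
  destruct (continuum_path y u v) as [Hf _]; [lra|intros t _; apply Hc|].
  destruct (Hf p) as [d [Hd0 K]]; [intros (t & _ & E); apply (Hne t); auto|].
  exists (Rmin d (Rmin (Cmod (p - a) / 2) 1)). split; [repeat apply Rmin_glb_lt; lra|]. intros t.
  destruct (Rlt_dec t u) as [h|h].
  - eapply Rle_trans; [apply Rmin_r|]. eapply Rle_trans; [apply Rmin_l|].
    specialize (K1 t ltac:(lra)). pose proof (Cmod_tri p (y t) a) as T. rewrite (Cmod_sym p (y t)) in T. lra.
  - destruct (Rlt_dec v t) as [h'|h'].
    + eapply Rle_trans; [apply Rmin_r|]. eapply Rle_trans; [apply Rmin_r|].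
      specialize (K2 t ltac:(lra)). pose proof (Cmod_rev (y t) p). lra.
    + eapply Rle_trans; [apply Rmin_l|]. apply K. exists t. split; [lra|auto].
Qed.

Lemma end_arc_pos M a y : end_arc M a y -> exists d, 0 < d /\ forall t, 0 <= t -> d <= Cmod (y t - a).
Proof.
  intros (Hc & Ha & _ & Hm & Hp & _).
  destruct (Hp (Cmod a + 1)) as [T2 K2].
  set (v := Rmax 0 T2 + 1).
  assert (T2 < v /\ 0 <= v).
  { pose proof (Rmax_r 0 T2). pose proof (Rmax_l 0 T2). unfold v; lra. }
  destruct (continuum_path y 0 v) as [Hf _]; [lra|intros t _; apply Hc|].
  destruct (Hf a) as [d [Hd0 K]]; [intros (t & _ & E); apply (Ha t); auto|].
  exists (Rmin d 1). split; [repeat apply Rmin_glb_lt; lra|]. intros t Ht.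
  destruct (Rlt_dec v t) as [h'|h'].
  + eapply Rle_trans; [apply Rmin_r|]. specialize (K2 t ltac:(lra)). pose proof (Cmod_rev (y t) a). lra.
  + eapply Rle_trans; [apply Rmin_l|]. apply K. exists t. split; [lra|auto].
Qed.

(** Taking the last exit from the disc makes a radius followed by the rest of the curve lead from
    [a] to infinity, touching the circle only once. *)
Lemma last_exit M a y r : end_arc M a y -> 0 < r -> (forall t, 0 <= t -> r < Cmod (y t - a)) ->
  exists tau, tau <= 0 /\ Cmod (y tau - a) = r /\ forall t, tau < t -> r < Cmod (y t - a).
Proof.
  intros (Hc & _ & _ & Hm & _) Hr H0. destruct (Hm r Hr) as [T K].
  destruct (completeness (fun t => Cmod (y t - a) <= r)) as [m [Hu Hl]].
  - exists 0. intros t Ht. apply Rnot_lt_le. intros h. specialize (H0 t ltac:(lra)). lra.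
  - exists (T - 1). left. apply K. lra.
  - assert (Hm0 : m <= 0).
    { apply Hl. intros t Ht. apply Rnot_lt_le. intros h. specialize (H0 t ltac:(lra)). lra. }
    assert (Hgt : forall t, m < t -> r < Cmod (y t - a)).
    { intros t Ht. apply Rnot_le_lt. intros h. specialize (Hu t h). lra. }
    exists m. split; [exact Hm0|]. split; [|exact Hgt].
    apply Rle_antisym.
    + apply Rnot_lt_le. intros h. destruct (Hc m (Cmod (y m - a) - r)) as [d [Hd Kd]]; [lra|].
      assert (m <= m - d); [|lra]. apply Hl. intros t Ht. apply Rnot_lt_le. intros h'.
      assert (t <= m) by (apply Hu; auto).
      specialize (Kd t ltac:(apply Rabs_def1; lra)).
      pose proof (Cmod_tri (y m) (y t) a) as T1. rewrite (Cmod_sym (y m) (y t)) in T1. lra.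
    + apply Rnot_lt_le. intros h. destruct (Hc m (r - Cmod (y m - a))) as [d [Hd Kd]]; [lra|].
      specialize (Kd (m + d / 2) ltac:(apply Rabs_def1; lra)). specialize (Hgt (m + d / 2) ltac:(lra)).
      pose proof (Cmod_tri (y (m + d / 2)) (y m) a). lra.
Qed.

(** [D] abstracts a piece of [y] from the circle to [y 0], a segment into [M] and a continuum in [M]
    through [c], the point shared by the three arms. *)
Record arm (M : C -> Prop) (a : C) (r : R) (c : C) (y : R -> C) (D : C -> Prop) (tau phi : R) : Prop := {
  arm_end : end_arc M a y;
  arm_continuum : continuum D;
  arm_c : D c;
  arm_start : D (arc_pt a r phi);
  arm_out : forall w, D w -> r <= Cmod (w - a);
  arm_phi : - PI < phi <= PI;
  arm_tau : y tau = arc_pt a r phi;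
  arm_after : forall t, tau < t -> r < Cmod (y t - a) }.

(* The third curve leads from [a] (along a radius of the small disc) to
   infinity without meeting the other two arms and the circular arc. *)
Lemma arm_has_arg M a r c y1 D1 t1 p1 y2 D2 t2 p2 y3 D3 t3 p3 x1 x2 : 0 < r ->
  arm M a r c y1 D1 t1 p1 -> arm M a r c y2 D2 t2 p2 -> arm M a r c y3 D3 t3 p3 ->
  (forall t, t3 <= t -> ~ D1 (y3 t)) -> (forall t, t3 <= t -> ~ D2 (y3 t)) ->
  x1 <= x2 -> arc_pt a r x1 = arc_pt a r p1 ->
  (forall x, x1 <= x <= x2 -> 0 < Rabs (x - p3) < 2 * PI) ->
  has_arg (fun z => (D1 z \/ D2 z) \/ path_image (arc_pt a r) x1 x2 z) a.
Proof.
  intros Hr H1 H2 H3 N1 N2 Hx Ex Hx3.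
  set (A := fun z => (D1 z \/ D2 z) \/ path_image (arc_pt a r) x1 x2 z).
  assert (HA : continuum A).
  { apply (continuum_union _ _ (arc_pt a r p1)).
    - apply (continuum_union _ _ c); [apply H1|apply H2|apply H1|apply H2].
    - apply continuum_path; auto using contI_arc.
    - left. apply H1.
    - exists x1. split; [lra|auto]. }
  destruct HA as (Hfar & [rho Hrho] & _).
  assert (Hout : forall w, A w -> r <= Cmod (w - a)).
  { intros w [[Hw|Hw]|(x & Hxx & ->)]; [now apply H1|now apply H2|rewrite arc_dist; lra]. }
  assert (Hny : forall t, t3 <= t -> ~ A (y3 t)).
  { intros t Ht [[Hw|Hw]|(x & Hxx & E)]; [now apply (N1 t)|now apply (N2 t)|].
    destruct (Req_dec t t3) as [->|n].
    - rewrite (arm_tau _ _ _ _ _ _ _ _ H3) in E. specialize (Hx3 x Hxx).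
      assert (cis p3 = cis x).
      { unfold arc_pt in E. assert (Hr0 : RtoC r <> 0) by (intros E0; apply RtoC_inj in E0; lra).
        transitivity ((a + RtoC r * cis p3 - a) / RtoC r)%C; [field; exact Hr0|]. rewrite E. field; exact Hr0. }
      symmetry in H. apply cis_inj in H; [|lra]. subst x. rewrite Rminus_diag, Rabs_R0 in Hx3. lra.
    - pose proof (arm_after _ _ _ _ _ _ _ _ H3 t ltac:(lra)) as G. rewrite E, arc_dist in G; lra. }
  destruct (arm_end _ _ _ _ _ _ _ _ H3) as (Hc & _ & _ & _ & Hp & _).
  destruct (Hp rho) as [T KT]. set (u := Rmax t3 T + 1).
  assert (Hu : t3 <= u /\ T < u) by (pose proof (Rmax_l t3 T); pose proof (Rmax_r t3 T); unfold u; lra).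
  assert (HL : has_arg A (y3 t3)).
  { apply (has_arg_path A y3 t3 u); [lra|intros t _; apply Hc|intros t Ht; apply Hfar, Hny; lra|].
    apply (has_arg_far A _ rho); auto. apply KT; lra. }
  rewrite <- (seg_0 a (y3 t3)). apply (has_arg_path A (seg a (y3 t3)) 0 1); [lra|apply contI_seg| |rewrite seg_1; exact HL].
  intros s Hs. apply Hfar. intros HAs. destruct (Req_dec s 1) as [->|n].
  - rewrite seg_1 in HAs. now apply (Hny t3 ltac:(lra)).
  - specialize (Hout _ HAs). unfold seg in Hout.
    replace (a + RtoC s * (y3 t3 - a) - a)%C with (RtoC s * (y3 t3 - a))%C in Hout by ring.
    rewrite Cmod_Rmult, Rabs_pos_eq, (arm_tau _ _ _ _ _ _ _ _ H3), arc_dist in Hout by lra. nra.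
Qed.

(** Two arms that are neighbours on the circle, joined by the arc between them, are missed by the
    third curve, hence have a branch at [a]; the three branches contradict [no_three_sectors]. *)
Lemma arms_sorted M a r c y1 D1 t1 p1 y2 D2 t2 p2 y3 D3 t3 p3 : 0 < r ->
  arm M a r c y1 D1 t1 p1 -> arm M a r c y2 D2 t2 p2 -> arm M a r c y3 D3 t3 p3 ->
  (forall t, t3 <= t -> ~ D1 (y3 t)) -> (forall t, t3 <= t -> ~ D2 (y3 t)) ->
  (forall t, t1 <= t -> ~ D2 (y1 t)) -> (forall t, t1 <= t -> ~ D3 (y1 t)) ->
  (forall t, t2 <= t -> ~ D1 (y2 t)) -> (forall t, t2 <= t -> ~ D3 (y2 t)) ->
  p1 < p2 -> p2 < p3 -> False.
Proof.
  intros Hr H1 H2 H3 N31 N32 N12 N13 N21 N23 L12 L23. pose proof PI_RGT_0 as HPI.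
  pose proof (arm_phi _ _ _ _ _ _ _ _ H1) as B1. pose proof (arm_phi _ _ _ _ _ _ _ _ H2) as B2.
  pose proof (arm_phi _ _ _ _ _ _ _ _ H3) as B3.
  assert (Hna : forall y D t p, arm M a r c y D t p -> ~ D a).
  { intros y D t p H Ha. pose proof (arm_out _ _ _ _ _ _ _ _ H a Ha) as G. rewrite Cmod_diag in G. lra. }
  apply (no_three_sectors a c r D1 D2 D3 p1 p2 p3); try lra; try apply H1; try apply H2; try apply H3; try (eapply Hna; eassumption).
  - apply (arm_has_arg M a r c y1 D1 t1 p1 y2 D2 t2 p2 y3 D3 t3 p3); auto; [lra|].
    intros x Hx. rewrite Rabs_left; lra.
  - apply (arm_has_arg M a r c y2 D2 t2 p2 y3 D3 t3 p3 y1 D1 t1 p1); auto; [lra|].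
    intros x Hx. rewrite Rabs_pos_eq; lra.
  - apply (arm_has_arg M a r c y3 D3 t3 p3 y1 D1 t1 p1 y2 D2 t2 p2); auto; [lra|].
    intros x Hx. rewrite Rabs_pos_eq; lra.
Qed.

(* Nonplanarity of K_{3,3} with vertices [a], infinity and [M] on one side and
   the three curves on the other. *)
Lemma three_arcs M a y1 y2 y3 : planar_domain M -> ~ M a ->
  end_arc M a y1 -> end_arc M a y2 -> end_arc M a y3 ->
  (forall t u, y1 t <> y2 u) -> (forall t u, y2 t <> y3 u) -> (forall t u, y1 t <> y3 u) -> False.
Proof.
  intros HM Ha E1 E2 E3 D12 D23 D13.
  (* The segment to a point of [M] is shorter than the distance from [y 0] to [a] and to the other
     two curves, so it meets none of them. *)
  assert (Hleg : forall y y' y'', end_arc M a y -> end_arc M a y' -> end_arc M a y'' ->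
    (forall t u, y t <> y' u) -> (forall t u, y t <> y'' u) ->
    exists m, M m /\ (forall w, path_image (seg (y 0) m) 0 1 w -> w <> a) /\
      (forall w, path_image (seg (y 0) m) 0 1 w -> forall t, y' t <> w /\ y'' t <> w)).
  { intros y y' y'' E E' E'' N N'. pose proof E as (_ & Hya & _ & _ & _ & Hacc).
    destruct (end_arc_far M a y' (y 0) E') as [d1 [Hd1 K1]]; auto.
    destruct (end_arc_far M a y'' (y 0) E'') as [d2 [Hd2 K2]]; auto.
    assert (Hd3 : 0 < Cmod (y 0 - a)) by (apply Cmod_minus_gt0; auto).
    destruct (Hacc (Rmin (Cmod (y 0 - a)) (Rmin d1 d2))) as [m [Hm Hmd]]; [repeat apply Rmin_glb_lt; auto|].
    assert (L1 : Cmod (m - y 0) < Cmod (y 0 - a)) by (eapply Rlt_le_trans; [exact Hmd|apply Rmin_l]).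
    assert (L2 : Cmod (m - y 0) < d1) by (eapply Rlt_le_trans; [exact Hmd|eapply Rle_trans; [apply Rmin_r|apply Rmin_l]]).
    assert (L3 : Cmod (m - y 0) < d2) by (eapply Rlt_le_trans; [exact Hmd|eapply Rle_trans; [apply Rmin_r|apply Rmin_r]]).
    exists m. split; auto. split; [|intros w (s & Hs & ->) t; split].
    - intros w (s & Hs & ->) E0. pose proof (seg_dist (y 0) m s Hs) as S. rewrite E0, Cmod_sym in S. lra.
    - intros E0. pose proof (seg_dist (y 0) m s Hs) as S. specialize (K1 t). rewrite E0 in K1. lra.
    - intros E0. pose proof (seg_dist (y 0) m s Hs) as S. specialize (K2 t). rewrite E0 in K2. lra. }
  destruct (Hleg y1 y2 y3) as (m1 & M1 & A1 & B1); auto.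
  destruct (Hleg y2 y1 y3) as (m2 & M2 & A2 & B2); auto.
  destruct (Hleg y3 y1 y2) as (m3 & M3 & A3 & B3); auto.
  clear Hleg.
  destruct (domain_continuum M m1 m2 HM M1 M2) as (C1 & NC1 & IC1 & C11 & C12).
  destruct (domain_continuum M m2 m3 HM M2 M3) as (C2 & NC2 & IC2 & C22 & C23).
  set (Cc := fun z => C1 z \/ C2 z).
  assert (NC : continuum Cc) by (apply (continuum_union C1 C2 m2); auto).
  assert (IC : forall w, Cc w -> M w) by (intros w [H|H]; auto).
  assert (HNa : forall m y, continuum (path_image (seg y m) 0 1) -> (forall w, path_image (seg y m) 0 1 w -> w <> a) ->
     exists d, 0 < d /\ forall w, path_image (seg y m) 0 1 w -> d <= Cmod (w - a)).
  { intros m y [Hf _] Hn. apply Hf. intros Hin. now apply (Hn a Hin). }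
  destruct (HNa m1 (y1 0) (continuum_seg _ _) A1) as [d1 [Hd1 K1]].
  destruct (HNa m2 (y2 0) (continuum_seg _ _) A2) as [d2 [Hd2 K2]].
  destruct (HNa m3 (y3 0) (continuum_seg _ _) A3) as [d3 [Hd3 K3]]. clear HNa.
  pose proof NC as [HfC _]. destruct (HfC a ltac:(intros H; auto)) as [d4 [Hd4 K4]]. clear HfC.
  destruct (end_arc_pos M a y1 E1) as [e1 [He1 P1]].
  destruct (end_arc_pos M a y2 E2) as [e2 [He2 P2]].
  destruct (end_arc_pos M a y3 E3) as [e3 [He3 P3]].
  (* The circle around [a] must be smaller than the distance from [a] to the three segments, to the
     continuum in [M] and to the curves at times [t >= 0]. *)
  assert (Hr : exists r, 0 < r /\ r < d1 /\ r < d2 /\ r < d3 /\ r < d4 /\ r < e1 /\ r < e2 /\ r < e3).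
  { set (m := Rmin d1 (Rmin d2 (Rmin d3 (Rmin d4 (Rmin e1 (Rmin e2 e3)))))).
    assert (0 < m) by (repeat apply Rmin_glb_lt; auto).
    assert (Hmin : forall x z w, w <= Rmin x z -> w <= x /\ w <= z).
    { intros x z w Hw. pose proof (Rmin_l x z). pose proof (Rmin_r x z). lra. }
    assert (Hmm : m <= m) by lra. unfold m at 2 in Hmm.
    apply Hmin in Hmm. destruct Hmm as [? Hmm]. apply Hmin in Hmm. destruct Hmm as [? Hmm].
    apply Hmin in Hmm. destruct Hmm as [? Hmm]. apply Hmin in Hmm. destruct Hmm as [? Hmm].
    apply Hmin in Hmm. destruct Hmm as [? Hmm]. apply Hmin in Hmm. destruct Hmm as [? ?].
    exists (m / 2). lra. }
  destruct Hr as (r & Hr & R1 & R2 & R3 & R4 & S1 & S2 & S3).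
  assert (Harm : forall y m d e, end_arc M a y -> Cc m ->
    (forall w, path_image (seg (y 0) m) 0 1 w -> d <= Cmod (w - a)) -> r < d ->
    (forall t, 0 <= t -> e <= Cmod (y t - a)) -> r < e ->
    exists tau phi, tau <= 0 /\
      arm M a r m1 y (fun z => (path_image y tau 0 z \/ path_image (seg (y 0) m) 0 1 z) \/ Cc z) tau phi).
  { intros y m d e E Hm Kd Rd Ke Re.
    destruct (last_exit M a y r E Hr) as (tau & Htau & Etau & Haft).
    { intros t Ht. specialize (Ke t Ht). lra. }
    destruct (polar_exists (y tau - a)) as (phi & Hphi & Ephi). rewrite Etau in Ephi.
    assert (Ey : y tau = arc_pt a r phi) by (unfold arc_pt; rewrite <- Ephi; ring).
    exists tau, phi. split; auto. constructor; auto.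
    - apply (continuum_union _ _ m); auto.
      + apply (continuum_union _ _ (y 0)); auto using continuum_seg, seg_start.
        * apply continuum_path; auto. intros t _. apply E.
        * exists 0. split; [lra|auto].
      + right. apply seg_end.
    - right. left. exact C11.
    - left. left. exists tau. split; [lra|auto].
    - intros w [[(t & Ht & ->)|Hw]|Hw].
      + destruct (Req_dec t tau) as [->|n]; [lra|]. left. apply Haft. lra.
      + specialize (Kd w Hw). lra.
      + specialize (K4 w Hw). lra. }
  destruct (Harm y1 m1 d1 e1 E1 (or_introl C11) K1 R1 P1 S1) as (t1 & p1 & T1 & G1).
  destruct (Harm y2 m2 d2 e2 E2 (or_introl C12) K2 R2 P2 S2) as (t2 & p2 & T2 & G2).
  destruct (Harm y3 m3 d3 e3 E3 (or_intror C23) K3 R3 P3 S3) as (t3 & p3 & T3 & G3). clear Harm.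
  set (D1 := fun z => (path_image y1 t1 0 z \/ path_image (seg (y1 0) m1) 0 1 z) \/ Cc z) in *.
  set (D2 := fun z => (path_image y2 t2 0 z \/ path_image (seg (y2 0) m2) 0 1 z) \/ Cc z) in *.
  set (D3 := fun z => (path_image y3 t3 0 z \/ path_image (seg (y3 0) m3) 0 1 z) \/ Cc z) in *.
  assert (HnM : forall y t, end_arc M a y -> ~ Cc (y t)).
  { intros y t (_ & _ & H & _) Hc. apply (H t), IC, Hc. }
  assert (N31 : forall t, t3 <= t -> ~ D1 (y3 t)).
  { intros t _ [[(s & _ & E)|H]|H]; [apply (D13 s t); auto|destruct (B1 _ H t); congruence|now apply (HnM y3 t)]. }
  assert (N32 : forall t, t3 <= t -> ~ D2 (y3 t)).
  { intros t _ [[(s & _ & E)|H]|H]; [apply (D23 s t); auto|destruct (B2 _ H t); congruence|now apply (HnM y3 t)]. }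
  assert (N21 : forall t, t2 <= t -> ~ D1 (y2 t)).
  { intros t _ [[(s & _ & E)|H]|H]; [apply (D12 s t); auto|destruct (B1 _ H t); congruence|now apply (HnM y2 t)]. }
  assert (N23 : forall t, t2 <= t -> ~ D3 (y2 t)).
  { intros t _ [[(s & _ & E)|H]|H]; [apply (D23 t s); auto|destruct (B3 _ H t); congruence|now apply (HnM y2 t)]. }
  assert (N12 : forall t, t1 <= t -> ~ D2 (y1 t)).
  { intros t _ [[(s & _ & E)|H]|H]; [apply (D12 t s); auto|destruct (B2 _ H t); congruence|now apply (HnM y1 t)]. }
  assert (N13 : forall t, t1 <= t -> ~ D3 (y1 t)).
  { intros t _ [[(s & _ & E)|H]|H]; [apply (D13 t s); auto|destruct (B3 _ H t); congruence|now apply (HnM y1 t)]. }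
  assert (Q12 : p1 <> p2).
  { intros E. apply (D12 t1 t2). rewrite (arm_tau _ _ _ _ _ _ _ _ G1), (arm_tau _ _ _ _ _ _ _ _ G2). now rewrite E. }
  assert (Q23 : p2 <> p3).
  { intros E. apply (D23 t2 t3). rewrite (arm_tau _ _ _ _ _ _ _ _ G2), (arm_tau _ _ _ _ _ _ _ _ G3). now rewrite E. }
  assert (Q13 : p1 <> p3).
  { intros E. apply (D13 t1 t3). rewrite (arm_tau _ _ _ _ _ _ _ _ G1), (arm_tau _ _ _ _ _ _ _ _ G3). now rewrite E. }
  (* The roles of the three arms are symmetric; each order of the angles is a relabelling. *)
  apply Rdichotomy in Q12, Q23, Q13. destruct Q12, Q23, Q13; try lra.
  - exact (arms_sorted _ _ _ _ _ _ _ _ _ _ _ _ _ _ _ _ Hr G1 G2 G3 N31 N32 N12 N13 N21 N23 ltac:(lra) ltac:(lra)).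
  - exact (arms_sorted _ _ _ _ _ _ _ _ _ _ _ _ _ _ _ _ Hr G1 G3 G2 N21 N23 N13 N12 N31 N32 ltac:(lra) ltac:(lra)).
  - exact (arms_sorted _ _ _ _ _ _ _ _ _ _ _ _ _ _ _ _ Hr G3 G1 G2 N23 N21 N31 N32 N13 N12 ltac:(lra) ltac:(lra)).
  - exact (arms_sorted _ _ _ _ _ _ _ _ _ _ _ _ _ _ _ _ Hr G2 G1 G3 N32 N31 N21 N23 N12 N13 ltac:(lra) ltac:(lra)).
  - exact (arms_sorted _ _ _ _ _ _ _ _ _ _ _ _ _ _ _ _ Hr G2 G3 G1 N12 N13 N23 N21 N32 N31 ltac:(lra) ltac:(lra)).
  - exact (arms_sorted _ _ _ _ _ _ _ _ _ _ _ _ _ _ _ _ Hr G3 G2 G1 N13 N12 N32 N31 N23 N21 ltac:(lra) ltac:(lra)).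
Qed.

(** * Orbits do not return to a flow box *)

Definition Cim (s : R) : C := (RtoC s * Ci)%C.

Lemma Cmod_Cim s : Cmod (Cim s) = Rabs s.
Proof. unfold Cim. rewrite Cmod_Rmult, Cmod_Ci. ring. Qed.

Lemma Cim_pair s x : (Cim s + RtoC x)%C = (x, s).
Proof. unfold Cim, Ci, RtoC, Cplus, Cmult; simpl. f_equal; ring. Qed.

Lemma Cim_pair0 s : Cim s = (0, s).
Proof. unfold Cim, Ci, RtoC, Cplus, Cmult; simpl. f_equal; ring. Qed.

Lemma Cmod_Cim_plus s x : Cmod (Cim s + RtoC x) <= Rabs s + Rabs x.
Proof. eapply Rle_trans; [apply Cmod_triangle|]. rewrite Cmod_Cim, Cmod_R. lra. Qed.

Lemma derR_Cim a b t : derR (fun u => Cim (a + u * b)) t (Cim b).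
Proof.
  apply (derR_ext (fun u => Cim a + RtoC u * Cim b)%C); [|apply derR_affine].
  intros s. unfold Cim. rewrite RtoC_plus, RtoC_mult. ring.
Qed.

Lemma chart_flow F p r psi w s : differentiable F -> chart F p r psi -> Cmod w + Rabs s < r ->
  max_interval F (psi w) s /\ flow F s (psi w) = psi (w + RtoC s)%C.
Proof. intros HF Hc. apply germ_flow with (p := p); auto using chart_germ. Qed.

(** The flow fixes an equilibrium, but in the flow box it shifts the parameter, and [psi] is
    injective. *)
Lemma chart_nonzero F p r psi w : differentiable F -> chart F p r psi -> Cmod w < r -> F (psi w) <> 0.
Proof.
  intros HF Hc Hw E. set (s := (r - Cmod w) / 2).
  destruct (chart_flow F p r psi w s HF Hc) as [_ H]; [unfold s; rewrite Rabs_pos_eq; lra|].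
  rewrite (proj2 (flow_zero F HF _ s E)) in H.
  pose proof Hc as (_ & _ & _ & Hinj & _). apply Hinj in H; auto.
  - assert (RtoC s = 0) as E0 by (transitivity (w + RtoC s - w)%C; [ring|rewrite <- H; ring]).
    apply RtoC_inj in E0. unfold s in E0. lra.
  - eapply Rle_lt_trans; [apply Cmod_triangle|]. rewrite Cmod_R, Rabs_pos_eq; unfold s; lra.
Qed.

Lemma chart_opp F p r psi : chart F p r psi -> chart (fun z => - F z)%C p r (fun w => psi (- w)%C).
Proof.
  intros (Hr & H0 & Hd & Hi & Ho). split; [exact Hr|]. split; [|split; [|split]].
  - rewrite <- H0. f_equal. ring.
  - intros w Hw. rewrite <- Cmod_opp in Hw. specialize (Hd _ Hw).
    intros e He. destruct (Hd e He) as [d [Hd0 K]]. exists d. split; auto. intros v Hv.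
    specialize (K (- v)%C). replace (- v - - w)%C with (- (v - w))%C in K by ring. rewrite Cmod_opp in K.
    replace (psi (- v)%C - psi (- w)%C - (v - w) * - F (psi (- w)%C))%C
      with (psi (- v)%C - psi (- w)%C - - (v - w) * F (psi (- w)%C))%C by ring. auto.
  - intros w w' Hw Hw' E. apply Hi in E; [|now rewrite Cmod_opp..].
    transitivity (- - w)%C; [ring|]. rewrite E. ring.
  - intros w0 Hw0 e He. rewrite <- Cmod_opp in Hw0. destruct (Ho _ Hw0 e He) as [d [Hd0 K]].
    exists d. split; auto. intros z Hz. destruct (K z Hz) as (w & H1 & H2 & H3).
    exists (- w)%C. rewrite Cmod_opp. split; auto. split.
    + rewrite <- Cmod_opp. replace (- (- w - w0))%C with (w - - w0)%C by ring. exact H2.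
    + rewrite <- H3. f_equal. ring.
Qed.

(** A finite supremum of the existence times would itself be an existence time by [flow_escape],
    against openness of the interval. *)
Lemma bounded_forever F z rho : differentiable F ->
  (forall t, 0 <= t -> max_interval F z t -> Cmod (flow F t z) <= rho) -> forall t, 0 <= t -> max_interval F z t.
Proof.
  intros HF Hb T HT. apply NNPP. intros Hno.
  assert (Hub : forall t, max_interval F z t -> t < T).
  { intros t Ht. apply Rnot_le_lt. intros h. apply Hno. apply (mi_conn0 F z t); auto. }
  destruct (completeness (max_interval F z)) as [b [Hu Hl]].
  - exists T. intros t Ht. specialize (Hub t Ht). lra.
  - exists 0. now apply mi_0.
  - destruct (mi_open F HF z 0 (mi_0 F HF z)) as [d [Hd Kd]].
    assert (Hb0 : 0 < b).
    { assert (d / 2 <= b); [|lra]. apply Hu, Kd. rewrite Rminus_0_r, Rabs_pos_eq; lra. }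
    assert (Hlt : forall t, 0 <= t < b -> max_interval F z t).
    { intros t Ht. apply NNPP. intros Hn. assert (b <= t); [|lra]. apply Hl. intros s Hs.
      apply Rnot_lt_le. intros h. apply Hn. apply (mi_conn0 F z s); auto. lra. }
    assert (Hbb : max_interval F z b).
    { apply (flow_escape F HF z b rho); auto. intros t Ht. apply Hb; [lra|auto]. }
    destruct (mi_open F HF z b Hbb) as [d' [Hd' Kd']].
    assert (b + d' / 2 <= b); [|lra]. apply Hu, Kd'. rewrite Rabs_pos_eq; lra.
Qed.

Lemma continuous_image_bounded F x a b : differentiable F -> a <= b ->
  (forall t, a <= t <= b -> max_interval F x t) -> exists M, forall t, a <= t <= b -> Cmod (flow F t x) <= M.
Proof.
  intros HF Hab HI. destruct (contI_bounded (fun t => flow F t x) a b Hab) as [M [_ HM]]; [|eauto].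
  intros t Ht. apply flow_cont; auto.
Qed.

(** This is how unboundedness forbids an orbit to pass twice through a point. *)
Lemma periodic_bounded F x t1 t2 : differentiable F -> max_interval F x t1 -> max_interval F x t2 -> t1 < t2 ->
  flow F t1 x = flow F t2 x -> bounded_set (orbit F x).
Proof.
  intros HF H1 H2 Hlt E. set (y := flow F t1 x). set (T := t2 - t1).
  assert (HT : max_interval F y T /\ flow F T y = y).
  { destruct (flow_minus F HF x t1 t2 H1 H2) as [A B]. fold y T in A, B. split; auto. rewrite B, <- E. reflexivity. }
  destruct HT as [HT ET].
  destruct (continuous_image_bounded F y 0 T HF) as [N HN]; [unfold T; lra|intros t Ht; apply (mi_conn0 F y T); auto|].
  assert (Hn : forall n s, INR n * T <= s <= INR (S n) * T -> max_interval F y s /\ Cmod (flow F s y) <= N).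
  { induction n; intros s Hs.
    - simpl in Hs. split; [apply (mi_conn0 F y T); auto; lra|apply HN; lra].
    - rewrite !S_INR in *. destruct (IHn (s - T)) as [A B]; [lra|].
      rewrite <- ET in A. destruct (flow_plus F HF y T (s - T) HT A) as [A' B'].
      replace (T + (s - T)) with s in A', B' by ring. split; auto. rewrite B', ET. exact B. }
  assert (HTp : 0 < T) by (unfold T; lra).
  assert (Hpos : forall s, 0 <= s -> Cmod (flow F s y) <= N).
  { intros s Hs. destruct (nfloor_ex (s / T)) as [n Hn']; [apply Rmult_le_pos; [lra|left; now apply Rinv_0_lt_compat]|].
    apply (Hn n). rewrite S_INR. split; apply Rmult_le_reg_r with (/ T); try (now apply Rinv_0_lt_compat);
      rewrite Rmult_assoc, Rinv_r by lra; unfold Rdiv in Hn'; lra. }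
  (* Existence at negative times is assumed, not derived: a time where the flow exists is moved
     forward by whole periods. *)
  assert (Hneg : forall n s, max_interval F y s -> - (INR n * T) <= s -> Cmod (flow F s y) <= N).
  { induction n; intros s Hs Hs'.
    - simpl in Hs'. apply Hpos. lra.
    - rewrite S_INR in Hs'. assert (Hs2 := Hs). rewrite <- ET in Hs2.
      destruct (flow_plus F HF y T s HT Hs2) as [A' B']. rewrite ET in B'. rewrite <- B'.
      apply IHn; auto. lra. }
  exists N. intros z Hz. apply (orbit_trans F HF y x z) in Hz; [|apply orbit_sym; auto; now apply orbit_flow].
  destruct Hz as [s [Hs ->]].
  destruct (Rle_dec 0 s); [now apply Hpos|].
  destruct (nfloor_ex (- s / T)) as [m Hn']; [apply Rmult_le_pos; [lra|left; now apply Rinv_0_lt_compat]|].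
  apply (Hneg (S m)); auto. rewrite S_INR. apply Ropp_le_cancel. rewrite Ropp_involutive.
  apply Rmult_le_reg_r with (/ T); [now apply Rinv_0_lt_compat|]. rewrite Rmult_assoc, Rinv_r by lra. unfold Rdiv in Hn'; lra.
Qed.

(** * Trapping by an orbit arc closed with a transversal segment *)

Section Trap.
Variables (F : C -> C) (x0 p : C) (r : R) (psi : C -> C) (t1 t2 s1 s2 : R).
Hypothesis HF : differentiable F.
Hypothesis Hc : chart F p r psi.
Hypothesis Ht12 : t1 < t2.
Hypothesis HI1 : max_interval F x0 t1.
Hypothesis HI2 : max_interval F x0 t2.
Hypothesis Hs12 : s1 <> s2.
Hypothesis Hs1 : Rabs s1 < r / 4.
Hypothesis Hs2 : Rabs s2 < r / 4.
Hypothesis HX1 : flow F t1 x0 = psi (Cim s1).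
Hypothesis HX2 : flow F t2 x0 = psi (Cim s2).
Let sg u := s1 + u * (s2 - s1).
Hypothesis Hcons : forall t u, t1 < t < t2 -> 0 <= u <= 1 -> flow F t x0 <> psi (Cim (sg u)).

Definition crossing (u : R) : C := psi (Cim (sg u)).
(** By [Hcons] the two crossings are consecutive, so the segment and the arc meet only in their end
    points. *)
Definition loop (z : C) : Prop := path_image (fun t => flow F t x0) t1 t2 z \/ path_image crossing 0 1 z.
(** Flow-box coordinates around the segment: position [u] along it and real time [h] away from it;
    positive [h] is the side entered by the flow. *)
Definition beside (u h : R) : C := psi (Cim (sg u) + RtoC h)%C.

Let Hr : 0 < r := proj1 Hc.

Lemma sg_bound u : 0 <= u <= 1 -> Rabs (sg u) < r / 4.
Proof.
  intros Hu. unfold sg. replace (s1 + u * (s2 - s1)) with ((1 - u) * s1 + u * s2) by ring.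
  eapply Rle_lt_trans; [apply Rabs_triang|]. rewrite !Rabs_mult, (Rabs_pos_eq (1 - u)), (Rabs_pos_eq u) by lra.
  destruct (Req_dec u 0) as [->|]; nra.
Qed.

Lemma HIt t : t1 <= t <= t2 -> max_interval F x0 t.
Proof. intros Ht. apply (mi_conn F x0 t1 t2); auto. Qed.

Lemma beside_flow u h k : 0 <= u <= 1 -> Rabs h < r / 4 -> Rabs k < r / 4 ->
  max_interval F (beside u h) k /\ flow F k (beside u h) = beside u (h + k).
Proof.
  intros Hu Hh Hk. pose proof (sg_bound u Hu).
  destruct (chart_flow F p r psi (Cim (sg u) + RtoC h)%C k HF Hc) as [A B].
  - pose proof (Cmod_Cim_plus (sg u) h). lra.
  - split; auto. fold (beside u h) in B. rewrite B. unfold beside. f_equal. rewrite RtoC_plus. ring.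
Qed.

Lemma beside_0 u : beside u 0 = crossing u.
Proof. unfold beside, crossing. f_equal. ring. Qed.

Lemma beside_inj u h u' h' : 0 <= u <= 1 -> Rabs h < r / 4 -> 0 <= u' <= 1 -> Rabs h' < r / 4 ->
  beside u h = beside u' h' -> u = u' /\ h = h'.
Proof.
  intros Hu Hh Hu' Hh' E. pose proof (sg_bound u Hu). pose proof (sg_bound u' Hu').
  pose proof Hc as (_ & _ & _ & Hinj & _). apply Hinj in E.
  - rewrite !Cim_pair in E. injection E as E1 E2. split; auto. unfold sg in E2.
    apply Rmult_eq_reg_r with (s2 - s1); lra.
  - pose proof (Cmod_Cim_plus (sg u) h). lra.
  - pose proof (Cmod_Cim_plus (sg u') h'). lra.
Qed.

Lemma crossing_0 : crossing 0 = flow F t1 x0.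
Proof. rewrite HX1. unfold crossing, sg. f_equal. f_equal. ring. Qed.

Lemma crossing_1 : crossing 1 = flow F t2 x0.
Proof. rewrite HX2. unfold crossing, sg. f_equal. f_equal. ring. Qed.

(** Flowing back by [h] puts the point on the segment at time [t - h]. This time cannot lie strictly
    between [t1] and [t2]; outside, it is so close to one of them that injectivity of the flow box
    identifies both coordinates. *)
Lemma beside_on_arc t u h : t1 <= t <= t2 -> 0 <= u <= 1 -> Rabs h < r / 4 -> flow F t x0 = beside u h ->
  (t - h = t1 /\ u = 0) \/ (t - h = t2 /\ u = 1).
Proof.
  intros Ht Hu Hh E.
  destruct (beside_flow u h (- h) Hu Hh) as [A B]; [now rewrite Rabs_Ropp|].
  rewrite <- E in A, B. destruct (flow_plus F HF x0 t (- h) (HIt t Ht) A) as [A' B'].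
  rewrite B in B'. replace (h + - h) with 0 in B' by ring. rewrite beside_0 in B'.
  replace (t + - h) with (t - h) in A', B' by ring.
  assert (Hh0 : Rabs 0 < r / 4) by (rewrite Rabs_R0; lra).
  apply Rabs_def2 in Hh as Hh2.
  destruct (Rle_dec (t - h) t1) as [h1|h1]; [left|destruct (Rle_dec t2 (t - h)) as [h2|h2]; [right|]].
  - set (k := t1 - (t - h)). assert (Hk : Rabs k < r / 4) by (unfold k; rewrite Rabs_pos_eq; lra).
    destruct (beside_flow u 0 k Hu Hh0 Hk) as [A2 B2]. rewrite beside_0, <- B' in A2, B2.
    destruct (flow_plus F HF x0 (t - h) k A' A2) as [_ B3]. rewrite B2, Rplus_0_l in B3.
    replace (t - h + k) with t1 in B3 by (unfold k; ring). rewrite <- crossing_0, <- beside_0 in B3.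
    apply beside_inj in B3; auto; [|lra]. unfold k in B3. lra.
  - set (k := t2 - (t - h)). assert (Hk : Rabs k < r / 4) by (unfold k; apply Rabs_def1; lra).
    destruct (beside_flow u 0 k Hu Hh0 Hk) as [A2 B2]. rewrite beside_0, <- B' in A2, B2.
    destruct (flow_plus F HF x0 (t - h) k A' A2) as [_ B3]. rewrite B2, Rplus_0_l in B3.
    replace (t - h + k) with t2 in B3 by (unfold k; ring). rewrite <- crossing_1, <- beside_0 in B3.
    apply beside_inj in B3; auto; [|lra]. unfold k in B3. lra.
  - exfalso. apply (Hcons (t - h) u); auto. lra.
Qed.

Lemma beside_off_crossing u h : 0 <= u <= 1 -> Rabs h < r / 4 -> h <> 0 -> ~ path_image crossing 0 1 (beside u h).
Proof.
  intros Hu Hh Hn (v & Hv & E). rewrite <- beside_0 in E. apply beside_inj in E; auto.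
  - lra.
  - rewrite Rabs_R0. lra.
Qed.

(** The corner [u = 0] is left out since the arc departs there into the upper side; at [u = 1] it
    arrives from the lower side, hence the other range in [below_off]. *)
Lemma above_off u h : 0 < u <= 1 -> 0 < h < r / 4 -> ~ loop (beside u h).
Proof.
  intros Hu Hh [(t & Ht & E)|H].
  - symmetry in E. apply beside_on_arc in E; auto; [|lra|rewrite Rabs_pos_eq; lra]. lra.
  - revert H. apply beside_off_crossing; [lra|rewrite Rabs_pos_eq; lra|lra].
Qed.

Lemma below_off u h : 0 <= u < 1 -> - (r / 4) < h < 0 -> ~ loop (beside u h).
Proof.
  intros Hu Hh [(t & Ht & E)|H].
  - symmetry in E. apply beside_on_arc in E; auto; [|lra|rewrite Rabs_left; lra]. lra.
  - revert H. apply beside_off_crossing; [lra|rewrite Rabs_left; lra|lra].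
Qed.

Lemma crossing_der u : 0 <= u <= 1 -> derR crossing u (Cim (s2 - s1) * F (crossing u))%C.
Proof.
  intros Hu. apply (derR_comp psi (fun u => Cim (sg u))).
  - pose proof Hc as (_ & _ & Hd & _). apply Hd. rewrite Cmod_Cim. pose proof (sg_bound u Hu). lra.
  - apply derR_Cim.
Qed.

Lemma crossing_contI : contI crossing 0 1.
Proof. intros u Hu. eapply contR_of_derR, crossing_der, Hu. Qed.

Lemma arc_continuum : continuum (path_image (fun t => flow F t x0) t1 t2).
Proof. apply continuum_path; [lra|]. intros t Ht. apply flow_cont; auto. now apply HIt. Qed.

Lemma loop_continuum : continuum loop.
Proof.
  apply (continuum_union _ _ (flow F t1 x0)).
  - apply arc_continuum.
  - apply continuum_path; [lra|apply crossing_contI].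
  - exists t1. split; [lra|auto].
  - exists 0. split; [lra|now rewrite crossing_0].
Qed.

Lemma beside_path u h u' h' : 0 <= u <= 1 -> Rabs h < r / 4 -> 0 <= u' <= 1 -> Rabs h' < r / 4 ->
  (forall t, 0 <= t <= 1 -> ~ loop (beside (u + t * (u' - u)) (h + t * (h' - h)))) ->
  (has_arg loop (beside u h) <-> has_arg loop (beside u' h')).
Proof.
  intros Hu Hh Hu' Hh' Hoff.
  pose proof (has_arg_path loop (fun t => beside (u + t * (u' - u)) (h + t * (h' - h))) 0 1 ltac:(lra)) as G.
  cbv beta in G. rewrite !Rmult_0_l, !Rmult_1_l, !Rplus_0_r in G.
  replace (u + (u' - u)) with u' in G by ring. replace (h + (h' - h)) with h' in G by ring.
  apply G.
  - intros t Ht. unfold beside.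
    apply (contR_comp psi (fun t => Cim (sg (u + t * (u' - u))) + RtoC (h + t * (h' - h)))%C).
    + pose proof Hc as (_ & _ & Hd & _). eapply contC_of_derC, Hd.
      eapply Rle_lt_trans; [apply Cmod_Cim_plus|].
      assert (0 <= u + t * (u' - u) <= 1) by (split; nra).
      pose proof (sg_bound _ H).
      assert (Rabs (h + t * (h' - h)) < r / 4).
      { apply Rabs_def2 in Hh, Hh'. replace (h + t * (h' - h)) with ((1 - t) * h + t * h') by ring.
        apply Rabs_def1; destruct (Req_dec t 0) as [->|]; nra. }
      lra.
    + apply (contR_ext (fun t => (Cim (sg u) + RtoC h) + RtoC t * (Cim ((u' - u) * (s2 - s1)) + RtoC (h' - h)))%C); [|apply contR_affine].
      intros s. unfold sg, Cim. rewrite ?RtoC_plus, ?RtoC_mult, ?RtoC_plus, ?RtoC_mult, ?RtoC_minus. ring.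
  - intros t Ht. apply loop_continuum. now apply Hoff.
Qed.

Lemma above_const u h u' h' : 0 < u <= 1 -> 0 < h < r / 4 -> 0 < u' <= 1 -> 0 < h' < r / 4 ->
  (has_arg loop (beside u h) <-> has_arg loop (beside u' h')).
Proof.
  intros Hu Hh Hu' Hh'. apply beside_path; try lra; try (rewrite Rabs_pos_eq; lra).
  intros t Ht. apply above_off.
  - replace (u + t * (u' - u)) with ((1 - t) * u + t * u') by ring. split; [destruct (Req_dec t 0) as [->|]|]; nra.
  - replace (h + t * (h' - h)) with ((1 - t) * h + t * h') by ring. split; destruct (Req_dec t 0) as [->|]; nra.
Qed.

Lemma below_const u h u' h' : 0 <= u < 1 -> - (r / 4) < h < 0 -> 0 <= u' < 1 -> - (r / 4) < h' < 0 ->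
  (has_arg loop (beside u h) <-> has_arg loop (beside u' h')).
Proof.
  intros Hu Hh Hu' Hh'. apply beside_path; try lra; try (rewrite Rabs_left; lra).
  intros t Ht. apply below_off.
  - replace (u + t * (u' - u)) with ((1 - t) * u + t * u') by ring. split; [|destruct (Req_dec t 0) as [->|]]; nra.
  - replace (h + t * (h' - h)) with ((1 - t) * h + t * h') by ring. split; destruct (Req_dec t 0) as [->|]; nra.
Qed.

(** By [jump] at the midpoint of the segment, not both sides have a branch there, and each side is
    connected off the loop. *)
Lemma one_side_encircled :
  (forall u h, 0 < u <= 1 -> 0 < h < r / 4 -> ~ has_arg loop (beside u h)) \/
  (forall u h, 0 <= u < 1 -> - (r / 4) < h < 0 -> ~ has_arg loop (beside u h)).
Proof.
  assert (Hb : Cmod (Cim (sg (1 / 2))) < r) by (rewrite Cmod_Cim; pose proof (sg_bound (1 / 2) ltac:(lra)); lra).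
  assert (HFp : F (crossing (1 / 2)) <> 0) by (now apply (chart_nonzero F p r psi)).
  (* The velocity of the segment is [v = i (s2 - s1) F], so the factor [- / (s2 - s1)] makes [k i v]
     equal to [F], the velocity of the flow across it. *)
  destruct (jump (path_image (fun t => flow F t x0) t1 t2) crossing 0 1 (1 / 2)
    (Cim (s2 - s1) * F (crossing (1 / 2)))%C (fun h => beside (1 / 2) h) (- / (s2 - s1))) as [eta0 [He K]].
  - lra.
  - apply crossing_contI.
  - apply crossing_der. lra.
  - apply Cmod_gt_0. rewrite Cmod_mult, Cmod_Cim. apply Rmult_lt_0_compat; [apply Rabs_pos_lt; lra|now apply Cmod_gt_0].
  - intros t Ht Hn E. rewrite <- !beside_0 in E. apply beside_inj in E; try lra; rewrite Rabs_R0; lra.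
  - apply arc_continuum.
  - exists t1. split; [lra|apply crossing_0].
  - exists t2. split; [lra|apply crossing_1].
  - intros (t & Ht & E). symmetry in E. rewrite <- beside_0 in E. apply beside_on_arc in E; try lra. rewrite Rabs_R0. lra.
  - apply Ropp_neq_0_compat, Rinv_neq_0_compat. lra.
  - eapply derR_eq.
    + apply derR_line. pose proof Hc as (_ & _ & Hd & _). apply Hd. rewrite Cplus_0_r. exact Hb.
    + rewrite Cplus_0_r. fold (crossing (1 / 2)). unfold Cim.
      transitivity (RtoC (- / (s2 - s1) * (s2 - s1)) * (Ci * Ci * F (crossing (1 / 2))))%C.
      * rewrite Ropp_mult_distr_l_reverse, Rinv_l by lra.
        replace (Ci * Ci)%C with (RtoC (- (1))) by (unfold Ci, RtoC, Cmult; simpl; f_equal; ring).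
        rewrite RtoC_opp. ring.
      * rewrite RtoC_mult. ring.
  - apply beside_0.
  - set (h := Rmin (eta0 / 2) (r / 8)).
    assert (Hh : 0 < h /\ h < eta0 /\ h < r / 4).
    { assert (0 < h) by (apply Rmin_glb_lt; lra). pose proof (Rmin_l (eta0 / 2) (r / 8)) as L1. pose proof (Rmin_r (eta0 / 2) (r / 8)) as L2.
      fold h in L1, L2. lra. }
    specialize (K h ltac:(lra)).
    destruct (classic (has_arg loop (beside (1 / 2) h))) as [Ha|Ha].
    + right. intros u h' Hu Hh' H. apply K. split; [exact Ha|].
      revert H. apply below_const; lra.
    + left. intros u h' Hu Hh' H. apply Ha. revert H. apply above_const; lra.
Qed.

Section Forward.
Hypothesis Habove : forall u h, 0 < u <= 1 -> 0 < h < r / 4 -> ~ has_arg loop (beside u h).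

(** The loop with all points it winds around, the substitute for the interior of a Jordan curve:
    closed by [has_arg_local] and bounded by [has_arg_far]. *)
Definition trapped (z : C) : Prop := loop z \/ ~ has_arg loop z.

(** From the loop the flow either continues along the arc or enters the upper side of the segment,
    which is encircled; off the loop being encircled is an open condition. *)
Lemma trapped_step z : trapped z -> exists h, 0 < h /\ forall s, 0 <= s < h -> max_interval F z s -> trapped (flow F s z).
Proof.
  intros Hz0. destruct (classic (loop z)) as [[(t & Ht & ->)|(u & Hu & ->)]|Hl].
  - destruct (Req_dec t t2) as [->|n].
    + exists (r / 4). split; [lra|]. intros s Hs _. rewrite <- crossing_1, <- beside_0.
      destruct (Req_dec s 0) as [->|n]; [left; right; exists 1; split; [lra|now rewrite flow_0, beside_0]|].
      rewrite (proj2 (beside_flow 1 0 s ltac:(lra) ltac:(rewrite Rabs_R0; lra) ltac:(rewrite Rabs_pos_eq; lra))).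
      right. apply Habove; lra.
    + exists (t2 - t). split; [lra|]. intros s Hs Hm. destruct (flow_plus F HF x0 t s (HIt t Ht) Hm) as [_ E].
      left. left. exists (t + s). split; [lra|auto].
  - destruct (Req_dec u 0) as [->|n].
    + exists (t2 - t1). split; [lra|]. rewrite crossing_0. intros s Hs Hm.
      destruct (flow_plus F HF x0 t1 s HI1 Hm) as [_ E]. left. left. exists (t1 + s). split; [lra|auto].
    + exists (r / 4). split; [lra|]. intros s Hs _. rewrite <- beside_0.
      destruct (Req_dec s 0) as [->|n']; [left; right; exists u; split; [lra|now rewrite flow_0, beside_0]|].
      rewrite (proj2 (beside_flow u 0 s ltac:(lra) ltac:(rewrite Rabs_R0; lra) ltac:(rewrite Rabs_pos_eq; lra))).
      right. apply Habove; lra.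
  - destruct Hz0 as [Hz|Hz]; [tauto|].
    destruct loop_continuum as [Hf _]. destruct (Hf z Hl) as [d [Hd K]].
    destruct (flow_cont F HF z 0 (mi_0 F HF z) (d / 2)) as [h [Hh Kh]]; [lra|].
    exists h. split; auto. intros s Hs _. right. intros Ha. apply Hz.
    specialize (Kh s ltac:(rewrite Rminus_0_r, Rabs_pos_eq; lra)). rewrite flow_0 in Kh by auto.
    apply (has_arg_local loop (flow F s z) z (d / 2)); auto.
    + intros w Hw. specialize (K w Hw). pose proof (Cmod_tri w (flow F s z) z). lra.
    + rewrite Cmod_sym. exact Kh.
Qed.

Lemma trapped_open z : ~ trapped z -> exists d, 0 < d /\ forall w, Cmod (w - z) < d -> ~ trapped w.
Proof.
  intros Hn. assert (Hl : ~ loop z) by (intros H; apply Hn; now left).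
  assert (Ha : has_arg loop z) by (apply NNPP; intros H; apply Hn; now right).
  destruct loop_continuum as [Hf _]. destruct (Hf z Hl) as [d [Hd K]]. exists d. split; auto.
  intros w Hw [H|H].
  - specialize (K w H). lra.
  - apply H. now apply (has_arg_local loop z w d).
Qed.

Lemma trapped_forward z T : trapped z -> 0 <= T -> max_interval F z T -> trapped (flow F T z).
Proof.
  intros Hz HT HTI. apply NNPP. intros Hn.
  destruct (completeness (fun t => 0 <= t <= T /\ trapped (flow F t z))) as [m [Hu Hl]].
  - exists T. intros t [Ht _]. lra.
  - exists 0. split; [lra|]. now rewrite flow_0.
  - assert (Hm : 0 <= m <= T).
    { split; [apply Hu; split; [lra|now rewrite flow_0]|]. apply Hl. intros t [Ht _]. lra. }
    assert (HmI : max_interval F z m) by (apply (mi_conn0 F z T); auto; lra).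
    assert (Htm : trapped (flow F m z)).
    { apply NNPP. intros Hnm. destruct (trapped_open _ Hnm) as [d [Hd K]].
      destruct (flow_cont F HF z m HmI d Hd) as [h [Hh Kh]].
      assert (m <= m - h); [|lra]. apply Hl. intros t [Ht Htt]. apply Rnot_lt_le. intros Hlt.
      assert (t <= m) by (apply Hu; auto). apply (K (flow F t z)); auto. apply Kh. apply Rabs_def1; lra. }
    destruct (trapped_step _ Htm) as [h [Hh Kh]].
    assert (Hlt : m < T). { destruct (Req_dec m T) as [->|]; [tauto|lra]. }
    set (s := Rmin (h / 2) (T - m)).
    assert (Hs : 0 < s /\ s < h /\ m + s <= T).
    { assert (0 < s) by (apply Rmin_glb_lt; lra). pose proof (Rmin_l (h / 2) (T - m)) as L1. pose proof (Rmin_r (h / 2) (T - m)) as L2.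
      fold s in L1, L2. lra. }
    assert (HsI : max_interval F z (m + s)) by (apply (mi_conn0 F z T); auto; lra).
    destruct (flow_minus F HF z m (m + s) HmI HsI) as [A B]. replace (m + s - m) with s in A, B by ring.
    specialize (Kh s ltac:(lra) A). rewrite B in Kh.
    assert (m + s <= m) by (apply Hu; split; [lra|auto]). lra.
Qed.

Lemma crossing_forever u t : 0 <= u <= 1 -> 0 <= t -> max_interval F (crossing u) t.
Proof.
  intros Hu. destruct loop_continuum as (_ & [rho Hrho] & _).
  apply (bounded_forever F (crossing u) rho HF). intros s Hs Hm.
  assert (H : trapped (flow F s (crossing u))).
  { apply trapped_forward; auto. left. right. exists u. auto. }
  destruct H as [H|H]; [now apply Hrho|]. apply Rnot_lt_le. intros Hlt. apply H. now apply (has_arg_far loop _ rho).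
Qed.

(** The flow commutes with complex-time translations, so it maps the transversal to another integral
    curve of [i (s2 - s1) F]. *)
Lemma flow_crossing_der tau u : 0 <= u <= 1 -> 0 <= tau ->
  derR (fun v => flow F tau (crossing v)) u (Cim (s2 - s1) * F (flow F tau (crossing u)))%C.
Proof.
  intros Hu Htau.
  assert (Hb : Cmod (Cim (sg u)) < r) by (rewrite Cmod_Cim; pose proof (sg_bound u Hu); lra).
  assert (H0 : F (crossing u) <> 0) by (now apply (chart_nonzero F p r psi)).
  assert (HI := crossing_forever u tau Hu Htau).
  assert (H1 : F (flow F tau (crossing u)) <> 0).
  { apply (orbit_nonzero F HF (crossing u)); auto. now apply orbit_flow. }
  destruct (chart_exists F _ HF H1) as (r' & chi & Hchi).
  destruct (flow_germ F (crossing u) (r - Cmod (Cim (sg u))) (fun w => psi (Cim (sg u) + w)%C) tau r' chi HF H0) as [e [He K]]; auto.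
  { apply germ_shift with (p := p); auto. now apply chart_germ. }
  { now apply chart_germ. }
  destruct Hchi as (Hr' & Hchi0 & Hchid & _).
  assert (Hd : derR (fun v => chi (Cim ((v - u) * (s2 - s1)))) u (Cim (s2 - s1) * F (flow F tau (crossing u)))%C).
  { rewrite <- Hchi0.
    assert (E0 : Cim ((u - u) * (s2 - s1)) = 0) by (rewrite Rminus_diag, Rmult_0_l; unfold Cim; ring).
    apply (derR_comp chi (fun v => Cim ((v - u) * (s2 - s1)))).
    - rewrite E0. apply Hchid. rewrite Cmod_0. exact Hr'.
    - apply (derR_ext (fun v => Cim (- u * (s2 - s1) + v * (s2 - s1)))); [intros; f_equal; ring|]. apply derR_Cim. }
  assert (Hd0 : 0 < Rabs (s2 - s1)) by (apply Rabs_pos_lt; lra).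
  apply (derR_local (fun v => chi (Cim ((v - u) * (s2 - s1)))) _ u _ (e / Rabs (s2 - s1))); auto.
  - now apply Rdiv_lt_0_compat.
  - intros v Hv. destruct (K (Cim ((v - u) * (s2 - s1)))) as [_ E].
    + rewrite Cmod_Cim, Rabs_mult. apply (Rmult_lt_compat_r (Rabs (s2 - s1))) in Hv; auto.
      replace (e / Rabs (s2 - s1) * Rabs (s2 - s1)) with e in Hv by (field; lra). exact Hv.
    + rewrite <- E. f_equal. unfold crossing. f_equal. unfold Cim, sg.
      rewrite <- Cmult_plus_distr_r, <- RtoC_plus. f_equal. f_equal. ring.
Qed.

(* The time-[T] map translates the transversal by [s2 - s1]. *)
Lemma run_step k : forall u, 0 <= u <= 1 -> Rabs (s1 + INR k * (s2 - s1)) < r ->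
  Rabs (s1 + (INR k + u) * (s2 - s1)) < r ->
  flow F (INR k * (t2 - t1)) (crossing u) = psi (Cim (s1 + (INR k + u) * (s2 - s1))).
Proof.
  induction k; intros u Hu H1 H2.
  - simpl. rewrite Rmult_0_l, flow_0, Rplus_0_l by auto. reflexivity.
  - assert (Hk : 0 <= INR k) by apply pos_INR. rewrite S_INR in *.
    assert (Htau : 0 <= INR k * (t2 - t1)) by nra.
    (* One turn takes the start of the segment to its end, so [k + 1] turns of [crossing 0] are [k]
       turns of [crossing 1], where the induction hypothesis applies. *)
    assert (E0 : flow F ((INR k + 1) * (t2 - t1)) (crossing 0) = psi (Cim (s1 + (INR k + 1) * (s2 - s1)))).
    { rewrite <- IHk; [| lra | | auto].
      - rewrite crossing_0.
        destruct (flow_minus F HF x0 t1 t2 HI1 HI2) as [A B].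
        assert (A2 : max_interval F (crossing 1) (INR k * (t2 - t1))) by (apply crossing_forever; lra).
        rewrite crossing_1, <- B in A2.
        destruct (flow_plus F HF _ _ _ A A2) as [_ B2].
        replace (t2 - t1 + INR k * (t2 - t1)) with ((INR k + 1) * (t2 - t1)) in B2 by ring.
        rewrite B2, B, crossing_1. reflexivity.
      - apply Rabs_def2 in H1. apply Rabs_def2 in Hs1 as Hs1'.
        (* The earlier parameter is a convex combination of [s1] and the later one, hence also
           within the flow box. *)
        set (lam := INR k / (INR k + 1)). assert (Hlam : 0 <= lam <= 1).
        { unfold lam. split; [apply Rmult_le_pos; [lra|left; apply Rinv_0_lt_compat; lra]|].
          apply Rmult_le_reg_r with (INR k + 1); [lra|]. unfold Rdiv. rewrite Rmult_assoc, Rinv_l by lra. lra. }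
        replace (s1 + INR k * (s2 - s1)) with ((1 - lam) * s1 + lam * (s1 + (INR k + 1) * (s2 - s1))) by (unfold lam; field; lra).
        set (q := s1 + (INR k + 1) * (s2 - s1)) in *.
        apply Rabs_def1; destruct (Req_dec lam 0) as [->|]; nra. }
    (* As functions of the position on the segment, both sides solve the same equation and start at
       the same point. *)
    assert (G := ode_unique F (Cim (s2 - s1)) (fun v => flow F ((INR k + 1) * (t2 - t1)) (crossing v))
      (fun v => psi (Cim (s1 + (INR k + 1 + v) * (s2 - s1)))) 0 u HF (proj1 Hu)).
    cbv beta in G. apply G.
    + intros v Hv. apply flow_crossing_der; [lra|nra].
    + intros v Hv. apply (derR_comp psi (fun v => Cim (s1 + (INR k + 1 + v) * (s2 - s1)))).
      * pose proof Hc as (_ & _ & Hd & _). apply Hd. rewrite Cmod_Cim.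
        destruct (Req_dec u 0) as [->|n]; [replace v with 0 by lra; exact H2|].
        set (lam := v / u). assert (Hlam : 0 <= lam <= 1).
        { unfold lam. split; [apply Rmult_le_pos; [lra|left; apply Rinv_0_lt_compat; lra]|].
          apply Rmult_le_reg_r with u; [lra|]. unfold Rdiv. rewrite Rmult_assoc, Rinv_l by lra. lra. }
        replace (s1 + (INR k + 1 + v) * (s2 - s1))
          with ((1 - lam) * (s1 + (INR k + 1) * (s2 - s1)) + lam * (s1 + (INR k + 1 + u) * (s2 - s1))) by (unfold lam; field; lra).
        set (q := s1 + (INR k + 1) * (s2 - s1)) in *. set (q' := s1 + (INR k + 1 + u) * (s2 - s1)) in *.
        apply Rabs_def2 in H1, H2. apply Rabs_def1; destruct (Req_dec lam 0) as [->|]; nra.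
      * apply (derR_ext (fun v => Cim ((s1 + (INR k + 1) * (s2 - s1)) + v * (s2 - s1)))); [intros; f_equal; ring|]. apply derR_Cim.
    + rewrite E0, Rplus_0_r. reflexivity.
Qed.

Lemma run k : Rabs (s1 + INR k * (s2 - s1)) < r -> orbit F x0 (psi (Cim (s1 + INR k * (s2 - s1)))).
Proof.
  intros Hk. assert (E := run_step k 0 ltac:(lra) Hk). rewrite Rplus_0_r in E. rewrite <- E by auto.
  apply (orbit_trans F HF x0 (crossing 0)).
  - rewrite crossing_0. now apply orbit_flow.
  - apply orbit_flow. apply crossing_forever; [lra|]. pose proof (pos_INR k). nra.
Qed.
End Forward.
End Trap.

(** The orbit meets the transversal along an arithmetic progression until this leaves the flow box;
    [d] may have either sign. *)
Definition has_run (F : C -> C) (x0 : C) (psi : C -> C) (r theta : R) : Prop :=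
  exists s d, Rabs s < theta /\ 0 < Rabs d < 2 * theta /\
    forall k, Rabs (s + INR k * d) < r -> orbit F x0 (psi (Cim (s + INR k * d))).

(** If the side behind the segment is the encircled one, reversing time exchanges the two sides and
    the two crossings, and the progression starts at [s2] instead. *)
Lemma consecutive_run F x0 p r psi theta t1 t2 s1 s2 : differentiable F -> chart F p r psi -> theta <= r / 4 ->
  t1 < t2 -> max_interval F x0 t1 -> max_interval F x0 t2 -> s1 <> s2 -> Rabs s1 < theta -> Rabs s2 < theta ->
  flow F t1 x0 = psi (Cim s1) -> flow F t2 x0 = psi (Cim s2) ->
  (forall t u, t1 < t < t2 -> 0 <= u <= 1 -> flow F t x0 <> psi (Cim (s1 + u * (s2 - s1)))) ->
  has_run F x0 psi r theta.
Proof.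
  intros HF Hc Hth Ht HI1 HI2 Hs Hs1 Hs2 HX1 HX2 Hcons.
  assert (Hstep : Rabs (s2 - s1) < 2 * theta).
  { apply Rabs_def2 in Hs1, Hs2. apply Rabs_def1; lra. }
  assert (Hstep0 : 0 < Rabs (s2 - s1)) by (apply Rabs_pos_lt; lra).
  destruct (one_side_encircled F x0 p r psi t1 t2 s1 s2 HF Hc Ht HI1 HI2 Hs ltac:(lra) ltac:(lra) HX1 HX2 Hcons) as [Hab|Hbe].
  - exists s1, (s2 - s1). split; [auto|]. split; [auto|].
    intros k Hk. apply (run F x0 p r psi t1 t2 s1 s2); auto; lra.
  - exists s2, (- (s2 - s1)). split; [auto|]. split; [rewrite Rabs_Ropp; auto|].
    intros k Hk.
    set (F' := fun z => (- F z)%C). set (psi' := fun w => psi (- w)%C).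
    assert (HF' : differentiable F') by now apply differentiable_opp.
    assert (EC : forall s, (- Cim s)%C = Cim (- s)) by (intros s; unfold Cim; rewrite RtoC_opp; ring).
    assert (Ecr : forall u, crossing psi' (- s2) (- s1) u = crossing psi s1 s2 (1 - u)).
    { intros u. unfold crossing, psi'. rewrite EC. f_equal. f_equal. ring. }
    (* Time reversal leaves the loop unchanged as a set, so the knowledge about branches carries
       over. *)
    assert (EL : loop F' x0 psi' (- t2) (- t1) (- s2) (- s1) = loop F x0 psi t1 t2 s1 s2).
    { apply functional_extensionality. intros z. apply propositional_extensionality. unfold loop.
      assert (HIt : forall t, t1 <= t <= t2 -> max_interval F x0 t) by (intros; apply (mi_conn F x0 t1 t2); auto).
      split; (intros [(t & Ht' & ->)|(u & Hu & ->)]; [left; exists (- t); split; [lra|]|right; exists (1 - u); split; [lra|]]).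
      - rewrite <- (Ropp_involutive t) at 1. apply flow_opp; auto. apply HIt; lra.
      - apply Ecr.
      - symmetry. apply flow_opp; auto.
      - rewrite Ecr. f_equal. ring. }
    replace (s2 + INR k * - (s2 - s1)) with (- (- s2 + INR k * (- s1 - - s2))) in * by ring.
    rewrite Rabs_Ropp in Hk. rewrite <- EC.
    rewrite <- (orbit_opp F x0 HF). change (fun z => (- F z)%C) with F'.
    apply (run F' x0 p r psi' (- t2) (- t1) (- s2) (- s1) HF' (chart_opp F p r psi Hc) ltac:(lra)
      (mi_opp F x0 t2 HI2) (mi_opp F x0 t1 HI1)); auto.
    + intros E. apply Hs. rewrite <- (Ropp_involutive s1), <- (Ropp_involutive s2), E. reflexivity.
    + rewrite Rabs_Ropp; lra.
    + rewrite Rabs_Ropp; lra.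
    + unfold F', psi'. rewrite flow_opp, EC, Ropp_involutive; auto.
    + unfold F', psi'. rewrite flow_opp, EC, Ropp_involutive; auto.
    + rewrite EL. intros u h Hu Hh.
      replace (beside psi' (- s2) (- s1) u h) with (beside psi s1 s2 (1 - u) (- h)).
      * apply Hbe; lra.
      * unfold beside, psi'. f_equal. unfold Cim. rewrite ?RtoC_plus, ?RtoC_mult, ?RtoC_minus, ?RtoC_opp, ?RtoC_mult, ?RtoC_minus, ?RtoC_opp. ring.
Qed.

(** Reduction to consecutive crossings: an intermediate one replaces the second. The time between
    crossings then drops by at least [r / 4], so [n] bounds the number of replacements. *)
Lemma crossings_run F x0 p r psi theta n : differentiable F -> chart F p r psi -> theta <= r / 4 ->
  (forall t t', max_interval F x0 t -> max_interval F x0 t' -> flow F t x0 = flow F t' x0 -> t = t') ->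
  forall t1 t2 s1 s2, t2 - t1 < INR n * (r / 4) ->
  t1 < t2 -> max_interval F x0 t1 -> max_interval F x0 t2 -> Rabs s1 < theta -> Rabs s2 < theta ->
  flow F t1 x0 = psi (Cim s1) -> flow F t2 x0 = psi (Cim s2) ->
  has_run F x0 psi r theta.
Proof.
  intros HF Hc Hth Hinj. pose proof Hc as (Hr & _ & _ & Hpi & _).
  induction n; intros t1 t2 s1 s2 Hn Ht HI1 HI2 Hs1 Hs2 HX1 HX2.
  - simpl in Hn. lra.
  - assert (Hs : s1 <> s2).
    { intros E. rewrite E, <- HX2 in HX1. apply Hinj in HX1; auto. lra. }
    destruct (classic (exists t u, (t1 < t < t2 /\ 0 <= u <= 1) /\ flow F t x0 = psi (Cim (s1 + u * (s2 - s1)))))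
      as [(t & u & [Htt Hu] & E)|Hno].
    + set (s := s1 + u * (s2 - s1)) in *.
      assert (Hss : Rabs s < theta).
      { unfold s. replace (s1 + u * (s2 - s1)) with ((1 - u) * s1 + u * s2) by ring.
        eapply Rle_lt_trans; [apply Rabs_triang|]. rewrite !Rabs_mult, (Rabs_pos_eq (1 - u)), (Rabs_pos_eq u) by lra.
        destruct (Req_dec u 0) as [->|]; nra. }
      assert (HIt : max_interval F x0 t) by (apply (mi_conn F x0 t1 t2); auto; lra).
      (* For shorter times the flow is a translation in the box and has left the transversal. *)
      assert (Hgap : r / 4 <= t2 - t).
      { apply Rnot_lt_le. intros Hlt.
        destruct (chart_flow F p r psi (Cim s) (t2 - t) HF Hc) as [A B].
        { rewrite Cmod_Cim, (Rabs_pos_eq (t2 - t)); lra. }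
        rewrite <- E in A, B. destruct (flow_plus F HF x0 t (t2 - t) HIt A) as [_ B'].
        rewrite B in B'. replace (t + (t2 - t)) with t2 in B' by ring. rewrite HX2 in B'.
        apply Hpi in B'.
        - rewrite Cim_pair, Cim_pair0 in B'. injection B' as B1 _. lra.
        - rewrite Cmod_Cim. lra.
        - eapply Rle_lt_trans; [apply Cmod_Cim_plus|]. rewrite (Rabs_pos_eq (t2 - t)); lra. }
      apply (IHn t1 t s1 s); auto; try lra. rewrite S_INR in Hn. lra.
    + apply (consecutive_run F x0 p r psi theta t1 t2 s1 s2); auto.
      intros t u Htt Hu E. apply Hno. exists t, u. auto.
Qed.

Lemma progression_hits v h sg e : 0 < h < e -> v < sg -> exists k, sg - e < v + INR k * h <= sg.
Proof.
  intros Hh Hv. destruct (nfloor_ex ((sg - v) / h)) as [k Hk].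
  - apply Rmult_le_pos; [lra|left; apply Rinv_0_lt_compat; lra].
  - exists k. destruct Hk as [K1 K2].
    apply (Rmult_le_compat_r h) in K1; [|lra]. apply (Rmult_lt_compat_r h) in K2; [|lra].
    replace ((sg - v) / h * h) with (sg - v) in K1, K2 by (field; lra). lra.
Qed.

(** * Boundary orbits and transversals *)

Section Boundary.
Variables (F : C -> C) (M : C -> Prop).
Hypothesis HF : differentiable F.
Hypothesis Mdom : planar_domain M.
Hypothesis Minv : flow_invariant F M.

Let Mopen : open M := proj1 Mdom.

Lemma boundary_orbit_not_in x z : boundary M x -> orbit F x z -> ~ M z.
Proof. intros Hx Hz. apply boundary_not_in; auto. now apply (boundary_orbit F M HF Minv x). Qed.

(** A nearby point of [M] is moved along the flow onto the transversal and stays in [M]. *)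
Lemma boundary_near_transversal p r psi s e : chart F p r psi -> 0 < e -> Rabs s + e < r -> boundary M (psi (Cim s)) ->
  exists s', Rabs (s' - s) < e /\ M (psi (Cim s')).
Proof.
  intros Hc He Hs Hb. pose proof Hc as (_ & _ & _ & _ & Ho).
  set (m := Rmin e ((r - Rabs s - e) / 4)).
  assert (Hm : 0 < m /\ m <= e /\ 4 * m <= r - Rabs s - e).
  { assert (0 < m) by (apply Rmin_glb_lt; lra).
    pose proof (Rmin_l e ((r - Rabs s - e) / 4)) as L1. pose proof (Rmin_r e ((r - Rabs s - e) / 4)) as L2. fold m in L1, L2. lra. }
  destruct (Ho (Cim s)) with (e := m) as [d [Hd K]]; [rewrite Cmod_Cim; lra|lra|].
  rewrite boundary_iff in Hb. destruct (Hb d Hd) as [(z & Hz & Mz) _].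
  destruct (K z Hz) as (w & Hw1 & Hw2 & <-). destruct w as [x s']. exists s'.
  assert (Hxs : Rabs x < m /\ Rabs (s' - s) < m).
  { pose proof (Rmax_Cmod ((x, s') - Cim s)%C) as R1. rewrite Cim_pair0 in R1. simpl in R1.
    pose proof (Rmax_l (Rabs (x + - 0)) (Rabs (s' + - s))). pose proof (Rmax_r (Rabs (x + - 0)) (Rabs (s' + - s))).
    rewrite Cim_pair0 in Hw2. replace (x + - 0) with x in * by ring. unfold Rminus. lra. }
  split; [lra|].
  assert (Hs' : Rabs s' < Rabs s + m).
  { pose proof (Rabs_triang (s' - s) s) as T. replace (s' - s + s) with s' in T by ring. lra. }
  destruct (chart_flow F p r psi (x, s') (- x) HF Hc) as [A B].
  - rewrite Rabs_Ropp, <- Cim_pair. pose proof (Cmod_Cim_plus s' x). lra.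
  - replace ((x, s') + RtoC (- x))%C with (Cim s') in B
      by (rewrite Cim_pair0; unfold RtoC, Cplus; simpl; f_equal; ring).
    rewrite <- B. now apply M_flow.
Qed.

(** A progression with small steps in the direction [dir] must land in a given interval of the
    half-transversal. If [M] meets that half, an interval inside [M] is avoided by boundary points;
    if not, any boundary point there would have points of [M] near it on the transversal. *)
Lemma no_long_run x0 p r psi (dir : R) : chart F p r psi -> boundary M x0 -> dir = 1 \/ dir = -1 ->
  exists theta, 0 < theta /\ forall s d, Rabs s < theta -> 0 < dir * d < 2 * theta ->
    ~ (forall k, Rabs (s + INR k * d) < r -> orbit F x0 (psi (Cim (s + INR k * d)))).
Proof.
  intros Hc Hb Hdir. pose proof Hc as (Hr & _ & Hd & _ & Ho).
  assert (Hd2 : dir * dir = 1) by (destruct Hdir as [-> | ->]; ring).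
  assert (Hda : forall v, Rabs (dir * v) = Rabs v).
  { intros v. destruct Hdir as [-> | ->]; [f_equal; ring|]. rewrite <- Rabs_Ropp. f_equal. ring. }
  (* An interval of length [e] on the side [dir] that no boundary orbit through [x0] can hit. *)
  assert (Hkey : exists sg e, 0 < e /\ e <= sg / 2 /\ sg < r /\
     forall v, sg - e < v <= sg -> ~ orbit F x0 (psi (Cim (dir * v)))).
  { destruct (classic (exists sg, 0 < sg < r /\ M (psi (Cim (dir * sg))))) as [(sg & Hsg & Hm)|Hno].
    - destruct (proj1 (open_Cmod M) Mopen _ Hm) as [d [Hd0 K]].
      assert (Hb0 : Cmod (Cim (dir * sg)) < r) by (rewrite Cmod_Cim, Hda, Rabs_pos_eq; lra).
      destruct (contC_of_derC _ _ _ (Hd _ Hb0) d Hd0) as [e [He Ke]].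
      exists sg, (Rmin e (sg / 2)). split; [apply Rmin_glb_lt; lra|]. split; [apply Rmin_r|]. split; [lra|].
      intros v Hv Horb. apply (boundary_orbit_not_in x0 _ Hb Horb). apply K, Ke.
      replace (Cim (dir * v) - Cim (dir * sg))%C with (Cim (dir * (v - sg)))
        by (unfold Cim; rewrite !RtoC_mult, RtoC_minus; ring).
      rewrite Cmod_Cim, Hda. pose proof (Rmin_l e (sg / 2)). apply Rabs_def1; lra.
    - exists (r / 2), (r / 4). split; [lra|]. split; [lra|]. split; [lra|]. intros v Hv Horb.
      assert (Hbv : boundary M (psi (Cim (dir * v)))) by (now apply (boundary_orbit F M HF Minv x0)).
      destruct (boundary_near_transversal p r psi (dir * v) (r / 8) Hc) as (s' & Hs' & Ms'); auto; [lra|rewrite Hda, Rabs_pos_eq; lra|].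
      apply Hno. exists (dir * s'). rewrite <- Rmult_assoc, Hd2, Rmult_1_l. split; auto.
      rewrite <- Hda in Hs'. replace (dir * (s' - dir * v)) with (dir * s' - (dir * dir) * v) in Hs' by ring.
      rewrite Hd2 in Hs'. apply Rabs_def2 in Hs'. lra. }
  destruct Hkey as (sg & e & He & Hes & Hsg & K).
  (* Steps below [2 theta = e] cannot jump over the interval, and starting points below
     [e / 2 <= sg / 4] lie before it. *)
  exists (e / 2). split; [lra|]. intros s d Hs Hdd Hrun.
  assert (Hv0 : dir * s < sg).
  { pose proof (Rle_abs (dir * s)). rewrite Hda in H. lra. }
  destruct (progression_hits (dir * s) (dir * d) sg e) as [k Hk]; [lra|lra|].
  replace (dir * s + INR k * (dir * d)) with (dir * (s + INR k * d)) in Hk by ring.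
  apply (K (dir * (s + INR k * d)) Hk). rewrite <- Rmult_assoc, Hd2, Rmult_1_l. apply Hrun.
  rewrite <- Hda. rewrite Rabs_pos_eq; lra.
Qed.

(** Two crossings of a short transversal would produce a run with small steps in one of the two
    directions, which [no_long_run] forbids. Unboundedness enters to make the crossing points
    distinct. *)
Lemma no_recurrence x0 p r psi : chart F p r psi -> boundary M x0 -> ~ bounded_set (orbit F x0) ->
  exists rho, 0 < rho <= r / 4 /\ forall t t' s s', max_interval F x0 t -> max_interval F x0 t' ->
    Rabs s < rho -> Rabs s' < rho -> flow F t x0 = psi (Cim s) -> flow F t' x0 = psi (Cim s') -> t = t'.
Proof.
  intros Hc Hb Hunb. pose proof Hc as (Hr & _).
  assert (Hinj : forall t t', max_interval F x0 t -> max_interval F x0 t' -> flow F t x0 = flow F t' x0 -> t = t').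
  { intros t t' H1 H2 E. destruct (Rtotal_order t t') as [h|[h|h]]; auto; exfalso; apply Hunb.
    - now apply (periodic_bounded F x0 t t').
    - now apply (periodic_bounded F x0 t' t). }
  destruct (no_long_run x0 p r psi 1 Hc Hb ltac:(auto)) as [th1 [Ht1 K1]].
  destruct (no_long_run x0 p r psi (-1) Hc Hb ltac:(auto)) as [th2 [Ht2 K2]].
  set (rho := Rmin (r / 4) (Rmin th1 th2)).
  assert (Hrho : 0 < rho /\ rho <= r / 4 /\ rho <= th1 /\ rho <= th2).
  { assert (0 < rho) by (repeat apply Rmin_glb_lt; lra).
    pose proof (Rmin_l (r / 4) (Rmin th1 th2)) as L1. pose proof (Rmin_r (r / 4) (Rmin th1 th2)) as L2.
    pose proof (Rmin_l th1 th2). pose proof (Rmin_r th1 th2). fold rho in L1, L2. lra. }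
  assert (Hno : ~ has_run F x0 psi r rho).
  { intros (s & d & Hs & Hd & Hrun). destruct (Rle_dec 0 d) as [h|h].
    - rewrite Rabs_pos_eq in Hd by lra. apply (K1 s d); auto; lra.
    - rewrite Rabs_left in Hd by lra. apply (K2 s d); auto; lra. }
  exists rho. split; [lra|]. intros t t' s s' H1 H2 Hs Hs' E E'.
  assert (Harch : forall u v, exists n, v - u < INR n * (r / 4)).
  { intros u v. destruct (INR_unbounded ((v - u) / (r / 4))) as [n Hn]. exists n.
    apply (Rmult_lt_compat_r (r / 4)) in Hn; [|lra]. replace ((v - u) / (r / 4) * (r / 4)) with (v - u) in Hn by (field; lra). lra. }
  destruct (Rtotal_order t t') as [h|[h|h]]; auto; exfalso; apply Hno.
  - destruct (Harch t t') as [n Hn]. apply (crossings_run F x0 p r psi rho n HF Hc ltac:(lra) Hinj t t' s s'); auto.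
  - destruct (Harch t' t) as [n Hn]. apply (crossings_run F x0 p r psi rho n HF Hc ltac:(lra) Hinj t' t s' s); auto.
Qed.

End Boundary.

(** * The ends of boundary orbits *)

Lemma heine_borel (G : (C -> Prop) -> Prop) (N : R) : 0 <= N ->
  (forall A B : C -> Prop, (forall z, A z -> B z) -> G B -> G A) ->
  (forall A B, G A -> G B -> G (fun z => A z \/ B z)) ->
  (forall z, exists d, 0 < d /\ G (fun w => Cmod (w - z) < d)) ->
  G (fun z => Cmod z <= N).
Proof.
  intros HN Hsub Huni Hloc.
  assert (Hxy : forall x y u v d, Rabs (u - x) < d / 2 -> Rabs (v - y) < d / 2 -> Cmod ((u, v) - (x, y)) < d).
  { intros x y u v d H1 H2. replace ((u, v) - (x, y))%C with (RtoC (u - x) + RtoC (v - y) * Ci)%C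
      by (unfold RtoC, Ci, Cminus, Cplus, Copp, Cmult; simpl; f_equal; ring).
    eapply Rle_lt_trans; [apply Cmod_triangle|]. rewrite Cmod_mult, Cmod_Ci, !Cmod_R. lra. }
  (* Two continuous inductions: along a vertical segment, keeping a strip of positive width, and
     then across the strips. *)
  assert (Hcol : forall x, exists d, 0 < d /\ G (fun w => Rabs (fst w - x) < d /\ - N <= snd w <= N)).
  { intros x.
    apply (interval_prop (fun y => exists d, 0 < d /\ G (fun w => Rabs (fst w - x) < d /\ - N <= snd w <= y)) (- N) N); [lra| |].
    - destruct (Hloc (x, - N)) as [d [Hd K]]. exists (d / 2). split; [lra|]. revert K. apply Hsub.
      intros [u v] [H1 H2]. simpl in H1, H2. apply Hxy; auto. replace (v - - N) with 0 by lra. rewrite Rabs_R0. lra.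
    - intros y Hy. destruct (Hloc (x, y)) as [d [Hd K]]. exists (d / 2). split; [lra|].
      intros s t Hs Ht Hsy Hty [d' [Hd' K']]. exists (Rmin d' (d / 2)). split; [apply Rmin_glb_lt; lra|].
      refine (Hsub _ _ _ (Huni _ _ K' K)). intros [u v] [H1 H2]. simpl in H1, H2.
      assert (L1 := Rlt_le_trans _ _ _ H1 (Rmin_l _ _)). assert (L2 := Rlt_le_trans _ _ _ H1 (Rmin_r _ _)).
      destruct (Rle_dec v s); [left; simpl; lra|right].
      apply Hxy; auto. apply Rabs_def2 in Hsy, Hty. apply Rabs_def1; lra. }
  assert (Hsq : G (fun w => - N <= fst w <= N /\ - N <= snd w <= N)).
  { apply (interval_prop (fun x => G (fun w => - N <= fst w <= x /\ - N <= snd w <= N)) (- N) N); [lra| |].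
    - destruct (Hcol (- N)) as [d [Hd K]]. revert K. apply Hsub. intros w [H1 H2]. split; auto.
      replace (fst w - - N) with 0 by lra. rewrite Rabs_R0. lra.
    - intros x Hx. destruct (Hcol x) as [d [Hd K]]. exists d. split; auto.
      intros s t Hs Ht Hsx Htx K'. refine (Hsub _ _ _ (Huni _ _ K' K)). intros w [H1 H2].
      destruct (Rle_dec (fst w) s); [left; lra|right]. split; auto.
      apply Rabs_def2 in Hsx, Htx. apply Rabs_def1; lra. }
  revert Hsq. apply Hsub. intros z Hz. pose proof (Rmax_Cmod z) as H.
  pose proof (Rmax_l (Rabs (fst z)) (Rabs (snd z))). pose proof (Rmax_r (Rabs (fst z)) (Rabs (snd z))).
  split; apply Rabs_le_between; lra.
Qed.

Definition fwd_limit (F : C -> C) (x a : C) : Prop := (forall t, 0 <= t -> max_interval F x t) /\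
  forall e, 0 < e -> exists T, 0 <= T /\ forall t, T <= t -> Cmod (flow F t x - a) < e.

(** Times range over the maximal interval only, so escape to infinity in finite time is included. *)
Definition fwd_escape (F : C -> C) (x : C) : Prop := forall rho, exists T, 0 <= T /\ max_interval F x T /\
  forall t, max_interval F x t -> T <= t -> rho < Cmod (flow F t x).

Section Ends.
Variables (F : C -> C) (M : C -> Prop).
Hypothesis HF : differentiable F.
Hypothesis Fnz : exists z, F z <> 0.
Hypothesis Mdom : planar_domain M.
Hypothesis Minv : flow_invariant F M.

Lemma mi_later x T : max_interval F x T -> exists T', T < T' /\ max_interval F x T'.
Proof.
  intros H. destruct (mi_open F HF x T H) as [d [Hd K]]. exists (T + d / 2). split; [lra|].
  apply K. rewrite Rabs_pos_eq; lra.
Qed.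

(** Every time spent close to [y] is close to a crossing of the transversal through [y], and by
    [no_recurrence] there is at most one crossing time. *)
Lemma visits x y : boundary M x -> ~ bounded_set (orbit F x) -> F y <> 0 ->
  exists t0, max_interval F x t0 /\ forall eta, 0 < eta -> exists d, 0 < d /\
    forall t, max_interval F x t -> Cmod (flow F t x - y) < d -> Rabs (t - t0) < eta.
Proof.
  intros Hb Hu Hy. destruct (chart_exists F y HF Hy) as (r & psi & Hc).
  destruct (no_recurrence F M HF Mdom Minv x y r psi Hc Hb Hu) as (rho & Hrho & Hno).
  pose proof Hc as (Hr & H0 & _ & _ & Ho).
  assert (Hcross : forall e, 0 < e <= rho -> exists d, 0 < d /\ forall t, max_interval F x t -> Cmod (flow F t x - y) < d ->
    exists u s, Rabs u < e /\ Rabs s < rho /\ max_interval F x (t - u) /\ flow F (t - u) x = psi (Cim s)).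
  { intros e He. destruct (Ho 0) with (e := e) as [d [Hd K]]; [rewrite Cmod_0; lra|lra|].
    exists d. split; auto. intros t Ht Hd'. rewrite <- H0 in Hd'. destruct (K _ Hd') as (w & Hw1 & Hw2 & Hw3).
    replace (w - 0)%C with w in Hw2 by ring. destruct w as [u s]. exists u, s.
    pose proof (Rmax_Cmod (u, s)) as R1. simpl in R1.
    pose proof (Rmax_l (Rabs u) (Rabs s)). pose proof (Rmax_r (Rabs u) (Rabs s)).
    split; [lra|]. split; [lra|].
    destruct (chart_flow F y r psi (u, s) (- u) HF Hc) as [A B]; [rewrite Rabs_Ropp; lra|].
    rewrite Hw3 in A, B. destruct (flow_plus F HF x t (- u) Ht A) as [A' B'].
    replace (t + - u) with (t - u) in A', B' by ring. split; auto. rewrite B', B. f_equal.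
    rewrite Cim_pair0. unfold RtoC, Cplus; simpl. f_equal; ring. }
  destruct (Hcross rho) as [d0 [Hd0 K0]]; [lra|].
  destruct (classic (exists t, max_interval F x t /\ Cmod (flow F t x - y) < d0)) as [(t & Ht & Htd)|Hno'].
  - destruct (K0 t Ht Htd) as (u & s & Hu1 & Hs & HI & E). exists (t - u). split; auto.
    intros eta Heta. destruct (Hcross (Rmin eta rho)) as [d [Hd K]]; [split; [apply Rmin_glb_lt; lra|apply Rmin_r]|].
    exists d. split; auto. intros t' Ht' Hd'. destruct (K t' Ht' Hd') as (u' & s' & Hu' & Hs' & HI' & E').
    rewrite (Hno (t - u) (t' - u') s s' HI HI' Hs Hs' E E').
    replace (t' - (t' - u')) with u' by ring. eapply Rlt_le_trans; [exact Hu'|apply Rmin_l].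
  (* No visit at all: any time would do. *)
  - exists 0. split; [now apply mi_0|]. intros eta _. exists d0. split; auto. intros t' Ht' Hd'. exfalso. eauto.
Qed.

Lemma eventually_off x y : boundary M x -> ~ bounded_set (orbit F x) -> F y <> 0 ->
  exists d, 0 < d /\ exists T, max_interval F x T /\ forall t, max_interval F x t -> T <= t -> d <= Cmod (flow F t x - y).
Proof.
  intros Hb Hu Hy. destruct (visits x y Hb Hu Hy) as (t0 & H0 & K).
  destruct (mi_later x t0 H0) as (T & HT & HTI). destruct (K (T - t0)) as [d [Hd Kd]]; [lra|].
  exists d. split; auto. exists T. split; auto. intros t Ht HTt. apply Rnot_lt_le. intros h.
  specialize (Kd t Ht h). apply Rabs_def2 in Kd. lra.
Qed.

Lemma mi_max x s t : max_interval F x s -> max_interval F x t -> max_interval F x (Rmax s t).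
Proof. intros. unfold Rmax. destruct (Rle_dec s t); auto. Qed.

(** The sets eventually left for good form an ideal. If every point has a neighbourhood in it, so do
    all discs by compactness, and the orbit escapes. Otherwise the orbit accumulates at some [a],
    which must be an equilibrium. *)
Lemma forward_end x : boundary M x -> ~ bounded_set (orbit F x) ->
  (exists a, F a = 0 /\ fwd_limit F x a) \/ fwd_escape F x.
Proof.
  intros Hb Hu.
  set (Ev := fun A : C -> Prop => exists T, max_interval F x T /\ forall t, max_interval F x t -> T <= t -> ~ A (flow F t x)).
  assert (Esub : forall A B : C -> Prop, (forall z, A z -> B z) -> Ev B -> Ev A).
  { intros A B HAB (T & HT & K). exists T. split; auto. intros t H1 H2 H3. apply (K t); auto. }
  assert (Euni : forall A B, Ev A -> Ev B -> Ev (fun z => A z \/ B z)).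
  { intros A B (T & HT & K) (T' & HT' & K'). exists (Rmax T T'). split; [now apply mi_max|].
    intros t H1 H2 [H3|H3]; [apply (K t)|apply (K' t)]; auto.
    - eapply Rle_trans; [apply Rmax_l|exact H2].
    - eapply Rle_trans; [apply Rmax_r|exact H2]. }
  assert (Hreg : forall y, F y <> 0 -> exists d, 0 < d /\ Ev (fun w => Cmod (w - y) < d)).
  { intros y Hy. destruct (eventually_off x y Hb Hu Hy) as (d & Hd & T & HT & K).
    exists d. split; auto. exists T. split; auto. intros t H1 H2 H3. specialize (K t H1 H2). lra. }
  destruct (classic (forall z, exists d, 0 < d /\ Ev (fun w => Cmod (w - z) < d))) as [Hall|Hex].
  - right. intros rho.
    destruct (heine_borel Ev (Rabs rho) (Rabs_pos rho) Esub Euni Hall) as (T & HT & K).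
    exists (Rmax 0 T). split; [apply Rmax_l|]. split; [apply mi_max; auto; now apply mi_0|].
    intros t Ht HTt. apply Rnot_le_lt. intros h. apply (K t Ht); [eapply Rle_trans; [apply Rmax_r|exact HTt]|].
    pose proof (Rle_abs rho). lra.
  - left. apply not_all_ex_not in Hex. destruct Hex as [a Ha]. exists a.
    assert (Fa : F a = 0) by (apply NNPP; intros h; apply Ha; now apply Hreg). split; auto.
    assert (Hacc : forall d T, 0 < d -> max_interval F x T -> exists t, max_interval F x t /\ T <= t /\ Cmod (flow F t x - a) < d).
    { intros d T Hd HT. apply NNPP. intros h. apply Ha. exists d. split; auto. exists T. split; auto.
      intros t H1 H2 H3. apply h. exists t. auto. }
    destruct (zeros_isolated F a HF Fnz Fa) as [r [Hr Kr]].
    assert (Hlim : forall e, 0 < e -> exists T, max_interval F x T /\ forall t, max_interval F x t -> T <= t -> Cmod (flow F t x - a) < e).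
    { intros e He. set (e' := Rmin e (r / 2)).
      assert (He' : 0 < e' /\ e' < r /\ e' <= e).
      { assert (0 < e') by (apply Rmin_glb_lt; lra). pose proof (Rmin_l e (r / 2)) as L1. pose proof (Rmin_r e (r / 2)) as L2.
        fold e' in L1, L2. lra. }
      (* A small circle around [a] carries only regular points, so by compactness it is eventually
         avoided; an orbit that comes back inside can then no longer leave. *)
      assert (Hcirc : Ev (fun z => Cmod (z - a) = e')).
      { assert (HH : Ev (fun z => Cmod z <= Cmod a + e' /\ Cmod (z - a) = e')).
        { apply (heine_borel (fun A => Ev (fun z => A z /\ Cmod (z - a) = e')) (Cmod a + e')).
          - pose proof (Cmod_ge_0 a). lra.
          - intros A B HAB. apply Esub. intros z [H1 H2]. auto.
          - intros A B HA HB. refine (Esub _ _ _ (Euni _ _ HA HB)). intros z [[H1|H1] H2]; auto.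
          - intros z. destruct (Req_dec (Cmod (z - a)) e') as [E|n].
            + destruct (Hreg z) as [d [Hd K]]; [apply Kr; lra|]. exists d. split; auto.
              revert K. apply Esub. tauto.
            + exists (Rabs (Cmod (z - a) - e')). split; [apply Rabs_pos_lt; lra|].
              exists 0. split; [now apply mi_0|]. intros t _ _ [H1 H2].
              pose proof (Cmod_tri (flow F t x) z a) as T1. pose proof (Cmod_tri z (flow F t x) a) as T2.
              rewrite (Cmod_sym z (flow F t x)) in T2.
              destruct (Rle_dec 0 (Cmod (z - a) - e')); [rewrite Rabs_pos_eq in H1 by auto|rewrite Rabs_left in H1 by lra]; lra. }
        revert HH. apply Esub. intros z Hz. split; auto.
        pose proof (Cmod_triangle (z - a) a) as T. replace (z - a + a)%C with z in T by ring. lra. }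
      destruct Hcirc as (T & HT & K).
      destruct (Hacc e' T ltac:(lra) HT) as (t0 & Ht0 & HTt0 & Hd0).
      exists t0. split; auto. intros t Ht Ht0t. eapply Rlt_le_trans; [|apply He'].
      apply Rnot_le_lt. intros h.
      destruct (continuum_path (fun s => flow F s x) t0 t Ht0t) as (_ & _ & IV).
      { intros s Hs. apply flow_cont; auto. apply (mi_conn F x t0 t); auto. }
      destruct (IV (fun z => Cmod (z - a))) with (u := flow F t0 x) (w := flow F t x) (v := e') as (q & (s & Hs & ->) & Eq).
      - intros w _ d Hd. exists d. split; auto. intros v _ Hv. pose proof (Cmod_tri v w a). pose proof (Cmod_tri w v a).
        rewrite (Cmod_sym w v) in H0. apply Rabs_def1; lra.
      - exists t0. split; [lra|auto].
      - exists t. split; [lra|auto].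
      - lra.
      - apply (K s); auto; [apply (mi_conn F x t0 t); auto|lra]. }
    assert (Hall : forall t, 0 <= t -> max_interval F x t).
    { destruct (Hlim 1) as (T & HT & K); [lra|]. set (T' := Rmax 0 T).
      assert (HT' : max_interval F x T') by (apply mi_max; auto; now apply mi_0).
      destruct (continuous_image_bounded F x 0 T' HF) as [N HN]; [apply Rmax_l|intros t Ht; apply (mi_conn0 F x T'); auto|].
      apply (bounded_forever F x (Rmax N (Cmod a + 1)) HF). intros t Ht HtI.
      destruct (Rle_dec t T') as [h|h].
      - eapply Rle_trans; [apply HN; lra|apply Rmax_l].
      - eapply Rle_trans; [|apply Rmax_r]. specialize (K t HtI). pose proof (Rmax_r 0 T). fold T' in H.
        pose proof (Cmod_rev (flow F t x) a). lra. }
    split; auto. intros e He. destruct (Hlim e He) as (T & HT & K). exists (Rmax 0 T). split; [apply Rmax_l|].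
    intros t Ht. pose proof (Rmax_l 0 T). pose proof (Rmax_r 0 T). apply K; [apply Hall; lra|lra].
Qed.

End Ends.

(** * Orbits attached to an equilibrium *)

Definition att (F : C -> C) (x a : C) : Prop := fwd_limit F x a \/ fwd_limit (fun z => - F z)%C x a.

Lemma fwd_limit_omega F x a v : fwd_limit F x a -> (omega_plus F x v <-> v = a).
Proof.
  intros [HI Hlim]. split.
  - intros (u & Hu & Hup & Huv). apply Cmod_small_eq. intros e He.
    destruct (Hlim (e / 2)) as (T & HT & K); [lra|].
    apply is_lim_seq_spec in Hup. specialize (Hup T).
    assert (HP : locally v (fun w => Cmod (w - v) < e / 2)).
    { apply locally_Cmod. exists (e / 2). split; [lra|auto]. }
    apply Huv in HP. destruct Hup as [n1 K1]. destruct HP as [n2 K2].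
    specialize (K1 (n1 + n2)%nat ltac:(lia)). specialize (K2 (n1 + n2)%nat ltac:(lia)).
    specialize (K _ (Rlt_le _ _ K1)).
    pose proof (Cmod_tri v (flow F (u (n1 + n2)%nat) x) a) as T1. rewrite Cmod_sym in K2. lra.
  - intros ->. exists INR. split; [intros k; apply HI, pos_INR|]. split; [apply is_lim_seq_INR|].
    intros P HP. apply locally_Cmod in HP. destruct HP as [e [He HP]].
    destruct (Hlim e He) as (T & HT & K). destruct (nfloor_ex T HT) as [n [_ Hn]].
    exists (S n). intros m Hm. apply HP, K. apply le_INR in Hm. rewrite S_INR in Hm. lra.
Qed.

Lemma omega_opp F x v : differentiable F -> (omega_minus F x v <-> omega_plus (fun z => - F z)%C x v).
Proof.
  intros HF. unfold omega_minus, omega_plus, limit_set. split.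
  - intros (u & Hu & Hup & Huv). exists (fun k => - u k). split; [intros k; now apply mi_opp|].
    split.
    + apply is_lim_seq_opp in Hup. exact Hup.
    + eapply filterlim_ext; [|exact Huv]. intros k. cbv beta. symmetry. now apply flow_opp.
  - intros (u & Hu & Hup & Huv).
    assert (HI : forall k, max_interval F x (- u k)).
    { intros k. specialize (Hu k). apply mi_opp in Hu. rewrite opp_opp_fun in Hu. exact Hu. }
    exists (fun k => - u k). split; [exact HI|]. split.
    + apply is_lim_seq_opp in Hup. exact Hup.
    + eapply filterlim_ext; [|exact Huv]. intros k. cbv beta.
      rewrite <- (flow_opp F x (- u k) HF (HI k)). now rewrite Ropp_involutive.
Qed.

(** [att] asserts convergence, with existence for all times at that end, while [attached] speaks of
    the limit set only. *)
Lemma att_attached F x a : differentiable F -> att F x a -> attached F x a.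
Proof.
  intros HF [H|H]; [left|right]; intros v.
  - now apply fwd_limit_omega.
  - rewrite omega_opp by exact HF. now apply fwd_limit_omega.
Qed.

Lemma flow_invariant_opp F M : differentiable F -> flow_invariant F M -> flow_invariant (fun z => - F z)%C M.
Proof. intros HF H x Hx z Hz. rewrite orbit_opp in Hz by exact HF. now apply (H x Hx). Qed.

Lemma fwd_limit_unique F x a b : fwd_limit F x a -> fwd_limit F x b -> a = b.
Proof.
  intros Ha Hb. apply (fwd_limit_omega F x b a Hb). now apply (fwd_limit_omega F x a a Ha).
Qed.

Lemma fwd_limit_bounded F x a : differentiable F -> fwd_limit F x a ->
  exists N, forall t, 0 <= t -> Cmod (flow F t x) <= N.
Proof.
  intros HF [HI Hlim]. destruct (Hlim 1) as (T & HT & K); [lra|].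
  destruct (continuous_image_bounded F x 0 T HF HT) as [N HN]; [intros t Ht; apply HI; lra|].
  exists (Rmax N (Cmod a + 1)). intros t Ht. destruct (Rle_dec t T).
  - eapply Rle_trans; [apply HN; lra|apply Rmax_l].
  - eapply Rle_trans; [|apply Rmax_r]. specialize (K t ltac:(lra)). pose proof (Cmod_rev (flow F t x) a). lra.
Qed.

Lemma two_limits_bounded F x a b : differentiable F -> fwd_limit F x a -> fwd_limit (fun z => - F z)%C x b ->
  bounded_set (orbit F x).
Proof.
  intros HF Ha Hb. destruct (fwd_limit_bounded F x a HF Ha) as [N1 K1].
  destruct (fwd_limit_bounded _ x b (differentiable_opp F HF) Hb) as [N2 K2].
  exists (Rmax N1 N2). intros z [t [Ht ->]]. destruct (Rle_dec 0 t).
  - eapply Rle_trans; [apply K1; auto|apply Rmax_l].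
  - eapply Rle_trans; [|apply Rmax_r]. rewrite <- (flow_opp F x t HF Ht). apply K2. lra.
Qed.

Lemma att_unique F x a b : differentiable F -> ~ bounded_set (orbit F x) -> att F x a -> att F x b -> a = b.
Proof.
  intros HF Hu [Ha|Ha] [Hb|Hb].
  - eapply fwd_limit_unique; eauto.
  - exfalso. apply Hu. eapply two_limits_bounded; eauto.
  - exfalso. apply Hu. eapply two_limits_bounded; eauto.
  - eapply fwd_limit_unique; eauto.
Qed.

(** The orbit exists for all negative times but may blow up in finite positive time, so its interval
    is reparametrized by the whole line. *)
Lemma end_arc_of_escape F M x a : differentiable F -> planar_domain M -> flow_invariant F M ->
  boundary M x -> F x <> 0 -> F a = 0 -> fwd_limit (fun z => - F z)%C x a -> fwd_escape F x ->
  exists y, end_arc M a y /\ forall u, orbit F x (y u).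
Proof.
  intros HF Hdom Hinv Hb Hx Fa [HI Hlim] Hesc.
  assert (HIm : forall t, t <= 0 -> max_interval F x t).
  { intros t Ht. specialize (HI (- t) ltac:(lra)). apply mi_opp in HI. rewrite opp_opp_fun, Ropp_involutive in HI. exact HI. }
  assert (Hlim' : forall e, 0 < e -> exists T, forall t, t < T -> Cmod (flow F t x - a) < e).
  { intros e He. destruct (Hlim e He) as (T & HT & K). exists (- T). intros t Ht.
    rewrite <- (flow_opp F x t HF) by (apply HIm; lra). apply K. lra. }
  assert (Hg : exists g : R -> R, (forall u, max_interval F x (g u)) /\ (forall u, continuity_pt g u) /\
    (forall T, exists U, forall u, u < U -> g u < T) /\
    (forall T, max_interval F x T -> exists U, forall u, U < u -> T <= g u)).
  { destruct (classic (forall t, max_interval F x t)) as [Hall|Hno].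
    - exists (fun u => u). split; [auto|]. split; [intros u; apply derivable_continuous_pt, derivable_pt_id|].
      split; intros T; [|intros _]; exists T; intros; lra.
    - apply not_all_ex_not in Hno. destruct Hno as [T1 HT1].
      assert (Hub : forall t, max_interval F x t -> t < T1).
      { intros t Ht. apply Rnot_le_lt. intros h. apply HT1. destruct (Rle_dec 0 T1).
        - apply (mi_conn0 F x t); auto.
        - apply HIm; lra. }
      destruct (completeness (max_interval F x)) as [b [Hu Hl]].
      + exists T1. intros t Ht. specialize (Hub t Ht). lra.
      + exists 0. now apply mi_0.
      + assert (Hlt : forall t, max_interval F x t <-> t < b).
        { intros t. split; intros Ht.
          - destruct (mi_open F HF x t Ht) as [d [Hd K]].
            assert (t + d / 2 <= b); [|lra]. apply Hu, K. rewrite Rabs_pos_eq; lra.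
          - apply NNPP. intros Hn. assert (b <= t); [|lra]. apply Hl. intros s Hs.
            apply Rnot_lt_le. intros h. apply Hn. destruct (Rle_dec 0 t).
            + apply (mi_conn0 F x s); auto; lra.
            + apply HIm; lra. }
        (* An increasing map of the line onto the half-line below [b]. *)
        exists (fun u => b - exp (- u)). split; [intros u; apply Hlt; pose proof (exp_pos (- u)); lra|]. split; [|split].
        * intros u. apply derivable_continuous_pt. exists (exp (- u)).
          apply is_derive_Reals. auto_derive; [auto|ring].
        * intros T. exists (- (b - T)). intros u Hu'. pose proof (exp_ineq1_le (- u)). lra.
        * intros T HT. apply Hlt in HT. exists (- ln (b - T)). intros u Hu'.
          assert (exp (- u) <= b - T); [|lra].
          rewrite <- (exp_ln (b - T)) by lra. left. apply exp_increasing. lra. }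
  destruct Hg as (g & Hg1 & Hg2 & Hg3 & Hg4).
  exists (fun u => flow F (g u) x). split; [|intros u; now apply orbit_flow].
  split; [|split; [|split; [|split; [|split]]]].
  - intros u e He. destruct (flow_cont F HF x (g u) (Hg1 u) e He) as [d [Hd K]].
    destruct (Hg2 u d Hd) as [d' [Hd' K']]. exists d'. split; auto. intros s Hs. apply K.
    destruct (Req_dec s u) as [->|n]; [rewrite Rminus_diag, Rabs_R0; auto|].
    apply (K' s). split; [split; [exact I|congruence]|exact Hs].
  - intros u E. apply (orbit_nonzero F HF x (flow F (g u) x)); auto; [now apply orbit_flow|]. now rewrite E.
  - intros u. apply (boundary_orbit_not_in F M HF Hdom Hinv x); auto. now apply orbit_flow.
  - intros e He. destruct (Hlim' e He) as [T K]. destruct (Hg3 T) as [U KU]. exists U. auto.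
  - intros rho. destruct (Hesc rho) as (T & _ & HT & K). destruct (Hg4 T HT) as [U KU]. exists U. auto.
  - intros e He. pose proof (boundary_flow F M HF Hinv x (g 0) Hb (Hg1 0)) as Hb0.
    rewrite boundary_iff in Hb0. destruct (Hb0 e He) as [(m & H1 & H2) _]. exists m. auto.
Qed.

Section Attached.
Variables (F : C -> C) (M : C -> Prop).
Hypothesis HF : differentiable F.
Hypothesis Fnz : exists z, F z <> 0.
Hypothesis Mdom : planar_domain M.
Hypothesis Minv : flow_invariant F M.
Hypothesis Munb : forall x, boundary M x -> F x <> 0 -> ~ bounded_set (orbit F x).

Lemma opp_nz : exists z, (- F z)%C <> 0.
Proof.
  destruct Fnz as [z Hz]. exists z. intros E. apply Hz. transitivity (- - F z)%C; [ring|]. rewrite E. ring.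
Qed.

Lemma backward_end x : boundary M x -> F x <> 0 ->
  (exists a, F a = 0 /\ fwd_limit (fun z => - F z)%C x a) \/ fwd_escape (fun z => - F z)%C x.
Proof.
  intros Hb Hx.
  destruct (forward_end (fun z => - F z)%C M (differentiable_opp F HF) opp_nz Mdom (flow_invariant_opp F M HF Minv) x Hb)
    as [(a & Fa & Ha)|H]; [now rewrite orbit_opp by exact HF; apply Munb| |auto].
  left. exists a. split; auto. transitivity (- - F a)%C; [ring|]. rewrite Fa. ring.
Qed.

Lemma att_end_arc x a : boundary M x -> F x <> 0 -> F a = 0 -> att F x a ->
  exists y, end_arc M a y /\ forall u, orbit F x (y u).
Proof.
  intros Hb Hx Fa [Ha|Ha].
  - assert (Ha' := Ha). rewrite <- (opp_opp_fun F) in Ha'.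
    destruct (end_arc_of_escape (fun z => - F z)%C M x a) as (y & Hy1 & Hy2); auto.
    + now apply differentiable_opp.
    + now apply flow_invariant_opp.
    + intros E. apply Hx. transitivity (- - F x)%C; [ring|]. rewrite E. ring.
    + rewrite Fa. ring.
    + destruct (backward_end x Hb Hx) as [(b & Fb & Hb')|H]; auto.
      exfalso. apply (Munb x Hb Hx). eapply two_limits_bounded; eauto.
    + exists y. split; auto. intros u. rewrite <- (orbit_opp F x HF). apply Hy2.
  - apply (end_arc_of_escape F M x a); auto.
    destruct (forward_end F M HF Fnz Mdom Minv x Hb (Munb x Hb Hx)) as [(b & Fb & Hb')|H]; auto.
    exfalso. apply (Munb x Hb Hx). eapply two_limits_bounded; eauto.
Qed.

Lemma att_zero x a : boundary M x -> F x <> 0 -> att F x a -> F a = 0.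
Proof.
  intros Hb Hx [Ha|Ha].
  - destruct (forward_end F M HF Fnz Mdom Minv x Hb (Munb x Hb Hx)) as [(b & Fb & Hb')|H].
    + now rewrite (fwd_limit_unique F x a b Ha Hb').
    + exfalso. destruct (fwd_limit_bounded F x a HF Ha) as [N HN]. destruct (H N) as (T & HT & HTI & K).
      specialize (K T HTI ltac:(lra)). specialize (HN T HT). lra.
  - destruct (backward_end x Hb Hx) as [(b & Fb & Hb')|H].
    + now rewrite (fwd_limit_unique _ x a b Ha Hb').
    + exfalso. destruct (fwd_limit_bounded _ x a (differentiable_opp F HF) Ha) as [N HN]. destruct (H N) as (T & HT & HTI & K).
      specialize (K T HTI ltac:(lra)). specialize (HN T HT). lra.
Qed.

Lemma fwd_limit_boundary G x a : differentiable G -> flow_invariant G M -> boundary M x -> fwd_limit G x a -> boundary M a.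
Proof.
  intros HG Ginv Hb [HI Hlim]. apply boundary_closed. intros d Hd. destruct (Hlim d Hd) as (T & HT & K).
  exists (flow G T x). split; [apply K; lra|]. apply boundary_flow; auto.
Qed.

Lemma att_boundary x a : boundary M x -> att F x a -> boundary M a.
Proof.
  intros Hb [Ha|Ha].
  - eapply fwd_limit_boundary; eauto.
  - eapply (fwd_limit_boundary (fun z => - F z)%C); eauto using differentiable_opp, flow_invariant_opp.
Qed.

Lemma at_most_two_attached a x1 x2 x3 : boundary M x1 -> boundary M x2 -> boundary M x3 ->
  F x1 <> 0 -> F x2 <> 0 -> F x3 <> 0 -> att F x1 a -> att F x2 a -> att F x3 a ->
  orbit F x1 <> orbit F x2 -> orbit F x2 <> orbit F x3 -> orbit F x1 <> orbit F x3 -> False.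
Proof.
  intros B1 B2 B3 N1 N2 N3 A1 A2 A3 D12 D23 D13.
  assert (Fa := att_zero x1 a B1 N1 A1).
  assert (HMa : ~ M a) by (apply boundary_not_in; [apply Mdom|now apply (att_boundary x1)]).
  destruct (att_end_arc x1 a B1 N1 Fa A1) as (y1 & E1 & O1).
  destruct (att_end_arc x2 a B2 N2 Fa A2) as (y2 & E2 & O2).
  destruct (att_end_arc x3 a B3 N3 Fa A3) as (y3 & E3 & O3).
  assert (Hd : forall x x' y y', (forall u, orbit F x (y u)) -> (forall u, orbit F x' (y' u)) -> orbit F x <> orbit F x' ->
     forall t u : R, y t <> y' u).
  { intros x x' y y' H H' Hn t u E. apply Hn. rewrite (orbit_eq F HF _ _ (H t)), (orbit_eq F HF _ _ (H' u)). now rewrite E. }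
  apply (three_arcs M a y1 y2 y3); auto.
  - now apply (Hd x1 x2).
  - now apply (Hd x2 x3).
  - now apply (Hd x1 x3).
Qed.

(** A limit point off the orbit comes from one of its ends, since the part over a compact time
    interval is closed. An end that escapes or converges elsewhere stays away from [y]. *)
Lemma closure_orbit x y : boundary M x -> F x <> 0 -> ~ orbit F x y ->
  (forall d, 0 < d -> exists z, orbit F x z /\ Cmod (z - y) < d) -> att F x y.
Proof.
  intros Hb Hx Hy Hcl.
  assert (Hend : forall G, differentiable G ->
    ((exists a, G a = 0 /\ fwd_limit G x a) \/ fwd_escape G x) -> fwd_limit G x y \/
    exists d T, 0 < d /\ 0 <= T /\ max_interval G x T /\ forall t, max_interval G x t -> T <= t -> d <= Cmod (flow G t x - y)).
  { intros G HG [(a & Ga & [HI Hlim])|H].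
    - destruct (classic (a = y)) as [->|n]; [left; split; auto|right].
      assert (Hd : 0 < Cmod (a - y)) by now apply Cmod_minus_gt0.
      destruct (Hlim (Cmod (a - y) / 2)) as (T & HT & K); [lra|]. exists (Cmod (a - y) / 2), T.
      split; [lra|]. split; [auto|]. split; [now apply HI|]. intros t _ Ht. specialize (K t Ht).
      pose proof (Cmod_tri a (flow G t x) y) as T1. rewrite (Cmod_sym a (flow G t x)) in T1. lra.
    - right. destruct (H (Cmod y + 1)) as (T & HT & HTI & K). exists 1, T. split; [lra|]. split; [auto|]. split; [auto|].
      intros t Ht HTt. specialize (K t Ht HTt). pose proof (Cmod_rev (flow G t x) y). lra. }
  destruct (Hend F HF (forward_end F M HF Fnz Mdom Minv x Hb (Munb x Hb Hx))) as [H|(d1 & T1 & Hd1 & HT1 & HI1 & K1)]; [now left|].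
  destruct (Hend (fun z => - F z)%C (differentiable_opp F HF)) as [H|(d2 & T2 & Hd2 & HT2 & HI2 & K2)].
  { destruct (backward_end x Hb Hx) as [(a & Fa & Ha)|H]; [left; exists a; split; auto; rewrite Fa; ring|now right]. }
  { now right. }
  exfalso. assert (HI2' : max_interval F x (- T2)) by (apply mi_opp in HI2; rewrite opp_opp_fun in HI2; exact HI2).
  assert (Hmid : forall t, - T2 <= t <= T1 -> max_interval F x t) by (intros; apply (mi_conn F x (- T2) T1); auto).
  destruct (continuum_path (fun t => flow F t x) (- T2) T1) as [Hf _]; [lra|intros t Ht; apply flow_cont; auto|].
  destruct (Hf y) as [d3 [Hd3 K3]].
  { intros (t & Ht & E). apply Hy. exists t. auto. }
  destruct (Hcl (Rmin d1 (Rmin d2 d3))) as (z & (t & Ht & ->) & Hz); [repeat apply Rmin_glb_lt; auto|].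
  assert (L1 : Cmod (flow F t x - y) < d1) by (eapply Rlt_le_trans; [exact Hz|apply Rmin_l]).
  assert (L2 : Cmod (flow F t x - y) < d2) by (eapply Rlt_le_trans; [exact Hz|eapply Rle_trans; [apply Rmin_r|apply Rmin_l]]).
  assert (L3 : Cmod (flow F t x - y) < d3) by (eapply Rlt_le_trans; [exact Hz|eapply Rle_trans; [apply Rmin_r|apply Rmin_r]]).
  destruct (Rle_dec T1 t) as [h|h]; [specialize (K1 t Ht h); lra|].
  destruct (Rle_dec t (- T2)) as [h'|h'].
  - specialize (K2 (- t) (mi_opp F x t Ht) ltac:(lra)). rewrite (flow_opp F x t HF Ht) in K2. lra.
  - specialize (K3 (flow F t x) ltac:(exists t; split; [lra|auto])). lra.
Qed.

End Attached.

(** * Countability *)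

Definition coded {T : Type} (S : T -> Prop) : Prop := exists R : nat -> T -> Prop,
  (forall a, S a -> exists n, R n a) /\ (forall n a b, S a -> S b -> R n a -> R n b -> a = b).

(** Up to here a code is a relation, so elements may have several codes; one is chosen only at this
    point. *)
Lemma coded_countable {T : Type} (S : T -> Prop) : coded S -> at_most_countable S.
Proof.
  intros (R & H1 & H2).
  assert (H : forall a, exists n, S a -> R n a).
  { intros a. destruct (classic (S a)) as [Ha|Ha].
    - destruct (H1 a Ha) as [n Hn]. exists n; auto.
    - exists O; tauto. }
  apply choice in H. destruct H as [f Hf]. exists f. intros a b Ha Hb E.
  apply (H2 (f a)); auto. rewrite E. auto.
Qed.

Lemma coded_union {T : Type} (S1 S2 : T -> Prop) : coded S1 -> coded S2 -> coded (fun a => S1 a \/ S2 a).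
Proof.
  intros (R1 & A1 & B1) (R2 & A2 & B2).
  exists (fun n a => (fst (of_nat n) = 0%nat /\ S1 a /\ R1 (snd (of_nat n)) a) \/
                     (fst (of_nat n) = 1%nat /\ S2 a /\ R2 (snd (of_nat n)) a)). split.
  - intros a [Ha|Ha].
    + destruct (A1 a Ha) as [n Hn]. exists (to_nat (0%nat, n)). rewrite cancel_of_to. auto.
    + destruct (A2 a Ha) as [n Hn]. exists (to_nat (1%nat, n)). rewrite cancel_of_to. auto.
  - intros n a b _ _ [(E & Ha & Ra)|(E & Ha & Ra)] [(E' & Hb & Rb)|(E' & Hb & Rb)]; try congruence; eauto.
Qed.

Lemma coded_sub {T : Type} (S1 S2 : T -> Prop) : (forall a, S1 a -> S2 a) -> coded S2 -> coded S1.
Proof. intros H (R & A & B). exists R. split; eauto. Qed.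

(** All rationals [(p - q) / (k + 1)], listed with repetitions through the Cantor pairing. *)
Definition dense_R (n : nat) : R :=
  (INR (fst (of_nat n)) - INR (fst (of_nat (snd (of_nat n))))) / (INR (snd (of_nat (snd (of_nat n)))) + 1).

Lemma dense_R_spec x e : 0 < e -> exists n, Rabs (dense_R n - x) < e.
Proof.
  intros He. destruct (INR_unbounded (/ e)) as [k Hk].
  assert (Hie : 0 < / e) by now apply Rinv_0_lt_compat.
  destruct (INR_unbounded (Rabs (x * (INR k + 1)))) as [m Hm].
  set (y := x * (INR k + 1) + INR m).
  assert (Hy : 0 <= y).
  { unfold y. pose proof (Rle_abs (- (x * (INR k + 1)))). rewrite Rabs_Ropp in H. lra. }
  destruct (nfloor_ex y Hy) as [n Hn].
  exists (to_nat (n, to_nat (m, k))). unfold dense_R. repeat (rewrite cancel_of_to; cbn [fst snd]).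
  replace ((INR n - INR m) / (INR k + 1) - x) with (- ((y - INR n) / (INR k + 1))) by (unfold y; field; lra).
  rewrite Rabs_Ropp, Rabs_pos_eq.
  - apply Rmult_lt_reg_r with (INR k + 1); [lra|]. unfold Rdiv. rewrite Rmult_assoc, Rinv_l by lra.
    assert (1 < e * (INR k + 1)).
    { apply (Rmult_lt_compat_l e) in Hk; [|lra]. rewrite Rinv_r in Hk by lra. lra. }
    lra.
  - apply Rmult_le_pos; [lra|]. left. apply Rinv_0_lt_compat. lra.
Qed.

Definition dense_C (n : nat) : C := (dense_R (fst (of_nat n)), dense_R (snd (of_nat n))).

Lemma dense_C_spec z e : 0 < e -> exists n, Cmod (dense_C n - z) < e.
Proof.
  intros He. destruct z as [x y].
  destruct (dense_R_spec x (e / 2)) as [n Hn]; [lra|]. destruct (dense_R_spec y (e / 2)) as [m Hm]; [lra|].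
  exists (to_nat (n, m)). unfold dense_C. rewrite cancel_of_to. simpl fst; simpl snd.
  replace ((dense_R n, dense_R m) - (x, y))%C with (RtoC (dense_R n - x) + RtoC (dense_R m - y) * Ci)%C
    by (unfold RtoC, Ci, Cminus, Cplus, Copp, Cmult; simpl; f_equal; ring).
  eapply Rle_lt_trans; [apply Cmod_triangle|]. rewrite Cmod_mult, Cmod_Ci, !Cmod_R. lra.
Qed.

(** An isolated point is the only one of [E] in some disc with centre in the dense sequence and
    radius [1 / (k + 1)]. *)
Lemma coded_isolated (E : C -> Prop) :
  (forall a, E a -> exists r, 0 < r /\ forall z, 0 < Cmod (z - a) < r -> ~ E z) -> coded E.
Proof.
  intros Hiso.
  exists (fun n a => Cmod (a - dense_C (fst (of_nat n))) < / (INR (snd (of_nat n)) + 1) /\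
     forall z, E z -> Cmod (z - dense_C (fst (of_nat n))) < / (INR (snd (of_nat n)) + 1) -> z = a). split.
  - intros a Ha. destruct (Hiso a Ha) as [r [Hr K]].
    (* The radius must be below [r / 2], because two points of the disc can be almost a diameter
       apart. *)
    destruct (INR_unbounded (2 / r)) as [k Hk].
    assert (Hk0 : 0 < 2 / r) by (apply Rdiv_lt_0_compat; lra).
    set (d := / (INR k + 1)). assert (Hd : 0 < d) by (apply Rinv_0_lt_compat; lra).
    assert (Hdr : 2 * d < r).
    { unfold d. apply Rmult_lt_reg_r with (INR k + 1); [lra|]. rewrite Rmult_assoc, Rinv_l by lra.
      apply (Rmult_lt_compat_l r) in Hk; [|lra]. replace (r * (2 / r)) with 2 in Hk by (field; lra). lra. }
    destruct (dense_C_spec a d Hd) as [n Hn].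
    exists (to_nat (n, k)). rewrite cancel_of_to. simpl fst; simpl snd. fold d. split.
    + now rewrite Cmod_sym.
    + intros z Hz Hzd. apply NNPP. intros Hne. apply (K z); auto. split; [now apply Cmod_minus_gt0|].
      pose proof (Cmod_tri z (dense_C n) a). lra.
  - intros n a b Ha Hb [H1 H2] [H3 H4]. symmetry. now apply H2.
Qed.

(** * Enumeration of the boundary orbits *)

Section Count.
Variables (F : C -> C) (M : C -> Prop).
Hypothesis HF : differentiable F.
Hypothesis Fnz : exists z, F z <> 0.
Hypothesis Mdom : planar_domain M.
Hypothesis Minv : flow_invariant F M.
Hypothesis Munb : forall x, boundary M x -> F x <> 0 -> ~ bounded_set (orbit F x).

(** The escaping half-orbit leaves every disc containing [A]; far out there is a branch, and it is
    transported back along the orbit. *)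
Lemma far_bounded_escape G x A : differentiable G -> fwd_escape G x -> continuum A -> forall h, 0 < h -> max_interval G x h ->
  (forall t, max_interval G x t -> h <= t -> ~ A (flow G t x)) -> has_arg A (flow G h x).
Proof.
  intros HG Hesc (Hfar & [rho Hrho] & _) h Hh HI Hoff.
  destruct (Hesc rho) as (T & HT & HTI & K).
  set (T' := Rmax h T). assert (HT' : max_interval G x T') by (apply mi_max; auto).
  assert (HhT : h <= T' /\ T <= T') by (split; [apply Rmax_l|apply Rmax_r]).
  assert (Hmid : forall t, h <= t <= T' -> max_interval G x t) by (intros; apply (mi_conn G x h T'); auto).
  apply (has_arg_path A (fun t => flow G t x) h T'); [lra| | |].
  - intros t Ht. apply flow_cont; auto.
  - intros t Ht. apply Hfar, Hoff; [auto|lra].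
  - apply (has_arg_far A _ rho); auto. apply K; [auto|lra].
Qed.

(* If [M] touched the orbit from both sides, then a path in [M] closed up by a
   transversal segment would separate the two ends of the orbit, although both
   go to infinity. *)
Lemma one_sided x r psi rho : chart F x r psi -> boundary M x -> F x <> 0 -> fwd_escape F x ->
  fwd_escape (fun z => - F z)%C x -> 0 < rho <= r / 4 ->
  (forall t t' s s', max_interval F x t -> max_interval F x t' ->
    Rabs s < rho -> Rabs s' < rho -> flow F t x = psi (Cim s) -> flow F t' x = psi (Cim s') -> t = t') ->
  forall s s', 0 < s < rho -> - rho < s' < 0 -> M (psi (Cim s)) -> M (psi (Cim s')) -> False.
Proof.
  intros Hc Hb Hx He1 He2 Hrho Hno s s' Hs Hs' Ms Ms'.
  pose proof Hc as (Hr & H0 & Hd & Hinj & _).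
  destruct (domain_continuum M _ _ Mdom Ms' Ms) as (A & NA & IA & As' & As).
  set (c := fun u => psi (Cim u)).
  assert (Ecim0 : Cim 0 = 0) by (unfold Cim; ring).
  assert (Hder : forall u, Rabs u < r -> derR c u (Cim 1 * F (c u))%C).
  { intros u Hu. apply (derR_comp psi Cim).
    - apply Hd. now rewrite Cmod_Cim.
    - apply (derR_ext (fun u => Cim (0 + u * 1))); [intros; f_equal; ring|]. apply derR_Cim. }
  assert (Hc0 : c 0 = x) by (unfold c; now rewrite Ecim0).
  assert (HnM : forall t, max_interval F x t -> ~ A (flow F t x)).
  { intros t Ht HA. apply (boundary_orbit_not_in F M HF Mdom Minv x (flow F t x)); auto. now apply orbit_flow. }
  assert (Hcont : contI c s' s).
  { intros u Hu. eapply contR_of_derR, Hder. apply Rabs_def1; lra. }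
  (* Here the transversal is the crossed curve, with velocity [v = i F], and the orbit crosses it
     with velocity [F = (-1) i v]. *)
  destruct (jump A c s' s 0 (Cim 1 * F x)%C (fun t => flow F t x) (-1)) as [eta0 [He0 K]]; auto.
  - lra.
  - rewrite <- Hc0. apply Hder. rewrite Rabs_R0. lra.
  - apply Cmod_gt_0. rewrite Cmod_mult, Cmod_Cim, Rabs_R1. apply Cmod_gt_0 in Hx. lra.
  - intros u Hu Hn E. apply Hinj in E.
    + rewrite !Cim_pair0 in E. injection E as E. lra.
    + rewrite Cmod_Cim. apply Rabs_def1; lra.
    + rewrite Cmod_Cim, Rabs_R0. lra.
  - rewrite Hc0, <- (flow_0 F HF x). apply HnM. now apply mi_0.
  - lra.
  - eapply derR_eq; [apply flow_der; auto; now apply mi_0|]. rewrite flow_0 by auto. unfold Cim.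
    transitivity (- (Ci * Ci) * F x)%C; [|replace (RtoC (-1)) with (- RtoC 1)%C by (unfold RtoC, Copp; simpl; f_equal; ring); ring].
    replace (Ci * Ci)%C with (- (1))%C by (unfold Ci, RtoC, Cmult, Copp; simpl; f_equal; ring). ring.
  - now rewrite flow_0, Hc0.
  - set (A' := fun z => A z \/ path_image c s' s z).
    assert (NA' : continuum A').
    { apply (continuum_union _ _ (c s)); auto.
      - apply continuum_path; [lra|auto].
      - exists s. split; [lra|auto]. }
    (* By [Hno] the orbit meets the transversal at time 0 only, and it never meets [M]. *)
    assert (Hoff : forall t, max_interval F x t -> t <> 0 -> ~ A' (flow F t x)).
    { intros t Ht Hn [H|(u & Hu & E)]; [now apply (HnM t)|]. apply Hn.
      apply (Hno t 0 u 0); auto; [now apply mi_0|apply Rabs_def1; lra|rewrite Rabs_R0; lra|].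
      rewrite flow_0 by auto. symmetry. exact Hc0. }
    destruct (mi_open F HF x 0 (mi_0 F HF x)) as [d [Hd0 Kd]].
    set (h := Rmin (eta0 / 2) (d / 2)).
    assert (Hh : 0 < h /\ h < eta0 /\ h < d).
    { assert (0 < h) by (apply Rmin_glb_lt; lra). pose proof (Rmin_l (eta0 / 2) (d / 2)) as L1. pose proof (Rmin_r (eta0 / 2) (d / 2)) as L2.
      fold h in L1, L2. lra. }
    assert (HI1 : max_interval F x h) by (apply Kd; rewrite Rminus_0_r, Rabs_pos_eq; lra).
    assert (HI2 : max_interval F x (- h)) by (apply Kd; rewrite Rminus_0_r, Rabs_left; lra).
    apply (K h); [lra|]. split.
    + apply (far_bounded_escape F x A'); auto; [lra|]. intros t Ht Hht. apply Hoff; [auto|lra].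
    + assert (HI2' := mi_opp F x _ HI2). rewrite Ropp_involutive in HI2'.
      assert (E := flow_opp F x (- h) HF HI2). rewrite Ropp_involutive in E. fold A'. rewrite <- E.
      apply (far_bounded_escape _ x A'); auto; [now apply differentiable_opp|lra|].
      intros t Ht Hht. assert (Ht' := Ht). apply mi_opp in Ht'. rewrite opp_opp_fun in Ht'.
      assert (E' := flow_opp F x (- t) HF Ht'). rewrite Ropp_involutive in E'. rewrite E'. apply Hoff; [auto|lra].
Qed.

(** Two dense points code an orbit: the one through the first boundary point on the segment between
    them. *)
Definition first_hit (q q' : C) (G : C -> Prop) : Prop := exists s, 0 <= s <= 1 /\ G (seg q q' s) /\
  forall s', 0 <= s' < s -> ~ boundary M (seg q q' s').

(** By [one_sided] one side of the orbit is free of [M] and therefore, near [x], of boundary points.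
    A segment between dense points from that side to the other first meets the boundary on the orbit
    itself. *)
Lemma escape_first_hit x : boundary M x -> F x <> 0 -> fwd_escape F x -> fwd_escape (fun z => - F z)%C x ->
  exists n m, first_hit (dense_C n) (dense_C m) (orbit F x).
Proof.
  intros Hb Hx He1 He2. destruct (chart_exists F x HF Hx) as (r & psi & Hc).
  destruct (no_recurrence F M HF Mdom Minv x x r psi Hc Hb (Munb x Hb Hx)) as (rho & Hrho & Hno).
  pose proof Hc as (Hr & H0 & Hd & Hinj & Ho).
  assert (Hside : exists dir, (dir = 1 \/ dir = -1) /\ forall s, 0 < s < rho -> ~ M (psi (Cim (dir * s)))).
  { destruct (classic (exists s, 0 < s < rho /\ M (psi (Cim s)))) as [(s & Hs & Ms)|Hn].
    - exists (-1). split; auto. intros s' Hs' Ms'.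
      apply (one_sided x r psi rho Hc Hb Hx He1 He2 Hrho Hno s (-1 * s')); auto. lra.
    - exists 1. split; auto. intros s Hs Ms. apply Hn. exists s. split; auto. now rewrite Rmult_1_l in Ms. }
  destruct Hside as (dir & Hdir & Hfree).
  assert (Hd2 : dir * dir = 1) by (destruct Hdir as [-> | ->]; ring).
  assert (Hda : forall v, Rabs (dir * v) = Rabs v).
  { intros v. destruct Hdir as [-> | ->]; [f_equal; ring|]. rewrite <- Rabs_Ropp. f_equal. ring. }
  assert (Hpm : forall w : C, Rabs (fst w) <= Cmod w /\ Rabs (snd w) <= Cmod w).
  { intros w. pose proof (Rmax_Cmod w). pose proof (Rmax_l (Rabs (fst w)) (Rabs (snd w))). pose proof (Rmax_r (Rabs (fst w)) (Rabs (snd w))). lra. }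
  (* A boundary point on the free side would bring points of [M] on the transversal of that side. *)
  assert (Hnb : forall w : C, Cmod w < rho / 2 -> 0 < dir * snd w -> ~ boundary M (psi w)).
  { intros w Hw Hpos Hbw. destruct (Hpm w) as [P1 P2].
    destruct (chart_flow F x r psi w (- fst w) HF Hc) as [A B]; [rewrite Rabs_Ropp; lra|].
    replace (w + RtoC (- fst w))%C with (Cim (snd w)) in B
      by (destruct w; rewrite Cim_pair0; unfold RtoC, Cplus; simpl; f_equal; ring).
    assert (Hbs : boundary M (psi (Cim (snd w)))) by (rewrite <- B; now apply (boundary_flow F M HF Minv)).
    destruct (boundary_near_transversal F M HF Minv x r psi (snd w) (Rmin (dir * snd w) (rho / 2)) Hc) as (s' & Hs' & Ms'); auto.
    - apply Rmin_glb_lt; lra.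
    - pose proof (Rmin_r (dir * snd w) (rho / 2)). lra.
    - assert (L1 := Rlt_le_trans _ _ _ Hs' (Rmin_l _ _)). assert (L2 := Rlt_le_trans _ _ _ Hs' (Rmin_r _ _)).
      apply (Hfree (dir * s')); [|rewrite <- Rmult_assoc, Hd2, Rmult_1_l; auto].
      pose proof (Rle_abs (dir * snd w)) as R1. rewrite Hda in R1.
      rewrite <- Hda in L1, L2. replace (dir * (s' - snd w)) with (dir * s' - dir * snd w) in L1, L2 by ring.
      apply Rabs_def2 in L1, L2. lra. }
  destruct (Ho 0) with (e := rho / 2) as [del [Hdel Kdel]]; [rewrite Cmod_0; lra|lra|]. rewrite H0 in Kdel.
  assert (Hcov : forall z, Cmod (z - x) < del -> exists w, Cmod w < rho / 2 /\ psi w = z).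
  { intros z Hz. destruct (Kdel z Hz) as (w & _ & Hw & E). exists w. split; auto.
    replace (w - 0)%C with w in Hw by ring. exact Hw. }
  (* A dense point on either side: [sg = 1] is the free side, where the segment starts, and
     [sg = -1] the other one. *)
  assert (Hpt : forall sg, sg = 1 \/ sg = -1 -> exists n w, Cmod w < rho / 2 /\ 0 < sg * (dir * snd w) /\
    psi w = dense_C n /\ Cmod (dense_C n - x) < del).
  { intros sg Hsg.
    assert (Hcx : contC psi 0) by (eapply contC_of_derC, Hd; rewrite Cmod_0; auto).
    destruct (Hcx (del / 2)) as [d1 [Hd1 K1]]; [lra|].
    set (h := Rmin (d1 / 2) (rho / 4)).
    assert (Hh : 0 < h /\ h < d1 /\ h < rho / 2).
    { assert (0 < h) by (apply Rmin_glb_lt; lra). pose proof (Rmin_l (d1 / 2) (rho / 4)) as L1. pose proof (Rmin_r (d1 / 2) (rho / 4)) as L2.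
      fold h in L1, L2. lra. }
    set (w1 := Cim (sg * (dir * h))).
    assert (Hw1 : Cmod w1 = h).
    { unfold w1. rewrite Cmod_Cim. destruct Hsg as [-> | ->]; [rewrite Rmult_1_l|replace (-1 * (dir * h)) with (- (dir * h)) by ring; rewrite Rabs_Ropp];
        rewrite Hda, Rabs_pos_eq; lra. }
    specialize (K1 w1). replace (w1 - 0)%C with w1 in K1 by ring. rewrite H0, Hw1 in K1. specialize (K1 ltac:(lra)).
    destruct (Ho w1) with (e := Rmin h (rho / 2 - h)) as [d2 [Hd2' K2]]; [lra|apply Rmin_glb_lt; lra|].
    destruct (dense_C_spec (psi w1) (Rmin d2 (del / 2))) as [n Hn]; [apply Rmin_glb_lt; lra|].
    destruct (K2 (dense_C n)) as (w & W1 & W2 & W3); [eapply Rlt_le_trans; [exact Hn|apply Rmin_l]|].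
    exists n, w.
    assert (L1 := Rlt_le_trans _ _ _ W2 (Rmin_l _ _)). assert (L2 := Rlt_le_trans _ _ _ W2 (Rmin_r _ _)).
    split; [|split; [|split; auto]].
    - pose proof (Cmod_triangle (w - w1) w1) as T. replace (w - w1 + w1)%C with w in T by ring. lra.
    - destruct (Hpm (w - w1)%C) as [_ P2]. unfold w1 in P2 at 1. rewrite Cim_pair0 in P2. simpl in P2.
      assert (Hsd : (sg * dir) * (sg * dir) = 1) by (destruct Hsg as [-> | ->], Hdir as [-> | ->]; ring).
      assert (P3 : Rabs (snd w + - (sg * (dir * h))) < h) by lra.
      apply Rabs_def2 in P3. destruct Hsg as [-> | ->], Hdir as [-> | ->]; lra.
    - assert (L3 := Rlt_le_trans _ _ _ Hn (Rmin_r _ _)). pose proof (Cmod_tri (dense_C n) (psi w1) x). lra. }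
  destruct (Hpt 1 ltac:(auto)) as (n & wn & Wn1 & Wn2 & Wn3 & Wn4).
  destruct (Hpt (-1) ltac:(auto)) as (m & wm & Wm1 & Wm2 & Wm3 & Wm4).
  exists n, m. set (q := dense_C n) in *. set (q' := dense_C m) in *.
  assert (Hseg : forall s, 0 <= s <= 1 -> exists w, Cmod w < rho / 2 /\ psi w = seg q q' s).
  { intros s Hs. apply Hcov. unfold seg.
    replace (q + RtoC s * (q' - q) - x)%C with (RtoC (1 - s) * (q - x) + RtoC s * (q' - x))%C by (rewrite RtoC_minus; ring).
    eapply Rle_lt_trans; [apply Cmod_triangle|]. rewrite !Cmod_Rmult, !Rabs_pos_eq by lra.
    destruct (Req_dec s 0) as [->|]; nra. }
  assert (Hloc : forall s w, 0 <= s <= 1 -> Cmod w < rho / 2 -> psi w = seg q q' s -> dir * snd w <> 0 ->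
    exists d, 0 < d /\ forall s' w', 0 <= s' <= 1 -> Rabs (s' - s) < d -> Cmod w' < rho / 2 -> psi w' = seg q q' s' ->
      (0 < dir * snd w <-> 0 < dir * snd w')).
  { intros s w Hs Hw E Hn. assert (Hab : 0 < Rabs (dir * snd w)) by now apply Rabs_pos_lt.
    destruct (Ho w) with (e := Rabs (dir * snd w)) as [d [Hd1 K]]; [lra|auto|].
    destruct (contR_affine q (q' - q) s d Hd1) as [d' [Hd' K']].
    exists d'. split; auto. intros s' w' Hs' Hss Hw' E'.
    destruct (K (seg q q' s')) as (w2 & W1 & W2 & W3); [rewrite E; apply K'; auto|].
    assert (w2 = w') as -> by (apply Hinj; [auto|lra|congruence]).
    destruct (Hpm (w' - w)%C) as [_ P2]. simpl in P2.
    assert (P3 : Rabs (dir * (snd w' + - snd w)) < Rabs (dir * snd w)) by (rewrite Hda; lra).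
    replace (dir * (snd w' + - snd w)) with (dir * snd w' - dir * snd w) in P3 by ring.
    destruct (Rle_dec 0 (dir * snd w)).
    - rewrite (Rabs_pos_eq (dir * snd w)) in P3 by auto. apply Rabs_def2 in P3. lra.
    - rewrite (Rabs_left (dir * snd w)) in P3 by lra. apply Rabs_def2 in P3. lra. }
  (* The supremum [s0] of these parameters is where the segment first reaches the leaf [snd w = 0],
     the orbit of [x]. *)
  set (Pos := fun s => 0 <= s <= 1 /\ forall s', 0 <= s' <= s -> forall w, Cmod w < rho / 2 -> psi w = seg q q' s' -> 0 < dir * snd w).
  assert (HP0 : Pos 0).
  { split; [lra|]. intros s' Hs' w Hw E. replace s' with 0 in E by lra. rewrite seg_0, <- Wn3 in E.
    apply Hinj in E; [subst w; lra|lra|lra]. }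
  destruct (completeness Pos) as [s0 [Hu Hl]]; [exists 1; intros s [Hs _]; lra|exists 0; exact HP0|].
  assert (Hs0 : 0 <= s0 <= 1) by (split; [now apply Hu|apply Hl; intros s [Hs _]; lra]).
  assert (Hbelow : forall s, 0 <= s < s0 -> forall w, Cmod w < rho / 2 -> psi w = seg q q' s -> 0 < dir * snd w).
  { intros s Hs w Hw E. destruct (classic (exists s1, Pos s1 /\ s < s1)) as [(s1 & [_ HP] & Hlt)|Hnx].
    - apply (HP s); auto; lra.
    - exfalso. assert (s0 <= s); [|lra]. apply Hl. intros s1 H1. apply Rnot_lt_le. intros h. apply Hnx. exists s1; auto. }
  destruct (Hseg s0 Hs0) as (w0 & Hw0 & E0).
  assert (Hz : dir * snd w0 = 0).
  { apply NNPP. intros Hn. destruct (Hloc s0 w0 Hs0 Hw0 E0 Hn) as [d [Hd1 K]].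
    destruct (Rlt_dec 0 (dir * snd w0)) as [h|h].
    - assert (Hs1 : s0 < 1).
      { destruct (Req_dec s0 1) as [->|]; [|lra]. exfalso. rewrite seg_1, <- Wm3 in E0.
        apply Hinj in E0; [subst w0; lra|lra|lra]. }
      set (s2 := Rmin 1 (s0 + d / 2)).
      assert (Hs2 : s0 < s2 /\ s2 <= 1 /\ s2 <= s0 + d / 2).
      { split; [apply Rmin_glb_lt; lra|]. split; [apply Rmin_l|apply Rmin_r]. }
      assert (s2 <= s0); [|lra]. apply Hu. split; [lra|]. intros s' Hs' w Hw E.
      destruct (Rlt_dec s' s0); [apply (Hbelow s'); auto; lra|]. apply (K s' w); auto; [lra|apply Rabs_def1; lra].
    - destruct (Req_dec s0 0) as [E|n0].
      + destruct HP0 as [_ HP]. rewrite E in E0. specialize (HP 0 ltac:(lra) w0 Hw0 E0). lra.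
      + set (s2 := Rmax 0 (s0 - d / 2)).
        assert (Hs2 : 0 <= s2 < s0 /\ s0 - d / 2 <= s2).
        { split; [split; [apply Rmax_l|apply Rmax_lub_lt; lra]|apply Rmax_r]. }
        destruct (Hseg s2 ltac:(lra)) as (w2 & Hw2 & E2).
        pose proof (Hbelow s2 ltac:(lra) w2 Hw2 E2) as P. destruct (K s2 w2 ltac:(lra) ltac:(apply Rabs_def1; lra) Hw2 E2) as [_ K']. specialize (K' P). lra. }
  exists s0. split; auto. split.
  - rewrite <- E0. assert (Hs : snd w0 = 0) by (destruct Hdir as [-> | ->]; lra).
    destruct (Hpm w0) as [P1 _].
    destruct (chart_flow F x r psi 0 (fst w0) HF Hc) as [A B]; [rewrite Cmod_0; lra|].
    exists (fst w0). rewrite H0 in A, B. split; auto. rewrite B. f_equal. rewrite Cplus_0_l.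
    destruct w0 as [u v]. simpl in *. subst v. reflexivity.
  - intros s' Hs'. destruct (Hseg s' ltac:(lra)) as (w & Hw & E). rewrite <- E. apply Hnb; auto.
    apply (Hbelow s'); auto.
Qed.

Definition boundary_orbits (G : C -> Prop) : Prop := exists x, boundary M x /\ G = orbit F x.

(** Three classes with different reasons: equilibria are isolated, each equilibrium has at most two
    attached orbits, and an orbit with both ends at infinity is determined by a first hit. *)
Lemma boundary_orbits_coded : coded boundary_orbits.
Proof.
  assert (HE : coded (fun a => F a = 0)).
  { apply coded_isolated. intros a Ha. destruct (zeros_isolated F a HF Fnz Ha) as [r [Hr K]]. exists r. split; auto. }
  destruct HE as (R & R1 & R2).
  set (S1 := fun G => exists a, boundary M a /\ F a = 0 /\ G = orbit F a).
  set (S2 := fun G => exists x a, boundary M x /\ F x <> 0 /\ att F x a /\ G = orbit F x).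
  set (S3 := fun G => exists x, boundary M x /\ F x <> 0 /\ fwd_escape F x /\ fwd_escape (fun z => - F z)%C x /\ G = orbit F x).
  apply (coded_sub _ (fun G => S1 G \/ (S2 G \/ S3 G))).
  { intros G (x & Hb & ->). destruct (classic (F x = 0)) as [E|E]; [left; exists x; auto|right].
    destruct (forward_end F M HF Fnz Mdom Minv x Hb (Munb x Hb E)) as [(a & Fa & Ha)|H1].
    { left. exists x, a. split; [auto|split; [auto|split; [now left|auto]]]. }
    destruct (backward_end F M HF Fnz Mdom Minv Munb x Hb E) as [(a & Fa & Ha)|H2].
    { left. exists x, a. split; [auto|split; [auto|split; [now right|auto]]]. }
    right. exists x. auto. }
  apply coded_union; [|apply coded_union].
  - exists (fun n G => exists a, F a = 0 /\ R n a /\ G = orbit F a). split.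
    + intros G (a & Hb & Fa & ->). destruct (R1 a Fa) as [n Hn]. exists n, a. auto.
    + intros n G G' _ _ (a & Fa & Ra & ->) (a' & Fa' & Ra' & ->). now rewrite (R2 n a a' Fa Fa' Ra Ra').
  - set (At := fun a G => exists x, boundary M x /\ F x <> 0 /\ att F x a /\ G = orbit F x).
    (* Singles out one of the orbits attached to [a]; the second code component, 0 or 1, tells it
       from the possible other one. *)
    set (pick := fun a => epsilon (inhabits (fun _ : C => True)) (At a)).
    exists (fun n G => exists a, F a = 0 /\ At a G /\ R (fst (of_nat n)) a /\
      ((snd (of_nat n) = 0%nat /\ G = pick a) \/ (snd (of_nat n) = 1%nat /\ G <> pick a))). split.
    + intros G (x & a & Hb & Hx & Ha & ->).
      assert (Fa : F a = 0) by (now apply (att_zero F M HF Fnz Mdom Minv Munb x a)).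
      destruct (R1 a Fa) as [n Hn].
      destruct (classic (orbit F x = pick a)) as [E|E].
      * exists (to_nat (n, 0%nat)), a. rewrite cancel_of_to. repeat split; auto. exists x; auto.
      * exists (to_nat (n, 1%nat)), a. rewrite cancel_of_to. repeat split; auto. exists x; auto.
    + intros n G G' _ _ (a & Fa & HA & Ra & Hc) (a' & Fa' & HA' & Ra' & Hc').
      assert (a = a') as <- by (now apply (R2 (fst (of_nat n)))).
      destruct Hc as [[En E]|[En E]], Hc' as [[En' E']|[En' E']]; try congruence.
      assert (HP : At a (pick a)) by (apply (epsilon_spec (inhabits (fun _ : C => True)) (At a)); eauto).
      apply NNPP. intros Hne.
      destruct HA as (x1 & B1 & N1 & A1 & E1). destruct HA' as (x2 & B2 & N2 & A2 & E2).
      destruct HP as (x3 & B3 & N3 & A3 & E3).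
      apply (at_most_two_attached F M HF Fnz Mdom Minv Munb a x1 x2 x3); auto; congruence.
  - exists (fun n G => first_hit (dense_C (fst (of_nat n))) (dense_C (snd (of_nat n))) G). split.
    + intros G (x & Hb & Hx & He1 & He2 & ->). destruct (escape_first_hit x Hb Hx He1 He2) as (n & m & H).
      exists (to_nat (n, m)). now rewrite cancel_of_to.
    + intros n G G' (x & Hb & _ & _ & _ & ->) (x' & Hb' & _ & _ & _ & ->) (s & Hs & Hg & Hbel) (s' & Hs' & Hg' & Hbel').
      assert (s = s') as <-.
      { destruct (Rtotal_order s s') as [h|[h|h]]; auto; exfalso.
        - apply (Hbel' s); [lra|]. now apply (boundary_orbit F M HF Minv x).
        - apply (Hbel s'); [lra|]. now apply (boundary_orbit F M HF Minv x'). }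
      rewrite (orbit_eq F HF x _ Hg), (orbit_eq F HF x' _ Hg'). reflexivity.
Qed.

End Count.

(** * Path components *)

Definition contW (g : R -> C) (t : R) : Prop := forall e, 0 < e ->
  exists d, 0 < d /\ forall s, 0 <= s <= 1 -> Rabs (s - t) < d -> Cmod (g s - g t) < e.

Lemma joined_iff (A : C -> Prop) x y : joined A x y <-> exists g : R -> C,
  (forall t, 0 <= t <= 1 -> contW g t) /\ (forall t, 0 <= t <= 1 -> A (g t)) /\ g 0 = x /\ g 1 = y.
Proof.
  split; intros (g & H1 & H2); exists g; split; auto; intros t Ht.
  - intros e He.
    assert (HP : locally (g t) (fun w => Cmod (w - g t) < e)).
    { apply locally_Cmod. exists e. auto. }
    apply (H1 t Ht) in HP. destruct HP as [d HP]. exists d. split; [apply cond_pos|].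
    intros s Hs Hst. apply (HP s); auto.
  - intros P HP. apply locally_Cmod in HP. destruct HP as [e [He HP]].
    destruct (H1 t Ht e He) as [d [Hd K]]. exists (mkposreal d Hd). intros s Hst Hs. apply HP, K; auto.
Qed.

Lemma contW_of_contR g t : contR g t -> contW g t.
Proof. intros H e He. destruct (H e He) as [d [Hd K]]. exists d. split; auto. Qed.

Lemma joined_refl (A : C -> Prop) x : A x -> joined A x x.
Proof.
  intros Hx. apply joined_iff. exists (fun _ => x). split; [|auto].
  intros t _. apply contW_of_contR, contR_const.
Qed.

Lemma joined_sym A x y : joined A x y -> joined A y x.
Proof.
  rewrite !joined_iff. intros (g & H1 & H2 & H3 & H4). exists (fun t => g (1 - t)). split; [|split; [|split]].
  - intros t Ht e He. destruct (H1 (1 - t) ltac:(lra) e He) as [d [Hd K]]. exists d. split; auto.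
    intros s Hs Hst. apply K; [lra|]. replace (1 - s - (1 - t)) with (- (s - t)) by ring. now rewrite Rabs_Ropp.
  - intros t Ht. apply H2. lra.
  - rewrite Rminus_0_r. exact H4.
  - rewrite Rminus_diag. exact H3.
Qed.

Lemma joined_trans A x y z : joined A x y -> joined A y z -> joined A x z.
Proof.
  rewrite !joined_iff. intros (g & G1 & G2 & G3 & G4) (h & H1 & H2 & H3 & H4).
  exists (fun t => if Rle_dec t (1 / 2) then g (2 * t) else h (2 * t - 1)). split; [|split; [|split]].
  - intros t Ht e He. destruct (Rtotal_order t (1 / 2)) as [h1|[h1|h1]].
    + destruct (G1 (2 * t) ltac:(lra) e He) as [d [Hd K]]. exists (Rmin (d / 2) (1 / 2 - t)).
      split; [apply Rmin_glb_lt; lra|]. intros s Hs Hst.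
      assert (L1 := Rlt_le_trans _ _ _ Hst (Rmin_l _ _)). assert (L2 := Rlt_le_trans _ _ _ Hst (Rmin_r _ _)).
      apply Rabs_def2 in L1, L2.
      destruct (Rle_dec s (1 / 2)); [|lra]. destruct (Rle_dec t (1 / 2)); [|lra].
      apply K; [lra|]. apply Rabs_def1; lra.
    + subst t. destruct (G1 1 ltac:(lra) e He) as [d [Hd K]]. destruct (H1 0 ltac:(lra) e He) as [d' [Hd' K']].
      exists (Rmin (d / 2) (d' / 2)).
      split; [apply Rmin_glb_lt; lra|]. intros s Hs Hst.
      assert (L1 := Rlt_le_trans _ _ _ Hst (Rmin_l _ _)). assert (L2 := Rlt_le_trans _ _ _ Hst (Rmin_r _ _)).
      apply Rabs_def2 in L1, L2.
      destruct (Rle_dec (1 / 2) (1 / 2)); [|lra]. replace (2 * (1 / 2)) with 1 by field.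
      destruct (Rle_dec s (1 / 2)).
      * apply K; [lra|]. apply Rabs_def1; lra.
      * rewrite G4, <- H3. apply K'; [lra|]. apply Rabs_def1; lra.
    + destruct (H1 (2 * t - 1) ltac:(lra) e He) as [d [Hd K]]. exists (Rmin (d / 2) (t - 1 / 2)).
      split; [apply Rmin_glb_lt; lra|]. intros s Hs Hst.
      assert (L1 := Rlt_le_trans _ _ _ Hst (Rmin_l _ _)). assert (L2 := Rlt_le_trans _ _ _ Hst (Rmin_r _ _)).
      apply Rabs_def2 in L1, L2.
      destruct (Rle_dec s (1 / 2)); [lra|]. destruct (Rle_dec t (1 / 2)); [lra|].
      apply K; [lra|]. apply Rabs_def1; lra.
  - intros t Ht. destruct (Rle_dec t (1 / 2)); [apply G2|apply H2]; lra.
  - destruct (Rle_dec 0 (1 / 2)); [|lra]. now rewrite Rmult_0_r.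
  - destruct (Rle_dec 1 (1 / 2)); [lra|]. rewrite <- H4. f_equal. ring.
Qed.

Lemma joined_eq A x y : joined A x y -> joined A x = joined A y.
Proof.
  intros H. apply functional_extensionality. intros z. apply propositional_extensionality.
  split; intros; eapply joined_trans; eauto using joined_sym.
Qed.

Lemma joined_mem A x y : joined A x y -> A y.
Proof. intros (g & _ & H & _ & <-). apply H. lra. Qed.

(** The premise is closedness of [Q] in the interval, so the supremum belongs to it. *)
Lemma last_time (Q : R -> Prop) a b : a <= b -> Q a ->
  (forall t, a <= t <= b -> ~ Q t -> exists d, 0 < d /\ forall s, a <= s <= b -> Rabs (s - t) < d -> ~ Q s) ->
  exists m, a <= m <= b /\ Q m /\ forall t, m < t <= b -> ~ Q t.
Proof.
  intros Hab Ha Hcl.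
  destruct (completeness (fun t => a <= t <= b /\ Q t)) as [m [Hu Hl]].
  - exists b. intros t [Ht _]. lra.
  - exists a. split; [lra|auto].
  - assert (Hm : a <= m <= b).
    { split; [apply Hu; split; [lra|auto]|]. apply Hl. intros t [Ht _]. lra. }
    exists m. split; auto. split.
    + apply NNPP. intros Hn. destruct (Hcl m Hm Hn) as [d [Hd K]].
      assert (m <= m - d); [|lra]. apply Hl. intros t [Ht Qt]. apply Rnot_lt_le. intros h.
      assert (t <= m) by (apply Hu; auto). apply (K t); auto. apply Rabs_def1; lra.
    + intros t Ht Qt. assert (t <= m); [|lra]. apply Hu. split; [lra|auto].
Qed.

Lemma first_time (Q : R -> Prop) a b : a <= b -> Q b ->
  (forall t, a <= t <= b -> ~ Q t -> exists d, 0 < d /\ forall s, a <= s <= b -> Rabs (s - t) < d -> ~ Q s) ->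
  exists m, a <= m <= b /\ Q m /\ forall t, a <= t < m -> ~ Q t.
Proof.
  intros Hab Hb Hcl. destruct (last_time (fun t => Q (- t)) (- b) (- a)) as (m & Hm & Qm & K).
  - lra.
  - now rewrite Ropp_involutive.
  - intros t Ht Hn. destruct (Hcl (- t) ltac:(lra) Hn) as [d [Hd K]]. exists d. split; auto.
    intros s Hs Hst. apply K; [lra|]. replace (- s - - t) with (- (s - t)) by ring. now rewrite Rabs_Ropp.
  - exists (- m). split; [lra|]. split; auto. intros t Ht. specialize (K (- t) ltac:(lra)).
    now rewrite Ropp_involutive in K.
Qed.

Lemma ivt_int h a b v : a <= b -> cont_int h a b -> (h a <= v <= h b \/ h b <= v <= h a) ->
  exists t, a <= t <= b /\ h t = v.
Proof.
  intros Hab Hh Hv. destruct (continuum_path RtoC a b Hab (contI_RtoC a b)) as (_ & _ & IV).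
  pose proof (IV _ (cont_int_on h a b Hh)) as IV'.
  assert (Ha : path_image RtoC a b (RtoC a)) by (exists a; split; [lra|auto]).
  assert (Hb : path_image RtoC a b (RtoC b)) by (exists b; split; [lra|auto]).
  destruct Hv as [Hv|Hv]; [destruct (IV' _ _ v Ha Hb Hv) as (z & (t & Ht & ->) & E)|destruct (IV' _ _ v Hb Ha Hv) as (z & (t & Ht & ->) & E)];
    exists t; auto.
Qed.

Section Paths.
Variables (F : C -> C) (M : C -> Prop).
Hypothesis HF : differentiable F.
Hypothesis Fnz : exists z, F z <> 0.
Hypothesis Mdom : planar_domain M.
Hypothesis Minv : flow_invariant F M.
Hypothesis Munb : forall x, boundary M x -> F x <> 0 -> ~ bounded_set (orbit F x).

Section OnePath.
Variable g : R -> C.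
Hypothesis Hg : forall t, 0 <= t <= 1 -> contW g t.
Hypothesis HgB : forall t, 0 <= t <= 1 -> boundary M (g t).

(* Two leaves met by the path would give an interval of leaves in the boundary. *)
Lemma leaf t0 : 0 <= t0 <= 1 -> F (g t0) <> 0 ->
  exists d, 0 < d /\ forall s, 0 <= s <= 1 -> Rabs (s - t0) < d -> orbit F (g t0) (g s).
Proof.
  intros Ht0 Hy. destruct (chart_exists F _ HF Hy) as (r & psi & Hc).
  pose proof Hc as (Hr & H0 & Hd & Hinj & Ho).
  destruct (Ho 0) with (e := r / 4) as [del [Hdel Kdel]]; [rewrite Cmod_0; lra|lra|]. rewrite H0 in Kdel.
  destruct (Hg t0 Ht0 del Hdel) as [d [Hd0 K]].
  exists d. split; auto.
  assert (Hw : forall s, exists w, 0 <= s <= 1 /\ Rabs (s - t0) < d -> Cmod w < r / 4 /\ psi w = g s).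
  { intros s. destruct (classic (0 <= s <= 1 /\ Rabs (s - t0) < d)) as [[H1 H2]|Hn]; [|exists 0; tauto].
    destruct (Kdel (g s) (K s H1 H2)) as (w & _ & W2 & W3). exists w. intros _. split; auto.
    replace (w - 0)%C with w in W2 by ring. exact W2. }
  apply choice in Hw. destruct Hw as [w Hw].
  assert (Hpm : forall z : C, Rabs (fst z) <= Cmod z /\ Rabs (snd z) <= Cmod z).
  { intros z. pose proof (Rmax_Cmod z). pose proof (Rmax_l (Rabs (fst z)) (Rabs (snd z))). pose proof (Rmax_r (Rabs (fst z)) (Rabs (snd z))). lra. }
  assert (Hfl : forall s, 0 <= s <= 1 -> Rabs (s - t0) < d -> boundary M (psi (Cim (snd (w s))))).
  { intros s H1 H2. destruct (Hw s (conj H1 H2)) as [W1 W2]. destruct (Hpm (w s)) as [P1 P2].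
    destruct (chart_flow F _ r psi (w s) (- fst (w s)) HF Hc) as [A B]; [rewrite Rabs_Ropp; lra|].
    replace (w s + RtoC (- fst (w s)))%C with (Cim (snd (w s))) in B
      by (destruct (w s); rewrite Cim_pair0; unfold RtoC, Cplus; simpl; f_equal; ring).
    rewrite <- B. rewrite W2 in *. apply (boundary_flow F M HF Minv); auto. }
  assert (Hw0 : w t0 = 0).
  { destruct (Hw t0) as [W1 W2]; [split; [auto|rewrite Rminus_diag, Rabs_R0; auto]|].
    apply Hinj; [lra|rewrite Cmod_0; lra|congruence]. }
  assert (Hcont : forall a b, 0 <= a -> b <= 1 -> t0 - d < a -> b < t0 + d -> cont_int (fun s => snd (w s)) a b).
  { intros a b Ha Hb Ha' Hb' s Hs e He.
    assert (H2 : Rabs (s - t0) < d) by (apply Rabs_def1; lra).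
    destruct (Hw s (conj (ltac:(lra) : 0 <= s <= 1) H2)) as [W1 W2].
    destruct (Ho (w s)) with (e := e) as [d1 [Hd1 K1]]; [lra|auto|].
    destruct (Hg s ltac:(lra) d1 Hd1) as [d2 [Hd2 K2]].
    exists d2. split; auto. intros s' Hs' Hss.
    assert (H2' : Rabs (s' - t0) < d) by (apply Rabs_def1; lra).
    destruct (Hw s' (conj (ltac:(lra) : 0 <= s' <= 1) H2')) as [W1' W2'].
    destruct (K1 (g s')) as (v & V1 & V2 & V3); [rewrite W2; apply K2; [lra|auto]|].
    assert (v = w s') as -> by (apply Hinj; [auto|lra|congruence]).
    destruct (Hpm (w s' - w s)%C) as [_ P]. simpl in P. unfold Rminus. lra. }
  intros s Hs Hst. destruct (Hw s (conj Hs Hst)) as [W1 W2]. destruct (Hpm (w s)) as [P1 P2].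
  assert (Hs0 : snd (w s) = 0).
  { apply NNPP. intros Hn. set (sg := snd (w s)) in *.
    assert (Hab : 0 < Rabs sg) by now apply Rabs_pos_lt.
    assert (Hall : forall v, (0 <= v <= sg \/ sg <= v <= 0) -> boundary M (psi (Cim v))).
    { intros v Hv. assert (Hst' := Hst). apply Rabs_def2 in Hst'.
      assert (Ht : exists t, (0 <= t <= 1 /\ Rabs (t - t0) < d) /\ snd (w t) = v).
      { assert (E0 : snd (w t0) = 0) by now rewrite Hw0.
        destruct (Rle_dec t0 s) as [h|h].
        - destruct (ivt_int (fun s => snd (w s)) t0 s v h) as (t & Ht & E).
          + apply Hcont; lra.
          + rewrite E0. exact Hv.
          + exists t. split; auto. split; [lra|]. apply Rabs_def1; lra.
        - destruct (ivt_int (fun s => snd (w s)) s t0 v) as (t & Ht & E); [lra| | |].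
          + apply Hcont; lra.
          + rewrite E0. fold sg. tauto.
          + exists t. split; auto. split; [lra|]. apply Rabs_def1; lra. }
      destruct Ht as (t & [H1 H2] & <-). now apply Hfl. }
    (* The point of [M] found within [Rabs sg / 4] of [sg / 2] lies between 0 and [sg], where every
       transversal point is a boundary point. *)
    destruct (boundary_near_transversal F M HF Minv _ r psi (sg / 2) (Rabs sg / 4) Hc) as (s' & Hs' & Ms').
    - lra.
    - replace (sg / 2) with (sg * / 2) by reflexivity. rewrite Rabs_mult, (Rabs_pos_eq (/ 2)) by lra. lra.
    - apply Hall. destruct (Rle_dec 0 sg); lra.
    - apply (boundary_not_in M (psi (Cim s'))); auto; [apply Mdom|].
      apply Hall. destruct (Rle_dec 0 sg).
      + rewrite (Rabs_pos_eq sg) in Hs' by lra. apply Rabs_def2 in Hs'. lra.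
      + rewrite (Rabs_left sg) in Hs' by lra. apply Rabs_def2 in Hs'. lra. }
  destruct (chart_flow F _ r psi 0 (fst (w s)) HF Hc) as [A B]; [rewrite Cmod_0; lra|].
  exists (fst (w s)). rewrite H0 in A, B. split; auto. rewrite B, <- W2. f_equal. rewrite Cplus_0_l.
  destruct (w s) as [u v]. simpl in *. subst v. reflexivity.
Qed.

Lemma same_orbit a b : 0 <= a <= b -> b <= 1 -> (forall t, a <= t <= b -> F (g t) <> 0) -> orbit F (g a) (g b).
Proof.
  intros Ha Hb Hn. apply (interval_prop (fun t => orbit F (g a) (g t)) a b); [lra|now apply orbit_refl|].
  intros t Ht. destruct (leaf t ltac:(lra) (Hn t Ht)) as [d [Hd K]]. exists d. split; auto.
  intros s u Hs Hu Hst Hut H.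
  apply (orbit_trans F HF _ (g s)); auto. apply (orbit_trans F HF _ (g t)).
  - apply orbit_sym; auto. apply K; [lra|auto].
  - apply K; [lra|auto].
Qed.

Lemma zero_set_closed t : 0 <= t <= 1 -> F (g t) <> 0 ->
  exists d, 0 < d /\ forall s, 0 <= s <= 1 -> Rabs (s - t) < d -> F (g s) <> 0.
Proof.
  intros Ht Hn. destruct (leaf t Ht Hn) as [d [Hd K]]. exists d. split; auto.
  intros s Hs Hst. apply (orbit_nonzero F HF (g t)); auto.
Qed.

(** Away from [a] the path stays on one orbit by [same_orbit], and this orbit comes arbitrarily
    close to the equilibrium [g a], so [closure_orbit] applies. *)
Lemma hit_att a b : 0 <= a <= 1 -> 0 <= b <= 1 -> F (g a) = 0 -> a <> b ->
  (forall t, (a < t <= b \/ b <= t < a) -> F (g t) <> 0) -> att F (g b) (g a).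
Proof.
  intros Ha Hb Fa Hab Hn.
  assert (Hnb : F (g b) <> 0) by (apply Hn; lra).
  apply (closure_orbit F M HF Fnz Mdom Minv Munb); auto.
  - intros H. apply (orbit_nonzero F HF (g b) (g a)); auto.
  - intros d Hd. destruct (Hg a Ha d Hd) as [h [Hh K]].
    destruct (Rlt_dec a b) as [h1|h1].
    + set (s := Rmin b (a + h / 2)).
      assert (Hs : a < s <= b /\ s <= a + h / 2).
      { split; [split; [apply Rmin_glb_lt; lra|apply Rmin_l]|apply Rmin_r]. }
      exists (g s). split; [|apply K; [lra|apply Rabs_def1; lra]].
      apply orbit_sym; auto. apply same_orbit; [lra|lra|]. intros t Ht. apply Hn. lra.
    + set (s := Rmax b (a - h / 2)).
      assert (Hs : b <= s < a /\ a - h / 2 <= s).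
      { split; [split; [apply Rmax_l|apply Rmax_lub_lt; lra]|apply Rmax_r]. }
      exists (g s). split; [|apply K; [lra|apply Rabs_def1; lra]].
      apply same_orbit; [lra|lra|]. intros t Ht. apply Hn. lra.
Qed.

(** Between two different equilibria the path would follow an orbit attached to both, which
    [att_unique] forbids. *)
Lemma zeros_on_path t : F (g 0) = 0 -> 0 <= t <= 1 -> F (g t) = 0 -> g t = g 0.
Proof.
  intros F0 Ht Ft. apply NNPP. intros Hne.
  (* [m] is the last time at the first equilibrium and [m2] below the next time at any equilibrium;
     isolation of the zeros keeps the two apart. *)
  destruct (last_time (fun s => g s = g 0) 0 t) as (m & Hm & Em & Km); [lra|auto| |].
  { intros s Hs Hns. destruct (Hg s ltac:(lra) (Cmod (g s - g 0))) as [d [Hd K]]; [now apply Cmod_minus_gt0|].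
    exists d. split; auto. intros u Hu Hus E. specialize (K u ltac:(lra) Hus). rewrite E, Cmod_sym in K. lra. }
  assert (Hmt : m < t) by (destruct (Req_dec m t) as [->|]; [tauto|lra]).
  destruct (zeros_isolated F (g 0) HF Fnz F0) as [r [Hr Kr]].
  destruct (Hg m ltac:(lra) r Hr) as [d [Hd Kd]].
  set (m1 := Rmin t (m + d / 2)).
  assert (Hm1 : m < m1 <= t /\ m1 <= m + d / 2).
  { split; [split; [apply Rmin_glb_lt; lra|apply Rmin_l]|apply Rmin_r]. }
  assert (Hnear : forall s, m < s <= m1 -> F (g s) <> 0).
  { intros s Hs. apply Kr. split; [apply Cmod_minus_gt0, Km; lra|]. rewrite <- Em. apply Kd; [lra|apply Rabs_def1; lra]. }
  destruct (first_time (fun s => F (g s) = 0) m1 t) as (m2 & Hm2 & E2 & K2); [lra|auto| |].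
  { intros s Hs Hns. destruct (zero_set_closed s ltac:(lra) Hns) as [d' [Hd' K']].
    exists d'. split; auto. intros u Hu Hus. apply K'; [lra|auto]. }
  assert (Hm12 : m1 < m2).
  { destruct (Req_dec m1 m2) as [E|]; [|lra]. exfalso. rewrite <- E in E2. now apply (Hnear m1 ltac:(lra)). }
  assert (Hn1 : F (g m1) <> 0) by (apply Hnear; lra).
  assert (A1 : att F (g m1) (g m)).
  { apply hit_att; try lra.
    - now rewrite Em.
    - intros s Hs. apply Hnear. lra. }
  assert (A2 : att F (g m1) (g m2)).
  { apply hit_att; try lra.
    - exact E2.
    - intros s [Hs|Hs]; [lra|]. apply K2. lra. }
  assert (E := att_unique F (g m1) _ _ HF (Munb _ (HgB m1 ltac:(lra)) Hn1) A1 A2).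
  apply (Km m2); [lra|]. now rewrite <- E.
Qed.

Lemma path_from_zero : F (g 0) = 0 -> g 1 = g 0 \/ (F (g 1) <> 0 /\ att F (g 1) (g 0)).
Proof.
  intros F0. destruct (classic (F (g 1) = 0)) as [E|E]; [left; apply zeros_on_path; auto; lra|right].
  split; auto.
  destruct (last_time (fun s => F (g s) = 0) 0 1) as (m & Hm & Em & Km); [lra|auto| |].
  { intros s Hs Hns. now apply zero_set_closed. }
  assert (Hm1 : m <> 1) by (intros ->; auto).
  rewrite <- (zeros_on_path m F0 Hm Em). apply hit_att; auto; [lra|].
  intros t [Ht|Ht]; [now apply Km|lra].
Qed.

(** The first equilibrium met by the path would be one to which its initial orbit is attached. *)
Lemma path_from_free : F (g 0) <> 0 -> (forall a, ~ att F (g 0) a) -> orbit F (g 0) (g 1).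
Proof.
  intros F0 Hna. apply same_orbit; [lra|lra|]. intros t Ht Ft.
  destruct (first_time (fun s => F (g s) = 0) 0 t) as (m & Hm & Em & Km); [lra|auto| |].
  { intros s Hs Hns. destruct (zero_set_closed s ltac:(lra) Hns) as [d [Hd K]]. exists d. split; auto.
    intros u Hu. apply K. lra. }
  assert (Hm0 : m <> 0) by (intros ->; auto).
  apply (Hna (g m)). apply hit_att; auto; [lra|lra|]. intros s [Hs|Hs]; [lra|]. apply Km. lra.
Qed.

End OnePath.

Lemma joined_orbit x z : boundary M x -> orbit F x z -> joined (boundary M) x z.
Proof.
  intros Hb [T [HT ->]]. apply joined_iff.
  assert (HI : forall t, 0 <= t <= 1 -> max_interval F x (t * T)).
  { intros t Ht. apply (mi_conn0 F x T); auto. destruct (Rle_dec 0 T); [left|right]; split; nra. }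
  exists (fun t => flow F (t * T) x). split; [|split; [|split]].
  - intros t Ht e He. destruct (flow_cont F HF x (t * T) (HI t Ht) e He) as [d [Hd K]].
    exists (d / (Rabs T + 1)). pose proof (Rabs_pos T). split; [apply Rdiv_lt_0_compat; lra|].
    intros s _ Hst. apply K. replace (s * T - t * T) with ((s - t) * T) by ring. rewrite Rabs_mult.
    apply (Rmult_lt_compat_r (Rabs T + 1)) in Hst; [|lra].
    replace (d / (Rabs T + 1) * (Rabs T + 1)) with d in Hst by (field; lra).
    pose proof (Rabs_pos (s - t)). nra.
  - intros t Ht. apply (boundary_flow F M HF Minv); auto.
  - rewrite Rmult_0_l. now apply flow_0.
  - now rewrite Rmult_1_l.
Qed.

(** The substitution [t / (1 - t)] compresses the half-orbit into [[0,1)], and convergence is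
    continuity at 1. *)
Lemma joined_limit G x a : differentiable G -> flow_invariant G M -> boundary M x -> fwd_limit G x a ->
  joined (boundary M) x a.
Proof.
  intros HG Ginv Hb Ha. pose proof Ha as [HI Hlim]. apply joined_iff.
  assert (Hpos : forall t, 0 <= t < 1 -> 0 <= t / (1 - t)).
  { intros t Ht. apply Rmult_le_pos; [lra|]. left. apply Rinv_0_lt_compat. lra. }
  exists (fun t => if Rlt_dec t 1 then flow G (t / (1 - t)) x else a). split; [|split; [|split]].
  - intros t Ht e He. destruct (Rlt_dec t 1) as [h|h].
    + destruct (flow_cont G HG x (t / (1 - t)) (HI _ (Hpos t ltac:(lra))) e He) as [d [Hd K]].
      assert (Hc : continuity_pt (fun t => t / (1 - t)) t).
      { apply derivable_continuous_pt. exists (/ ((1 - t) * (1 - t))). apply is_derive_Reals. auto_derive; [lra|field; lra]. }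
      destruct (Hc d Hd) as [d' [Hd' K']]. exists (Rmin d' (1 - t)). split; [apply Rmin_glb_lt; lra|].
      intros s Hs Hst.
      assert (L1 := Rlt_le_trans _ _ _ Hst (Rmin_l _ _)). assert (L2 := Rlt_le_trans _ _ _ Hst (Rmin_r _ _)).
      apply Rabs_def2 in L2. destruct (Rlt_dec s 1); [|lra]. apply K.
      destruct (Req_dec s t) as [->|n]; [rewrite Rminus_diag, Rabs_R0; auto|].
      apply (K' s). split; [split; [exact I|congruence]|exact L1].
    (* [1 - s < 1 / (T + 1)] amounts to [s / (1 - s) > T]. *)
    + destruct (Hlim e He) as (T & HT & K). exists (/ (T + 1)). split; [apply Rinv_0_lt_compat; lra|].
      intros s Hs Hst. destruct (Rlt_dec s 1); [|rewrite Cmod_diag; auto].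
      apply K. replace t with 1 in Hst by lra. apply Rabs_def2 in Hst. destruct Hst as [_ Hst].
      apply Rmult_le_reg_r with (1 - s); [lra|]. unfold Rdiv. rewrite Rmult_assoc, Rinv_l by lra.
      assert ((1 - s) * (T + 1) <= 1); [|lra].
      apply Rmult_le_reg_r with (/ (T + 1)); [apply Rinv_0_lt_compat; lra|]. rewrite Rmult_assoc, Rinv_r by lra. lra.
  - intros t Ht. destruct (Rlt_dec t 1).
    + apply (boundary_flow G M HG Ginv); auto. apply HI, Hpos. lra.
    + now apply (fwd_limit_boundary M G x a).
  - destruct (Rlt_dec 0 1); [|lra]. unfold Rdiv. rewrite Rmult_0_l. now apply flow_0.
  - destruct (Rlt_dec 1 1); [lra|auto].
Qed.

Lemma joined_att x a : boundary M x -> att F x a -> joined (boundary M) x a.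
Proof.
  intros Hb [Ha|Ha].
  - now apply (joined_limit F).
  - apply (joined_limit (fun z => - F z)%C); auto using differentiable_opp, flow_invariant_opp.
Qed.

Lemma component_free x : boundary M x -> F x <> 0 -> (forall a, ~ att F x a) ->
  forall z, joined (boundary M) x z <-> orbit F x z.
Proof.
  intros Hb Hx Hna z. split; [|now apply joined_orbit].
  intros H. apply joined_iff in H. destruct H as (g & G1 & G2 & <- & <-). now apply path_from_free.
Qed.

(** A path starting at [a] returns to [a] or ends on an orbit attached to [a]; conversely such an
    orbit is joined to its limit. *)
Lemma component_zero a : boundary M a -> F a = 0 ->
  forall z, joined (boundary M) a z <-> z = a \/ (boundary M z /\ F z <> 0 /\ att F z a).
Proof.
  intros Hb Fa z. split.
  - intros H. pose proof (joined_mem _ _ _ H) as Hz. apply joined_iff in H. destruct H as (g & G1 & G2 & <- & <-).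
    destruct (path_from_zero g G1 G2 Fa) as [E|[E1 E2]]; auto.
  - intros [->|(Hz & _ & Ha)]; [now apply joined_refl|]. apply joined_sym. now apply joined_att.
Qed.

(** A component with an equilibrium consists of it and its attached orbits, of which there are at
    most two. A component without one comes from an orbit attached to nothing, since the limit would
    lie in the same component. *)
Lemma component_types P : path_component (boundary M) P ->
     (exists x : C, F x <> 0 /\ (forall z : C, P z <-> orbit F x z))
     \/ (exists a : C, F a = 0 /\ (forall z : C, P z <-> z = a))
     \/ (exists a x : C, F a = 0 /\ F x <> 0 /\ attached F x a /\ (forall z : C, P z <-> z = a \/ orbit F x z))
     \/ (exists a x y : C, F a = 0 /\ F x <> 0 /\ F y <> 0 /\ orbit F x <> orbit F y /\
        attached F x a /\ attached F y a /\ (forall z : C, P z <-> z = a \/ orbit F x z \/ orbit F y z)).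
Proof.
  intros (x & Hb & ->).
  destruct (classic (exists a, F a = 0 /\ boundary M a /\ joined (boundary M) x a)) as [(a & Fa & Ba & Ja)|Hno].
  - right. rewrite (joined_eq _ _ _ Ja). pose proof (component_zero a Ba Fa) as Hcomp.
    assert (Horb : forall y z, boundary M y -> att F y a -> orbit F y z -> joined (boundary M) a z).
    { intros y z By Ay Oz. apply (joined_trans _ a y z); [apply joined_sym; now apply joined_att|now apply joined_orbit]. }
    destruct (classic (exists y, boundary M y /\ F y <> 0 /\ att F y a)) as [(y1 & B1 & N1 & A1)|Hn1].
    2:{ left. exists a. split; auto. intros z. rewrite Hcomp. split; [|auto]. intros [E|H]; auto. exfalso; eauto. }
    right.
    destruct (classic (exists y, boundary M y /\ F y <> 0 /\ att F y a /\ orbit F y1 <> orbit F y)) as [(y2 & B2 & N2 & A2 & D)|Hn2].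
    + right. exists a, y1, y2. do 6 (split; [auto using att_attached|]). intros z. split.
      * rewrite Hcomp. intros [E|(Bz & Nz & Az)]; auto. right. apply NNPP. intros Hz.
        apply (at_most_two_attached F M HF Fnz Mdom Minv Munb a y1 y2 z); auto; intros E; apply Hz;
          [right|left]; rewrite E; now apply orbit_refl.
      * intros [->|[Oz|Oz]]; [now apply joined_refl|now apply (Horb y1)|now apply (Horb y2)].
    + left. exists a, y1. do 3 (split; [auto using att_attached|]). intros z. split.
      * rewrite Hcomp. intros [E|(Bz & Nz & Az)]; auto. right.
        assert (E : orbit F y1 = orbit F z) by (apply NNPP; intros E; apply Hn2; exists z; auto).
        rewrite E. now apply orbit_refl.
      * intros [->|Oz]; [now apply joined_refl|now apply (Horb y1)].
  - left. assert (Nx : F x <> 0).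
    { intros E. apply Hno. exists x. split; auto. split; auto. now apply joined_refl. }
    exists x. split; auto. apply component_free; auto.
    intros a Ha. apply Hno. exists a. split; [now apply (att_zero F M HF Fnz Mdom Minv Munb x a)|].
    split; [now apply (att_boundary F M HF Minv x a)|now apply joined_att].
Qed.

(** Every orbit lies in a single component, so a component inherits the codes of the orbits in
    it. *)
Lemma components_coded : coded (path_component (boundary M)).
Proof.
  destruct (boundary_orbits_coded F M HF Fnz Mdom Minv Munb) as (R & R1 & R2).
  exists (fun n P => exists x, boundary M x /\ P = joined (boundary M) x /\ R n (orbit F x)). split.
  - intros P (x & Hb & ->). destruct (R1 (orbit F x)) as [n Hn]; [exists x; auto|]. exists n, x. auto.
  - intros n P P' _ _ (x & Hb & -> & Hx) (x' & Hb' & -> & Hx').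
    apply joined_eq, joined_orbit; auto.
    rewrite (R2 n (orbit F x) (orbit F x')); auto; [now apply orbit_refl|exists x; auto|exists x'; auto].
Qed.

End Paths.

Theorem proposition3p5 (F : C -> C) (M : C -> Prop)
  (F_entire : entire F)
  (F_nonzero : exists z : C, F z <> RtoC 0)
  (M_domain : planar_domain M)
  (M_invariant : flow_invariant F M)
  (M_unbounded : forall x : C, boundary M x -> F x <> RtoC 0 ->
     ~ bounded_set (orbit F x)) :
  at_most_countable (path_component (boundary M)) /\
  (forall P : C -> Prop, path_component (boundary M) P ->
     (exists x : C, F x <> RtoC 0 /\
        (forall z : C, P z <-> orbit F x z))
     \/
     (exists a : C, F a = RtoC 0 /\
        (forall z : C, P z <-> z = a))
     \/
     (exists a x : C, F a = RtoC 0 /\ F x <> RtoC 0 /\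
        attached F x a /\
        (forall z : C, P z <-> z = a \/ orbit F x z))
     \/
     (exists a x y : C, F a = RtoC 0 /\ F x <> RtoC 0 /\ F y <> RtoC 0 /\
        orbit F x <> orbit F y /\
        attached F x a /\ attached F y a /\
        (forall z : C, P z <-> z = a \/ orbit F x z \/ orbit F y z))) /\
  at_most_countable
    (fun G : C -> Prop => exists x : C, boundary M x /\ G = orbit F x).
Proof.
  pose proof (entire_differentiable F F_entire) as HF.
  split; [|split].
  - now apply coded_countable, (components_coded F M).
  - intros P HP. now apply (component_types F M).
  - now apply coded_countable, (boundary_orbits_coded F M).
Qed.
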